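(* Let $\mathcal{A}$ be a Fréchet algebra equipped with a smooth isometric action $\alpha$ of a vector group $V\cong\mathbb{R}^d$ with a fixed scalar product $\langle\cdot,\cdot\rangle$, and let $J$ be a skew-symmetric operator on $V$. Then for every $f\in S(V;\mathcal{A})$ we have $$\pi_J(f)=\pi(\Theta_J(f))$$ as operators on $S(V;\mathcal{A})$. Hence $\Theta_J$ defines an isomorphism $V\ltimes_{\alpha^J}\mathcal{A}_J\cong V\ltimes_\alpha\mathcal{A}$ of Fréchet algebras.
   Context: Algebras are over $\mathbb{C}$ and not assumed unital. $V\cong\mathbb{R}^d$ is a finite-dimensional real vector space with scalar product $\langle\cdot,\cdot\rangle$; integrals over $V$ are with respect to the corresponding Lebesgue measure. Write $e(x\cdot y)=e^{2\pi i\langle x,y\rangle}$. An action $\alpha$ of $V$ by automorphisms of a Fréchet algebra $\mathcal{A}$ is isometric if the topology on $\mathcal{A}$ is defined by a sequence of $\alpha$-invariant seminorms. It is smooth if for every $a\in\mathcal{A}$ the function $V\to\mathcal{A}$, $x\mapsto\alpha_x(a)$, is differentiable, and for every $X\in V$ the partial differentiation in the direction $X$ at $x=0$ defines a bounded operator on $\mathcal{A}$. $S(V;\mathcal{A})$ is the Fréchet space of $\mathcal{A}$-valued Schwartz functions on $V$. The smooth crossed product $V\ltimes_\alpha\mathcal{A}$ is $S(V;\mathcal{A})$ with the product $(f*g)(x)=\int_V f(y)\alpha_y(g(x-y))\,dy$. Rieffel's deformation $\mathcal{A}_J$ is the Fréchet space $\mathcal{A}$ with the product $$a\times_J b=\int_{V\times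 V}\alpha_{Jx}(a)\alpha_y(b)e(x\cdot y)\,dx\,dy,$$ the integral being understood in the oscillatory sense, i.e. as $\lim_{\varepsilon\to0}\int_{V\times V}\alpha_{Jx}(a)\alpha_y(b)\,\chi(\varepsilon x,\varepsilon y)\,e(x\cdot y)\,dx\,dy$ for any $\chi\in C_c^\infty(V\times V)$ with $\chi(0,0)=1$. The automorphisms $\alpha_x$ of $\mathcal{A}$ are also automorphisms of $\mathcal{A}_J$; the resulting action of $V$ on $\mathcal{A}_J$ is denoted $\alpha^J$, and $V\ltimes_{\alpha^J}\mathcal{A}_J$ is the corresponding smooth crossed product: the space $S(V;\mathcal{A})$ with product $(f*g)(x)=\int_V f(y)\times_J\alpha_y(g(x-y))\,dy$. The Fourier transform on $S(V;\mathcal{A})$ is $\hat\xi(x)=\int_V\xi(y)e(-x\cdot y)\,dy$. For $a\in\mathcal{A}$ and $\xi\in S(V;\mathcal{A})$ put $$(\pi(a)\xi)(x)=\alpha_{-x}(a)\xi(x),\qquad (\pi_J(a)\xi)(x)=\int_V\alpha_{Jy-x}(a)\hat\xi(y)e(x\cdot y)\,dy,$$ with products inside the integral taken in $\mathcal{A}$. These are representations of $\mathcal{A}$ and $\mathcal{A}_J$, respectively, on $S(V;\mathcal{A})$, covariant with respect to the operators of left translation $((\lambda_x\otimes1)\xi)(y)=\xi(y-x)$. The corresponding representations of $V\ltimes_\alpha\mathcal{A}$ and $V\ltimes_{\alpha^J}\mathcal{A}_J$ on $S(V;\mathcal{A})$, again denoted $\pi$ and $\pi_J$, are given for $f\in S(V;\mathcal{A})$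 by $$\pi(f)\xi=\int_V\pi(f(z))(\lambda_z\otimes1)\xi\,dz,\qquad \pi_J(f)\xi=\int_V\pi_J(f(z))(\lambda_z\otimes1)\xi\,dz .$$ The operator $\Theta_J$ on $S(V;\mathcal{A})$ is defined by $$\Theta_J(f)(x)=\int_V\alpha_{Jy}(\hat f(y))e(x\cdot y)\,dy.$$ *)

(* Defs.v *)
From HB Require Import structures.
From mathcomp Require Import all_boot all_order all_algebra.
From mathcomp Require Import sesquilinear complex.
From mathcomp Require Import all_classical all_reals all_analysis.

Set Implicit Arguments.
Unset Strict Implicit.
Unset Printing Implicit Defensive.
Import Order.TTheory GRing.Theory Num.Theory.
Import numFieldNormedType.Exports.

Local Open Scope classical_set_scope.
Local Open Scope ring_scope.
Local Open Scope complex_scope.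

Section LebesgueTuple.
Context (R : realType) (n : nat).
Local Notation RR := (measurableTypeR R).
Variable mu : {sigma_finite_measure set (n.-tuple RR) -> \bar R}.

Definition tuple_cons (p : RR * n.-tuple RR) : n.+1.-tuple RR :=
  [tuple of p.1 :: p.2].

Definition lebesgue_tuple_step : set (n.+1.-tuple RR) -> \bar R :=
  pushforward (@lebesgue_measure R \x mu)%E tuple_cons.

Let measurable_tuple_cons : measurable_fun [set: RR * n.-tuple RR] tuple_cons.
Proof. exact: measurable_cons. Qed.

Let step0 : lebesgue_tuple_step set0 = 0%E.
Proof. by rewrite /lebesgue_tuple_step /pushforward preimage_set0 measure0. Qed.

Let step_ge0 A : (0 <= lebesgue_tuple_step A)%E.
Proof. exact: measure_ge0. Qed.

Let step_sigma_additive : semi_sigma_additive lebesgue_tuple_step.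
Proof.
move=> F mF tF mUF; rewrite /lebesgue_tuple_step /pushforward preimage_bigcup.
apply: measure_semi_sigma_additive.
- by move=> k; rewrite -[X in measurable X]setTI; exact: measurable_tuple_cons.
- apply/trivIsetP => /= i j _ _ ij; rewrite -preimage_setI.
  by move/trivIsetP : tF => /(_ _ _ _ _ ij) ->//; rewrite preimage_set0.
- by rewrite -preimage_bigcup -[X in measurable X]setTI;
    exact: measurable_tuple_cons.
Qed.

HB.instance Definition _ := isMeasure.Build _ _ _
  lebesgue_tuple_step step0 step_ge0 step_sigma_additive.

Let step_sigma_finite : sigma_finite setT lebesgue_tuple_step.
Proof.
have /sigma_finiteP[F [FT Fnd Foo]] := sigma_finiteT (@lebesgue_measure R).
have /sigma_finiteP[G [GT Gnd Goo]] := sigma_finiteT mu.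
pose hd (t : n.+1.-tuple RR) : RR := tnth t ord0.
pose tl (t : n.+1.-tuple RR) : n.-tuple RR := [tuple of behead t].
exists (fun k => (hd @^-1` F k) `&` (tl @^-1` G k)).
  apply/esym; rewrite -subTset => t _.
  have : setT (hd t) by [].
  rewrite FT => -[i _ Fi].
  have : setT (tl t) by [].
  rewrite GT => -[j _ Gj].
  exists (maxn i j) => //=; split.
    by move: (Fi); apply/subsetPset/Fnd; rewrite leq_maxl.
  by move: (Gj); apply/subsetPset/Gnd; rewrite leq_maxr.
move=> k; have [mF Fo] := Foo k; have [mG Go] := Goo k; split.
  apply: measurableI; rewrite -[X in measurable X]setTI.
  - exact: (measurable_tnth ord0).
  - exact: (@measurable_behead _ RR n).
rewrite /lebesgue_tuple_step /pushforward.
rewrite (_ : _ @^-1` _ = F k `*` G k); last first.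
  have tlE x t : tl (tuple_cons (x, t)) = t by apply/val_inj.
  have hdE x t : hd (tuple_cons (x, t)) = x by [].
  by apply/seteqP; split => -[x t] /=; rewrite tlE hdE.
by rewrite product_measure1E//; apply: lte_mul_pinfty; rewrite ?ge0_fin_numE.
Qed.

HB.instance Definition _ := Measure_isSigmaFinite.Build _ _ _
  lebesgue_tuple_step step_sigma_finite.

End LebesgueTuple.

Fixpoint lebesgue_tuple (R : realType) (n : nat) :
    {sigma_finite_measure set (n.-tuple (measurableTypeR R)) -> \bar R} :=
  if n is n'.+1 then lebesgue_tuple_step (lebesgue_tuple R n')
  else \d_([tuple] : 0.-tuple (measurableTypeR R)).

Section VectorIntegral.
Context {R : realType} {A : tvsType R[i]}.
Context {disp : measure_display} {T : measurableType disp}.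
Variable mu : {measure set T -> \bar R}.

(* Gelfand-Pettis integral of a vector-valued function. In a Hausdorff locally
   convex space the value [a] is unique; [vint F] is 0 when there is none. *)
Definition is_vint (F : T -> A) (a : A) : Prop :=
  forall phi : {linear A -> R[i]^o}, continuous phi ->
    [/\ mu.-integrable setT (EFin \o (fun t => complex.Re (phi (F t)))),
        mu.-integrable setT (EFin \o (fun t => complex.Im (phi (F t)))) &
        phi a = (\int[mu]_t complex.Re (phi (F t)))
                  +i* (\int[mu]_t complex.Im (phi (F t)))].

Definition vint (F : T -> A) : A := xget 0 [set a | is_vint F a].

End VectorIntegral.

Section FrechetSpaces.
Context {R : realType} {A : tvsType R[i]}.

Record seminorm (p : A -> R) : Prop := Seminorm {
  seminormD : forall a b, p (a + b) <= p a + p b ;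
  seminormZ : forall (c : R[i]) a, (p (c *: a))%:C = `|c| * (p a)%:C }.

Definition defining_seminorms (p : nat -> A -> R) : Prop :=
  (forall n, seminorm (p n)) /\
  forall U : set A, nbhs (0 : A) U <->
    exists n (eps : R),
      0 < eps /\ [set a | forall i, (i <= n)%N -> p i a < eps] `<=` U.

(* The uniformity carried by a [tvsType] is not required to be the one induced
   by its addition, so Cauchy sequences are defined from [nbhs 0]. *)
Definition cauchy_sequence (u : nat -> A) : Prop :=
  forall U : set A, nbhs (0 : A) U ->
    exists N, forall m n, (N <= m)%N -> (N <= n)%N -> U (u m - u n).

Record frechet_algebra (mul : {bilinear A -> A -> A}) : Prop := FrechetAlgebra {
  frechet_hausdorff : hausdorff_space A ;
  frechet_seminorms : exists p, defining_seminorms p ;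
  frechet_complete : forall u, cauchy_sequence u ->
    exists l : A, u @ \oo --> l ;
  frechet_mulA : associative mul ;
  frechet_mul_continuous : continuous (fun ab : A * A => mul ab.1 ab.2) }.

End FrechetSpaces.

Section Smoothness.
Context {R : realType} {W : normedModType R} {A : tvsType R[i]}.
Implicit Type f : W -> A.

(* [derivable] and ['D_v f] of the library need a normed codomain. *)
Definition is_dderive f (x v : W) (l : A) : Prop :=
  (fun h : R => (h^-1)%:C *: (f (x + h *: v) - f x)) @ 0^' --> l.

Definition dderive f (x v : W) : A := xget 0 [set l | is_dderive f x v l].

Definition iter_dderive (s : seq W) f : W -> A :=
  foldr (fun v g x => dderive g x v) f s.

Definition smooth f : Prop := forall s : seq W,
  continuous (iter_dderive s f) /\
  forall x v, exists l, is_dderive (iter_dderive s f) x v l.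

Definition fdifferentiable f (x : W) : Prop :=
  exists D : W -> A,
    [/\ forall v w, D (v + w) = D v + D w,
        forall (r : R) v, D (r *: v) = r%:C *: D v,
        continuous D &
        (fun h : W => (`|h|^-1)%:C *: (f (x + h) - f x - D h)) @ 0^' --> (0 : A)].

Definition schwartz : set (W -> A) :=
  [set f | smooth f /\
    forall p : A -> R, seminorm p -> continuous p ->
    forall (s : seq W) (k : nat), exists M : R,
    forall x, `|x| ^+ k * p (iter_dderive s f x) <= M].

(* Neighbourhoods of [f] in the topology of [schwartz] given by the seminorms
   sup_x |x|^k p(D^s f(x)). A single [p] suffices for a finite list of indices
   (k, s), since the continuous seminorms on [A] are directed. *)
Definition schwartz_nbhs f : set_system (W -> A) :=
  [set O | exists (ks : seq (nat * seq W)) (p : A -> R) (eps : R),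
    [/\ seminorm p, continuous p, 0 < eps &
        forall g, schwartz g ->
          (forall i, i \in ks -> forall x,
             `|x| ^+ i.1 * p (iter_dderive i.2 (g - f) x) <= eps) -> O g]].

End Smoothness.

Section Actions.
Context {R : realType} {V : normedModType R} {A : tvsType R[i]}.
Variable alpha : V -> {linear A -> A}.

Record algebra_action (mul : A -> A -> A) : Prop := AlgebraAction {
  action0 : forall a, alpha 0 a = a ;
  actionD : forall x y a, alpha (x + y) a = alpha x (alpha y a) ;
  actionM : forall x a b, alpha x (mul a b) = mul (alpha x a) (alpha x b) }.

Definition isometric_action : Prop :=
  exists p : nat -> A -> R, defining_seminorms p /\
    forall n x a, p n (alpha x a) = p n a.

Definition smooth_action : Prop :=
  (forall a x, fdifferentiable (fun y => alpha y a) x) /\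
  forall X, continuous (fun a => dderive (fun y => alpha y a) 0 X).

End Actions.

Section Euclidean.
Context {R : realType} {V : normedModType R} {A : tvsType R[i]}.
Variables (dotp : {dot V for @idfun R}) (d : nat) (e : 'I_d -> V).

Definition coord_vec (t : d.-tuple (measurableTypeR R)) : V :=
  \sum_(i < d) (tnth t i : R) *: e i.

Record euclidean_space : Prop := EuclideanSpace {
  euclidean_norm : forall x : V, `|x| ^+ 2 = dotp x x ;
  euclidean_orthonormal : forall i j, dotp (e i) (e j) = (i == j)%:R ;
  euclidean_span : forall x, exists t, x = coord_vec t }.

Definition skew_operator (J : V -> V) : Prop :=
  forall x y, dotp (J x) y = - dotp x (J y).

(* The Lebesgue measure of a Euclidean space is the image of that of R^d under
   the coordinates of an orthonormal basis, and does not depend on the basis. *)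
Definition intV (F : V -> A) : A :=
  vint (lebesgue_tuple R d) (F \o coord_vec).

Definition intVV (F : V -> V -> A) : A :=
  vint (lebesgue_tuple R d \x lebesgue_tuple R d)%E
    (fun t => F (coord_vec t.1) (coord_vec t.2)).

(* e^{2 pi i <x, y>} *)
Definition character (x y : V) : R[i] :=
  cos (2 * pi * dotp x y) +i* sin (2 * pi * dotp x y).

Definition fourier (xi : V -> A) (x : V) : A :=
  intV (fun y => character (- x) y *: xi y).

Definition test_function (chi : V * V -> R[i]^o) : Prop :=
  smooth chi /\ exists2 K : set (V * V), compact K & forall z, ~ K z -> chi z = 0.

Definition translation (z : V) (xi : V -> A) (y : V) : A := xi (y - z).

Definition integrated_form (rho : A -> (V -> A) -> V -> A)
    (f xi : V -> A) (x : V) : A :=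
  intV (fun z => rho (f z) (translation z xi) x).

Section Deformation.
Variables (alpha : V -> {linear A -> A}) (mul : A -> A -> A) (J : V -> V).

Definition crossed_mul (m : A -> A -> A) (f g : V -> A) (x : V) : A :=
  intV (fun y => m (f y) (alpha y (g (x - y)))).

Definition rieffel_mul (a b : A) : A :=
  xget 0 [set c | forall chi : V * V -> R[i]^o,
    test_function chi -> chi (0, 0) = 1 ->
    (fun eps : R => intVV (fun x y =>
       ((chi (eps *: x, eps *: y) : R[i]) * character x y) *:
         mul (alpha (J x) a) (alpha y b))) @ 0^' --> c].

Definition crossed_rep (a : A) (xi : V -> A) (x : V) : A :=
  mul (alpha (- x) a) (xi x).

Definition deformed_rep (a : A) (xi : V -> A) (x : V) : A :=
  intV (fun y => character x y *: mul (alpha (J y - x) a) (fourier xi y)).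

Definition Theta (f : V -> A) (x : V) : A :=
  intV (fun y => character x y *: alpha (J y) (fourier f y)).

End Deformation.
End Euclidean.

(* Isomorphism of topological algebras whose underlying spaces are the linear
   subspaces [S] and [T] of [X] and [Y], with multiplications [mS], [mT] and
   neighbourhoods [nbhsS], [nbhsT]. *)
Record topological_algebra_iso (R : realType) (X Y : lmodType R[i])
    (S : set X) (nbhsS : X -> set_system X) (mS : X -> X -> X)
    (T : set Y) (nbhsT : Y -> set_system Y) (mT : Y -> Y -> Y)
    (Phi : X -> Y) : Prop := TopologicalAlgebraIso {
  iso_closedS : forall f g, S f -> S g -> S (mS f g) ;
  iso_closedT : forall f g, T f -> T g -> T (mT f g) ;
  iso_bij : set_bij S T Phi ;
  iso_linear : forall (c : R[i]) f g, S f -> S g ->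
    Phi (c *: f + g) = c *: Phi f + Phi g ;
  iso_mul : forall f g, S f -> S g -> Phi (mS f g) = mT (Phi f) (Phi g) ;
  iso_continuous : forall f, S f -> Phi @ nbhsS f --> nbhsT (Phi f) ;
  iso_open : forall f, S f -> forall O, nbhsS f O ->
    nbhsT (Phi f) (Phi @` (O `&` S)) }.

(* Main.v *)
Require Import Defs.
From HB Require Import structures.
From mathcomp Require Import all_boot all_order all_algebra.
From mathcomp Require Import sesquilinear complex.
From mathcomp Require Import all_classical all_reals all_analysis.
From mathcomp Require Import measurable_realfun ring lra.

(** On the Fourier side Theta_J is the multiplier fhat(y) -> alpha_(Jy)(fhat(y)).
    Fourier inversion for Schwartz functions with values in A makes Theta_J and
    Theta_(-J) mutually inverse (thetaK), and the seminorm estimates for the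
    Fourier transform and for such multipliers (schwartz_operator_theta) make
    both continuous. The equality of the two representations
    (deformed_rep_theta) is Fubini: both sides are equal to the integral over y
    of alpha_(Jy - x)(fhat(y)) xihat(y) e(x.y).

    Multiplicativity rests on one identity (deformed_integral): for every
    Schwartz function f and every b in A,
      int (f(y) x_J alpha_y(b)) dy = int Theta_J(f)(v) alpha_v(b) dv.
    Expanding g into characters, applying this identity to f modulated by a
    character and recombining gives
      f *_J g = Theta_(-J) (Theta_J(f) * Theta_J(g))
    (deformed_crossed), from which the isomorphism of algebras follows.

    The product x_J is an oscillatory integral, which has to be turned into an
    absolutely convergent one. Write rho(u) for the product over all j of
    (1 + i u_j)^-2. Integrating by parts in v moves the factor rho(u) into the
    amplitude at the price of derivatives of b, the terms containing derivatives
    of the test function vanishing in the limit. The inner integral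
      transform(a)(v) = int rho(u) alpha_(Ju)(a) e(u.v) du
    then converges, and integrating by parts in u shows that it decays
    integrably in v (osc_decay). Hence (rieffel_mulE)
      a x_J b = int transform(a)(v) alpha_v(b') dv,
    where b' is obtained from b by regularizing twice in every coordinate. To
    prove deformed_integral, Fubini turns the integral over y into a Fourier
    transform with the damping factor rho, and the factors of rho are removed
    one at a time by integrating by parts against the regularizations
    (damping_parts).

    Integrals of functions with values in A are weak integrals. They exist for
    continuous functions dominated, in every seminorm, by the integrable weight
    prod_j (1 + x_j^2)^-1 (dominated_vint). Identities between them are checked
    on real functionals, which separate points by the Hahn-Banach theorem, and
    this reduces Fubini, linear substitutions and dominated convergence to the
    scalar case. Integration by parts follows from translation invariance
    (intV_derivative0). Fourier inversion (ft_inversion) uses a cutoff for which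
    all one-dimensional integrals are elementary. *)

Set Implicit Arguments.
Unset Strict Implicit.
Unset Printing Implicit Defensive.
Import Order.TTheory GRing.Theory Num.Theory.
Import numFieldNormedType.Exports.

Local Open Scope classical_set_scope.
Local Open Scope ring_scope.
Local Open Scope complex_scope.

Local Notation normc := Normc.normc.

(** * Separation by real functionals *)

Section HahnBanach.
Context {R : realType} {A : lmodType R[i]}.

Definition real_linear (psi : A -> R) : Prop :=
  forall (t : R) a b, psi (t%:C *: a + b) = t * psi a + psi b.

Definition sublinear (p : A -> R) : Prop :=
  (forall a b, p (a + b) <= p a + p b) /\
  (forall (t : R) a, 0 <= t -> p (t%:C *: a) = t * p a).

Variables (p : A -> R) (p_sub : sublinear p) (a0 : A).
Hypothesis p_sym : forall a, p (- a) = p a.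

Let line : set (A * R) := [set u | exists t : R, u = (t%:C *: a0, t * p a0)].

Let closed_graph (G : set (A * R)) := forall (t : R) u v, G u -> G v ->
  G (t%:C *: u.1 + v.1, t * u.2 + v.2).

Let dominated (G : set (A * R)) := forall u, G u -> u.2 <= p u.1.

(** Partial functionals are represented by their graphs; adding the line keeps
    the union of the empty chain inside the family that Zorn's lemma explores. *)
Let extension (G : set (A * R)) :=
  closed_graph (G `|` line) /\ dominated (G `|` line).

Let p0 : p 0 = 0.
Proof. by have := p_sub.2 0 0 (lexx _); rewrite mul0r scaler0. Qed.

Let pge0 a : 0 <= p a.
Proof.
by have := p_sub.1 a (- a); rewrite subrr p0 p_sym; lra.
Qed.

Let pZ (t : R) a : p (t%:C *: a) = `|t| * p a.
Proof.
have [t0|t0] := lerP 0 t; first by rewrite p_sub.2// ger0_norm.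
rewrite -{1}(opprK t) rmorphN scaleNr p_sym p_sub.2 ?ltr0_norm//.
by rewrite oppr_ge0 ltW.
Qed.

Let extension_chain (F : set (set (A * R))) :
  F `<=` extension -> total_on F subset -> extension (\bigcup_(X in F) X).
Proof.
move=> Fext Ftot.
have line_cl t u v : line u -> line v -> line (t%:C *: u.1 + v.1, t * u.2 + v.2).
  move=> [s ->] [r ->] /=; exists (t * s + r).
  by rewrite rmorphD rmorphM scalerDl scalerA mulrDl mulrA.
split.
  move=> t u v [[X FX Xu]|lu] [[Y FY Yv]|lv].
  - have [XY|YX] := Ftot _ _ FX FY.
      have [w|w] := (Fext _ FY).1 t u v (or_introl (XY _ Xu)) (or_introl Yv).
      + by left; exists Y.
      + by right.
    have [w|w] := (Fext _ FX).1 t u v (or_introl Xu) (or_introl (YX _ Yv)).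
    + by left; exists X.
    + by right.
  - have [w|w] := (Fext _ FX).1 t u v (or_introl Xu) (or_intror lv).
      by left; exists X.
    by right.
  - have [w|w] := (Fext _ FY).1 t u v (or_intror lu) (or_introl Yv).
      by left; exists Y.
    by right.
  - by right; exact: line_cl.
move=> u [[X FX Xu]|[t ->]] /=; first exact: (Fext _ FX).2 _ (or_introl Xu).
by rewrite pZ ler_wpM2r// ler_norm.
Qed.

(** Zorn's lemma on dominated partial functionals that contain the line
    through a0. A maximal one is total: the triangle inequality leaves room
    for a value at any further vector. *)
Lemma hahn_banach : exists psi : A -> R,
  [/\ real_linear psi, forall a, `|psi a| <= p a & psi a0 = p a0].
Proof.
have [G0 [[Gcl Gdom] Gmax]] := Zorn_bigcup extension_chain.
pose G := G0 `|` line.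
have G00 : G (0, 0) by right; exists 0; rewrite mul0r rmorph0 scale0r.
have Ga0 : G (a0, p a0) by right; exists 1; rewrite mul1r scale1r.
have GZ t u : G u -> G (t%:C *: u.1, t * u.2).
  by move=> Gu; have := Gcl t u _ Gu G00; rewrite !addr0.
have GB u v : G u -> G v -> G (u.1 - v.1, u.2 - v.2).
  move=> Gu Gv; have := Gcl (-1) v u Gv Gu.
  by rewrite rmorphN scaleN1r mulN1r addrC [- _ + _]addrC.
have Gfun0 r : G (0, r) -> r = 0.
  move=> Gr; apply/eqP; rewrite eq_le; apply/andP; split.
    by rewrite -p0; exact: Gdom Gr.
  rewrite -oppr_le0 -p0; have := GZ (-1) _ Gr.
  by rewrite /= scaler0 mulN1r => /Gdom.
have Gfun a r s : G (a, r) -> G (a, s) -> r = s.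
  move=> Gr Gs; apply/eqP; rewrite -subr_eq0; apply/eqP/Gfun0.
  by have := GB _ _ Gr Gs; rewrite /= subrr.
(* one more vector: its value c separates the two families of bounds *)
have Gtot v : exists r, G (v, r).
  apply: contrapT => /forallNP nv.
  pose L := [set r | exists u, G u /\ r = u.2 - p (u.1 - v)].
  have Lub u : G u -> ubound L (p (u.1 + v) - u.2).
    move=> Gu _ [w [Gw ->]]; rewrite lerBrDr addrAC lerBlDr.
    have /Gdom /= := Gcl 1 _ _ Gw Gu; rewrite scale1r mul1r => h.
    apply: (le_trans h); rewrite (_ : w.1 + u.1 = (u.1 + v) + (w.1 - v)).
      exact: p_sub.1.
    by rewrite addrACA subrr addr0 addrC.
  have Lhs : has_sup L.
    by split; [exists (0 - p (0 - v)), (0, 0)|exists (p (0 + v) - 0); exact: (Lub (0, 0))].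
  pose c := sup L.
  have cdom u t : G u -> u.2 + t * c <= p (u.1 + t%:C *: v).
    move=> Gu; have [t0|t0|->] := ltrgtP t 0; last first.
    - by rewrite mul0r rmorph0 scale0r !addr0; exact: Gdom.
    - have tu := Lub _ (GZ t^-1 _ Gu).
      have : c <= p (t^-1%:C *: u.1 + v) - t^-1 * u.2 by apply: sup_le_ub => //; case: Lhs.
      rewrite -(ler_pM2l t0) mulrBr mulrA divff ?gt_eqF// mul1r.
      rewrite -(p_sub.2 _ _ (ltW t0)) scalerDr scalerA -rmorphM divff ?gt_eqF// scale1r.
      by rewrite lerBrDl.
    have [s s0 ->] : exists2 s, 0 < s & t = - s.
      by exists (- t); rewrite ?oppr_gt0 ?opprK.
    have : s^-1 * u.2 - p (s^-1%:C *: u.1 - v) <= c.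
      by apply: sup_upper_bound => //; exists (s^-1%:C *: u.1, s^-1 * u.2); split => //; exact: (GZ _ u).
    rewrite -(ler_pM2l s0) mulrBr mulrA divff ?gt_eqF// mul1r.
    rewrite -(p_sub.2 _ _ (ltW s0)) scalerBr scalerA -rmorphM divff ?gt_eqF// scale1r.
    by rewrite rmorphN scaleNr; lra.
  pose G1 := [set u | exists w t, G w /\ u = (w.1 + t%:C *: v, w.2 + t * c)].
  have GG1 : G `<=` G1.
    by move=> w Gw; exists w, 0; rewrite mul0r rmorph0 scale0r !addr0; case: w Gw.
  have G1l : G1 `|` line = G1.
    by apply/setUidPl => u lu; apply: GG1; right.
  apply: (Gmax G1); last first.
    rewrite /extension G1l; split; last by move=> _ [w [t [Gw ->]]]; exact: cdom.
    move=> t _ _ [u [r [Gu ->]]] [w [s [Gw ->]]] /=.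
    exists (t%:C *: u.1 + w.1, t * u.2 + w.2), (t * r + s); split; first exact: Gcl.
    rewrite /= rmorphD rmorphM scalerDl scalerDr scalerA.
    by rewrite addrACA mulrDr mulrDl mulrA (addrACA (t * u.2)).
  split; first by move=> u Gu; apply: GG1; left.
  move=> /(_ (v, c)) G1G; apply: (nv c); left; apply: G1G.
  by exists (0, 0), 1; split=> //=; rewrite scale1r mul1r !add0r.
pose psi v := projT1 (cid (Gtot v)).
have psiG v : G (v, psi v) := projT2 (cid (Gtot v)).
have psil : real_linear psi.
  by move=> t a b; apply: (Gfun _ _ _ (psiG _)); exact: (Gcl t _ _ (psiG a) (psiG b)).
exists psi; split => //; last exact: Gfun (psiG _) Ga0.
move=> a; rewrite ler_norml; apply/andP; split; last exact: Gdom (psiG a).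
rewrite lerNl -(p_sym a); suff <- : psi (- a) = - psi a by exact: Gdom (psiG _).
have psi0 : psi 0 = 0 by exact: Gfun (psiG _) G00.
have := psil (-1) a 0; rewrite psi0 !addr0 mulN1r.
by rewrite rmorphN scaleN1r.
Qed.

End HahnBanach.

(** * Directed systems of seminorms *)

Section Modulus.
Context {R : realType}.
Implicit Types (c : R[i]) (r : R).

Lemma normcE c : `|c| = (normc c)%:C. Proof. by []. Qed.

Lemma normc_ge0 c : 0 <= normc c.
Proof. by case: c => a b; rewrite /= sqrtr_ge0. Qed.

Lemma normcD c1 c2 : normc (c1 + c2) <= normc c1 + normc c2.
Proof. exact: le_normcD. Qed.

Lemma normc_real r : normc r%:C = `|r|.
Proof. by rewrite /= expr0n addr0 sqrtr_sqr. Qed.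

Lemma normc_i : normc ('i : R[i]) = 1.
Proof. by rewrite /= expr0n expr1n add0r sqrtr1. Qed.

Lemma normc_Re c : `|complex.Re c| <= normc c.
Proof.
case: c => a b /=; rewrite -sqrtr_sqr ler_sqrt ?addr_ge0 ?sqr_ge0//.
by rewrite lerDl sqr_ge0.
Qed.

Lemma normc_Im c : `|complex.Im c| <= normc c.
Proof.
case: c => a b /=; rewrite -sqrtr_sqr ler_sqrt ?addr_ge0 ?sqr_ge0//.
by rewrite lerDr sqr_ge0.
Qed.

Lemma normc_le_ReIm (a b : R) : normc (a +i* b) <= `|a| + `|b|.
Proof.
rewrite /= -(ger0_norm (addr_ge0 (normr_ge0 a) (normr_ge0 b))) -sqrtr_sqr.
rewrite ler_sqrt ?sqr_ge0// sqrrD !real_normK ?num_real// addrAC lerDl.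
by rewrite mulrn_wge0// mulr_ge0.
Qed.

Lemma normc_sq c : normc c ^+ 2 = complex.Re c ^+ 2 + complex.Im c ^+ 2.
Proof. by case: c => a b /=; rewrite sqr_sqrtr// addr_ge0 ?sqr_ge0. Qed.

End Modulus.

Section SeminormSystem.
Context {R : realType} {A : tvsType R[i]}.

(** Families directed by the index, so that a single member dominates any
    finite list of seminorms and one index suffices in every estimate. *)
Record seminorm_system (P : nat -> A -> R) : Prop := SeminormSystem {
  sys_seminorm : forall n, seminorm (P n) ;
  sys_mono : forall m n a, (m <= n)%N -> P m a <= P n a ;
  sys_nbhs : forall U : set A, nbhs (0 : A) U <->
    exists n (eps : R), 0 < eps /\ [set a | P n a < eps] `<=` U ;
  sys_separated : forall a, (forall n, P n a = 0) -> a = 0 }.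

Definition complete_system (P : nat -> A -> R) : Prop :=
  forall u : nat -> A,
  (forall n eps, 0 < eps -> exists N : nat, forall i j, (N <= i)%N -> (N <= j)%N ->
     P n (u i - u j) < eps) ->
  exists l, forall n eps, 0 < eps -> exists N : nat, forall i, (N <= i)%N ->
     P n (u i - l) < eps.

Variables (P : nat -> A -> R) (hP : seminorm_system P).

Lemma sysD n a b : P n (a + b) <= P n a + P n b.
Proof. exact: seminormD (sys_seminorm hP n) _ _. Qed.

Lemma sysZ n c a : P n (c *: a) = normc c * P n a.
Proof.
by apply: (@complexI R); rewrite (seminormZ (sys_seminorm hP n)) rmorphM.
Qed.

Lemma sysZr n (r : R) a : P n (r%:C *: a) = `|r| * P n a.
Proof. by rewrite sysZ normc_real. Qed.

Lemma sys0 n : P n 0 = 0.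
Proof. by rewrite -(scale0r (0 : A)) sysZ Normc.normc0 mul0r. Qed.

Lemma sysN n a : P n (- a) = P n a.
Proof. by rewrite -scaleN1r sysZ normcN Normc.normc1 mul1r. Qed.

Lemma sysB n a b : P n (a - b) <= P n a + P n b.
Proof. by rewrite -[in leRHS](sysN n b) sysD. Qed.

Lemma sysC n a b : P n (a - b) = P n (b - a).
Proof. by rewrite -sysN opprB. Qed.

Lemma sys_ge0 n a : 0 <= P n a.
Proof. by have := sysB n a a; rewrite subrr sys0; lra. Qed.

Lemma sys_dist n a b : `|P n a - P n b| <= P n (a - b).
Proof.
have := sysD n (a - b) b; have := sysD n (b - a) a.
by rewrite !subrK (sysC n b); rewrite ler_norml; lra.
Qed.

Lemma sys_tri n a b c : P n (a - c) <= P n (a - b) + P n (b - c).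
Proof. by have := sysD n (a - b) (b - c); rewrite addrA subrK. Qed.

Lemma sys_nbhsP (a : A) (U : set A) : nbhs a U <->
  exists n (eps : R), 0 < eps /\ [set b | P n (b - a) < eps] `<=` U.
Proof.
split=> [h|[n [eps [e0 sub]]]].
  have := nbhsB (- a) h; rewrite addNr => /(sys_nbhs hP)[n [eps [e0 sub]]].
  exists n, eps; split => // b /sub[c Uc]; rewrite addrC => /addIr.
  by move=> <-.
have h : nbhs (0 : A) [set b | P n b < eps] by apply/(sys_nbhs hP); exists n, eps; split.
apply: filterS (nbhsT a h) => _ [b /= Pb <-].
by apply: sub; rewrite /= addrC addKr.
Qed.

Lemma sys_cvgP T (F : set_system T) {FF : Filter F} (f : T -> A) (l : A) :
  f @ F --> l <->
  forall n eps, 0 < eps -> \forall x \near F, P n (f x - l) < eps.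
Proof.
split=> [fl n eps e0|h U /sys_nbhsP[n [eps [e0 sub]]]].
  by apply: (fl [set b | P n (b - l) < eps]); apply/sys_nbhsP; exists n, eps; split.
by apply: filterS (h n eps e0) => x /= ?; exact: sub.
Qed.

Lemma sys_hausdorff : hausdorff_space A.
Proof.
move=> a b ab; apply/eqP; rewrite -subr_eq0; apply/eqP/(sys_separated hP) => n.
apply/eqP; rewrite eq_le sys_ge0 andbT; apply/ler_addgt0Pr => _/posnumP[e].
have h c : nbhs c [set x | P n (x - c) < e%:num / 2].
  by apply/sys_nbhsP; exists n, (e%:num / 2); split.
have [c [/= h1 h2]] := ab _ _ (h a) (h b).
rewrite add0r; apply: le_trans (sys_tri n a c b) _.
by rewrite (sysC n a); move: h1 h2; lra.
Qed.

Lemma sys_continuous n : continuous (P n).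
Proof.
move=> a; apply/cvgrPdist_lt => eps e0.
have : \forall x \near a, P n (x - a) < eps.
  by apply/sys_nbhsP; exists n, eps; split.
by apply: filterS => x /=; apply: le_lt_trans; rewrite sysC; exact: sys_dist.
Qed.

Lemma homogeneous_bound (q : A -> R) m (del K : R) : 0 < del ->
  (forall r a, 0 <= r -> q (r%:C *: a) = r * q a) ->
  (forall a, P m a < del -> q a <= K) ->
  forall a, q a <= (2 * K / del) * P m a.
Proof.
move=> d0 qZ qK a; have [Pa|Pa] := ltrP 0 (P m a).
  pose r := del / (2 * P m a); have r0 : 0 < r by rewrite divr_gt0// mulr_gt0.
  have : P m (r%:C *: a) < del.
    rewrite sysZr gtr0_norm// /r -mulrA invfM -!mulrA mulVf ?gt_eqF//.
    by rewrite mulr1 ltr_pdivrMr//; lra.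
  move/qK; rewrite (qZ _ _ (ltW r0)) -ler_pdivlMl// => h.
  by apply: le_trans h _; rewrite /r invf_div le_eqVlt; apply/orP; left; apply/eqP; ring.
have P0 : P m a = 0 by apply/eqP; rewrite eq_le Pa sys_ge0.
rewrite P0 mulr0; apply/negP => /negP; rewrite -ltNge => qa.
pose r := (`|K| + 1) / q a; have r0 : 0 < r by rewrite divr_gt0// ltr_wpDl.
have := qK (r%:C *: a); rewrite sysZr P0 mulr0 => /(_ d0).
rewrite (qZ _ _ (ltW r0)) /r -mulrA mulVf ?gt_eqF// mulr1.
by have := ler_norm K; lra.
Qed.

Lemma homogeneous_near0 (q : A -> R) :
  (forall r a, 0 <= r -> q (r%:C *: a) = r * q a) ->
  (\forall a \near (0 : A), q a < 1) ->
  exists n C, 0 <= C /\ forall a, q a <= C * P n a.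
Proof.
move=> qZ /(sys_nbhs hP)[n [del [d0 sub]]]; exists n, (2 * 1 / del); split.
  by rewrite divr_ge0// ?ltW//; lra.
by apply: homogeneous_bound => // a /sub /= /ltW.
Qed.

(** Continuity at 0 gives the bound on a ball, homogeneity elsewhere. *)
Lemma continuous_seminorm_bound (p : A -> R) : seminorm p -> continuous p ->
  exists n C, 0 <= C /\ forall a, p a <= C * P n a.
Proof.
move=> hp cp; have pZ (c : R[i]) a : p (c *: a) = normc c * p a.
  by apply: (@complexI R); rewrite (seminormZ hp) rmorphM.
apply: homogeneous_near0 => [r a r0|]; first by rewrite pZ normc_real ger0_norm.
have p0 : p 0 = 0 by rewrite -(scale0r (0 : A)) pZ Normc.normc0 mul0r.
have /cvgrPdist_lt/(_ 1 ltr01) := cp 0.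
apply: filterS => x; rewrite p0 sub0r normrN; exact/le_lt_trans/ler_norm.
Qed.

End SeminormSystem.

Section ContinuousLinear.
Context {R : realType} {A B : tvsType R[i]}.
Variables (P : nat -> A -> R) (hP : seminorm_system P).
Variables (Q : nat -> B -> R) (hQ : seminorm_system Q).

Lemma continuous_linear_bound (L : A -> B) :
  (forall (r : R) a, L (r%:C *: a) = r%:C *: L a) -> L @ (0 : A) --> (0 : B) ->
  forall n, exists m C, 0 <= C /\ forall a, Q n (L a) <= C * P m a.
Proof.
move=> LZ cL n; apply: (homogeneous_near0 hP) => [r a r0|].
  by rewrite LZ (sysZr hQ) ger0_norm.
have /(sys_cvgP hQ)/(_ n 1 ltr01) := cL; apply: filterS => a.
by rewrite subr0.
Qed.

Lemma linear_bound_continuous (L : A -> B) :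
  (forall a b, L (a - b) = L a - L b) ->
  (forall n, exists m C, 0 <= C /\ forall a, Q n (L a) <= C * P m a) ->
  continuous L.
Proof.
move=> LB bL a; apply/(sys_cvgP hQ) => n eps e0.
have [m [C [C0 hC]]] := bL n.
apply/(sys_nbhsP hP); exists m, (eps / (C + 1)).
rewrite divr_gt0 ?ltr_wpDl//; split=> // b /=.
rewrite ltr_pdivlMr ?ltr_wpDl// => h; rewrite -LB; apply: le_lt_trans (hC _) _.
by have := sys_ge0 hP m (b - a); nra.
Qed.

End ContinuousLinear.

Section ScalarSystem.
Context {R : realType}.

Definition scalar_seminorm (_ : nat) (c : R[i]^o) : R := normc c.

Lemma scalar_system : seminorm_system scalar_seminorm.
Proof.
split=> [n|//|U|a /(_ 0%N)]; last exact: Normc.eq0_normc.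
  by split=> [a b|c a]; [exact: normcD|rewrite -!normcE normrM].
split=> [/nbhs_ballP[e /= e0 eU]|[n [eps [e0 sub]]]].
  have [ei er] : complex.Im e = 0 /\ 0 < complex.Re e.
    by move: e0; rewrite ltcE /= => /andP[/eqP].
  exists 0%N, (complex.Re e); split=> // a /= ae; apply: eU.
  rewrite -ball_normE /= sub0r normrN normcE ltcE /= ei eqxx /=.
  by case: a ae.
apply/nbhs_ballP; exists (eps%:C); first by rewrite /= ltcR.
move=> a; rewrite -ball_normE /= sub0r normrN normcE ltcR => ?.
exact: sub.
Qed.

End ScalarSystem.

Section Convergence.
Context {R : realType} {A : tvsType R[i]} {T : Type}.
Context {F : set_system T} {FF : Filter F}.
Implicit Types (f g : T -> A) (h : T -> R[i]^o).

Lemma eq_cvg_fun (X : Type) (G : set_system X) (f g : T -> X) :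
  f =1 g -> f @ F --> G -> g @ F --> G.
Proof. by move=> /funext ->. Qed.

Lemma tvs_cvgD f g (a b : A) : f @ F --> a -> g @ F --> b ->
  (fun t => f t + g t) @ F --> a + b.
Proof.
move=> fa gb.
exact: continuous2_cvg (@add_continuous A (a, b)) fa gb.
Qed.

Lemma tvs_cvgB f g (a b : A) : f @ F --> a -> g @ F --> b ->
  (fun t => f t - g t) @ F --> a - b.
Proof.
move=> fa gb.
apply: tvs_cvgD => //; exact: cvg_comp gb (@opp_continuous A b).
Qed.

Lemma tvs_cvgZ h g (c : R[i]^o) (b : A) : h @ F --> c -> g @ F --> b ->
  (fun t => (h t : R[i]) *: g t) @ F --> (c : R[i]) *: b.
Proof.
move=> hc gb.
exact: continuous2_cvg (@scale_continuous _ A (c, b)) hc gb.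
Qed.

Lemma cvg_complex (f g : T -> R) (a b : R) : f @ F --> a -> g @ F --> b ->
  (fun t => f t +i* g t : R[i]^o) @ F --> (a +i* b : R[i]^o).
Proof.
move=> /cvgrPdist_lt fa /cvgrPdist_lt gb.
apply/(sys_cvgP (@scalar_system R)) => n eps e0.
have e2 : 0 < eps / 2 by rewrite divr_gt0.
have := fa _ e2; have := gb _ e2; apply: filterS2 => t; rewrite distrC => h1.
rewrite distrC => h2; apply: le_lt_trans (normc_le_ReIm _ _) _.
by move: h1 h2; rewrite /=; lra.
Qed.

Lemma cvg_real_complex (f : T -> R) (a : R) : f @ F --> a ->
  (fun t => (f t)%:C : R[i]^o) @ F --> (a%:C : R[i]^o).
Proof. by move=> fa; apply: cvg_complex => //; exact: cvg_cst. Qed.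

End Convergence.

Section FrechetSystem.
Context {R : realType} {A : tvsType R[i]}.
Variables (p : nat -> A -> R) (hp : defining_seminorms p).

(** Partial sums turn a defining family into a directed one. *)
Definition cumulative_seminorm (n : nat) (a : A) : R := \sum_(i < n.+1) p i a.

Let pge0 n a : 0 <= p n a.
Proof.
have pZ (c : R[i]) b : p n (c *: b) = normc c * p n b.
  by apply: (@complexI R); rewrite (seminormZ (hp.1 n)) rmorphM.
have p0 : p n 0 = 0 by rewrite -(scale0r (0 : A)) pZ Normc.normc0 mul0r.
have := seminormD (hp.1 n) a (- a); rewrite subrr p0 -scaleN1r pZ normcN.
by rewrite Normc.normc1 mul1r; lra.
Qed.

Let p_le n i a : (i <= n)%N -> p i a <= cumulative_seminorm n a.
Proof.
rewrite -ltnS => lin; rewrite /cumulative_seminorm (bigD1 (Ordinal lin))//=.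
by rewrite lerDl; apply: sumr_ge0 => *; exact: pge0.
Qed.

Lemma cumulative_seminorm_nbhs (U : set A) : nbhs (0 : A) U <->
  exists n (eps : R), 0 < eps /\ [set a | cumulative_seminorm n a < eps] `<=` U.
Proof.
rewrite (hp.2 U); split=> -[n [eps [e0 sub]]].
  exists n, eps; split=> // a /= ae; apply: sub => i lin.
  exact: le_lt_trans (p_le _ lin) ae.
exists n, (eps / n.+1%:R); rewrite divr_gt0//; split=> // a /= ae; apply: sub => /=.
rewrite /cumulative_seminorm.
apply: (@lt_le_trans _ _ (\sum_(i < n.+1) (eps / n.+1%:R))).
  apply: ltr_sum => [|i _]; last by apply: ae; rewrite -ltnS.
  by apply/hasP; exists ord0; rewrite ?mem_index_enum.
rewrite sumr_const card_ord -[leLHS]mulr_natr -mulrA mulVf ?mulr1//.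
Qed.

Lemma cumulative_seminorm_system :
  hausdorff_space A -> seminorm_system cumulative_seminorm.
Proof.
move=> hA; split.
- move=> n; split=> [a b|c a].
    rewrite -big_split; apply: ler_sum => i _; exact: seminormD (hp.1 i) _ _.
  rewrite /cumulative_seminorm !rmorph_sum mulr_sumr.
  by apply: eq_bigr => i _; exact: seminormZ (hp.1 i) _ _.
- move=> m n a mn; rewrite /cumulative_seminorm -!(big_mkord xpredT (fun i => p i a)).
  rewrite [leRHS](@big_cat_nat _ _ _ m.+1)//=.
  by rewrite lerDl; apply: sumr_ge0 => *; exact: pge0.
- exact: cumulative_seminorm_nbhs.
- move=> a Pa; apply: hA => U W U0 W0; exists 0; split; last exact: nbhs_singleton.
  have : nbhs (0 : A) [set b | U (a + b)].
    have := @add_continuous A (a, 0) U; rewrite /= addr0 => /(_ U0).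
    move=> [[X Y] /= [X0 Y0] XY]; apply: filterS Y0 => b Yb.
    by apply: (XY (a, b)); split => //; exact: nbhs_singleton.
  move=> /cumulative_seminorm_nbhs[n [eps [e0 /(_ (- a))]]] /=.
  rewrite subrr; apply; suff -> : cumulative_seminorm n (- a) = cumulative_seminorm n a.
    by rewrite Pa.
  apply: eq_bigr => i _; apply: (@complexI R).
  by rewrite -scaleN1r (seminormZ (hp.1 i)) normrN1 mul1r.
Qed.

Lemma cumulative_seminorm_complete :
  (forall u : nat -> A, cauchy_sequence u -> exists l : A, u @ \oo --> l) ->
  hausdorff_space A -> complete_system cumulative_seminorm.
Proof.
move=> cA hA u cu; have hP := cumulative_seminorm_system hA.
have [|l ul] := cA u.
  move=> U /cumulative_seminorm_nbhs[n [eps [e0 sub]]].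
  by have [N hN] := cu n _ e0; exists N => i j iN jN; apply: sub; exact: hN.
exists l => n eps e0; have /(sys_cvgP hP)/(_ n eps e0) := ul.
by case=> N _ hN; exists N => i iN; exact: hN.
Qed.

End FrechetSystem.

Section RealFunctionals.
Context {R : realType} {A : tvsType R[i]}.
Variables (P : nat -> A -> R) (hP : seminorm_system P).
Implicit Type psi : A -> R.

(** Continuous real-linear functionals. They are the real parts of the
    continuous complex functionals, and come with a real-valued integration
    theory. *)
Definition real_functional psi : Prop :=
  real_linear psi /\ exists n C, 0 <= C /\ forall a, `|psi a| <= C * P n a.

Lemma real_linear0 psi : real_linear psi -> psi 0 = 0.
Proof. by move=> h; have := h (-1) 0 0; rewrite scaler0 addr0; lra. Qed.

Lemma real_linearD psi : real_linear psi -> {morph psi : a b / a + b}.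
Proof. by move=> h a b; have := h 1 a b; rewrite scale1r mul1r. Qed.

Lemma real_linearZ psi (r : R) a : real_linear psi -> psi (r%:C *: a) = r * psi a.
Proof. by move=> h; have := h r a 0; rewrite !addr0 real_linear0// addr0. Qed.

Lemma real_linearN psi a : real_linear psi -> psi (- a) = - psi a.
Proof.
by move=> h; have := real_linearZ (-1) a h; rewrite rmorphN scaleN1r mulN1r.
Qed.

Lemma real_linearB psi : real_linear psi -> {morph psi : a b / a - b}.
Proof. by move=> h a b; rewrite real_linearD// real_linearN. Qed.

Lemma real_linear_sum psi I (r : seq I) (Q : pred I) (F : I -> A) :
  real_linear psi ->
  psi (\sum_(i <- r | Q i) F i) = \sum_(i <- r | Q i) psi (F i).
Proof.
by move=> h; exact: (big_morph psi (real_linearD h) (real_linear0 h)).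
Qed.

Lemma complexZE (a b : R) (x : A) : (a +i* b) *: x = a%:C *: x + b%:C *: ('i *: x).
Proof.
by rewrite scalerA -scalerDl; congr (_ *: _); rewrite (complexE (a +i* b)) /= mulrC.
Qed.

Lemma real_linear_complexZ psi (a b : R) x : real_linear psi ->
  psi ((a +i* b) *: x) = a * psi x + b * psi ('i *: x).
Proof. by move=> h; rewrite complexZE h real_linearZ. Qed.

Lemma real_functional_comp psi (L : A -> A) : real_functional psi ->
  (forall (r : R) a b, L (r%:C *: a + b) = r%:C *: L a + L b) ->
  (forall n, exists m C, 0 <= C /\ forall a, P n (L a) <= C * P m a) ->
  real_functional (psi \o L).
Proof.
move=> [psil [n [C [C0 hC]]]] Ll Lb; split.
  by move=> r a b /=; rewrite Ll psil.
have [m [D [D0 hD]]] := Lb n; exists m, (C * D); split; first exact: mulr_ge0.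
by move=> a /=; rewrite -mulrA (le_trans (hC _))// ler_wpM2l.
Qed.

Lemma real_functionalZ psi (c : R[i]) : real_functional psi ->
  real_functional (fun a => psi (c *: a)).
Proof.
move=> h; apply: (real_functional_comp (L := fun a => c *: a) h).
  by move=> r a b; rewrite scalerDr !scalerA mulrC.
move=> n; exists n, (normc c); split=> [|a]; first exact: normc_ge0.
by rewrite (sysZ hP).
Qed.

Lemma real_functional_continuous psi : real_functional psi -> continuous psi.
Proof.
move=> [psil [n [C [C0 hC]]]] a; apply/cvgrPdist_lt => eps e0.
have : \forall x \near a, P n (x - a) < eps / (C + 1).
  apply/(sys_nbhsP hP); exists n, (eps / (C + 1)).
  by rewrite divr_gt0 ?ltr_wpDl//; split.
apply: filterS => x; rewrite ltr_pdivlMr ?ltr_wpDl// => h.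
rewrite -real_linearB//; apply: le_lt_trans (hC _) _; rewrite (sysC hP).
by have := sys_ge0 hP n (x - a); nra.
Qed.

Lemma norming_functional n a : exists psi,
  [/\ real_functional psi, forall b, `|psi b| <= P n b & psi a = P n a].
Proof.
have sub : sublinear (P n).
  by split=> [x y|t x t0]; [exact: sysD|rewrite (sysZr hP) ger0_norm].
have [psi [psil psile psia]] := hahn_banach sub a (sysN hP n).
exists psi; split => //; split => //; exists n, 1; split => // b.
by rewrite mul1r.
Qed.

Lemma functional_separation a b :
  (forall psi, real_functional psi -> psi a = psi b) -> a = b.
Proof.
move=> h; apply/eqP; rewrite -subr_eq0; apply/eqP/(sys_separated hP) => n.
have [psi [psif _ <-]] := norming_functional n (a - b).
by rewrite real_linearB ?(h psi psif) ?subrr//; case: psif.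
Qed.

Lemma seminorm_le_functional n a (M : R) :
  (forall psi, real_functional psi -> (forall b, `|psi b| <= P n b) ->
     psi a <= M) -> P n a <= M.
Proof.
move=> h; have [psi [psif psib psia]] := norming_functional n a.
by rewrite -psia; exact: h.
Qed.

Section Complexification.
Variables (psi : A -> R) (psif : real_functional psi).

Definition complexification (a : A) : R[i]^o := psi a -i* psi ('i *: a).

Lemma complexification_linear : linear complexification.
Proof.
move=> [s t] a b; rewrite /complexification.
rewrite scalerDr [_ +i* _ *: _]complexZE.
have -> : 'i *: (s%:C *: a + t%:C *: ('i *: a)) = s%:C *: ('i *: a) + (- t)%:C *: a.
  rewrite scalerDr !scalerA; congr (_ + _); first by rewrite mulrC.
  congr (_ *: _); rewrite mulrAC -expr2 sqr_i mulN1r rmorphN//.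
have psil := psif.1.
rewrite !real_linearD// !real_linearZ//.
rewrite /GRing.scale /=; apply/eqP; rewrite eq_complex /=.
by apply/andP; split; apply/eqP; ring.
Qed.

Lemma complexification_continuous : continuous complexification.
Proof.
apply: (linear_bound_continuous hP scalar_system) => [a b|k].
  rewrite [a - b]addrC -(scaleN1r b) complexification_linear [RHS]addrC.
  by congr (_ + _); exact: (@scaleN1r _ R[i]^o).
have [n [C [C0 hC]]] := psif.2; exists n, (C + C); split; first exact: addr_ge0.
move=> a; rewrite /scalar_seminorm; apply: le_trans (normc_le_ReIm _ _) _.
rewrite mulrDl lerD// normrN; apply: le_trans (hC _) _.
by rewrite (sysZ hP) normc_i mul1r.
Qed.

End Complexification.

(** Complex functionals are determined by their real parts, so weak integrals
    can be tested on real functionals. *)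
Lemma is_vintP disp (T : measurableType disp) (mu : {measure set T -> \bar R})
    (F : T -> A) (a : A) :
  is_vint mu F a <-> forall psi, real_functional psi ->
    mu.-integrable setT (EFin \o (psi \o F)) /\ psi a = \int[mu]_t psi (F t).
Proof.
split=> [h psi psif|h phi phic].
  have [] := h (HB.pack_for {linear A -> R[i]^o} (complexification psi)
     (GRing.isLinear.Build R[i] A R[i]^o _ _ (complexification_linear psif)))
     (complexification_continuous psif).
  by move=> ih _ /= [].
have [n [C [C0 hC]]] : exists n C, 0 <= C /\ forall a, normc (phi a) <= C * P n a.
  apply: (continuous_linear_bound hP scalar_system _ _ 0%N).
    by move=> r b; rewrite linearZ.
  by have := phic (0 : A); rewrite /continuous_at (linear0 phi).
have re : real_functional (fun a => complex.Re (phi a)).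
  split; last first.
    by exists n, C; split => // b; exact: le_trans (normc_Re _) (hC _).
  move=> t b c; rewrite linearP; case: (phi b) => ? ?; case: (phi c) => ? ? /=.
  by rewrite mul0r subr0.
have im : real_functional (fun a => complex.Im (phi a)).
  split; last first.
    by exists n, C; split => // b; exact: le_trans (normc_Im _) (hC _).
  move=> t b c; rewrite linearP; case: (phi b) => ? ?; case: (phi c) => ? ? /=.
  by rewrite mul0r addr0.
have [i1 e1] := h _ re; have [i2 e2] := h _ im.
by split => //; rewrite -e1 -e2; case: (phi a).
Qed.

Lemma is_vint_unique disp (T : measurableType disp)
    (mu : {measure set T -> \bar R}) (F : T -> A) a b :
  is_vint mu F a -> is_vint mu F b -> a = b.
Proof.
move=> /is_vintP ha /is_vintP hb; apply: functional_separation => psi psif.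
by rewrite (ha psi psif).2 (hb psi psif).2.
Qed.

Lemma vintE disp (T : measurableType disp) (mu : {measure set T -> \bar R})
    (F : T -> A) a : is_vint mu F a -> vint mu F = a.
Proof.
move=> ha; apply: (is_vint_unique _ ha); rewrite /vint.
by have := @xgetPex _ 0 [set b | is_vint mu F b]; apply; exists a.
Qed.

End RealFunctionals.

(** * Weak integrals of dominated continuous functions *)

Section RealIntegration.
Context {disp : measure_display} {T : measurableType disp} {R : realType}.
Variable mu : {measure set T -> \bar R}.
Implicit Types f g : T -> R.

Definition rintegrable f := mu.-integrable setT (EFin \o f).

Lemma rintegrable_measurable f : rintegrable f -> measurable_fun setT f.
Proof. by move=> /measurable_int /measurable_EFinP. Qed.

Lemma rintegrable_le f g : measurable_fun setT f -> rintegrable g ->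
  (forall t, `|f t| <= g t) -> rintegrable f.
Proof.
move=> mf ig fg; apply: (@le_integrable _ _ _ mu setT measurableT _ (EFin \o g)) => //.
  exact/measurable_EFinP.
by move=> t _ /=; rewrite lee_fin (le_trans (fg t)) ?ler_norm.
Qed.

Lemma rintegrableD f g : rintegrable f -> rintegrable g ->
  rintegrable (fun t => f t + g t).
Proof.
move=> fi gi; rewrite /rintegrable (_ : _ \o _ = (EFin \o f) \+ (EFin \o g))%E//.
exact: integrableD.
Qed.

Lemma rintegrableZ (r : R) f : rintegrable f -> rintegrable (fun t => r * f t).
Proof.
move=> fi; rewrite /rintegrable (_ : _ \o _ = (fun t => r%:E * (EFin \o f) t))%E//.
exact: integrableZl.
Qed.

Lemma rintegrable_sum I (s : seq I) (f : I -> T -> R) :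
  (forall i, rintegrable (f i)) -> rintegrable (fun t => \sum_(i <- s) f i t).
Proof.
move=> fi; elim: s => [|i s IH].
  rewrite /rintegrable (_ : _ \o _ = cst 0%E); first exact: integrable0.
  by apply/funext => t /=; rewrite big_nil.
rewrite (_ : (fun t => _) = (fun t => f i t + \sum_(i <- s) f i t)).
  exact: rintegrableD.
by apply/funext => t; rewrite big_cons.
Qed.

Lemma Rintegral_sum I (s : seq I) (f : I -> T -> R) :
  (forall i, rintegrable (f i)) ->
  \int[mu]_t (\sum_(i <- s) f i t) = \sum_(i <- s) \int[mu]_t f i t.
Proof.
move=> fi; elim: s => [|i s IH].
  rewrite big_nil (_ : (fun t => _) = cst 0) ?Rintegral_cst ?mul0r//.
  by apply/funext => t; rewrite big_nil.
rewrite big_cons -IH -RintegralD//; last exact: rintegrable_sum.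
  by congr Rintegral; apply/funext => t; rewrite big_cons.
exact: fi.
Qed.

Lemma le_rintegral f g : rintegrable f -> rintegrable g ->
  (forall t, f t <= g t) -> \int[mu]_t f t <= \int[mu]_t g t.
Proof. by move=> fi gi fg; apply: le_Rintegral. Qed.

Lemma norm_rintegral_le f g : rintegrable f -> rintegrable g ->
  (forall t, `|f t| <= g t) -> `|\int[mu]_t f t| <= \int[mu]_t g t.
Proof.
move=> fi gi fg; apply: le_trans (le_normr_Rintegral measurableT fi) _.
by apply: le_rintegral => //; exact: integrable_norm.
Qed.

Lemma dominated_rintegral_cvg (F : nat -> T -> R) f g :
  (forall n, measurable_fun setT (F n)) -> rintegrable g ->
  (forall n t, `|F n t| <= g t) -> (forall t, F ^~ t @ \oo --> f t) ->
  rintegrable f /\ (fun n => \int[mu]_t F n t) @ \oo --> \int[mu]_t f t.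
Proof.
move=> mF ig Fg Ff.
have mf : measurable_fun setT f.
  by apply: (measurable_fun_cvg mF) => t _; exact: Ff.
have [||||fi _ h] := @dominated_convergence _ T R mu setT measurableT
  (fun n => EFin \o F n) (EFin \o f) (EFin \o g) _ _ _ ig _.
- by move=> n; exact/measurable_EFinP.
- exact/measurable_EFinP.
- by apply: aeW => t _ /=; apply: cvg_EFin; [exact: nearW|exact: Ff].
- by apply: aeW => t n _ /=; rewrite lee_fin.
split => //; apply: fine_cvg; rewrite fineK//.
exact: (integrable_fin_num measurableT fi).
Qed.

End RealIntegration.

Section MeasurableBasis.
Context {disp : measure_display} {T : measurableType disp} {X : topologicalType}.

(** A parametrization [c] of a second countable space by a measurable one.
    Traces of a countable topological basis replace a Borel structure on [T]. *)
Definition measurable_basis (c : T -> X) : Prop :=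
  exists B : nat -> set T, (forall k, measurable (B k)) /\
    forall t (U : set X), nbhs (c t) U ->
      exists k, B k t /\ forall s, B k s -> U (c s).

Lemma basis_measurable_fun {R : realType} (c : T -> X) (F : X -> R) :
  measurable_basis c -> continuous F -> measurable_fun setT (F \o c).
Proof.
move=> [B [mB hB]] cF; apply: (measurability _ (RGenOInfty.measurableE R)).
move=> _ [_ [x ->] <-]; rewrite setTI.
rewrite (_ : _ @^-1` _ =
    \bigcup_(k in [set k | forall s, B k s -> x < F (c s)]) B k); last first.
  apply/seteqP; split => [t|t [k /= h Bt]] /=; last first.
    by rewrite in_itv /= andbT; exact: h.
  rewrite in_itv /= andbT => xt.
  have [k [Bt Bs]] := hB t (F @^-1` [set y | x < y]) (cF (c t) _ (lt_nbhsr xt)).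
  by exists k.
by apply: bigcup_measurable => k _; exact: mB.
Qed.

End MeasurableBasis.

Lemma measurable_basis_prod (d1 d2 : measure_display) (T1 : measurableType d1)
    (T2 : measurableType d2) (X1 X2 : topologicalType) (c1 : T1 -> X1) (c2 : T2 -> X2) :
  measurable_basis c1 -> measurable_basis c2 ->
  measurable_basis (fun t : T1 * T2 => (c1 t.1, c2 t.2)).
Proof.
move=> [B1 [m1 h1]] [B2 [m2 h2]].
exists (fun k => if @unpickle (nat * nat)%type k is Some (i, j) then B1 i `*` B2 j else set0).
split=> [k|t U /= [[U1 U2] /= [nU1 nU2] sub]].
  by case: unpickle => [[i j]|]; [exact: measurableX|exact: measurable0].
have [i [Bi Ui]] := h1 _ _ nU1; have [j [Bj Uj]] := h2 _ _ nU2.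
exists (pickle (i, j)); rewrite pickleK; split => // s [si sj].
by apply: sub; split; [exact: Ui|exact: Uj].
Qed.

Section WeakIntegral.
Context {R : realType} {A : tvsType R[i]}.
Variables (P : nat -> A -> R) (hP : seminorm_system P).
Context {disp : measure_display} {T : measurableType disp}.
Variable mu : {measure set T -> \bar R}.
Context {X : topologicalType}.
Variables (c : T -> X) (w : X -> R).
Hypothesis cbasis : measurable_basis c.
Hypothesis w_gt0 : forall x, 0 < w x.
Hypothesis w_cont : continuous w.
Hypothesis w_int : rintegrable mu (w \o c).

(** Domination by one integrable weight in every seminorm: this class of
    integrands is stable under all the operations below. *)
Definition dominated (F : X -> A) : Prop :=
  continuous F /\ forall n, exists C, 0 <= C /\ forall x, P n (F x) <= C * w x.

Lemma dominated_functional F psi : dominated F -> real_functional P psi ->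
  rintegrable mu (fun t => psi (F (c t))).
Proof.
move=> [cF bF] psif; have [psil [n [C [C0 hC]]]] := psif.
have [D [D0 hD]] := bF n.
apply: (@rintegrable_le _ _ _ _ _ (fun t => (C * D) * w (c t))).
- apply: (basis_measurable_fun (F := psi \o F) cbasis) => x.
  by apply: continuous_comp; [exact: cF|exact: (real_functional_continuous hP)].
- exact: rintegrableZ.
- move=> t; apply: le_trans (hC _) _.
  by rewrite -mulrA ler_wpM2l.
Qed.

(** Cut [T] into countably many pieces on which [F / w] oscillates little and
    integrate [w] on finitely many of them. The estimate is uniform over the
    functionals dominated by a seminorm, which makes these sums Cauchy. *)
Lemma dominated_approximation F n (del : R) : dominated F -> 0 < del ->
  exists a, forall psi, real_linear psi -> (forall b, `|psi b| <= P n b) ->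
    `|psi a - \int[mu]_t psi (F (c t))| <= del.
Proof.
move=> domF d0; have [cF bF] := domF; have [C [C0 hC]] := bF n.
pose W := \int[mu]_t w (c t).
have W0 : 0 <= W by apply: Rintegral_ge0 => t _; exact/ltW.
(* G is bounded in the n-th seminorm, and E k is a region where it varies by less than del1 *)
pose G x := (w x)^-1%:C *: F x.
have FG x : F x = (w x)%:C *: G x.
  by rewrite /G scalerA -rmorphM divff ?gt_eqF// scale1r.
have GC x : P n (G x) <= C.
  rewrite (sysZr hP) gtr0_norm ?invr_gt0//.
  by rewrite ler_pdivrMl// mulrC.
have cPn a : continuous (fun x => P n (G x - a)).
  move=> x; have cG : {for x, continuous G}.
    apply: tvs_cvgZ; last exact: cF.
    by apply: cvg_real_complex; apply: cvgV; [exact: lt0r_neq0|exact: w_cont].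
  apply: (@continuous_comp _ _ _ (fun x => G x - a) (P n)); last exact: sys_continuous.
  by apply: tvs_cvgB => //; exact: cvg_cst.
pose del1 := del / (2 * (W + 1)); have d10 : 0 < del1.
  by rewrite divr_gt0// mulr_gt0// ltr_wpDl.
have [B [mB hB]] := cbasis.
pose tk k := xget point (B k).
pose E k := [set s | P n (G (c s) - G (c (tk k))) < del1].
have mE k : measurable (E k).
  rewrite (_ : E k = (fun s => P n (G (c s) - G (c (tk k)))) @^-1` `]-oo, del1[).
    rewrite -[X in measurable X]setTI.
    apply: (basis_measurable_fun (F := fun x => P n (G x - G (c (tk k)))) cbasis) => //.
  by apply/seteqP; split=> s; rewrite /E /= in_itv.
have coverE s : exists k, E k s.
  have [|k [Bs Bk]] := hB s [set y | P n (G y - G (c s)) < del1].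
    have := cPn (G (c s)) (c s); move/cvgrPdist_lt => /(_ _ d10); apply: filterS => y.
    rewrite subrr (sys0 hP) sub0r normrN; exact/le_lt_trans/ler_norm.
  exists k; rewrite /E /= (sysC hP); apply: Bk.
  by apply: (@xgetPex _ point (B k)); exists s.
pose D := seqDU E.
have mD k : measurable (D k) by apply: measurableD => //; exact: bigsetU_measurable.
have Dtriv : trivIset setT D := trivIset_seqDU E.
pose wD k t := \1_(D k) t * w (c t).
have iwD k : rintegrable mu (wD k).
  apply: rintegrable_le w_int _ => [|t].
    apply: measurable_funM; first exact: measurable_indic.
    exact: rintegrable_measurable w_int.
  rewrite /wD normrM !ger0_norm ?(ltW (w_gt0 _))// ler_piMl ?(ltW (w_gt0 _))//.
(* the K first pieces; the mass of w on the others is the tail *)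
pose a K := \sum_(k <- iota 0 K) (\int[mu]_t wD k t)%:C *: G (c (tk k)).
pose tail K t := (1 - \sum_(k <- iota 0 K) \1_(D k) t) * w (c t).
have sum1 K t : (exists2 j, (j < K)%N & D j t /\
      forall f : nat -> R, \sum_(k <- iota 0 K) \1_(D k) t * f k = f j) \/
    (forall k, (k < K)%N -> ~ D k t).
  have [[j jK Dj]|nj] := pselect (exists2 j, (j < K)%N & D j t); last first.
    by right => k kK Dk; apply: nj; exists k.
  left; exists j => //; split => // f.
  rewrite (bigD1_seq j) ?mem_iota ?iota_uniq//= indicE mem_set// mul1r.
  rewrite big1 ?addr0// => k kj; rewrite indicE memNset ?mul0r// => Dk.
  by move/trivIsetP: Dtriv => /(_ k j I I kj)/seteqP[/(_ t)+ _]; apply.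
have sum0 K t (f : nat -> R) : (forall k, (k < K)%N -> ~ D k t) ->
    \sum_(k <- iota 0 K) \1_(D k) t * f k = 0.
  move=> nD; rewrite big_seq big1// => k; rewrite mem_iota add0n => /andP[_ kK].
  by rewrite indicE memNset ?mul0r//; exact: nD.
have sumE K t : \sum_(k <- iota 0 K) \1_(D k) t = \sum_(k <- iota 0 K) \1_(D k) t * (1 : R).
  by apply: eq_bigr => k _; rewrite mulr1.
have [itail tail0] : rintegrable mu (fun=> 0 : R) /\
    (fun K => \int[mu]_t tail K t) @ \oo --> \int[mu]_t (0 : R).
  apply: (dominated_rintegral_cvg (g := w \o c)) => //.
  - move=> K; apply: measurable_funM; last exact: rintegrable_measurable w_int.
    apply: measurable_funB => //; apply: measurable_sum => k.
    exact: measurable_indic.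
  - move=> K t; rewrite /tail sumE; have [[j jK [Dj ->]]|nj] := sum1 K t.
      by rewrite subrr mul0r normr0 ltW//=.
    by rewrite sum0// subr0 mul1r gtr0_norm//=.
  - move=> t; apply/cvgrPdist_lt => eps e0.
    have [k Dk] : exists k, D k t.
      have [k Ek] := coverE t; have : (\bigcup_k E k) t by exists k.
      by rewrite seqDU_bigcup_eq => -[j _ Dj]; exists j.
    exists k.+1 => // K /= kK; rewrite /tail sumE.
    have [[j jK [Dj ->]]|nj] := sum1 K t; first by rewrite subrr mul0r subrr normr0.
    by have := nj k kK.
have [K hK] : exists K, C * \int[mu]_t tail K t <= del / 2.
  move: tail0; rewrite (_ : \int[mu]_t 0 = 0); last by rewrite Rintegral_cst// mul0r.
  have d2 : 0 < del / (2 * (C + 1)) by rewrite divr_gt0// mulr_gt0// ltr_wpDl.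
  move=> /cvgrPdist_lt/(_ _ d2)[K _ /(_ K (leqnn K))]; rewrite sub0r normrN => h.
  exists K; have := ltW (le_lt_trans (ler_norm _) h).
  rewrite ler_pdivlMr ?mulr_gt0 ?ltr_wpDl// => h2.
  have t0 : 0 <= \int[mu]_t tail K t.
    apply: Rintegral_ge0 => t _; rewrite /tail sumE.
    have [[j jK [Dj ->]]|nj] := sum1 K t; first by rewrite subrr mul0r.
    by rewrite sum0// subr0 mul1r ltW.
  by nra.
exists (a K) => psi psil psib.
have psif : real_functional P psi.
  by split => //; exists n, 1; split => // b; rewrite mul1r.
have iF := dominated_functional domF psif.
pose S t := \sum_(k <- iota 0 K) wD k t * psi (G (c (tk k))).
have iS k : rintegrable mu (fun t => wD k t * psi (G (c (tk k)))).
  rewrite (_ : (fun t => _) = (fun t => psi (G (c (tk k))) * wD k t)); last first.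
    by apply/funext => t; rewrite mulrC.
  exact: rintegrableZ.
have -> : psi (a K) = \int[mu]_t S t.
  rewrite /a real_linear_sum// Rintegral_sum//; apply: eq_bigr => k _.
  by rewrite real_linearZ// RintegralZr//; exact: iwD.
rewrite -RintegralB//; last exact: rintegrable_sum.
have iT : rintegrable mu (tail K).
  apply: rintegrable_le w_int _ => [|t].
    apply: measurable_funM; last exact: rintegrable_measurable w_int.
    by apply: measurable_funB => //; apply: measurable_sum => k; exact: measurable_indic.
  rewrite /tail sumE; have [[j jK [Dj ->]]|nj] := sum1 K t.
    by rewrite subrr mul0r normr0 ltW//=.
  by rewrite sum0// subr0 mul1r gtr0_norm//=.
apply: (@le_trans _ _ (\int[mu]_t (del1 * w (c t) + C * tail K t))).
  apply: norm_rintegral_le => [||t].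
  - rewrite (_ : (fun t => _) = (fun t => S t + (-1) * psi (F (c t)))); last first.
      by apply/funext => t; rewrite mulN1r.
    by apply: rintegrableD; [exact: rintegrable_sum|exact: rintegrableZ].
  - by apply: rintegrableD; exact: rintegrableZ.
  have -> : S t = w (c t) * \sum_(k <- iota 0 K) \1_(D k) t * psi (G (c (tk k))).
    by rewrite mulr_sumr; apply: eq_bigr => k _; rewrite /wD mulrCA mulrA.
  rewrite FG real_linearZ// -mulrBr normrM gtr0_norm// /tail sumE.
  have [[j jK [Dj hj]]|nj] := sum1 K t.
    rewrite !hj subrr mul0r mulr0 addr0 mulrC; apply: ler_wpM2r; first exact: ltW.
    rewrite -real_linearB//; apply: le_trans (psib _) _; rewrite (sysC hP).
    exact: ltW (subset_seqDU Dj).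
  rewrite !sum0// subr0 mul1r sub0r normrN mulrC.
  apply: le_trans (ler_wpM2r (ltW (w_gt0 _)) (le_trans (psib _) (GC _))) _.
  by rewrite lerDr mulr_ge0 ?ltW.
rewrite RintegralD//; [|exact: rintegrableZ|exact: rintegrableZ].
rewrite (RintegralZl _ measurableT w_int) (RintegralZl _ measurableT iT).
rewrite [leRHS]splitr; apply: lerD => //; rewrite -/W.
have W1 : 0 < W + 1 by rewrite ltr_wpDl.
rewrite (_ : del1 * W = del / 2 * (W / (W + 1))); last first.
  by rewrite /del1; field; rewrite gt_eqF.
apply: ler_piMr; first by rewrite divr_ge0// ltW.
by rewrite ler_pdivrMr// mul1r lerDl ler01.
Qed.

Hypothesis cP : complete_system P.

(** The approximations of the integral in the k-th seminorm, up to 1/(k+1),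
    form a Cauchy sequence. *)
Lemma dominated_vint F : dominated F -> is_vint mu (F \o c) (vint mu (F \o c)).
Proof.
move=> domF; suff [l hl] : exists l, is_vint mu (F \o c) l by rewrite (vintE hP hl).
have hu k : {a | forall psi, real_linear psi -> (forall b, `|psi b| <= P k b) ->
    `|psi a - \int[mu]_t psi (F (c t))| <= k.+1%:R^-1}.
  by apply: cid; apply: dominated_approximation => //; rewrite invr_gt0.
pose u k := projT1 (hu k).
have uP k m psi : (m <= k)%N -> real_linear psi -> (forall b, `|psi b| <= P m b) ->
    `|psi (u k) - \int[mu]_t psi (F (c t))| <= k.+1%:R^-1.
  move=> mk psil psib; apply: (projT2 (hu k)) => // b.
  by apply: le_trans (psib b) _; exact: sys_mono.
have inv_small eps : 0 < eps -> exists N : nat, forall k, (N <= k)%N ->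
    k.+1%:R^-1 < eps :> R.
  move=> e0; have [N _ hN] : \forall k \near \oo, k.+1%:R^-1 < eps :> R.
    have /cvgrPdist_lt/(_ _ e0) := @cvg_harmonic R; apply: filterS => k.
    by rewrite /harmonic /= sub0r normrN ger0_norm// invr_ge0.
  by exists N => k Nk; exact: hN.
have [|l hl] := cP (u := u).
  move=> m eps e0; have [N hN] := inv_small (eps / 2) (divr_gt0 e0 (ltr0n _ 2)).
  exists (maxn N m) => i j; rewrite !geq_max => /andP[Ni mi] /andP[Nj mj].
  apply: (@le_lt_trans _ _ (i.+1%:R^-1 + j.+1%:R^-1)); last first.
    by rewrite [eps]splitr ltrD// hN.
  apply: (seminorm_le_functional hP) => psi [psil _] psib.
  rewrite real_linearB//; have := uP i m psi mi psil psib.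
  have := uP j m psi mj psil psib; rewrite !ler_norml.
  move: (i.+1%:R^-1) (j.+1%:R^-1) => x y.
  by move=> /andP[h1 h2] /andP[h3 h4]; lra.
exists l; apply/(is_vintP hP) => psi psif; split; first exact: (dominated_functional domF).
have [psil [n [C [C0 hC]]]] := psif; pose D := C + 1.
have D0 : 0 < D by rewrite /D ltr_wpDl.
pose psi1 a := D^-1 * psi a.
have psi1l : real_linear psi1 by move=> t a b; rewrite /psi1 psil; ring.
have psi1b b : `|psi1 b| <= P n b.
  rewrite /psi1 normrM gtr0_norm ?invr_gt0// ler_pdivrMl//.
  by apply: le_trans (hC b) _; have := sys_ge0 hP n b; rewrite /D; nra.
have : psi1 l = \int[mu]_t psi1 (F (c t)).
  apply/eqP; rewrite -subr_eq0 -normr_le0; apply/ler_addgt0Pr => eps e0.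
  rewrite add0r; have e2 : 0 < eps / 2 by rewrite divr_gt0.
  have [N1 hN1] := inv_small _ e2; have [N2 hN2] := hl n _ e2.
  pose k := maxn n (maxn N1 N2).
  have h1 := hN1 k; have h2 := hN2 k; have h3 := uP k n psi1.
  move: h1; rewrite /k !leq_max leqnn orbT => /(_ isT) h1.
  move: h2; rewrite /k !leq_max leqnn !orbT => /(_ isT) h2.
  move: h3; rewrite /k !leq_max leqnn => /(_ isT psi1l psi1b) h3.
  have := le_trans (psi1b (u k - l)) (ltW h2); rewrite real_linearB//.
  move: h3 h1; rewrite -/k => h3 h1 h4; rewrite -(subrK (psi1 (u k)) (psi1 l)) -addrA.
  apply: le_trans (ler_normD _ _) _; rewrite [leRHS]splitr.
  by apply: lerD; [rewrite distrC|exact: le_trans h3 (ltW h1)].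
rewrite /psi1 RintegralZl//; last exact: (dominated_functional domF).
by apply: mulfI; rewrite invr_neq0// gt_eqF.
Qed.

Lemma vint_functional F psi : dominated F -> real_functional P psi ->
  psi (vint mu (F \o c)) = \int[mu]_t psi (F (c t)).
Proof. by move=> /dominated_vint /(is_vintP hP) h /h[]. Qed.

Lemma vint_bound F n C : dominated F -> (forall x, P n (F x) <= C * w x) ->
  P n (vint mu (F \o c)) <= C * \int[mu]_t w (c t).
Proof.
move=> domF hC; apply: (seminorm_le_functional hP) => psi psif psib.
rewrite vint_functional// -RintegralZl//; apply: le_trans (ler_norm _) _.
apply: norm_rintegral_le; [exact: (dominated_functional domF)|exact: rintegrableZ|].
by move=> t; exact: le_trans (psib _) (hC _).
Qed.

End WeakIntegral.

(** * Lebesgue measure on tuples *)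

Section LebesgueLine.
Context {R : realType}.
Local Notation leb := (@lebesgue_measure R).
Local Notation RR := (measurableTypeR R).

Lemma lebesgue_measure_translate (s : R) (B : set RR) : measurable B ->
  pushforward leb ((fun x => s + x) : RR -> RR) B = leb B.
Proof.
move=> mB; apply/esym.
have ms : measurable_fun [set: RR] ((fun x => s + x) : RR -> RR).
  by apply: measurable_funD.
pose mu : {measure set RR -> \bar R} := pushforward leb ((fun x => s + x) : RR -> RR).
rewrite (@lebesgue_measure_unique R (mu ms) _ B mB)// => _ [[a b] _ <-] /=.
rewrite /pushforward (_ : _ @^-1` _ = `]a - s, b - s]%classic); last first.
  by apply/seteqP; split=> x /=; rewrite !in_itv /= ltrBlDl lerBrDl.
rewrite !lebesgue_measure_itv /= !lte_fin ltrD2r; case: ifPn => // _.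
by rewrite -!EFinB; congr EFin; ring.
Qed.

Lemma ge0_lebesgue_translate (s : R) (f : RR -> \bar R) :
  measurable_fun setT f -> (forall x, 0 <= f x)%E ->
  (\int[leb]_x f (s + x)%R = \int[leb]_x f x)%E.
Proof.
move=> mf f0; have ms : measurable_fun [set: RR] ((fun x => s + x) : RR -> RR).
  by apply: measurable_funD.
rewrite -(@ge0_integral_pushforward _ _ RR RR R _ ms leb setT f)//.
by apply: eq_measure_integral => B mB _; exact: lebesgue_measure_translate.
Qed.

Lemma ge0_lebesgue_opp (f : RR -> \bar R) :
  measurable_fun setT f -> (forall x, 0 <= f x)%E ->
  (\int[leb]_x f (- x)%R = \int[leb]_x f x)%E.
Proof.
move=> mf f0; have ms : measurable_fun [set: RR] (-%R : RR -> RR).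
  exact: oppr_measurable.
rewrite -(@ge0_integral_pushforward _ _ RR RR R _ ms leb setT f)//.
by apply: eq_measure_integral => B mB _; exact: lebesgue_measureN.
Qed.

End LebesgueLine.

Section TupleMeasure.
Context {R : realType}.
Local Notation leb := (@lebesgue_measure R).
Local Notation RR := (measurableTypeR R).

Lemma measurable_tuple_cons n : measurable_fun [set: RR * n.-tuple RR] (@tuple_cons R n).
Proof. exact: measurable_cons. Qed.

Lemma tnth_cons0 n x (t : n.-tuple RR) : tnth (tuple_cons (x, t)) ord0 = x.
Proof. by []. Qed.

Lemma tnth_consS n x (t : n.-tuple RR) i :
  tnth (tuple_cons (x, t)) (lift ord0 i) = tnth t i.
Proof. by rewrite !(tnth_nth x). Qed.

Lemma ge0_integral_tupleS n (f : n.+1.-tuple RR -> \bar R) :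
  measurable_fun setT f -> (forall t, 0 <= f t)%E ->
  (\int[lebesgue_tuple R n.+1]_t f t =
   \int[leb]_x \int[lebesgue_tuple R n]_t f (tuple_cons (x, t)))%E.
Proof.
move=> mf f0; pose m : {measure set (n.+1.-tuple RR) -> \bar R} :=
  pushforward (@lebesgue_measure R \x lebesgue_tuple R n)%E (@tuple_cons R n).
rewrite (@eq_measure_integral _ _ R setT (m (@measurable_tuple_cons n)))//.
rewrite (@ge0_integral_pushforward _ _ _ _ R _ (@measurable_tuple_cons n))//.
rewrite preimage_setT fubini_tonelli1//; last by move=> x /=; exact: f0.
by apply: measurableT_comp => //; exact: measurable_tuple_cons.
Qed.

Lemma measurable_section n (f : n.+1.-tuple RR -> \bar R) x :
  measurable_fun setT f -> measurable_fun setT (fun t => f (tuple_cons (x, t))).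
Proof.
move=> mf; apply: measurableT_comp => //.
by apply: measurable_cons => //; exact: measurable_id.
Qed.

(** The affine substitutions needed for Fourier analysis: translations and
    point reflections, treated at once. *)
Lemma ge0_integral_tuple_affine n (neg : bool) (s : 'I_n -> R)
    (f : n.-tuple RR -> \bar R) :
  measurable_fun setT f -> (forall t, 0 <= f t)%E ->
  (\int[lebesgue_tuple R n]_t
     f [tuple (s i + (if neg then - tnth t i else tnth t i))%R | i < n] =
   \int[lebesgue_tuple R n]_t f t)%E.
Proof.
elim: n s f => [|n IH] s f mf f0.
  apply: eq_integral => t _; congr f; apply/eq_from_tnth => -[]//.
have maff k (r : 'I_k -> R) : measurable_fun [set: k.-tuple RR]
    (fun t => [tuple (r i + (if neg then - tnth t i else tnth t i))%R | i < k]
       : k.-tuple RR).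
  apply/measurable_fun_tnthP => i; rewrite (_ : _ \o _ =
    (fun t : k.-tuple RR => (r i + (if neg then - tnth t i else tnth t i))%R)).
    apply: measurable_funD => //; case: (neg); last exact: measurable_tnth.
    exact: (measurableT_comp (@oppr_measurable R setT) (measurable_tnth i)).
  by apply/funext => t /=; rewrite tnth_mktuple.
rewrite (ge0_integral_tupleS mf f0).
have := ge0_integral_tupleS (measurableT_comp mf (maff _ s)) (fun t => f0 _).
move=> /= ->.
pose h x := (\int[lebesgue_tuple R n]_t f (tuple_cons (x, t)))%E.
have mh : measurable_fun setT h.
  apply: (@measurable_fun_fubini_tonelli_F _ _ _ _ R (lebesgue_tuple R n)
    (f \o @tuple_cons R n)) => [|x]; last exact: f0.
  by apply: measurableT_comp => //; exact: measurable_tuple_cons.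
have h0 x : (0 <= h x)%E by apply: integral_ge0.
transitivity (\int[leb]_x h (s ord0 + (if neg then - x else x))%R)%E.
  apply: eq_integral => x _; rewrite /h.
  rewrite -(IH (fun i => s (lift ord0 i)) (fun t => f (tuple_cons (_, t)))).
  - apply: eq_integral => t _; congr f; apply/eq_from_tnth => i.
    rewrite tnth_mktuple; have [->|] := eqVneq i ord0; first by rewrite !tnth_cons0.
    by case: (unliftP ord0 i) => [j -> _|->]; [rewrite !tnth_consS tnth_mktuple|rewrite eqxx].
  - exact: measurable_section.
  - by move=> t; exact: f0.
case: (neg).
  transitivity (\int[leb]_x h (s ord0 + x)%R)%E.
    apply: (@ge0_lebesgue_opp R (fun x => h (s ord0 + x)%R)) => //.
    by apply: (measurableT_comp mh); exact: measurable_funD.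
  exact: ge0_lebesgue_translate mh h0.
exact: ge0_lebesgue_translate mh h0.
Qed.

Lemma measurable_tuple_prod n (f : 'I_n -> R -> R) :
  (forall i, measurable_fun setT (f i)) ->
  measurable_fun [set: n.-tuple RR] (fun t => \prod_(i < n) f i (tnth t i)).
Proof.
move=> mf; apply: measurable_prod => i _.
exact: (measurableT_comp (mf i) (measurable_tnth i)).
Qed.

Lemma ge0_integral_tuple_prod n (f : 'I_n -> R -> R) (c : 'I_n -> R) :
  (forall i, measurable_fun setT (f i)) -> (forall i x, 0 <= f i x) ->
  (forall i, \int[leb]_x (f i x)%:E = (c i)%:E)%E ->
  (\int[lebesgue_tuple R n]_t (\prod_(i < n) f i (tnth t i))%:E =
   (\prod_(i < n) c i)%:E)%E.
Proof.
elim: n f c => [|n IH] f c mf f0 fc.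
  transitivity (\int[lebesgue_tuple R 0]_t (cst 1%:E t))%E.
    by apply: eq_integral => t _; rewrite big_ord0.
  by rewrite integral_dirac//= diracT mul1e big_ord0.
rewrite ge0_integral_tupleS; last 2 first.
- by apply/measurable_EFinP; exact: measurable_tuple_prod.
- by move=> t; rewrite lee_fin; exact: prodr_ge0.
transitivity (\int[leb]_x ((\prod_(i < n) c (lift ord0 i))%:E * (f ord0 x)%:E))%E.
  apply: eq_integral => x _.
  rewrite -(IH (fun i => f (lift ord0 i)))// muleC -ge0_integralZl_EFin//.
  - apply: eq_integral => t _; rewrite big_ord_recl tnth_cons0 EFinM.
    by congr (_ * _%:E)%E; apply: eq_bigr => i _; rewrite tnth_consS.
  - by move=> t _; rewrite lee_fin; exact: prodr_ge0.
  - apply/measurable_EFinP.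
    exact: (measurable_tuple_prod (fun i => mf (lift ord0 i))).
rewrite ge0_integralZl_EFin//; last 3 first.
- by move=> x _; rewrite lee_fin.
- by apply/measurable_EFinP; exact: mf.
- apply: prodr_ge0 => i _; rewrite -lee_fin -fc.
  by apply: integral_ge0 => x _; rewrite lee_fin.
by rewrite fc big_ord_recl mulrC EFinM.
Qed.

End TupleMeasure.

(** * Two integrals on the line *)

Section LineIntegrals.
Context {R : realType}.
Local Notation leb := (@lebesgue_measure R).

Lemma is_derive1_affine (a b y : R) : is_derive y 1 (fun y : R => a + b * y) b.
Proof.
have h : is_derive y 1 (cst a + b *: id) (0 + b *: (1 : R)) by exact: is_deriveD.
apply: is_derive_eq h _; by rewrite add0r /GRing.scale /= mulr1.
Qed.

Lemma ge0_integral_halfline (f F : R -> R) (l : R) :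
  (forall x, 0 <= f x) -> continuous f -> (forall x : R, is_derive x (1 : R) F (f x)) ->
  F x @[x --> +oo] --> l ->
  (\int[leb]_(x in `[0%R, +oo[) (f x)%:E = (l - F 0)%:E)%E.
Proof.
move=> f0 cf dF Fl; rewrite (ge0_continuous_FTC2y (F := F) (l := l))//.
- exact: continuous_subspaceT.
- apply: cvg_at_right_filter.
  by have /derivable1_diffP/differentiable_continuous := @ex_derive _ _ _ _ _ _ _ (dF 0).
- by move=> x _; rewrite derive1E derive_val.
Qed.

(** The two half-lines have separate primitives, since the integrands below
    involve the absolute value. *)
Lemma ge0_integral_line (f f1 f2 F G : R -> R) (l m : R) :
  (forall x, 0 <= f x) -> continuous f ->
  (forall x, 0 <= f1 x) -> continuous f1 -> (forall x, 0 <= x -> f x = f1 x) ->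
  (forall x, 0 <= f2 x) -> continuous f2 -> (forall x, 0 <= x -> f (- x) = f2 x) ->
  (forall x : R, is_derive x (1 : R) F (f1 x)) -> F x @[x --> +oo] --> l ->
  (forall x : R, is_derive x (1 : R) G (f2 x)) -> G x @[x --> +oo] --> m ->
  (\int[leb]_x (f x)%:E = ((l - F 0) + (m - G 0))%:E)%E.
Proof.
move=> f0 cf f10 cf1 ff1 f20 cf2 ff2 dF Fl dG Gm.
have mf : measurable_fun setT f by exact: continuous_measurable_fun.
rewrite EFinD -(ge0_integral_halfline f10 cf1 dF Fl).
rewrite -(ge0_integral_halfline f20 cf2 dG Gm).
have e1 : (\int[leb]_(x in `[0%R, +oo[) (f1 x)%:E = \int[leb]_(x in `[0%R, +oo[) (f x)%:E)%E.
  by apply: eq_integral => x; rewrite inE /= in_itv /= andbT => x0; rewrite ff1.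
have e2 : (\int[leb]_(x in `[0%R, +oo[) (f2 x)%:E =
    \int[leb]_(x in `[0%R, +oo[) (f (- x))%:E)%E.
  by apply: eq_integral => x; rewrite inE /= in_itv /= andbT => x0; rewrite ff2.
rewrite e1 e2.
rewrite (@ge0_integration_by_substitution0 R (fun x => (f (- x))%:E)); last 2 first.
- apply/measurable_EFinP; apply: continuous_measurable_fun => x.
  by apply: (continuous_comp (@opp_continuous _ x)); exact: cf.
- by move=> r; rewrite lee_fin.
under [X in (_ + X)%E]eq_integral do rewrite opprK.
rewrite -integral_itv_bndo_bndc; last exact/measurable_EFinP/measurable_funTS.
rewrite -(setUv (`[0%R, +oo[%classic : set R)) ge0_integral_setU//=.
- by rewrite setCitvr.
- exact: measurableC.
- by rewrite setUv; exact/measurable_EFinP.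
- by move=> x _; rewrite lee_fin.
- exact/disj_setPCl.
Qed.

Lemma integral_cauchy_density (c : R) : 0 < c ->
  (\int[leb]_x (c / (c ^+ 2 + x ^+ 2))%:E = pi%:E)%E.
Proof.
move=> c0; have pos x : 0 < c ^+ 2 + x ^+ 2.
  by rewrite ltr_pwDl ?exprn_gt0// sqr_ge0.
pose F x := atan (0 + c^-1 * x).
have dF (x : R) : is_derive x (1 : R) F (c / (c ^+ 2 + x ^+ 2)).
  apply: is_derive_eq (is_derive1_comp (is_derive1_atan _) (is_derive1_affine 0 c^-1 x)) _.
  by rewrite add0r; field; rewrite !gt_eqF//=.
have Fl : F x @[x --> +oo] --> pi / 2.
  apply: cvg_comp (@cvgy_atan R).
  rewrite (_ : (fun x => _) = (fun x => x * c^-1)); last first.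
    by apply/funext => x; rewrite add0r mulrC.
  by apply: gt0_cvgMly; [rewrite invr_gt0|exact: cvg_id].
pose f x := c / (c ^+ 2 + x ^+ 2).
have f0 x : 0 <= f x by rewrite divr_ge0 ?ltW.
have cf : continuous f.
  move=> x; apply: cvgM; first exact: cvg_cst.
  apply: cvgV; first by rewrite gt_eqF.
  by apply: cvgD; [exact: cvg_cst|apply: exprn_continuous].
rewrite (@ge0_integral_line f f f F F (pi / 2) (pi / 2))//.
  by rewrite /F mulr0 addr0 atan0 !subr0; congr EFin; field.
by move=> x _; rewrite /f sqrrN.
Qed.

(** The summand 1 keeps the integrand nonnegative, so that only integrals of
    nonnegative functions occur; the cosine transform of the Laplace kernel is
    recovered by comparing phases. *)
Lemma integral_laplace_cos (c th b : R) : 0 < c ->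
  (\int[leb]_y (expR (- (c * `|y|)) * (1 + cos (th + b * y)))%:E =
   (2 / c + 2 * c * cos th / (c ^+ 2 + b ^+ 2))%:E)%E.
Proof.
move=> c0; have cb : 0 < c ^+ 2 + b ^+ 2 by rewrite ltr_pwDl ?exprn_gt0// sqr_ge0.
pose H (k y : R) : R := expR (0 + (- c) * y) *
  ((k * sin (th + k * y) - c * cos (th + k * y)) / (c ^+ 2 + k ^+ 2) - c^-1).
pose g (k y : R) := expR (- (c * y)) * (1 + cos (th + k * y)).
have dH (k x : R) : is_derive x (1 : R) (H k) (g k x).
  have ck : 0 < c ^+ 2 + k ^+ 2 by rewrite ltr_pwDl ?exprn_gt0// sqr_ge0.
  have d1 := is_derive1_comp (is_derive_expR _) (is_derive1_affine 0 (- c) x).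
  have d2 := is_derive1_comp (is_derive_sin _) (is_derive1_affine th k x).
  have d3 := is_derive1_comp (is_derive_cos _) (is_derive1_affine th k x).
  have d4 := is_deriveZ (c ^+ 2 + k ^+ 2)^-1 (is_deriveB (is_deriveZ k d2) (is_deriveZ c d3)).
  have d5 := is_deriveM d1 (is_deriveB d4 (is_derive_cst c^-1 x 1)).
  rewrite (_ : H k = (expR \o (fun y => 0 + - c * y)) *
     ((c ^+ 2 + k ^+ 2)^-1 \*: (k \*: (sin \o (fun y => th + k * y)) -
        c \*: (cos \o (fun y => th + k * y))) - cst c^-1)); last first.
    by apply/funext => y; rewrite /H /= mulrC [X in _ = X]mulrC; congr (_ * _); rewrite [X in X - _]mulrC.
  apply: is_derive_eq d5 _; rewrite !fctE /g /= /GRing.scale /= add0r mulNr.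
  field; rewrite !gt_eqF//.
have Hl k : H k y @[y --> +oo] --> (0 : R).
  have ck : 0 < c ^+ 2 + k ^+ 2 by rewrite ltr_pwDl ?exprn_gt0// sqr_ge0.
  pose K := (`|k| + c) / (c ^+ 2 + k ^+ 2) + c^-1.
  have El : expR (0 + (- c) * y) @[y --> +oo] --> (0 : R).
    rewrite (_ : (fun y => _) = (fun x => expR (- x)) \o (fun y => y * c)); last first.
      by apply/funext => y /=; rewrite add0r mulNr mulrC.
    by apply: cvg_comp (@cvgr_expR R); apply: gt0_cvgMly => //; exact: cvg_id.
  have EK : expR (0 + (- c) * y) * K @[y --> +oo] --> (0 : R).
    have := @cvgM _ _ _ _ _ (cst K) _ _ El (@cvg_cst _ _ _ _ _).
    by rewrite mul0r; apply.
  apply: (@squeeze_cvgr _ _ _ _ (fun y => - (expR (0 + (- c) * y) * K))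
     (fun y => expR (0 + (- c) * y) * K)); last 2 first.
  - have EN := cvgN EK; rewrite oppr0 in EN; exact: EN.
  - exact: EK.
  apply: nearW => y; rewrite -ler_norml /H normrM gtr0_norm ?expR_gt0//.
  apply: ler_wpM2l; first exact: expR_ge0.
  apply: le_trans (ler_normB _ _) _; rewrite normfV (gtr0_norm c0) lerD2r.
  rewrite normrM normfV (gtr0_norm ck) ler_pM2r ?invr_gt0//.
  apply: le_trans (ler_normB _ _) _; rewrite !normrM (gtr0_norm c0).
  apply: lerD; first by rewrite ler_piMr// sin_max.
  by rewrite ler_piMr ?cos_max ?ltW.
have cN x : 0 <= 1 + cos x :> R by have := cos_geN1 x; lra.
have cexp h : continuous h -> continuous (fun y => expR (- (c * h y)) * (1 + cos (th + b * y))).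
  move=> ch y; apply: cvgM.
    apply: continuous_comp; last exact: continuous_expR.
    by apply: cvgN; apply: cvgM; [exact: cvg_cst|exact: ch].
  apply: cvgD; first exact: cvg_cst.
  apply: continuous_comp; last exact: continuous_cos.
  by apply: cvgD; [exact: cvg_cst|apply: cvgM; [exact: cvg_cst|exact: cvg_id]].
have cg k : continuous (g k).
  move=> y; apply: cvgM.
    apply: continuous_comp; last exact: continuous_expR.
    by apply: cvgN; apply: cvgM; [exact: cvg_cst|exact: cvg_id].
  apply: cvgD; first exact: cvg_cst.
  apply: continuous_comp; last exact: continuous_cos.
  by apply: cvgD; [exact: cvg_cst|apply: cvgM; [exact: cvg_cst|exact: cvg_id]].
have g0 k y : 0 <= g k y by rewrite mulr_ge0// expR_ge0.
rewrite (@ge0_integral_line _ (g b) (g (- b)) (H b) (H (- b)) 0 0)//.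
- rewrite /H !mulr0 !addr0 expR0 sqrrN; congr EFin; field.
  by rewrite !gt_eqF.
- exact: (cexp (fun y : R => `|y|) (@norm_continuous R R)).
- by move=> x x0; rewrite ger0_norm.
- by move=> x x0; rewrite normrN ger0_norm// mulrN -mulNr.
Qed.

End LineIntegrals.

(** * Integration on Euclidean spaces *)

Section TupleIntegral.
Context {R : realType}.
Local Notation RR := (measurableTypeR R).

Lemma measurable_affine n (neg : bool) (s : 'I_n -> R) :
  measurable_fun [set: n.-tuple RR]
    (fun t => [tuple (s i + (if neg then - tnth t i else tnth t i))%R | i < n]
       : n.-tuple RR).
Proof.
apply/measurable_fun_tnthP => i; rewrite (_ : _ \o _ =
  (fun t : n.-tuple RR => (s i + (if neg then - tnth t i else tnth t i))%R)).
  apply: measurable_funD => //; case: (neg); last exact: measurable_tnth.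
  exact: (measurableT_comp (@oppr_measurable R setT) (measurable_tnth i)).
by apply/funext => t /=; rewrite tnth_mktuple.
Qed.

Lemma rintegral_affine n (neg : bool) (s : 'I_n -> R) (f : n.-tuple RR -> R) :
  let aff (t : n.-tuple RR) : n.-tuple RR :=
    [tuple (s i + (if neg then - tnth t i else tnth t i))%R | i < n] in
  rintegrable (lebesgue_tuple R n) f ->
  rintegrable (lebesgue_tuple R n) (f \o aff) /\
  \int[lebesgue_tuple R n]_t f (aff t) = \int[lebesgue_tuple R n]_t f t.
Proof.
move=> aff fi; have /integrableP[mf foo] := fi.
have maff : measurable_fun [set: n.-tuple RR] aff by exact: measurable_affine.
split.
  apply/integrableP; split; first exact: measurableT_comp mf maff.
  rewrite (@ge0_integral_tuple_affine R n neg s (fun t => abse (f t)%:E))//.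
  exact: measurableT_comp.
rewrite /Rintegral; congr fine.
rewrite [LHS]integralE [RHS]integralE; congr (_ - _)%E.
  rewrite -(@ge0_integral_tuple_affine R n neg s ((EFin \o f)^\+)%E)//.
    by apply: eq_integral => t _; rewrite !funeposE.
  exact: measurable_funepos.
rewrite -(@ge0_integral_tuple_affine R n neg s ((EFin \o f)^\-)%E)//.
  by apply: eq_integral => t _; rewrite !funenegE.
exact: measurable_funeneg.
Qed.

End TupleIntegral.

Section Euclid.
Context {R : realType} {V : normedModType R}.
Context {dotp : {dot V for @idfun R}} {d : nat} {e : 'I_d -> V}.
Variable hE : euclidean_space dotp e.
Local Notation RR := (measurableTypeR R).
Implicit Types (x y z : V) (r : R).

Lemma dotDl x y z : dotp (x + y) z = dotp x z + dotp y z.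
Proof. by rewrite linearDl. Qed.
Lemma dotDr x y z : dotp z (x + y) = dotp z x + dotp z y.
Proof. by rewrite linearDr. Qed.
Lemma dotZl r x z : dotp (r *: x) z = r * dotp x z.
Proof. by rewrite linearZl_LR. Qed.
Lemma dotZr r x z : dotp z (r *: x) = r * dotp z x.
Proof. by rewrite linearZr_LR. Qed.
Lemma dotC x y : dotp x y = dotp y x.
Proof. by rewrite hermC /= expr0 mul1r. Qed.
Lemma dotNl x z : dotp (- x) z = - dotp x z.
Proof. by rewrite linearNl. Qed.
Lemma dotNr x z : dotp z (- x) = - dotp z x.
Proof. by rewrite linearNr. Qed.
Lemma dot0l z : dotp 0 z = 0. Proof. by rewrite linear0l. Qed.
Lemma dotBl x y z : dotp (x - y) z = dotp x z - dotp y z.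
Proof. by rewrite dotDl dotNl. Qed.
Lemma dotBr x y z : dotp z (x - y) = dotp z x - dotp z y.
Proof. by rewrite dotDr dotNr. Qed.

Lemma dot_coord_vec t i : dotp (coord_vec e t) (e i) = tnth t i.
Proof.
rewrite /coord_vec linear_sumlz (bigD1 i)//= dotZl (euclidean_orthonormal hE).
rewrite eqxx mulr1 big1 ?addr0// => j ji.
by rewrite dotZl (euclidean_orthonormal hE) (negbTE ji) mulr0.
Qed.

Lemma euclidean_expand x : x = \sum_(i < d) dotp x (e i) *: e i.
Proof.
have [t ->] := euclidean_span hE x.
by rewrite {1}/coord_vec; apply: eq_bigr => i _; rewrite dot_coord_vec.
Qed.

Lemma dot_expand x y : dotp x y = \sum_(i < d) dotp x (e i) * dotp y (e i).
Proof.
rewrite {1}(euclidean_expand x) linear_sumlz; apply: eq_bigr => i _.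
by rewrite /= dotZl (dotC (e i)).
Qed.

Lemma coord_le_norm x i : `|dotp x (e i)| <= `|x|.
Proof.
rewrite -(@ler_pXn2r _ 2)// ?nnegrE//.
rewrite (euclidean_norm hE) (dot_expand x x) (bigD1 i)//= real_normK ?num_real//.
by rewrite -expr2 lerDl sumr_ge0// => j _; rewrite -expr2 sqr_ge0.
Qed.

Lemma norm_basis i : `|e i| = 1.
Proof.
apply/eqP; rewrite -(@eqrXn2 _ 2)// (euclidean_norm hE).
by rewrite (euclidean_orthonormal hE) eqxx expr1n.
Qed.

Lemma norm_le_coord x : `|x| <= \sum_(i < d) `|dotp x (e i)|.
Proof.
rewrite {1}(euclidean_expand x); apply: le_trans (ler_norm_sum _ _ _) _.
by apply: ler_sum => i _; rewrite normrZ norm_basis mulr1.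
Qed.

Lemma dot_bound x y : `|dotp x y| <= d%:R * (`|x| * `|y|).
Proof.
rewrite dot_expand; apply: le_trans (ler_norm_sum _ _ _) _.
rewrite mulr_natl -[X in _ *+ X]card_ord -sumr_const; apply: ler_sum => i _.
by rewrite normrM ler_pM// coord_le_norm.
Qed.

Lemma dot_continuous : continuous (fun z : V * V => dotp z.1 z.2).
Proof.
move=> [x y]; apply/cvgrPdist_lt => eps e0 /=.
pose K := d%:R * (`|x| + `|y| + 1) + 1.
have K0 : 0 < K by rewrite ltr_wpDl// mulr_ge0// !addr_ge0.
pose del := Num.min 1 (eps / (2 * K)).
have del0 : 0 < del by rewrite lt_min ltr01 divr_gt0// mulr_gt0.
have : \forall z \near (x, y), `|x - z.1| < del /\ `|y - z.2| < del.
  exists (ball x del, ball y del) => /=; first by split; exact: nbhsx_ballx.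
  by move=> [a b] /= []; rewrite -!ball_normE.
apply: filterS => -[a b] /= [xa yb].
have -> : dotp x y - dotp a b = dotp (x - a) b + dotp x (y - b).
  by rewrite dotBl dotBr; ring.
apply: le_lt_trans (ler_normD _ _) _.
have h1 := dot_bound (x - a) b; have h2 := dot_bound x (y - b).
have del1 : del <= 1 by rewrite ge_min lexx.
have del2 : del <= eps / (2 * K) by rewrite ge_min lexx orbT.
have b1 : `|b| <= `|y| + 1.
  rewrite -(subrK y b); apply: le_trans (ler_normD _ _) _.
  by rewrite addrC lerD2l distrC; exact: le_trans (ltW yb) del1.
apply: le_lt_trans (lerD h1 h2) _; rewrite -mulrDr.
apply: (@le_lt_trans _ _ (d%:R * (del * (`|y| + 1) + `|x| * del))).
  rewrite ler_wpM2l// lerD//; first by rewrite ler_pM// ltW.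
  by rewrite ler_wpM2l// ltW.
rewrite (_ : _ * _ = del * (K - 1)); last by rewrite /K; ring.
have : del * K <= eps / 2.
  by move: del2; rewrite ler_pdivlMr ?mulr_gt0// => ?; lra.
by move: K0 del0 e0 => *; lra.
Qed.

Lemma dotl_continuous y : continuous (fun x => dotp x y).
Proof.
move=> x; apply: (@continuous_comp _ _ _ (fun x => (x, y)) (fun z : V * V => dotp z.1 z.2)).
  by apply: cvg_pair; [exact: cvg_id|exact: cvg_cst].
exact: dot_continuous.
Qed.

Lemma coord_vec_affine (neg : bool) x t :
  coord_vec e [tuple (dotp x (e i) + (if neg then - tnth t i else tnth t i))%R | i < d] =
  if neg then x - coord_vec e t else x + coord_vec e t.
Proof.
rewrite {1}/coord_vec; under eq_bigr do rewrite tnth_mktuple scalerDl.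
rewrite big_split /= -euclidean_expand.
case: neg => //; congr (_ + _); rewrite /coord_vec -sumrN.
by apply: eq_bigr => i _; rewrite scaleNr.
Qed.

Lemma coord_vec_dist s t : `|coord_vec e s - coord_vec e t| <=
  \sum_(i < d) `|(tnth s i : R) - tnth t i|.
Proof.
rewrite /coord_vec -sumrB; apply: le_trans (ler_norm_sum _ _ _) _.
by apply: ler_sum => i _; rewrite -scalerBl normrZ norm_basis mulr1.
Qed.

(** Boxes with rational centres. *)
Lemma coord_vec_basis : measurable_basis (coord_vec e).
Proof.
pose box (q : d.-tuple rat) (m : nat) : set (d.-tuple RR) :=
  [set t | forall i, `|(tnth t i : R) - ratr (tnth q i)| < m.+1%:R^-1].
exists (fun k => if @unpickle (d.-tuple rat * nat)%type k is Some (q, m)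
                 then box q m else set0); split=> [k|t U tU].
  case: unpickle => [[q m]|]; last exact: measurable0.
  rewrite (_ : box q m = \bigcap_(i in [set: 'I_d])
     ((fun t : d.-tuple RR => tnth t i) @^-1`
        (`](ratr (tnth q i) - m.+1%:R^-1)%R, (ratr (tnth q i) + m.+1%:R^-1)%R[%classic
          : set RR))); last first.
    apply/seteqP; split=> t /= h i; last by have /= := h i I; rewrite in_itv /= ltr_distl.
    by move=> _ /=; rewrite in_itv /= -ltr_distl; exact: h.
  apply: fin_bigcap_measurable => // i _; rewrite -[X in measurable X]setTI.
  by apply: measurable_tnth => //; exact: measurable_itv.
have /nbhs_ballP[eps /= e0 sub] := tU.
have [m hm] : exists m, d%:R * (2 * m.+1%:R^-1) < eps.
  have e2 : 0 < eps / (d%:R * 2 + 1) by rewrite divr_gt0// ltr_wpDl// mulr_ge0.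
  have /cvgrPdist_lt/(_ _ e2)[N _ /(_ N (leqnn N))] := @cvg_harmonic R.
  rewrite /harmonic /= sub0r normrN ger0_norm ?invr_ge0// => h; exists N.
  move: h; rewrite ltr_pdivlMr ?ltr_wpDl ?mulr_ge0//.
  have : 0 < N.+1%:R^-1 :> R by rewrite invr_gt0.
  by move: (N.+1%:R^-1) => u; nra.
have hq i : {q : rat | `|(tnth t i : R) - ratr q| < m.+1%:R^-1}.
  apply: cid; have : (tnth t i : R) - m.+1%:R^-1 < (tnth t i : R) + m.+1%:R^-1.
    have : 0 < m.+1%:R^-1 :> R by rewrite invr_gt0.
    by move: (m.+1%:R^-1) => u; lra.
  move=> /rat_in_itvoo[q]; rewrite in_itv /= => /andP[q1 q2]; exists q.
  by rewrite ltr_norml; move: q1 q2; move: (m.+1%:R^-1) => u; lra.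
exists (pickle ([tuple projT1 (hq i) | i < d], m)); rewrite pickleK; split=> [i|s hs].
  by rewrite tnth_mktuple; exact: projT2 (hq i).
apply: sub; rewrite -ball_normE /=; apply: le_lt_trans (coord_vec_dist _ _) _.
apply: le_lt_trans hm; rewrite mulr_natl -[X in _ *+ X]card_ord -sumr_const.
apply: ler_sum => i _; have := hs i; have := projT2 (hq i); rewrite tnth_mktuple.
move: (projT1 (hq i)) => q; rewrite !ltr_norml; move: (m.+1%:R^-1) => u.
by move=> /andP[h1 h2] /andP[h3 h4]; rewrite ler_norml; lra.
Qed.

End Euclid.

Section Weight.
Context {R : realType} {V : normedModType R}.
Context {dotp : {dot V for @idfun R}} {d : nat} {e : 'I_d -> V}.
Variable hE : euclidean_space dotp e.

(** The weight is integrable, satisfies Peetre's inequality, and is reciprocal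
    to a function of polynomial growth. *)
Definition weight (x : V) : R := \prod_(i < d) (1 + dotp x (e i) ^+ 2)^-1.

Let factor_gt0 (a : R) : 0 < 1 + a ^+ 2.
Proof. by rewrite ltr_pwDl// sqr_ge0. Qed.

Lemma weight_gt0 x : 0 < weight x.
Proof. by apply: prodr_gt0 => i _; rewrite invr_gt0. Qed.

Lemma weight_le1 x : weight x <= 1.
Proof.
apply: prodr_ile1 => i; rewrite invr_ge0 ltW//=.
by rewrite invf_le1// lerDl sqr_ge0.
Qed.

Lemma weightN x : weight (- x) = weight x.
Proof. by apply: eq_bigr => i _; rewrite dotNl sqrrN. Qed.

Lemma weight_continuous : continuous weight.
Proof.
apply: continuous_big => [|i _ x]; first exact: mul_continuous.
apply: cvgV; first by rewrite gt_eqF.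
apply: cvgD; first exact: cvg_cst.
apply: (@continuous_comp _ _ _ (fun x => dotp x (e i)) (fun a : R => a ^+ 2)).
  exact: (dotl_continuous hE).
exact: exprn_continuous.
Qed.

Lemma weight_coord t : weight (coord_vec e t) = \prod_(i < d) (1 + tnth t i ^+ 2)^-1.
Proof. by apply: eq_bigr => i _; rewrite dot_coord_vec. Qed.

Lemma weight_integrable : rintegrable (lebesgue_tuple R d) (weight \o coord_vec e).
Proof.
have mf : measurable_fun setT (weight \o coord_vec e).
  exact: basis_measurable_fun (coord_vec_basis hE) weight_continuous.
apply/integrableP; split; first exact/measurable_EFinP.
rewrite [X in (X < _)%E](_ : _ = \int[lebesgue_tuple R d]_t
    (\prod_(i < d) (fun x : R => (1 + x ^+ 2)^-1) (tnth t i))%:E)%E; last first.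
  apply: eq_integral => t _; rewrite gee0_abs; first by rewrite /= weight_coord.
  by rewrite lee_fin ltW// weight_gt0.
rewrite (@ge0_integral_tuple_prod R d (fun _ x => (1 + x ^+ 2)^-1) (fun _ => pi)).
- exact: ltry.
- move=> _; apply: continuous_measurable_fun => x; apply: cvgV; first by rewrite gt_eqF.
  by apply: cvgD; [exact: cvg_cst|exact: exprn_continuous].
- by move=> _ x; rewrite invr_ge0 ltW.
- move=> _; rewrite -(integral_cauchy_density ltr01); apply: eq_integral => x _.
  by rewrite expr1n mul1r.
Qed.

(** Peetre's inequality: a convolution of dominated functions is dominated
    when one of them has a weight to spare. *)
Lemma weight_split x y : weight (x + y) * weight y <= 2 ^+ d * weight x.
Proof.
have -> : 2 ^+ d = \prod_(i < d) (2 : R) by rewrite prodr_const card_ord.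
rewrite /weight -!big_split /=.
apply: ler_prod => i _; rewrite -invfM; apply/andP; split.
  by rewrite invr_ge0 ltW// mulr_gt0.
rewrite dotDl; move: (dotp x (e i)) (dotp y (e i)) => a b.
rewrite ler_pdivlMr// mulrC ler_pdivrMr ?mulr_gt0//.
have := sqr_ge0 (a + b + b); have := sqr_ge0 (a + b); have := sqr_ge0 b.
have := mulr_ge0 (sqr_ge0 (a + b)) (sqr_ge0 b).
rewrite !expr2; nra.
Qed.

Lemma weight_inv_le x : (weight x)^-1 <= (1 + `|x|) ^+ (2 * d).
Proof.
rewrite /weight prodfV invrK exprM.
have -> : ((1 + `|x|) ^+ 2) ^+ d = \prod_(i < d) (1 + `|x|) ^+ 2.
  by rewrite prodr_const card_ord.
apply: ler_prod => i _; rewrite ltW//=.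
have := coord_le_norm hE x i; have := normr_ge0 (dotp x (e i)).
rewrite -(real_normK (num_real (dotp x (e i)))).
by move: `|dotp x (e i)| `|x| => a b; nra.
Qed.

Lemma weight_prod_continuous : continuous (fun z : V * V => weight z.1 * weight z.2).
Proof.
move=> [x y]; apply: cvgM.
  by apply: (continuous_comp (@cvg_fst _ _ _ _ _)); exact: weight_continuous.
by apply: (continuous_comp (@cvg_snd _ _ _ _ _)); exact: weight_continuous.
Qed.

Lemma weight_prod_integrable : rintegrable (lebesgue_tuple R d \x lebesgue_tuple R d)%E
  (fun t => weight (coord_vec e t.1) * weight (coord_vec e t.2)).
Proof.
have mf : measurable_fun setT (fun t : d.-tuple (measurableTypeR R) * d.-tuple (measurableTypeR R) =>
    weight (coord_vec e t.1) * weight (coord_vec e t.2)).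
  apply: (basis_measurable_fun (F := fun z : V * V => weight z.1 * weight z.2)
    (measurable_basis_prod (coord_vec_basis hE) (coord_vec_basis hE))).
  exact: weight_prod_continuous.
apply/integrable12ltyP; first exact/measurable_EFinP.
pose I := \int[lebesgue_tuple R d]_t weight (coord_vec e t).
have EI : (\int[lebesgue_tuple R d]_t (weight (coord_vec e t))%:E = I%:E)%E.
  by rewrite fineK//; exact: (integrable_fin_num measurableT weight_integrable).
rewrite (eq_integral (fun t => (I * weight (coord_vec e t))%:E)).
  have := integrable_lty measurableT (rintegrableZ I weight_integrable); exact.
move=> t _ /=; rewrite mulrC EFinM -EI -ge0_integralZl_EFin//; last 3 first.
- by move=> y _; rewrite lee_fin ltW// weight_gt0.
- by apply/measurable_EFinP; exact: (rintegrable_measurable weight_integrable).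
- by rewrite ltW// weight_gt0.
by apply: eq_integral => s _; rewrite /= ger0_norm// mulr_ge0// ltW// weight_gt0.
Qed.

End Weight.

Arguments weight {R V} dotp {d} e x.

Section VectorIntegration.
Context {R : realType} {V : normedModType R}.
Context {dotp : {dot V for @idfun R}} {d : nat} {e : 'I_d -> V}.
Variable hE : euclidean_space dotp e.
Context {A : tvsType R[i]}.
Variables (P : nat -> A -> R) (hP : seminorm_system P) (cP : complete_system P).
Local Notation mu := (lebesgue_tuple R d).
Local Notation w := (weight dotp e).
Local Notation c := (coord_vec e).

Definition wdominated (F : V -> A) := dominated P w F.

Definition wdominated2 (F : V * V -> A) :=
  dominated P (fun z => w z.1 * w z.2) F.

Definition weight_mass : R := \int[mu]_t w (c t).

Lemma weight_mass_ge0 : 0 <= weight_mass.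
Proof. by apply: Rintegral_ge0 => t _; rewrite ltW// weight_gt0. Qed.

Lemma intV_is_vint F : wdominated F -> is_vint mu (F \o c) (intV e F).
Proof.
move=> domF.
exact: (dominated_vint hP (coord_vec_basis hE) weight_gt0 (weight_continuous hE)
  (weight_integrable hE) cP domF).
Qed.

Lemma intV_integrable F psi : wdominated F -> real_functional P psi ->
  rintegrable mu (fun t => psi (F (c t))).
Proof. by move=> /intV_is_vint /(is_vintP hP) h /h[]. Qed.

Lemma intV_functional F psi : wdominated F -> real_functional P psi ->
  psi (intV e F) = \int[mu]_t psi (F (c t)).
Proof. by move=> /intV_is_vint /(is_vintP hP) h /h[]. Qed.

Lemma intV_bound F n C : wdominated F -> (forall x, P n (F x) <= C * w x) ->
  P n (intV e F) <= C * weight_mass.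
Proof.
move=> domF.
exact: (vint_bound hP (coord_vec_basis hE) weight_gt0 (weight_continuous hE)
  (weight_integrable hE) cP domF).
Qed.

Lemma intV_eq F a :
  (forall psi, real_functional P psi ->
     rintegrable mu (fun t => psi (F (c t))) /\
     psi a = \int[mu]_t psi (F (c t))) -> intV e F = a.
Proof. by move=> h; apply: (vintE hP); apply/(is_vintP hP). Qed.

Lemma intV_linear (L : A -> A) F :
  (forall (r : R) a b, L (r%:C *: a + b) = r%:C *: L a + L b) ->
  (forall n, exists m C, 0 <= C /\ forall a, P n (L a) <= C * P m a) ->
  wdominated F -> intV e (fun x => L (F x)) = L (intV e F).
Proof.
move=> Ll Lb domF; apply: intV_eq => psi psif.
have psiL := real_functional_comp psif Ll Lb.
split; first exact: (intV_integrable domF psiL).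
exact: (intV_functional domF psiL).
Qed.

Lemma intVZ (k : R[i]) F : wdominated F ->
  intV e (fun x => k *: F x) = k *: intV e F.
Proof.
apply: intV_linear => [r a b|n].
  by rewrite scalerDr !scalerA mulrC.
by exists n, (normc k); rewrite normc_ge0; split => // a; rewrite (sysZ hP).
Qed.

Lemma intVD F G : wdominated F -> wdominated G ->
  intV e (fun x => F x + G x) = intV e F + intV e G.
Proof.
move=> dF dG; apply: intV_eq => psi psif; have [psil _] := psif.
have iF := intV_integrable dF psif; have iG := intV_integrable dG psif.
rewrite (_ : (fun t => psi _) = (fun t => psi (F (c t)) + psi (G (c t)))); last first.
  by apply/funext => t; rewrite real_linearD.
split; first exact: rintegrableD.
by rewrite RintegralD// real_linearD// !intV_functional.
Qed.

Lemma intVB F G : wdominated F -> wdominated G ->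
  intV e (fun x => F x - G x) = intV e F - intV e G.
Proof.
move=> dF dG; apply: intV_eq => psi psif; have [psil _] := psif.
have iF := intV_integrable dF psif; have iG := intV_integrable dG psif.
rewrite (_ : (fun t => psi _) = (fun t => psi (F (c t)) + (-1) * psi (G (c t)))); last first.
  by apply/funext => t; rewrite real_linearB// mulN1r.
split; first by apply: rintegrableD => //; exact: rintegrableZ.
rewrite RintegralD//; last exact: rintegrableZ.
by rewrite RintegralZl// real_linearB// !intV_functional// mulN1r.
Qed.

Lemma intV_affine (neg : bool) s F : wdominated F ->
  intV e (fun x => F (if neg then s - x else s + x)) = intV e F.
Proof.
move=> domF; apply: intV_eq => psi psif.
have iF := intV_integrable domF psif.
have [] := rintegral_affine neg (fun i => dotp s (e i)) iF.
under [X in \int[_]_x X x]eq_fun do rewrite (coord_vec_affine hE neg s).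
move=> h1 h2; split.
  rewrite /rintegrable; congr (integrable _ _ _): h1.
  by apply/funext => t /=; rewrite (coord_vec_affine hE).
by rewrite (intV_functional domF psif) -h2.
Qed.

Lemma intV_translate s F : wdominated F -> intV e (fun x => F (s + x)) = intV e F.
Proof. exact: intV_affine false s F. Qed.

Lemma intV_reflect s F : wdominated F -> intV e (fun x => F (s - x)) = intV e F.
Proof. exact: intV_affine true s F. Qed.

Lemma wdominated_curry F x : wdominated2 F -> wdominated (fun y => F (x, y)).
Proof.
move=> [cF bF]; split.
  move=> y; apply: (@continuous_comp _ _ _ (fun y => (x, y)) F); last exact: cF.
  by apply: cvg_pair; [exact: cvg_cst|exact: cvg_id].
move=> n; have [C [C0 hC]] := bF n; exists C; split => // y.
apply: le_trans (hC _) _; rewrite ler_wpM2l//= ler_piMl ?weight_le1//.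
by rewrite ltW// weight_gt0.
Qed.

Lemma wdominated_swap F : wdominated2 F -> wdominated2 (fun z => F (z.2, z.1)).
Proof.
move=> [cF bF]; split.
  move=> [x y]; apply: (@continuous_comp _ _ _ (fun z : V * V => (z.2, z.1)) F); last exact: cF.
  by apply: cvg_pair; [exact: cvg_snd|exact: cvg_fst].
by move=> n; have [C [C0 hC]] := bF n; exists C; split => // z; rewrite [w _ * _]mulrC.
Qed.

Lemma intVV_is_vint F : wdominated2 F ->
  is_vint (mu \x mu)%E (fun t => F (c t.1, c t.2)) (intVV e (fun x y => F (x, y))).
Proof.
move=> domF; apply: (dominated_vint hP
  (measurable_basis_prod (coord_vec_basis hE) (coord_vec_basis hE))
  _ (weight_prod_continuous hE) (weight_prod_integrable hE) cP domF).
by move=> x; rewrite mulr_gt0// weight_gt0.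
Qed.

(** Fubini: measurability of the partial integral comes with the scalar
    theorem, so no continuity in the parameter has to be shown first. *)
Lemma intV_intV F : wdominated2 F ->
  intV e (fun x => intV e (fun y => F (x, y))) = intVV e (fun x y => F (x, y)).
Proof.
move=> domF; apply: intV_eq => psi psif.
have [iF ->] : (mu \x mu)%E.-integrable setT (EFin \o (fun t => psi (F (c t.1, c t.2)))) /\
    psi (intVV e (fun x y => F (x, y))) = \int[(mu \x mu)%E]_t psi (F (c t.1, c t.2)).
  by have := intVV_is_vint domF; move=> /(is_vintP hP) /(_ psi psif) [].
have E t : psi (intV e (fun y => F (c t, y))) = \int[mu]_s psi (F (c t, c s)).
  by rewrite (intV_functional (wdominated_curry (c t) domF) psif).
have E2 t : (\int[mu]_s (psi (F (c t, c s)))%:E = (psi (intV e (fun y => F (c t, y))))%:E)%E.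
  rewrite E fineK//.
  exact: (integrable_fin_num measurableT (intV_integrable (wdominated_curry (c t) domF) psif)).
have fF : fubini_F mu (EFin \o (fun t => psi (F (c t.1, c t.2)))) =
    EFin \o (fun t => psi (intV e (fun y => F (c t, y)))).
  by apply/funext => t; rewrite /fubini_F /= E2.
split.
  by have := integrable_fubini_F iF; rewrite fF.
rewrite /Rintegral -(integral12_prod_meas1 iF) fF.
by [].
Qed.

Lemma wdominated2_intVV_swap F : wdominated2 F ->
  intVV e (fun x y => F (y, x)) = intVV e (fun x y => F (x, y)).
Proof.
move=> domF; apply: (is_vint_unique hP (intVV_is_vint (wdominated_swap domF))).
apply/(is_vintP hP) => psi psif.
have := intVV_is_vint domF; move=> /(is_vintP hP) /(_ psi psif) [iF ->].
have := intVV_is_vint (wdominated_swap domF).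
move=> /(is_vintP hP) /(_ psi psif) [iG _].
split; first exact: iG.
rewrite /Rintegral -(integral12_prod_meas1 iF) -(integral21_prod_meas1 iG).
by congr fine; apply: eq_integral.
Qed.

Lemma intV_swap F : wdominated2 F ->
  intV e (fun x => intV e (fun y => F (x, y))) =
  intV e (fun y => intV e (fun x => F (x, y))).
Proof.
move=> domF; rewrite intV_intV// -wdominated2_intVV_swap//.
by rewrite -(intV_intV (wdominated_swap domF)).
Qed.

End VectorIntegration.

(** * Directional derivatives *)

Lemma punctured_filter (R : realType) : Filter (0 : R)^'.
Proof. exact: dnbhs_filter. Qed.

Lemma punctured_cst {R : realType} (B : topologicalType) (b : B) :
  (fun _ : R => b) @ 0^' --> b.
Proof. exact: cvg_cst. Qed.
Arguments punctured_cst {R B} b.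

Section DirectionalDerivative.
Context {R : realType} {W : normedModType R} {A : tvsType R[i]}.
Implicit Types (f g : W -> A) (x v : W).

Lemma is_dderive_unique f x v l m : hausdorff_space A ->
  is_dderive f x v l -> is_dderive f x v m -> l = m.
Proof. by move=> hA; exact: cvg_unique. Qed.

Lemma dderiveE f x v l : hausdorff_space A -> is_dderive f x v l ->
  dderive f x v = l.
Proof.
move=> hA h; apply: (is_dderive_unique hA _ h); rewrite /dderive.
by have := @xgetPex _ 0 [set l | is_dderive f x v l]; apply; exists l.
Qed.

Lemma eq_is_dderive f g x v l : f =1 g -> is_dderive f x v l -> is_dderive g x v l.
Proof. by move=> /funext ->. Qed.

Lemma is_dderive_cst (a : A) x v : is_dderive (fun=> a) x v 0.
Proof.
rewrite /is_dderive (_ : (fun h => _) = (fun=> 0)); first exact: cvg_cst.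
by apply/funext => h; rewrite subrr scaler0.
Qed.

Lemma is_dderiveD f g x v l m : is_dderive f x v l -> is_dderive g x v m ->
  is_dderive (fun y => f y + g y) x v (l + m).
Proof.
move=> fl gm; apply: eq_cvg_fun (tvs_cvgD fl gm) => h.
by rewrite -scalerDr; congr (_ *: _); rewrite opprD addrACA.
Qed.

Lemma is_dderive_comp_linear (W' : normedModType R) (L : W' -> W) f (x v : W') l :
  (forall h : R, L (x + h *: v) = L x + h *: (L (x + v) - L x)) ->
  is_dderive f (L x) (L (x + v) - L x) l -> is_dderive (fun y => f (L y)) x v l.
Proof.
by move=> hL; apply: eq_cvg_fun => h; rewrite hL.
Qed.

Lemma is_dderive_translate f (a x v : W) l :
  is_dderive f (a + x) v l -> is_dderive (fun y => f (a + y)) x v l.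
Proof.
move=> fl; apply: is_dderive_comp_linear => [h|]; first by rewrite !addrA (addrC (a + x) v) addrK.
by rewrite addrA (addrC (a + x) v) addrK.
Qed.

Lemma is_dderive_scale f x v l (r : R) :
  is_dderive f x v l -> is_dderive f x (r *: v) (r%:C *: l).
Proof.
have [->|r0] := eqVneq r 0.
  move=> _; rewrite scale0r rmorph0 scale0r.
  rewrite /is_dderive (_ : (fun h => _) = (fun=> 0)); first exact: cvg_cst.
  by apply/funext => h; rewrite scaler0 addr0 subrr scaler0.
move=> fl; have hr : (fun h : R => r * h) @ 0^' --> (0 : R)^'.
  move=> U /nbhs_ballP[eps /= e0 hU]; apply/nbhs_ballP; exists (eps / `|r|) => /=.
    by rewrite divr_gt0// normr_gt0.
  move=> h; rewrite /ball /= sub0r normrN ltr_pdivlMr ?normr_gt0// => hb hn0.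
  by apply: hU; rewrite ?mulf_neq0// /ball /= sub0r normrN normrM mulrC.
have h1 : (fun h : R => ((r * h)^-1)%:C *: (f (x + (r * h) *: v) - f x)) @ 0^' --> l.
  exact: cvg_comp hr fl.
have h2 := tvs_cvgZ (FF := punctured_filter R) (punctured_cst (B := R[i]^o) r%:C) h1.
rewrite /is_dderive; apply: eq_cvg_fun h2 => h /=.
by rewrite scalerA -rmorphM invfM mulrA divff// mul1r scalerA (mulrC h).
Qed.

Lemma is_dderive_cvg f x v l : is_dderive f x v l ->
  (fun h : R => f (x + h *: v)) @ 0^' --> f x.
Proof.
move=> fl.
have h0 : (fun h : R => h%:C : R[i]^o) @ 0^' --> ((0 : R)%:C : R[i]^o).
  by apply: cvg_real_complex; exact: cvg_within.
have := tvs_cvgZ (FF := punctured_filter R) h0 fl; rewrite rmorph0 scale0r => h1.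
have := tvs_cvgD (FF := punctured_filter R) h1 (punctured_cst (B := A) (f x)); rewrite add0r.
move=> h2; apply: cvg_trans h2; apply: near_eq_cvg; near=> h.
have hn0 : h != 0 by near: h; exact: nbhs_dnbhs_neq.
by rewrite scalerA -rmorphM divff// scale1r subrK.
Unshelve. all: by end_near. Qed.

End DirectionalDerivative.

Section Leibniz.
Context {R : realType} {W : normedModType R} {A B C : tvsType R[i]}.
Implicit Types (x v : W).

Lemma is_dderive_linear (L : A -> B) (f : W -> A) x v l :
  (forall (r : R) a b, L (r%:C *: (a - b)) = r%:C *: (L a - L b)) ->
  {for l, continuous L} ->
  is_dderive f x v l -> is_dderive (fun y => L (f y)) x v (L l).
Proof.
move=> LB cL fl; apply: eq_cvg_fun (continuous_cvg (punctured_filter R) cL fl) => h /=.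
by rewrite LB.
Qed.

Lemma is_dderive_bilinear (M : A -> B -> C) (f : W -> A) (g : W -> B) x v l m :
  (forall a a' b, M (a - a') b = M a b - M a' b) ->
  (forall a b b', M a (b - b') = M a b - M a b') ->
  (forall (r : R) a b, M (r%:C *: a) b = r%:C *: M a b) ->
  (forall (r : R) a b, M a (r%:C *: b) = r%:C *: M a b) ->
  continuous (fun z : A * B => M z.1 z.2) ->
  is_dderive f x v l -> is_dderive g x v m ->
  is_dderive (fun y => M (f y) (g y)) x v (M l (g x) + M (f x) m).
Proof.
move=> MBl MBr MZl MZr cM fl gm.
have h1 := continuous2_cvg (punctured_filter R) (cM (l, g x)) fl (is_dderive_cvg gm).
have h2 := continuous2_cvg (punctured_filter R) (cM (f x, m)) (punctured_cst (B := A) (f x)) gm.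
apply: eq_cvg_fun (tvs_cvgD (FF := punctured_filter R) h1 h2) => h.
rewrite /= MZl MZr -scalerDr MBl MBr; congr (_ *: _).
by rewrite addrA subrK.
Qed.

Lemma is_dderiveZ (s : W -> R[i]^o) (g : W -> A) x v l m :
  is_dderive s x v l -> is_dderive g x v m ->
  is_dderive (fun y => (s y : R[i]) *: g y) x v ((l : R[i]) *: g x + (s x : R[i]) *: m).
Proof.
move=> sl gm; rewrite /is_dderive.
have h1 := tvs_cvgZ (FF := punctured_filter R) sl (is_dderive_cvg gm).
have h2 := tvs_cvgZ (FF := punctured_filter R) (punctured_cst (B := R[i]^o) (s x)) gm.
apply: eq_cvg_fun (tvs_cvgD (FF := punctured_filter R) h1 h2) => h /=.
have e (k a : R[i]) (b : A) : ((k *: (a : R[i]^o)) : R[i]) *: b = k *: (a *: b).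
  by rewrite scalerA.
rewrite [X in _ + X]scalerA (mulrC (s x : R[i])) -[X in _ + X]scalerA e -scalerDr; congr (_ *: _).
by rewrite scalerBl scalerBr addrA subrK.
Qed.

End Leibniz.

Section MeanValue.
Context {R : realType} {W : normedModType R} {A : tvsType R[i]}.
Variables (P : nat -> A -> R) (hP : seminorm_system P).
Implicit Types (f g : W -> A) (x v : W).

Lemma is_dderive_functional f g x v psi : real_functional P psi ->
  (forall s : R, is_dderive f (x + s *: v) v (g (x + s *: v))) ->
  forall s : R, is_derive s (1 : R) (fun s => psi (f (x + s *: v))) (psi (g (x + s *: v))).
Proof.
move=> psif fg s; have [psil _] := psif.
have h := continuous_cvg (punctured_filter R)
    (real_functional_continuous hP psif (x := g (x + s *: v))) (fg s).
have e1 : (fun h : R => h^-1 *: (((fun s => psi (f (x + s *: v))) \o shift s) (h *: (1 : R))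
     - psi (f (x + s *: v)))) @ 0^' --> psi (g (x + s *: v)).
  apply: eq_cvg_fun h => h /=.
  rewrite real_linearZ// real_linearB//; congr (_ *: (psi (f _) - _)).
  by rewrite [h%:A]mulr1 (addrC h) scalerDl addrA.
by split; [apply/cvg_ex; eexists; exact: e1|exact: cvg_lim].
Qed.

(** The scalar mean value theorem, applied to a norming functional of the
    increment. *)
Lemma mean_value f g x v n M :
  (forall s : R, is_dderive f (x + s *: v) v (g (x + s *: v))) ->
  (forall s : R, 0 <= s <= 1 -> P n (g (x + s *: v)) <= M) ->
  P n (f (x + v) - f x) <= M.
Proof.
move=> fg gM; apply: (seminorm_le_functional hP) => psi psif psib.
have [psil _] := psif.
have dphi := is_dderive_functional psif fg.
have [|s s01] := @MVT_segment R (fun s => psi (f (x + s *: v)))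
    (fun s => psi (g (x + s *: v))) 0 1 ler01 (fun s _ => dphi s).
  apply: continuous_subspaceT => s.
  by have /derivable1_diffP/differentiable_continuous := @ex_derive _ _ _ _ _ _ _ (dphi s).
rewrite scale1r scale0r addr0 subr0 mulr1 real_linearB// => ->.
apply: le_trans (ler_norm _) _; apply: le_trans (psib _) _; apply: gM.
by move: s01; rewrite in_itv.
Qed.

Lemma dquotient_bound f g x v n M (h : R) : h != 0 ->
  (forall y, is_dderive f y v (g y)) ->
  (forall s : R, `|s| <= `|h| -> P n (g (x + s *: v)) <= M) ->
  P n ((h^-1)%:C *: (f (x + h *: v) - f x)) <= M.
Proof.
move=> h0 fg gM.
rewrite (sysZr hP) normfV ler_pdivrMl ?normr_gt0//.
apply: (mean_value (g := fun y => h%:C *: g y)) => s.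
  exact: is_dderive_scale (fg _).
move=> /andP[s0 s1]; rewrite (sysZr hP) ler_wpM2l// scalerA gM//.
by rewrite normrM ger0_norm// ler_piMl.
Qed.

End MeanValue.

(** * Limits and derivatives of integrals *)

(** Dominated convergence is a statement about sequences; countable bases of
    neighbourhoods turn it into continuity and differentiability. *)
Lemma within_seq {R : realType} {W : pseudoMetricType R} (D : set W) (x : W) (U : set W) :
  (forall u : nat -> W, (forall k, D (u k)) -> u @ \oo --> x ->
     \forall k \near \oo, U (u k)) ->
  within D (nbhs x) U.
Proof.
move=> h; apply: contrapT => nU.
have [u hu] : {u : nat -> W & forall k, [/\ ball x k.+1%:R^-1 (u k), D (u k) & ~ U (u k)]}.
  apply: (@choice _ _ (fun k y => [/\ ball x k.+1%:R^-1 y, D y & ~ U y])) => k.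
  apply: contrapT => hk; apply: nU; apply/nbhs_ballP; exists k.+1%:R^-1 => /=.
    by rewrite invr_gt0.
  by move=> y xy Dy; apply: contrapT => nUy; apply: hk; exists y.
have ux : u @ \oo --> x.
  apply/cvg_ballP => eps e0.
  have : \forall k \near \oo, k.+1%:R^-1 < eps.
    exact: near_infty_natSinv_lt (PosNum e0).
  apply: filterS => k /ltW ke; have [] := hu k.
  by move=> xu _ _; apply: le_ball xu.
have [|N _ /(_ N (leqnn N))] := h u _ ux; first by move=> k; have [] := hu k.
by have [] := hu N.
Qed.

Section IntegralLimits.
Context {R : realType} {V : normedModType R}.
Context {dotp : {dot V for @idfun R}} {d : nat} {e : 'I_d -> V}.
Variable hE : euclidean_space dotp e.
Context {A : tvsType R[i]}.
Variables (P : nat -> A -> R) (hP : seminorm_system P) (cP : complete_system P).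
Local Notation mu := (lebesgue_tuple R d).
Local Notation w := (weight dotp e).
Local Notation c := (coord_vec e).
Local Notation wdominated := (wdominated (dotp := dotp) (e := e) P).

Lemma seminorm_measurable (F : V -> A) n : continuous F ->
  measurable_fun setT (fun t => P n (F (c t))).
Proof.
move=> cF; apply: (basis_measurable_fun (F := fun x => P n (F x)) (coord_vec_basis hE)).
move=> x; apply: (@continuous_comp _ _ _ F (P n)); [exact: cF|exact: sys_continuous].
Qed.

Lemma seminorm_integrable F n : wdominated F -> rintegrable mu (fun t => P n (F (c t))).
Proof.
move=> [cF bF]; have [C [C0 hC]] := bF n.
apply: rintegrable_le (rintegrableZ C (weight_integrable hE)) _.
  exact: seminorm_measurable.
by move=> t; rewrite ger0_norm ?sys_ge0.
Qed.

Lemma intV_seminorm_le F n : wdominated F ->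
  P n (intV e F) <= \int[mu]_t P n (F (c t)).
Proof.
move=> domF; apply: (seminorm_le_functional hP) => psi psif psib.
rewrite (intV_functional hE hP cP domF psif).
apply: le_rintegral; [exact: intV_integrable domF psif|exact: seminorm_integrable|].
by move=> t; apply: le_trans (ler_norm _) (psib _).
Qed.

Lemma wdominatedB F G : wdominated F -> wdominated G -> wdominated (fun x => F x - G x).
Proof.
move=> [cF bF] [cG bG]; split=> [x|n].
  exact: tvs_cvgB (cF x) (cG x).
have [C [C0 hC]] := bF n; have [D [D0 hD]] := bG n; exists (C + D).
split=> [|x]; first exact: addr_ge0.
apply: le_trans (sysB hP _ _ _) _; rewrite mulrDl; exact: lerD.
Qed.

Lemma wdominatedD F G : wdominated F -> wdominated G -> wdominated (fun x => F x + G x).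
Proof.
move=> [cF bF] [cG bG]; split=> [x|n].
  exact: tvs_cvgD (cF x) (cG x).
have [C [C0 hC]] := bF n; have [D [D0 hD]] := bG n; exists (C + D).
split=> [|x]; first exact: addr_ge0.
apply: le_trans (sysD hP _ _ _) _; rewrite mulrDl; exact: lerD.
Qed.

Lemma wdominatedZ (k : R[i]) F : wdominated F -> wdominated (fun x => k *: F x).
Proof.
move=> [cF bF]; split=> [x|n]; first by apply: tvs_cvgZ; [exact: cvg_cst|exact: cF].
have [C [C0 hC]] := bF n; exists (normc k * C).
split=> [|x]; first by rewrite mulr_ge0 ?normc_ge0.
by rewrite (sysZ hP) -mulrA ler_wpM2l ?normc_ge0.
Qed.

Lemma intV_cvg_seq (F : nat -> V -> A) G :
  (forall k, continuous (F k)) -> continuous G ->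
  (forall n, exists C, 0 <= C /\ forall k x, P n (F k x) <= C * w x) ->
  (forall x, F ^~ x @ \oo --> G x) ->
  (fun k => intV e (F k)) @ \oo --> intV e G.
Proof.
move=> cF cG bF FG.
have domF k : wdominated (F k).
  split; first exact: cF.
  by move=> n; have [C [C0 hC]] := bF n; exists C.
have domG : wdominated G.
  split=> // n; have [C [C0 hC]] := bF n; exists C; split => // x.
  apply/ler_addgt0Pr => eps e0.
  have /(sys_cvgP hP)/(_ n eps e0)/filter_ex [k] := FG x; rewrite (sysC hP) => hk.
  have := sysD hP n (G x - F k x) (F k x); rewrite subrK.
  by move: (hC k x) hk; lra.
apply/(sys_cvgP hP) => n eps e0; have [C [C0 hC]] := bF n.
have [C' [C'0 hC']] := domG.2 n.
have mFG k : measurable_fun setT (fun t => P n (F k (c t) - G (c t))).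
  exact: (seminorm_measurable (F := fun x => F k x - G x) n (wdominatedB (domF k) domG).1).
have cv : (fun k => \int[mu]_t P n (F k (c t) - G (c t))) @ \oo --> (0 : R).
  rewrite -[X in _ --> X](_ : \int[mu]_t cst 0 t = 0); last by rewrite /Rintegral integral0.
  apply: (dominated_rintegral_cvg (f := cst 0) mFG
    (rintegrableZ (C + C') (weight_integrable hE)) _ _).2 => [k t|t].
    rewrite ger0_norm ?sys_ge0//; apply: le_trans (sysB hP _ _ _) _.
    by rewrite mulrDl lerD.
  apply/cvgrPdist_lt => del d0.
  have /(sys_cvgP hP)/(_ n del d0) := FG (c t); apply: filterS => k.
  by rewrite sub0r normrN ger0_norm ?sys_ge0.
have /cvgrPdist_lt/(_ _ e0) := cv; apply: filterS => k.
rewrite sub0r normrN => /(le_lt_trans (ler_norm _)); apply: le_lt_trans.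
rewrite -(intVB hE hP cP (domF k) domG).
exact: (intV_seminorm_le n (wdominatedB (domF k) domG)).
Unshelve. all: by end_near. Qed.

Lemma intV_continuous (W : normedModType R) (F : W -> V -> A) :
  (forall x, continuous (F x)) -> (forall y, continuous (F ^~ y)) ->
  (forall n, exists C, 0 <= C /\ forall x y, P n (F x y) <= C * w y) ->
  continuous (fun x => intV e (F x)).
Proof.
move=> cF cF' bF x U hU.
suff : within setT (nbhs x) [set y | U (intV e (F y))].
  by move=> h; apply: filterS (h : nbhs x [set y | setT y -> U (intV e (F y))]) => y; exact.
apply: within_seq => u _ ux.
suff : (fun k => intV e (F (u k))) @ \oo --> intV e (F x) by exact.
apply: intV_cvg_seq => [k||n|y].
- exact: cF.
- exact: cF.
- by have [C [C0 hC]] := bF n; exists C.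
- exact: cvg_comp ux (cF' y x).
Qed.

Lemma intV_cvg0 (F : R -> V -> A) G :
  (forall h, h != 0 -> `|h| <= 1 -> continuous (F h)) -> continuous G ->
  (forall n, exists C, 0 <= C /\
     forall h x, h != 0 -> `|h| <= 1 -> P n (F h x) <= C * w x) ->
  (forall x, F ^~ x @ 0^' --> G x) ->
  (fun h => intV e (F h)) @ 0^' --> intV e G.
Proof.
move=> cF cG bF FG U hU.
have : within [set h : R | h != 0 /\ `|h| <= 1] (nbhs 0) [set h | U (intV e (F h))].
  apply: within_seq => u uD u0.
  suff : (fun k => intV e (F (u k))) @ \oo --> intV e G by exact.
  apply: intV_cvg_seq => [k||n|y].
  - by have [] := uD k; exact: cF.
  - exact: cG.
  - have [C [C0 hC]] := bF n; exists C; split => // k y.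
    by have [] := uD k; exact: hC.
  - have u0' : u @ \oo --> (0 : R)^'.
      move=> O /u0 h; apply: (filterS _ (h : \forall k \near \oo, u k != 0 -> O (u k))).
      by move=> k; apply; have [] := uD k.
    exact: cvg_comp u0' (FG y).
have h1 : nbhs (0 : R) [set h : R | `|h| <= 1].
  apply/nbhs_ballP; exists 1 => //= h; rewrite /ball /= sub0r normrN; exact: ltW.
by rewrite /within /=; apply: filterS2 h1 => h h1 /[swap] hn0; apply.
Unshelve. all: by end_near. Qed.

(** The mean value inequality dominates the difference quotients. *)
Lemma intV_dderive (W : normedModType R) (F F1 : W -> V -> A) x v :
  (forall x, wdominated (F x)) -> (forall x, continuous (F1 x)) ->
  (forall x y, is_dderive (F ^~ y) x v (F1 x y)) ->
  (forall n, exists C, 0 <= C /\ forall x y, P n (F1 x y) <= C * w y) ->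
  is_dderive (fun x => intV e (F x)) x v (intV e (F1 x)).
Proof.
move=> domF cF1 dF bF1.
have domQ h : wdominated (fun y => (h^-1)%:C *: (F (x + h *: v) y - F x y)).
  have [cB bB] := wdominatedB (domF (x + h *: v)) (domF x).
  split=> [y|n]; first exact: tvs_cvgZ (cvg_cst _) (cB y).
  have [C [C0 hC]] := bB n; exists (`|h^-1| * C); rewrite mulr_ge0//; split => // y.
  by rewrite (sysZr hP) -mulrA ler_wpM2l.
rewrite /is_dderive.
apply: (eq_cvg_fun (f := fun h : R => intV e (fun y => (h^-1)%:C *: (F (x + h *: v) y - F x y)))).
  move=> h; rewrite (intVZ hE hP cP) ?(intVB hE hP cP)//.
  exact: wdominatedB.
apply: intV_cvg0 => [h _ _||n|y].
- exact: (domQ h).1.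
- exact: cF1.
- have [C [C0 hC]] := bF1 n; exists C; split => // h y h0 _.
  exact: (dquotient_bound hP (f := F ^~ y) (g := F1 ^~ y) h0 (fun x => dF x y)).
- exact: dF.
Qed.

(** Integration by parts: the integral of the translates of [h] is constant,
    and its derivative is the integral of the derivative of [h]. *)
Lemma intV_derivative0 (h g : V -> A) v :
  wdominated h -> wdominated g -> (forall x, is_dderive h x v (g x)) -> intV e g = 0.
Proof.
move=> domh domg hg.
pose Q (s : R) y := (s^-1)%:C *: (h (y + s *: v) - h y).
have domT s : wdominated (fun y => h (y + s *: v)).
  have [ch bh] := domh; split=> [y|n].
    apply: (@continuous_comp _ _ _ (fun y => y + s *: v) h); last exact: ch.
    by apply: cvgD; [exact: cvg_id|exact: cvg_cst].
  have [C [C0 hC]] := bh n; exists (C * (2 ^+ d / w (s *: v))).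
  split=> [|y]; first by rewrite mulr_ge0// divr_ge0 ?exprn_ge0// ltW// weight_gt0.
  apply: le_trans (hC _) _; rewrite -mulrA ler_wpM2l// mulrAC ler_pdivlMr ?weight_gt0//.
  exact: weight_split.
have Q0 s : intV e (Q s) = 0.
  have domB := wdominatedB (domT s) domh.
  rewrite (intVZ hE hP cP) ?(intVB hE hP cP)//.
  rewrite (_ : (fun y => h (y + s *: v)) = (fun y => h (s *: v + y))); last first.
    by apply/funext => y; rewrite addrC.
  by rewrite (intV_translate hE hP cP)// subrr scaler0.
have cv : (fun s => intV e (Q s)) @ 0^' --> intV e g.
  apply: intV_cvg0 => [s _ _||n|y].
  - by move=> y; apply: tvs_cvgZ (cvg_cst _) _; exact: (wdominatedB (domT s) domh).1.
  - exact: domg.1.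
  - have [C [C0 hC]] := domg.2 n.
    pose K := (1 + `|v|) ^+ (2 * d) * 2 ^+ d.
    exists (C * K); split=> [|s y s0 s1].
      by rewrite mulr_ge0// mulr_ge0// exprn_ge0// addr_ge0.
    apply: (dquotient_bound hP (f := h) (g := g) s0 hg) => t ts.
    apply: le_trans (hC _) _; rewrite -mulrA ler_wpM2l// /K -mulrA.
    rewrite -ler_pdivrMl; last by rewrite exprn_gt0// ltr_pwDl.
    apply: le_trans _ (weight_split y (t *: v)); rewrite mulrC.
    apply: ler_wpM2l; first by rewrite ltW// weight_gt0.
    rewrite -[leRHS]invrK lef_pV2 ?posrE ?invr_gt0 ?weight_gt0 ?exprn_gt0 ?ltr_pwDl//.
    apply: le_trans (weight_inv_le hE _) _.
    rewrite lerXn2r ?nnegrE ?addr_ge0// lerD2l normrZ ler_piMl//.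
    exact: le_trans ts s1.
  - exact: hg.
apply/esym/(cvg_unique (sys_hausdorff hP) (F := (fun s => intV e (Q s)) @ 0^')).
  by apply: (eq_cvg_fun (f := cst 0)) => [s|]; [rewrite Q0|exact: cvg_cst].
exact: cv.
Qed.

End IntegralLimits.

(** * Operators on Schwartz functions *)

Section SchwartzSpace.
Context {R : realType} {W : normedModType R} {A : tvsType R[i]}.
Variables (P : nat -> A -> R) (hP : seminorm_system P).
Implicit Types (f g : W -> A) (v : W) (s : seq W) (n k : nat).
Implicit Types (ks : seq (nat * seq W)).
Local Notation S := (@schwartz R W A).
Local Notation operator := ((W -> A) -> W -> A).

Lemma seminorm_sys n : seminorm (P n) /\ continuous (P n).
Proof. by split; [exact: sys_seminorm|exact: sys_continuous]. Qed.

Lemma schwartz_dderive f s (x v : W) : S f ->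
  is_dderive (iter_dderive s f) x v (iter_dderive (v :: s) f x).
Proof.
move=> [/(_ s)[_ /(_ x v)[l hl]] _].
by rewrite /= (dderiveE (sys_hausdorff hP) hl).
Qed.

Lemma schwartz_continuous f s : S f -> continuous (iter_dderive s f).
Proof. by move=> [/(_ s)[]]. Qed.

Definition schwartz_sup n f (i : nat * seq W) : R :=
  sup (range (fun x => `|x| ^+ i.1 * P n (iter_dderive i.2 f x))).

Lemma le_schwartz_sup n f i x : S f ->
  `|x| ^+ i.1 * P n (iter_dderive i.2 f x) <= schwartz_sup n f i.
Proof.
move=> [_ /(_ (P n) (seminorm_sys n).1 (seminorm_sys n).2 i.2 i.1)[M hM]].
by apply: ub_le_sup; [exists M => _ [y _ <-]|exists x].
Qed.

Lemma schwartz_sup_le n f i M :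
  (forall x, `|x| ^+ i.1 * P n (iter_dderive i.2 f x) <= M) -> schwartz_sup n f i <= M.
Proof. by move=> hM; apply: ge_sup; [eexists; exists 0|move=> _ [y _ <-]]. Qed.

Lemma schwartz_sup_ge0 n f i : S f -> 0 <= schwartz_sup n f i.
Proof.
move=> hf; apply: le_trans (le_schwartz_sup n i 0 hf).
by rewrite mulr_ge0 ?exprn_ge0// sys_ge0.
Qed.

Definition schwartz_norm ks n f : R := \sum_(i <- ks) schwartz_sup n f i.

Lemma schwartz_norm_ge0 ks n f : S f -> 0 <= schwartz_norm ks n f.
Proof. by move=> hf; apply: sumr_ge0 => i _; exact: schwartz_sup_ge0. Qed.

Lemma schwartz_norm_mono ks n m f : (n <= m)%N -> S f ->
  schwartz_norm ks n f <= schwartz_norm ks m f.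
Proof.
move=> nm hf; apply: ler_sum => i _; apply: schwartz_sup_le => x.
apply: le_trans (le_schwartz_sup m i x hf); rewrite ler_wpM2l ?exprn_ge0//.
exact: sys_mono.
Qed.

(** Quantities that depend on a Schwartz function and a parameter, and are
    estimated by finitely many Schwartz seminorms uniformly in the parameter.
    Estimates on operators compose in this form without naming the indices. *)
Definition schwartz_bounded (X : Type) (q : (W -> A) -> X -> R) : Prop :=
  exists ks m C, 0 <= C /\
    forall f, S f -> forall x : X, q f x <= C * schwartz_norm ks m f.

Section Bounds.
Variable X : Type.
Implicit Types q r : (W -> A) -> X -> R.

Lemma schwartz_bounded_le q r : schwartz_bounded r ->
  (forall f, S f -> forall x : X, q f x <= r f x) -> schwartz_bounded q.
Proof.
move=> [ks [m [C [C0 hC]]]] qr; exists ks, m, C; split => // f hf x.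
exact: le_trans (qr f hf x) (hC f hf x).
Qed.

Lemma schwartz_boundedD q r : schwartz_bounded q -> schwartz_bounded r ->
  schwartz_bounded (fun f x => q f x + r f x).
Proof.
move=> [ks [m [C [C0 hC]]]] [ks' [m' [C' [C'0 hC']]]].
exists (ks ++ ks'), (maxn m m'), (C + C'); rewrite addr_ge0//; split => // f hf x.
rewrite /schwartz_norm big_cat -!/(schwartz_norm _ _ _) /=.
have := hC f hf x; have := hC' f hf x.
have := ler_wpM2l C0 (schwartz_norm_mono ks (leq_maxl m m') hf).
have := ler_wpM2l C'0 (schwartz_norm_mono ks' (leq_maxr m m') hf).
have := mulr_ge0 C0 (schwartz_norm_ge0 ks' (maxn m m') hf).
have := mulr_ge0 C'0 (schwartz_norm_ge0 ks (maxn m m') hf).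
lra.
Qed.

Lemma schwartz_boundedZ (c : R) q : 0 <= c -> schwartz_bounded q ->
  schwartz_bounded (fun f x => c * q f x).
Proof.
move=> c0 [ks [m [C [C0 hC]]]]; exists ks, m, (c * C); rewrite mulr_ge0//.
by split => // f hf x; rewrite -mulrA ler_wpM2l// hC.
Qed.

Lemma schwartz_bounded_sum I (l : seq I) (q : I -> (W -> A) -> X -> R) :
  (forall i, schwartz_bounded (q i)) ->
  schwartz_bounded (fun f x => \sum_(i <- l) q i f x).
Proof.
move=> hq; elim: l => [|i l IH].
  exists [::], 0%N, 0; split => // f hf x.
  by rewrite big_nil mul0r.
apply: schwartz_bounded_le (schwartz_boundedD (hq i) IH) _ => f _ x.
by rewrite big_cons.
Qed.

End Bounds.

Lemma schwartz_bounded_base k n s :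
  schwartz_bounded (fun f x => `|x| ^+ k * P n (iter_dderive s f x)).
Proof.
exists [:: (k, s)], n, 1; split => // f hf x.
by rewrite mul1r /schwartz_norm big_seq1; exact: (le_schwartz_sup n (k, s) x hf).
Qed.

(** Continuous operators of the space of Schwartz functions. *)
Definition schwartz_operator (T : operator) : Prop :=
  (forall f, S f -> S (T f)) /\
  forall n k s, schwartz_bounded (fun f x => `|x| ^+ k * P n (iter_dderive s (T f) x)).

Lemma schwartz_bounded_comp (X : Type) (q : (W -> A) -> X -> R) T :
  schwartz_bounded q -> schwartz_operator T -> schwartz_bounded (fun f x => q (T f) x).
Proof.
move=> [ks [m [C [C0 hC]]]] [ST bT].
have [ks' [m' [C' [C'0 hC']]]] :
    schwartz_bounded (X := unit) (fun f _ => schwartz_norm ks m (T f)).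
  apply: schwartz_bounded_sum => i.
  have [ks' [m' [C' [C'0 hC']]]] := bT m i.1 i.2.
  exists ks', m', C'; split => // f hf _; apply: schwartz_sup_le => x; exact: hC'.
exists ks', m', (C * C'); rewrite mulr_ge0//; split => // f hf x.
apply: le_trans (hC _ (ST f hf) x) _; rewrite -mulrA ler_wpM2l//.
exact: hC' f hf tt.
Qed.

(** A family of operators that is stable under differentiation consists of
    Schwartz operators as soon as its members satisfy the undifferentiated
    estimates. This replaces higher product and chain rules. *)
Lemma schwartz_operator_class (K : operator -> Prop) :
  (forall T, K T -> forall f, S f -> continuous (T f)) ->
  (forall T, K T -> forall v, exists T', K T' /\
     forall f, S f -> forall x, is_dderive (T f) x v (T' f x)) ->
  (forall T, K T -> forall n k, schwartz_bounded (fun f x => `|x| ^+ k * P n (T f x))) ->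
  forall T, K T -> schwartz_operator T.
Proof.
move=> cK dK bK T KT.
have iterK s : exists T', K T' /\ forall f, S f -> iter_dderive s (T f) = T' f.
  elim: s => [|v s [T' [KT' ET']]]; first by exists T.
  have [T'' [KT'' dT'']] := dK _ KT' v; exists T''; split => // f hf.
  apply/funext => x; rewrite /= -/(iter_dderive s (T f)) ET'//.
  exact: (dderiveE (sys_hausdorff hP) (dT'' f hf x)).
have bT n k s : schwartz_bounded (fun f x => `|x| ^+ k * P n (iter_dderive s (T f) x)).
  have [T' [KT' ET']] := iterK s.
  by apply: schwartz_bounded_le (bK _ KT' n k) _ => f hf x; rewrite ET'.
split=> // f hf; split=> [s|p hp cp s k].
  have [T' [KT' ET']] := iterK s; rewrite ET'//; split; first exact: cK.
  move=> x v; have [T'' [_ dT'']] := dK _ KT' v.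
  by exists (T'' f x); exact: dT''.
have [n [C [C0 hC]]] := continuous_seminorm_bound hP hp cp.
have [ks [m [D [D0 hD]]]] := bT n k s.
exists (C * (D * schwartz_norm ks m f)) => x.
apply: (@le_trans _ _ (C * (`|x| ^+ k * P n (iter_dderive s (T f) x)))).
  by rewrite mulrCA ler_wpM2l ?exprn_ge0.
by rewrite ler_wpM2l// hD.
Qed.

Lemma schwartz_operator_iter s : schwartz_operator (iter_dderive s).
Proof.
apply: (@schwartz_operator_class (fun T => exists s, T = iter_dderive s)).
- by move=> _ [s' ->] f; exact: schwartz_continuous.
- move=> _ [s' ->] v; exists (iter_dderive (v :: s')).
  by split; [exists (v :: s')|move=> f hf x; exact: schwartz_dderive].
- by move=> _ [s' ->] n k; exact: schwartz_bounded_base.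
- by exists s.
Qed.

Lemma schwartz_operator_id : schwartz_operator id.
Proof. exact: (schwartz_operator_iter [::]). Qed.

Lemma schwartz_operator_comp T U : schwartz_operator T -> schwartz_operator U ->
  schwartz_operator (fun f => T (U f)).
Proof.
move=> [ST bT] hU; split=> [f hf|n k s]; first by apply: ST; exact: hU.1.
exact: (schwartz_bounded_comp (bT n k s) hU).
Qed.

Lemma schwartz_operator_dderive T v : schwartz_operator T ->
  schwartz_operator (fun f => iter_dderive [:: v] (T f)).
Proof. exact: (schwartz_operator_comp (schwartz_operator_iter [:: v])). Qed.

Lemma schwartz_operator_bound T n k : schwartz_operator T ->
  schwartz_bounded (fun f x => `|x| ^+ k * P n (T f x)).
Proof. by move=> [_ /(_ n k [::])]. Qed.

Lemma schwartz_operator_continuous T f : schwartz_operator T -> S f -> continuous (T f).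
Proof. by move=> [ST _] hf; exact: (schwartz_continuous (s := [::]) (ST f hf)). Qed.

Lemma schwartz_operator_is_dderive T f (x v : W) : schwartz_operator T -> S f ->
  is_dderive (T f) x v (iter_dderive [:: v] (T f) x).
Proof. by move=> [ST _] hf; exact: (schwartz_dderive (s := [::]) (ST f hf)). Qed.

Lemma schwartz_operatorD T U : schwartz_operator T -> schwartz_operator U ->
  schwartz_operator (fun f x => T f x + U f x).
Proof.
move=> hT hU.
apply: (@schwartz_operator_class (fun T' => exists T U, [/\ schwartz_operator T,
  schwartz_operator U & T' = fun f x => T f x + U f x])) => [|||]; last by exists T, U.
- move=> _ [T1 [U1 [hT1 hU1 ->]]] f hf x.
  apply: tvs_cvgD; first exact: (schwartz_operator_continuous hT1 hf).
  exact: (schwartz_operator_continuous hU1 hf).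
- move=> _ [T1 [U1 [hT1 hU1 ->]]] v; eexists; split.
    exists (fun f => iter_dderive [:: v] (T1 f)), (fun f => iter_dderive [:: v] (U1 f)).
    by split; [exact: schwartz_operator_dderive|exact: schwartz_operator_dderive|].
  by move=> f hf x; apply: is_dderiveD; exact: schwartz_operator_is_dderive.
- move=> _ [T1 [U1 [hT1 hU1 ->]]] n k.
  apply: schwartz_bounded_le (schwartz_boundedD (schwartz_operator_bound n k hT1)
    (schwartz_operator_bound n k hU1)) _ => f _ x.
  by rewrite -mulrDr ler_wpM2l ?exprn_ge0// sysD.
Qed.

(** Smooth scalar functions all of whose derivatives grow polynomially. The
    witness O is any family that contains m and is stable under
    differentiation, which avoids iterated derivatives. *)
Definition multiplier (m : W -> R[i]^o) : Prop :=
  exists O : (W -> R[i]^o) -> Prop, O m /\ forall q, O q ->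
    [/\ continuous q,
        exists k C, 0 <= C /\ forall x, normc (q x) <= C * (1 + `|x|) ^+ k &
        forall v, exists r, O r /\ forall x, is_dderive q x v (r x)].

Lemma multiplier_dderive m v : multiplier m ->
  exists r, multiplier r /\ forall x, is_dderive m x v (r x).
Proof.
move=> [Q [mQ hQ]]; have [_ _ /(_ v)[r [Or dr]]] := hQ m mQ.
by exists r; split=> //; exists Q.
Qed.

Lemma exp_norm_split k (x : W) : (1 + `|x|) ^+ k <= 2 ^+ k * (1 + `|x| ^+ k).
Proof.
have x0 := normr_ge0 x; have [x1|x1] := lerP `|x| 1.
  apply: (@le_trans _ _ (2 ^+ k)).
    by rewrite lerXn2r ?nnegrE ?addr_ge0//; lra.
  by rewrite ler_peMr ?exprn_ge0// lerDl exprn_ge0.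
apply: (@le_trans _ _ ((2 * `|x|) ^+ k)).
  by rewrite lerXn2r ?nnegrE ?addr_ge0 ?mulr_ge0//; lra.
by rewrite exprMn ler_wpM2l ?exprn_ge0// lerDr.
Qed.

Lemma schwartz_bounded_poly T n k : schwartz_operator T ->
  schwartz_bounded (fun f x => (1 + `|x|) ^+ k * P n (T f x)).
Proof.
move=> hT; have h := schwartz_boundedD (schwartz_operator_bound n 0 hT)
  (schwartz_operator_bound n k hT).
apply: schwartz_bounded_le (schwartz_boundedZ (exprn_ge0 k (ler0n R 2)) h) _ => f _ x.
rewrite -mulrDl mulrA expr0 ler_wpM2r ?sys_ge0//.
exact: exp_norm_split.
Qed.

(** Leibniz's rule leaves the set of operators f -> m T(f), but not the set of
    their sums. *)
Inductive multiplier_operator : operator -> Prop :=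
| multiplier_mul m T : multiplier m -> schwartz_operator T ->
    multiplier_operator (fun f x => (m x : R[i]) *: T f x)
| multiplier_add T U : multiplier_operator T -> multiplier_operator U ->
    multiplier_operator (fun f x => T f x + U f x).

Lemma schwartz_operator_multiplier m T : multiplier m -> schwartz_operator T ->
  schwartz_operator (fun f x => (m x : R[i]) *: T f x).
Proof.
move=> hm hT; apply: (@schwartz_operator_class multiplier_operator) => [|||]; last first.
- exact: multiplier_mul.
- move=> U; elim=> {hm hT m T U} [m T [Q [mQ hQ]] hT n k|T U _ IHT _ IHU n k].
    have [_ [j [C [C0 hC]]] _] := hQ m mQ.
    have h := schwartz_boundedZ C0 (schwartz_bounded_poly n (j + k) hT).
    apply: schwartz_bounded_le h _ => f _ x; rewrite (sysZ hP) exprD !mulrA.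
    rewrite ler_wpM2r ?sys_ge0// mulrC; apply: ler_pM (hC x) _.
    + exact: normc_ge0.
    + exact: exprn_ge0.
    + by rewrite lerXn2r ?nnegrE ?addr_ge0// lerDr.
  apply: schwartz_bounded_le (schwartz_boundedD (IHT n k) (IHU n k)) _ => f _ x.
  by rewrite -mulrDr ler_wpM2l ?exprn_ge0// sysD.
- move=> U; elim=> {hm hT m T U} [m T hm hT v|T U _ IHT _ IHU v].
    have [r [hr dr]] := multiplier_dderive v hm.
    eexists; split; last first.
      move=> f hf x; apply: is_dderiveZ (dr x) _.
      exact: (schwartz_operator_is_dderive hT hf).
    apply: (multiplier_add (T := fun f x => r x *: T f x)
      (U := fun f x => m x *: iter_dderive [:: v] (T f) x)).
      exact: multiplier_mul.
    by apply: multiplier_mul => //; exact: schwartz_operator_dderive.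
  have [T' [hT' dT']] := IHT v; have [U' [hU' dU']] := IHU v.
  exists (fun f x => T' f x + U' f x); split; first exact: multiplier_add.
  by move=> f hf x; apply: is_dderiveD; [exact: dT'|exact: dU'].
- move=> U; elim=> {hm hT m T U} [m T [Q [mQ hQ]] hT f hf x|T U _ IHT _ IHU f hf x].
    have [cm _ _] := hQ m mQ.
    by apply: tvs_cvgZ; [exact: cm|exact: (schwartz_operator_continuous hT hf)].
  exact: tvs_cvgD (IHT f hf x) (IHU f hf x).
Qed.

End SchwartzSpace.

(** * Characters and resolvents *)

Section Symbols.
Context {R : realType} {V : normedModType R}.
Context {dotp : {dot V for @idfun R}} {d : nat} {e : 'I_d -> V}.
Variable hE : euclidean_space dotp e.
Implicit Types (x y v : V) (i : 'I_d).
Local Notation chi := (character dotp).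

Lemma characterC x y : chi x y = chi y x.
Proof. by rewrite /character dotC. Qed.

Lemma characterD x y z : chi (x + y) z = chi x z * chi y z.
Proof.
rewrite /character dotDl mulrDr cosD sinD.
by apply/eqP; rewrite eq_complex /= eqxx /= addrC mulrC (mulrC (sin _)) eqxx.
Qed.

Lemma characterDr x y z : chi x (y + z) = chi x y * chi x z.
Proof. by rewrite characterC characterD !(characterC _ x). Qed.

Lemma character0 y : chi 0 y = 1.
Proof. by rewrite /character dot0l mulr0 cos0 sin0. Qed.

Lemma characterNr x y : chi x (- y) = chi (- x) y.
Proof. by rewrite /character dotNr dotNl. Qed.

Lemma normc_character x y : normc (chi x y) = 1.
Proof. by rewrite /= cos2Dsin2 sqrtr1. Qed.

Lemma character_continuous : continuous (fun z : V * V => chi z.1 z.2 : R[i]^o).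
Proof.
move=> z; have h : (fun z : V * V => 2 * pi * dotp z.1 z.2) @ z --> 2 * pi * dotp z.1 z.2.
  by apply: cvgM; [exact: cvg_cst|exact: (dot_continuous hE)].
apply: cvg_complex.
  exact: (continuous_cvg _ (@continuous_cos _ _) h).
exact: (continuous_cvg _ (@continuous_sin _ _) h).
Qed.

Lemma characterl_continuous y : continuous (fun x => chi x y : R[i]^o).
Proof.
move=> x; apply: (@continuous_comp _ _ _ (fun x => (x, y)) (fun z : V * V => chi z.1 z.2 : R[i]^o)).
  by apply: cvg_pair; [exact: cvg_id|exact: cvg_cst].
exact: character_continuous.
Qed.

Lemma is_derive_quotient (f : R -> R) (a l : R) : is_derive a (1 : R) f l ->
  (fun h => h^-1 * (f (a + h) - f a)) @ 0^' --> l.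
Proof.
move=> fl; have := @ex_derive _ _ _ _ _ _ _ fl; rewrite /derivable => cf.
rewrite -(@derive_val _ _ _ _ _ _ _ fl); apply: eq_cvg_fun cf => h /=.
by rewrite [h%:A]mulr1 [a + h]addrC.
Qed.

Lemma is_dderive_circle (t c : R) :
  is_dderive (fun t : R => cos t +i* sin t : R[i]^o) t c (c%:C * 'i * (cos t +i* sin t)).
Proof.
have -> : c = c *: (1 : R) by rewrite /GRing.scale /= mulr1.
rewrite -mulrA [X in X%:C]mulr1; apply: is_dderive_scale.
have -> : 'i * (cos t +i* sin t) = (- sin t) +i* cos t.
  by apply/eqP; rewrite eq_complex /= !mul0r !mul1r ?add0r ?sub0r !eqxx.
apply: (eq_cvg_fun (f := fun h => (h^-1 * (cos (t + h) - cos t)) +i*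
   (h^-1 * (sin (t + h) - sin t)) : R[i]^o)) => [h|].
  rewrite [h *: 1]mulr1; apply/eqP; rewrite eq_complex /=.
  by rewrite !mul0r subr0 addr0 !eqxx.
apply: cvg_complex; first by apply: is_derive_quotient; exact: is_derive_cos.
by apply: is_derive_quotient; exact: is_derive_sin.
Qed.

Lemma is_dderive_character y x v :
  is_dderive (fun x => chi x y : R[i]^o) x v ((2 * pi * dotp v y)%:C * 'i * chi x y).
Proof.
have := is_dderive_circle (t := 2 * pi * dotp x y) (c := 2 * pi * dotp v y).
have -> : 2 * pi * dotp v y = 2 * pi * dotp (x + v) y - 2 * pi * dotp x y.
  by rewrite dotDl; ring.
apply: (is_dderive_comp_linear (W' := V) (L := fun x => 2 * pi * dotp x y : R^o)) => h.
rewrite !dotDl dotZl /GRing.scale /=; ring.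
Qed.

Definition dotC_fun v x : R[i]^o := (dotp v x)%:C.

Lemma dotC_fun_continuous v : continuous (dotC_fun v).
Proof.
move=> x; apply: cvg_real_complex.
rewrite (_ : dotp v = (fun x => dotp x v)); first exact: (dotl_continuous hE).
by apply/funext => y; rewrite dotC.
Qed.

Lemma is_dderive_dotC_fun u x v : is_dderive (dotC_fun u) x v (dotC_fun u v).
Proof.
apply: cvg_trans (punctured_cst (R := R) (dotC_fun u v)).
apply: near_eq_cvg; near=> h; rewrite /dotC_fun -rmorphB dotDr dotZr addrC addKr.
have h0 : h != 0 by near: h; exact: nbhs_dnbhs_neq.
transitivity ((h^-1 * (h * dotp u v))%:C : R[i]^o); first by rewrite mulKf.
by rewrite rmorphM.
Unshelve. all: by end_near. Qed.

(** The resolvent (1 + i x_j)^-1 of a partial derivative, seen on the Fourier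
    side. *)
Definition resolvent (j : 'I_d) x : R[i]^o := (1 +i* dotp x (e j))^-1.

Let denom_neq0 (t : R) : 1 +i* t != 0 :> R[i].
Proof. by rewrite eq_complex /= oner_eq0. Qed.

Lemma resolventK j x : (1 +i* dotp x (e j)) * resolvent j x = 1.
Proof. by rewrite divff. Qed.

Lemma normc_resolvent2 j x : normc (resolvent j x) ^+ 2 = (1 + dotp x (e j) ^+ 2)^-1.
Proof.
apply: (@mulfI _ (1 + dotp x (e j) ^+ 2)); first by rewrite gt_eqF// ltr_pwDl// sqr_ge0.
rewrite divff; last by rewrite gt_eqF// ltr_pwDl// sqr_ge0.
have -> : 1 + dotp x (e j) ^+ 2 = normc (1 +i* dotp x (e j)) ^+ 2.
  by rewrite normc_sq /= expr1n.
by rewrite -exprMn -Normc.normcM resolventK Normc.normc1 expr1n.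
Qed.

Lemma normc_resolvent_le1 j x : normc (resolvent j x) <= 1.
Proof.
rewrite -(@ler_pXn2r _ 2)// ?nnegrE ?normc_ge0// normc_resolvent2 expr1n.
by rewrite invf_le1 ?lerDl ?sqr_ge0// ltr_pwDl// sqr_ge0.
Qed.

Lemma resolventB j x y : resolvent j x - resolvent j y =
  - ('i * (dotp (x - y) (e j))%:C) * (resolvent j x * resolvent j y).
Proof.
rewrite /resolvent; move: (denom_neq0 (dotp x (e j))) (denom_neq0 (dotp y (e j))).
have E t : 1 +i* t = 1 + 'i * t%:C :> R[i].
  by apply/eqP; rewrite eq_complex /= !mul0r !mul1r ?subr0 ?addr0 ?add0r !eqxx.
have EB (a b : R) : (a - b)%:C = a%:C - b%:C :> R[i] by exact: rmorphB.
rewrite dotBl EB !E.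
move: (dotp x (e j))%:C (dotp y (e j))%:C => a b ha hb; field.
by rewrite ha hb.
Qed.

Lemma resolvent_continuous j : continuous (resolvent j).
Proof.
move=> x; apply/(sys_cvgP (@scalar_system R)) => n eps e0.
have /cvgrPdist_lt/(_ eps e0) := dotl_continuous hE (y := e j) (x := x).
apply: filterS => y; rewrite distrC; apply: le_lt_trans.
rewrite /scalar_seminorm resolventB mulNr normcN !Normc.normcM normc_i mul1r normc_real.
rewrite dotBl ler_piMr// mulr_ile1 ?normc_ge0//; exact: normc_resolvent_le1.
Qed.

Lemma is_dderive_resolvent j x v :
  is_dderive (resolvent j) x v (- ('i * (dotp v (e j))%:C) * (resolvent j x * resolvent j x)).
Proof.
have cl : (fun h : R => resolvent j (x + h *: v)) @ 0^' --> resolvent j x.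
  have cx : (fun h : R => x + h *: v) @ 0^' --> x.
    rewrite -[X in _ --> X]addr0 -(scale0r v); apply: cvgD; first exact: cvg_cst.
    by apply: cvgZr_tmp; exact: cvg_within.
  exact: cvg_comp cx (resolvent_continuous (j := j) (x := x)).
have h1 := tvs_cvgZ (FF := punctured_filter R) cl (punctured_cst (R := R) (resolvent j x)).
have h2 := tvs_cvgZ (FF := punctured_filter R)
  (punctured_cst (R := R) (- ('i * (dotp v (e j))%:C) : R[i]^o)) h1.
apply: cvg_trans h2; apply: near_eq_cvg; near=> h.
have h0 : h != 0 by near: h; exact: nbhs_dnbhs_neq.
have e1 : x + h *: v - x = h *: v by rewrite addrC addKr.
have e2 : (h * dotp v (e j))%:C = h%:C * (dotp v (e j))%:C :> R[i] by exact: rmorphM.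
have e3 : (h^-1)%:C = h%:C^-1 :> R[i] by exact: fmorphV.
rewrite resolventB e1 dotZl e2 e3 /GRing.scale /=; have : h%:C != 0 :> R[i] by rewrite fmorph_eq0.
move: (resolvent j (x + h *: v) : R[i]) (resolvent j x : R[i]) (h%:C : R[i]) => p q k k0.
by field.
Unshelve. all: by end_near. Qed.

(** Scalar functions generated by constants, characters, resolvents and, when
    the flag is set, coordinates. Those without coordinates are bounded. The
    class is stable under differentiation because the derivative of a
    resolvent is a polynomial in it. *)
Inductive symbol : bool -> (V -> R[i]^o) -> Prop :=
| symbol_cst b (c : R[i]) : symbol b (fun=> c)
| symbol_character b y : symbol b (fun x => chi x y)
| symbol_resolvent b j : symbol b (resolvent j)
| symbol_dot v : symbol true (dotC_fun v)
| symbolD b m m' : symbol b m -> symbol b m' -> symbol b (fun x => m x + m' x)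
| symbolM b m m' : symbol b m -> symbol b m' -> symbol b (fun x => (m x : R[i]) * m' x).

Lemma symbol_continuous b m : symbol b m -> continuous m.
Proof.
elim=> {b m} [b c|b y|b j|v|b m m' _ cm _ cm'|b m m' _ cm _ cm'] x.
- exact: cvg_cst.
- exact: characterl_continuous.
- exact: resolvent_continuous.
- exact: dotC_fun_continuous.
- exact: tvs_cvgD (cm x) (cm' x).
- exact: tvs_cvgZ (cm x) (cm' x).
Qed.

Lemma symbol_dderive b m v : symbol b m ->
  exists m', symbol b m' /\ forall x, is_dderive m x v (m' x).
Proof.
elim=> {b m} [b c|b y|b j|u|b m n _ [m' [sm' dm']] _ [n' [sn' dn']]
  |b m n sm [m' [sm' dm']] sn [n' [sn' dn']]].
- by exists (fun=> 0); split; [exact: symbol_cst|move=> x; exact: is_dderive_cst].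
- eexists; split; last by move=> x; exact: is_dderive_character.
  by apply: symbolM; [exact: symbol_cst|exact: symbol_character].
- eexists; split; last by move=> x; exact: is_dderive_resolvent.
  apply: symbolM; first exact: symbol_cst.
  by apply: symbolM; exact: symbol_resolvent.
- eexists; split; last by move=> x; exact: is_dderive_dotC_fun.
  exact: symbol_cst.
- eexists; split; last by move=> x; apply: is_dderiveD; [exact: dm'|exact: dn'].
  exact: symbolD.
- eexists; split; last by move=> x; apply: (is_dderiveZ (dm' x) (dn' x)).
  by apply: (symbolD (m := fun x => m' x * n x) (m' := fun x => m x * n' x)); exact: symbolM.
Qed.

Lemma symbol_bounded m : symbol false m -> exists C, 0 <= C /\ forall x, normc (m x) <= C.
Proof.
move Eb : false => b sm; elim: sm Eb => {b m} [b c|b y|b j|v|b m m' _ IH _ IH'|b m m' _ IH _ IH'] // Eb.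
- by exists (normc c); rewrite normc_ge0.
- by exists 1; split => // x; rewrite normc_character.
- by exists 1; split => // x; exact: normc_resolvent_le1.
- have [C [C0 hC]] := IH Eb; have [D [D0 hD]] := IH' Eb; exists (C + D).
  by split=> [|x]; [exact: addr_ge0|apply: le_trans (normcD _ _) _; exact: lerD].
- have [C [C0 hC]] := IH Eb; have [D [D0 hD]] := IH' Eb; exists (C * D).
  split=> [|x]; first exact: mulr_ge0.
  by rewrite Normc.normcM ler_pM ?normc_ge0.
Qed.

Lemma symbol_poly b m : symbol b m ->
  exists k C, 0 <= C /\ forall x, normc (m x) <= C * (1 + `|x|) ^+ k.
Proof.
have ge1 k x : 1 <= (1 + `|x|) ^+ k by rewrite exprn_ege1// lerDl.
elim=> {b m} [b c|b y|b j|v|b m m' _ [k [C [C0 hC]]] _ [l [D [D0 hD]]]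
  |b m m' _ [k [C [C0 hC]]] _ [l [D [D0 hD]]]].
- by exists 0%N, (normc c); rewrite normc_ge0; split=> // x; rewrite expr0 mulr1.
- by exists 0%N, 1; split=> // x; rewrite expr0 mulr1 normc_character.
- by exists 0%N, 1; split=> // x; rewrite expr0 mulr1; exact: normc_resolvent_le1.
- exists 1%N, (d%:R * `|v|); split=> [|x]; first by rewrite mulr_ge0.
  rewrite /dotC_fun normc_real; apply: le_trans (dot_bound hE _ _) _.
  by rewrite mulrA ler_wpM2l ?mulr_ge0// expr1 lerDr.
- exists (k + l)%N, (C + D); split=> [|x]; first exact: addr_ge0.
  apply: le_trans (normcD _ _) _; rewrite mulrDl exprD; apply: lerD.
    by apply: le_trans (hC x) _; rewrite ler_wpM2l// ler_peMr ?(le_trans ler01).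
  by apply: le_trans (hD x) _; rewrite ler_wpM2l// ler_peMl ?(le_trans ler01).
- exists (k + l)%N, (C * D); split=> [|x]; first exact: mulr_ge0.
  by rewrite Normc.normcM exprD mulrACA ler_pM ?normc_ge0.
Qed.

Lemma symbol_multiplier b m : symbol b m -> multiplier m.
Proof.
move=> sm; exists (symbol b); split=> // q sq; split.
- exact: symbol_continuous sq.
- exact: symbol_poly sq.
- by move=> v; exact: symbol_dderive sq.
Qed.

End Symbols.

(** * The Fourier transform of Schwartz functions *)

Section Fourier.
Context {R : realType} {V : normedModType R}.
Context {dotp : {dot V for @idfun R}} {d : nat} {e : 'I_d -> V}.
Variable hE : euclidean_space dotp e.
Context {A : tvsType R[i]}.
Variables (P : nat -> A -> R) (hP : seminorm_system P) (cP : complete_system P).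
Local Notation chi := (character dotp).
Local Notation w := (weight dotp e).
Local Notation wdominated := (wdominated (dotp := dotp) (e := e) P).
Local Notation S := (@schwartz R V A).
Local Notation schwartz_operator := (schwartz_operator P).
Local Notation schwartz_bounded := (schwartz_bounded P).
Implicit Types (f g : V -> A) (s : R).

Lemma schwartz_bounded_weight T n k : schwartz_operator T ->
  schwartz_bounded (fun f x => (w x) ^- k * P n (T f x)).
Proof.
move=> hT; apply: schwartz_bounded_le (schwartz_bounded_poly hP n (2 * d * k) hT) _ => // f _ x.
rewrite ler_wpM2r ?sys_ge0// -exprVn exprM lerXn2r ?nnegrE ?invr_ge0 ?exprn_ge0//.
- by rewrite ltW// weight_gt0.
- exact: weight_inv_le.
Qed.

Lemma schwartz_bounded_fixed (X : Type) (q : (V -> A) -> X -> R) f :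
  schwartz_bounded q -> S f -> exists C, 0 <= C /\ forall x, q f x <= C.
Proof.
move=> [ks [m [C [C0 hC]]]] hf; exists (C * schwartz_norm P ks m f).
by rewrite mulr_ge0 ?schwartz_norm_ge0//; split => // x; exact: hC.
Qed.

Lemma schwartz_weight f n k : S f ->
  exists C, 0 <= C /\ forall x, P n (f x) <= C * w x ^+ k.
Proof.
move=> hf; have [C [C0 hC]] :=
  schwartz_bounded_fixed (schwartz_bounded_weight n k (schwartz_operator_id hP)) hf.
exists C; split=> // x; have := hC x.
by rewrite mulrC ler_pdivrMr// exprn_gt0// weight_gt0.
Qed.

Lemma schwartz_wdominated f : S f -> wdominated f.
Proof.
move=> hf; split; first exact: (schwartz_continuous (s := [::]) hf).
by move=> n; have [C [C0 hC]] := schwartz_weight n 1 hf; exists C.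
Qed.

Lemma wdominated_scale (m : V -> R[i]^o) f (C : R) : continuous m ->
  (forall x, normc (m x) <= C) -> wdominated f ->
  wdominated (fun x => (m x : R[i]) *: f x).
Proof.
move=> cm bm [cf bf]; split=> [x|n]; first exact: tvs_cvgZ (cm x) (cf x).
have C0 : 0 <= C := le_trans (normc_ge0 _) (bm 0).
have [D [D0 hD]] := bf n; exists (C * D); rewrite mulr_ge0//; split => // x.
by rewrite (sysZ hP) -mulrA ler_pM ?normc_ge0 ?sys_ge0.
Qed.

Lemma intV_schwartz_bounded (X : Type) (q : (V -> A) -> X -> R) (F : (V -> A) -> X -> V -> A) n :
  schwartz_bounded q -> (forall f x, S f -> wdominated (F f x)) ->
  (forall f x y, S f -> P n (F f x y) <= q f x * w y) ->
  schwartz_bounded (fun f x => P n (intV e (F f x))).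
Proof.
move=> bq dF bF; have := schwartz_boundedZ (weight_mass_ge0 (dotp := dotp) (e := e)) bq.
move=> h; apply: schwartz_bounded_le h _ => // f hf x.
by rewrite mulrC; apply: (intV_bound hE hP cP (dF f x hf)) => y; exact: bF.
Qed.

Definition ft s f x : A := intV e (fun y => chi (s *: x) y *: f y).

Lemma fourierE f : fourier dotp e f = ft (-1) f.
Proof. by apply/funext => x; rewrite /fourier /ft scaleN1r. Qed.

Lemma characterZ s x y : chi (s *: x) y = chi x (s *: y).
Proof. by rewrite /character dotZl dotZr. Qed.

Lemma characterr_continuous x : continuous (fun y => chi x y : R[i]^o).
Proof.
move=> y; apply: (@continuous_comp _ _ _ (fun y => (x, y)) (fun z : V * V => chi z.1 z.2 : R[i]^o)).
  by apply: cvg_pair; [exact: cvg_cst|exact: cvg_id].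
exact: (character_continuous hE).
Qed.

Lemma wdominated_ft s x f : wdominated f -> wdominated (fun y => chi (s *: x) y *: f y).
Proof.
apply: (wdominated_scale (m := chi (s *: x)) (C := 1)); first exact: characterr_continuous.
by move=> y; rewrite normc_character.
Qed.

Lemma ft_continuous s f : wdominated f -> continuous (ft s f).
Proof.
move=> domf; apply: (intV_continuous hE hP cP) => [x|y|n].
- exact: (wdominated_ft s x domf).1.
- move=> x; apply: tvs_cvgZ; last exact: cvg_cst.
  under [X in X @ _ --> _]eq_fun do rewrite characterZ; rewrite characterZ.
  exact: (characterl_continuous hE).
- have [C [C0 hC]] := domf.2 n; exists C; split=> // x y.
  by rewrite (sysZ hP) normc_character mul1r.
Qed.

Lemma multiplier_coordinate s v :
  multiplier (fun y => (2 * pi * dotp v (s *: y))%:C * 'i : R[i]^o).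
Proof.
apply: (symbol_multiplier hE (b := true)).
rewrite (_ : (fun y => _) = (fun y => (((2 * pi * s)%:C * 'i : R[i]) * (dotC_fun (dotp := dotp) v y) : R[i]))).
  by apply: symbolM; [exact: symbol_cst|exact: symbol_dot].
apply/funext => y; rewrite /dotC_fun dotZr [RHS]mulrAC; congr (_ * _).
have E (a b : R) : (a * b)%:C = a%:C * b%:C :> R[i] by exact: rmorphM.
by rewrite -E; congr (_%:C); ring.
Qed.

(** The integrand of the derivative is dominated because f times a coordinate
    is again Schwartz. *)
Lemma is_dderive_ft s f x v : S f ->
  is_dderive (ft s f) x v (ft s (fun y => ((2 * pi * dotp v (s *: y))%:C * 'i) *: f y) x).
Proof.
move=> hf; have domf := schwartz_wdominated hf.
have hm := multiplier_coordinate s v.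
have hg : S (fun y => ((2 * pi * dotp v (s *: y))%:C * 'i) *: f y).
  exact: (schwartz_operator_multiplier hP hm (schwartz_operator_id hP)).1.
have domg := schwartz_wdominated hg.
apply: (intV_dderive hE hP cP (F := fun x y => chi (s *: x) y *: f y)
  (F1 := fun x y => chi (s *: x) y *: (((2 * pi * dotp v (s *: y))%:C * 'i) *: f y))).
- by move=> z; exact: wdominated_ft.
- by move=> z; exact: (wdominated_ft s z domg).1.
- move=> z y.
  have hc : is_dderive (fun _ : V => f y) z v 0 by exact: is_dderive_cst.
  have := is_dderiveZ (is_dderive_character (dotp := dotp) (y := s *: y) (x := z) (v := v)) hc.
  rewrite scaler0 addr0 scalerA mulrC -characterZ.
  by apply: eq_is_dderive => t; rewrite characterZ.
- move=> n; have [C [C0 hC]] := domg.2 n; exists C; split=> // z y.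
  by rewrite (sysZ hP) normc_character mul1r.
Qed.

(** Integration by parts against the character. *)
Lemma ft_dderive s f x v : S f ->
  ft s (iter_dderive [:: v] f) x = - (((2 * pi * dotp v (s *: x))%:C * 'i) *: ft s f x).
Proof.
move=> hf; have domf := wdominated_ft s x (schwartz_wdominated hf).
have hf' := (schwartz_operator_iter hP [:: v]).1 f hf.
have domf' := wdominated_ft s x (schwartz_wdominated hf').
set k := (2 * pi * dotp v (s *: x))%:C * 'i.
have domk : wdominated (fun y => k *: (chi (s *: x) y *: f y)).
  exact: (wdominatedZ hP k domf).
apply/eqP; rewrite -addr_eq0 addrC -(intVZ hE hP cP)// -(intVD hE hP cP)//; apply/eqP.
apply: (intV_derivative0 hE hP cP (h := fun y => chi (s *: x) y *: f y) (v := v)) => //.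
  exact: wdominatedD.
move=> y.
have := is_dderiveZ (is_dderive_character (dotp := dotp) (y := s *: x) (x := y) (v := v))
   (schwartz_dderive hP (s := [::]) (x := y) (v := v) hf).
rewrite -/k -scalerA [chi y _]characterC.
by apply: eq_is_dderive => t; rewrite characterC.
Qed.

(** Every factor of norm x is traded for a derivative of the function. *)
Lemma schwartz_bounded_ft s T n k : `|s| = 1 -> schwartz_operator T ->
  schwartz_bounded (fun f x => `|x| ^+ k * P n (ft s (T f) x)).
Proof.
move=> s1; elim: k T => [|k IH] T hT.
  have h : schwartz_bounded (fun f x => P n (ft s (T f) x)).
    have [ks [m [C [C0 hC]]]] := schwartz_bounded_weight n 1 hT.
    apply: (intV_schwartz_bounded (q := fun f (x : V) => C * schwartz_norm P ks m f)).
    - by exists ks, m, C.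
    - by move=> f x hf; apply: wdominated_ft; exact: schwartz_wdominated (hT.1 f hf).
    - move=> f x y hf; rewrite (sysZ hP) normc_character mul1r.
      by have := hC f hf y; rewrite expr1 mulrC ler_pdivrMr// weight_gt0.
  by apply: schwartz_bounded_le h _ => // f _ x; rewrite expr0 mul1r.
have h := schwartz_bounded_sum hP (index_enum 'I_d) (fun i =>
  IH _ (schwartz_operator_dderive hP (e i) hT)).
have p0 : 0 < 2 * pi :> R by rewrite mulr_gt0 ?pi_gt0.
have p1 : 0 <= (2 * pi)^-1 :> R by rewrite invr_ge0 ltW.
apply: schwartz_bounded_le (schwartz_boundedZ p1 h) _ => // f hf x.
rewrite ler_pdivlMl// exprSr -mulrA mulrCA -mulr_sumr.
apply: ler_wpM2l; first exact: exprn_ge0.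
apply: (@le_trans _ _ (\sum_(i < d) (2 * pi * `|dotp x (e i)|) * P n (ft s (T f) x))).
  rewrite -mulr_suml mulrA -mulr_sumr; apply: ler_wpM2r; first exact: sys_ge0.
  by apply: ler_wpM2l; [exact: ltW|exact: (norm_le_coord hE)].
apply: ler_sum => i _; rewrite (ft_dderive s x (e i) (hT.1 f hf)) (sysN hP) (sysZ hP).
rewrite Normc.normcM normc_i mulr1 normc_real dotZr !normrM s1 mul1r (dotC (e i)).
by rewrite (gtr0_norm (pi_gt0 R)) normr_nat.
Qed.

Lemma schwartz_operator_ft s T : `|s| = 1 -> schwartz_operator T ->
  schwartz_operator (fun f => ft s (T f)).
Proof.
move=> s1 hT.
apply: (@schwartz_operator_class _ _ _ _ hP
  (fun T' => exists T, schwartz_operator T /\ T' = fun f => ft s (T f))); last by exists T.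
- move=> _ [U [hU ->]] f hf; apply: ft_continuous; exact: schwartz_wdominated (hU.1 f hf).
- move=> _ [U [hU ->]] v; eexists; split; last first.
    by move=> f hf x; exact: (is_dderive_ft (x := x) (v := v) (hU.1 f hf)).
  eexists; split; last by reflexivity.
  exact: (schwartz_operator_multiplier hP (multiplier_coordinate s v)).
- by move=> _ [U [hU ->]] n k; exact: schwartz_bounded_ft.
Qed.

End Fourier.

Arguments ft {R V} dotp {d} e {A} s f x.

(** * An approximate identity and its Fourier transform *)

Section Kernel.
Context {R : realType}.
Local Notation leb := (@lebesgue_measure R).
Local Notation RR := (measurableTypeR R).

Lemma ge0_integral_sub disp (T : measurableType disp)
    (mu : {measure set T -> \bar R}) (f g h : T -> R) (a b : R) :
  measurable_fun setT g -> measurable_fun setT h ->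
  (forall t, 0 <= g t) -> (forall t, 0 <= h t) -> (forall t, f t = h t + g t) ->
  (\int[mu]_t (f t)%:E = a%:E)%E -> (\int[mu]_t (g t)%:E = b%:E)%E ->
  (\int[mu]_t (h t)%:E = (a - b)%:E)%E.
Proof.
move=> mg mh g0 h0 E fa gb.
have : (\int[mu]_t (f t)%:E = \int[mu]_t (h t)%:E + \int[mu]_t (g t)%:E)%E.
  rewrite -ge0_integralD//; last 4 first.
  - by move=> t _; rewrite lee_fin.
  - exact/measurable_EFinP.
  - by move=> t _; rewrite lee_fin.
  - exact/measurable_EFinP.
  by apply: eq_integral => t _; rewrite E EFinD.
rewrite fa gb => /(congr1 (fun x => x - b%:E)%E); rewrite addeK// => <-.
Qed.

Lemma ge0_integral_scale disp (T : measurableType disp)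
    (mu : {measure set T -> \bar R}) (f : T -> R) (r a : R) :
  measurable_fun setT f -> (forall t, 0 <= f t) -> 0 <= r ->
  (\int[mu]_t (f t)%:E = a%:E)%E -> (\int[mu]_t (r * f t)%:E = (r * a)%:E)%E.
Proof.
move=> mf f0 r0 fa; under eq_integral do rewrite EFinM.
rewrite ge0_integralZl_EFin//; first by rewrite fa.
  by move=> t _; rewrite lee_fin.
exact/measurable_EFinP.
Qed.

Lemma ge0_integral_comb disp (T : measurableType disp)
    (mu : {measure set T -> \bar R}) (f g : T -> R) (r s a b : R) :
  measurable_fun setT f -> measurable_fun setT g ->
  (forall t, 0 <= f t) -> (forall t, 0 <= g t) -> 0 <= r -> 0 <= s ->
  (\int[mu]_t (f t)%:E = a%:E)%E -> (\int[mu]_t (g t)%:E = b%:E)%E ->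
  (\int[mu]_t (r * f t + s * g t)%:E = (r * a + s * b)%:E)%E.
Proof.
move=> mf mg f0 g0 r0 s0 fa gb.
under eq_integral do rewrite EFinD.
rewrite ge0_integralD//; last 4 first.
- by move=> t _; rewrite lee_fin mulr_ge0.
- by apply/measurable_EFinP; exact: measurable_funM.
- by move=> t _; rewrite lee_fin mulr_ge0.
- by apply/measurable_EFinP; exact: measurable_funM.
by rewrite (ge0_integral_scale mf f0 r0 fa) (ge0_integral_scale mg g0 s0 gb).
Qed.

Let cos1_ge0 (x : R) : 0 <= 1 + cos x.
Proof. by have := cos_geN1 x; lra. Qed.

Lemma continuous_expRN (c : R) : continuous (fun y : R => expR (- (c * `|y|))).
Proof.
move=> y; apply: continuous_comp; last exact: continuous_expR.
apply: cvgN; apply: cvgM; [exact: cvg_cst|exact: norm_continuous].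
Qed.

Lemma continuous_1cos (th b : R) : continuous (fun y : R => 1 + cos (th + b * y)).
Proof.
move=> y; apply: cvgD; first exact: cvg_cst.
apply: continuous_comp; last exact: continuous_cos.
by apply: cvgD; [exact: cvg_cst|apply: cvgM; [exact: cvg_cst|exact: cvg_id]].
Qed.

(** A combination of two Laplace kernels. The coefficients cancel the leading
    terms of the transforms, which leaves a positive transform with a finite
    first moment. Unlike for a Gaussian, all the integrals involved have
    elementary primitives. *)
Definition laplace_kernel (c t : R) : R :=
  2 * expR (- (c * `|t|)) - expR (- (2 * c * `|t|)).

Definition laplace_transform (c b : R) : R :=
  12 * c ^+ 3 / ((c ^+ 2 + b ^+ 2) * (4 * c ^+ 2 + b ^+ 2)).

Lemma continuous_laplace_kernel c : continuous (laplace_kernel c).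
Proof.
move=> t; apply: cvgB; last exact: continuous_expRN.
by apply: cvgM; [exact: cvg_cst|exact: continuous_expRN].
Qed.

Lemma laplace_kernel_ge0 c t : 0 <= c -> 0 <= laplace_kernel c t.
Proof.
move=> c0; rewrite /laplace_kernel (_ : - (2 * c * `|t|) = - (c * `|t|) - c * `|t|) ?expRD; last by ring.
have : expR (- (c * `|t|)) <= 1 by rewrite expR_le1 oppr_le0 mulr_ge0.
have := expR_ge0 (- (c * `|t|)); nra.
Qed.

Lemma laplace_kernel_le1 c t : laplace_kernel c t <= 1.
Proof.
rewrite /laplace_kernel (_ : - (2 * c * `|t|) = - (c * `|t|) - c * `|t|) ?expRD; last by ring.
by have := sqr_ge0 (expR (- (c * `|t|)) - 1); rewrite expr2; lra.
Qed.

Lemma laplace_kernel_bound c t : 0 < c ->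
  laplace_kernel c t <= 2 * (1 + 4 / c ^+ 2) * (1 + t ^+ 2)^-1.
Proof.
move=> c0; have t0 : 0 < 1 + t ^+ 2 by rewrite ltr_pwDl// sqr_ge0.
have h : expR (- (c * `|t|)) <= (1 + 4 / c ^+ 2) * (1 + t ^+ 2)^-1.
  rewrite ler_pdivlMr// expRN ler_pdivrMl ?expR_gt0//.
  apply: (@le_trans _ _ ((1 + (c * t / 2) ^+ 2) * (1 + 4 / c ^+ 2))).
    rewrite (_ : _ * _ = 1 + t ^+ 2 + (4 / c ^+ 2 + c ^+ 2 * t ^+ 2 / 4)); last first.
      by field; rewrite gt_eqF.
    by rewrite lerDl addr_ge0// divr_ge0 ?sqr_ge0// mulr_ge0 ?sqr_ge0.
  apply: ler_wpM2r; first by rewrite addr_ge0// divr_ge0// sqr_ge0.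
  have -> : c * `|t| = c * `|t| / 2 + c * `|t| / 2 by lra.
  rewrite expRD -expr2.
  have u0 : 0 <= c * `|t| / 2 by rewrite divr_ge0// mulr_ge0// ltW.
  have := expR_ge1Dx (c * `|t| / 2).
  rewrite (_ : (c * t / 2) ^+ 2 = (c * `|t| / 2) ^+ 2); last first.
    by rewrite !exprMn real_normK ?num_real.
  by move: (expR _) u0; move: (c * `|t| / 2) => u E; rewrite !expr2; nra.
apply: (@le_trans _ _ (2 * expR (- (c * `|t|)))).
  by rewrite /laplace_kernel; have := expR_ge0 (- (2 * c * `|t|)); lra.
by rewrite -mulrA ler_wpM2l.
Qed.

Lemma laplace_transform_ge0 c b : 0 <= c -> 0 <= laplace_transform c b.
Proof.
move=> c0; have c3 : 0 <= c ^+ 3 by rewrite exprn_ge0.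
rewrite divr_ge0 ?mulr_ge0//; last by rewrite addr_ge0 ?sqr_ge0// mulr_ge0 ?sqr_ge0.
by rewrite addr_ge0 ?sqr_ge0.
Qed.

Lemma laplace_transform_le c b : 0 < c -> laplace_transform c b <= laplace_transform c 0.
Proof.
move=> c0; rewrite /laplace_transform ler_wpM2l ?mulr_ge0 ?exprn_ge0 ?(ltW c0)//.
have c2 : 0 < c ^+ 2 by rewrite exprn_gt0.
have b2 : 0 <= b ^+ 2 := sqr_ge0 b.
rewrite lef_pV2 ?posrE; first by rewrite expr0n !addr0; nra.
  by rewrite mulr_gt0; nra.
by rewrite expr0n !addr0 mulr_gt0; nra.
Qed.

Lemma integral_laplace_kernel_cos (c th b : R) : 0 < c ->
  (\int[leb]_y (laplace_kernel c y * (1 + cos (th + b * y)))%:E =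
   (laplace_transform c 0 + laplace_transform c b * cos th)%:E)%E.
Proof.
move=> c0; have c20 : 0 < 2 * c by lra.
have cp k : continuous (fun y : R => expR (- (k * `|y|)) * (1 + cos (th + b * y))).
  by move=> y; apply: cvgM; [exact: continuous_expRN|exact: continuous_1cos].
have h := @ge0_integral_scale _ _ leb
  (fun y => expR (- (c * `|y|)) * (1 + cos (th + b * y))) 2 _
  (continuous_measurable_fun (cp c)) (fun y => mulr_ge0 (expR_ge0 _) (cos1_ge0 _))
  (ler0n _ _) (integral_laplace_cos th b c0).
have := @ge0_integral_sub _ _ leb _ (fun y => expR (- (2 * c * `|y|)) * (1 + cos (th + b * y)))
  (fun y => laplace_kernel c y * (1 + cos (th + b * y))) _ _
  (continuous_measurable_fun (cp (2 * c))) _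
  (fun y => mulr_ge0 (expR_ge0 _) (cos1_ge0 _)) _ _ h (integral_laplace_cos th b c20).
move=> -> //; last 3 first.
- apply: continuous_measurable_fun => y; apply: cvgM; last exact: continuous_1cos.
  exact: continuous_laplace_kernel.
- by move=> y; rewrite mulr_ge0// laplace_kernel_ge0// ltW.
- by move=> y; rewrite /laplace_kernel; ring.
congr (_%:E); rewrite /laplace_transform; move: (cos th) => k.
have c2 : 0 < c ^+ 2 by rewrite exprn_gt0.
have b2 : 0 <= b ^+ 2 := sqr_ge0 b.
have e2 : (2 * c) ^+ 2 = 4 * c ^+ 2 by ring.
rewrite e2; field.
by rewrite !gt_eqF//; nra.
Qed.

Lemma integral_laplace_kernel (c : R) : 0 < c ->
  (\int[leb]_y (laplace_kernel c y)%:E = (laplace_transform c 0)%:E)%E.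
Proof.
move=> c0; have := integral_laplace_kernel_cos (pi / 2) 0 c0.
rewrite cos_pihalf mulr0 addr0 => <-; apply: eq_integral => y _.
by rewrite mul0r addr0 cos_pihalf addr0 mulr1.
Qed.

(** Induction on the dimension: integrating the other variables gives the
    formula at a phase shifted by the first one. *)
Lemma integral_tuple_cos n (k : R -> R) (a : R) (b B : 'I_n -> R) (th : R) :
  continuous k -> (forall y, 0 <= k y) ->
  (\int[leb]_y (k y)%:E = a%:E)%E ->
  (forall i th, \int[leb]_y (k y * (1 + cos (th + b i * y)))%:E =
     (a + B i * cos th)%:E)%E ->
  (forall i, 0 <= B i <= a) ->
  (\int[lebesgue_tuple R n]_t ((\prod_(i < n) k (tnth t i)) *
      (1 + cos (th + \sum_(i < n) b i * tnth t i)))%:E =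
   (a ^+ n + (\prod_(i < n) B i) * cos th)%:E)%E.
Proof.
move=> ck k0 ka hB Ba; have mk := continuous_measurable_fun ck.
have measurable_phase m (f : 'I_m -> R) (c0 : R) :
    measurable_fun setT (fun t : m.-tuple RR => (\prod_(i < m) k (tnth t i)) *
      (1 + cos (c0 + \sum_(i < m) f i * tnth t i))).
  apply: measurable_funM.
    by apply: (measurable_tuple_prod (f := fun=> k)) => i.
  apply: measurable_funD; first exact: measurable_cst.
  apply: measurableT_comp; first exact: continuous_measurable_fun (@continuous_cos R).
  apply: measurable_funD; first exact: measurable_cst.
  apply: measurable_sum => i; apply: measurable_funM; first exact: measurable_cst.
  exact: measurable_tnth.
elim: n b B hB Ba th => [|n IH] b B hB Ba th.
  transitivity (\int[lebesgue_tuple R 0]_t (cst (1 + cos th) t)%:E)%E.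
    by apply: eq_integral => t _; rewrite !big_ord0 addr0 mul1r.
  by rewrite integral_dirac//= diracT mul1e big_ord0 expr0 mul1r.
rewrite ge0_integral_tupleS; last 2 first.
- by apply/measurable_EFinP; exact: measurable_phase.
- by move=> t; rewrite lee_fin mulr_ge0//; exact: prodr_ge0.
have pB : 0 <= \prod_(i < n) B (lift ord0 i) <= a ^+ n.
  rewrite prodr_ge0/=; last by move=> i _; have /andP[] := Ba (lift ord0 i).
  rewrite -[X in a ^+ X]card_ord -prodr_const; apply: ler_prod => i _; exact: Ba.
set Q := \prod_(i < n) B (lift ord0 i) in pB *.
transitivity (\int[leb]_x ((a ^+ n - Q) * k x + Q * (k x * (1 + cos (th + b ord0 * x))))%:E)%E.
  apply: eq_integral => x _.
  have mt (c0 : R) : measurable_fun setT (fun t : n.-tuple RR => (\prod_(i < n) k (tnth t i)) *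
      (1 + cos (c0 + \sum_(i < n) b (lift ord0 i) * tnth t i))).
    exact: measurable_phase.
  have g0 (c0 : R) (t : n.-tuple RR) : 0 <= (\prod_(i < n) k (tnth t i)) *
      (1 + cos (c0 + \sum_(i < n) b (lift ord0 i) * tnth t i)).
    by rewrite mulr_ge0// prodr_ge0.
  have h := @ge0_integral_scale _ _ (lebesgue_tuple R n) _ (k x) _ (mt (th + b ord0 * x))
    (g0 _) (k0 x)
    (IH (b \o lift ord0) (B \o lift ord0) (fun i => hB _) (fun i => Ba _) (th + b ord0 * x)).
  rewrite /= -/Q in h.
  transitivity ((k x * (a ^+ n + Q * cos (th + b ord0 * x)))%:E)%E; last first.
    by congr (_%:E); ring.
  rewrite -h; apply: eq_integral => t _; congr (_%:E).
  rewrite !big_ord_recl tnth_cons0 addrA -mulrA; congr (_ * (_ * (1 + cos (_ + _)))).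
    by apply: eq_bigr => i _; rewrite tnth_consS.
  by apply: eq_bigr => i _; rewrite tnth_consS.
have /andP[Q0 Qa] := pB.
rewrite (@ge0_integral_comb _ _ leb k (fun x => k x * (1 + cos (th + b ord0 * x)))
   (a ^+ n - Q) Q a (a + B ord0 * cos th))//.
- by rewrite big_ord_recl exprS; congr (_%:E); rewrite -/Q; ring.
- apply: measurable_funM => //; apply: continuous_measurable_fun; exact: continuous_1cos.
- by move=> x; rewrite mulr_ge0.
- by rewrite subr_ge0.
Qed.

Lemma laplace_transform_scale (k ep t : R) : k != 0 -> 0 < ep ->
  laplace_transform (k * ep) (k * t) =
  12 * ep ^+ 3 / (k * ((ep ^+ 2 + t ^+ 2) * (4 * ep ^+ 2 + t ^+ 2))).
Proof.
move=> k0 e0; have e2 : 0 < ep ^+ 2 by rewrite exprn_gt0.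
have t2 := sqr_ge0 t; rewrite /laplace_transform.
rewrite (_ : (k * ep) ^+ 2 + (k * t) ^+ 2 = k ^+ 2 * (ep ^+ 2 + t ^+ 2)); last by ring.
rewrite (_ : 4 * (k * ep) ^+ 2 + (k * t) ^+ 2 = k ^+ 2 * (4 * ep ^+ 2 + t ^+ 2)); last by ring.
have : ep ^+ 2 + t ^+ 2 != 0 by rewrite gt_eqF//; lra.
have : 4 * ep ^+ 2 + t ^+ 2 != 0 by rewrite gt_eqF//; lra.
move: (4 * ep ^+ 2 + t ^+ 2) (ep ^+ 2 + t ^+ 2) => X Y X0 Y0; field.
by rewrite X0 Y0 k0.
Qed.

Lemma integral_laplace_transform (ep : R) : 0 < ep ->
  (\int[leb]_t (laplace_transform (2 * pi * ep) (2 * pi * t))%:E = 1%:E)%E.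
Proof.
move=> e0; have e20 : 0 < 2 * ep by lra.
have p0 : 0 < pi :> R := pi_gt0 R.
have cp (k : R) : 0 < k -> continuous (fun t : R => k / (k ^+ 2 + t ^+ 2)).
  move=> k0 t; apply: cvgM; first exact: cvg_cst.
  apply: cvgV; first by rewrite gt_eqF// ltr_pwDl ?exprn_gt0// sqr_ge0.
  by apply: cvgD; [exact: cvg_cst|exact: exprn_continuous].
have pp (k t : R) : 0 < k -> 0 <= k / (k ^+ 2 + t ^+ 2).
  by move=> k0; rewrite divr_ge0 ?(ltW k0)// addr_ge0 ?sqr_ge0.
have P2 : 0 <= 2 / pi :> R by rewrite divr_ge0// ltW.
have P1 : 0 <= 1 / pi :> R by rewrite divr_ge0// ltW.
have h1 := @ge0_integral_scale _ _ leb (fun t => ep / (ep ^+ 2 + t ^+ 2)) _ _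
  (continuous_measurable_fun (cp ep e0)) (fun t => pp ep t e0) P2
  (integral_cauchy_density e0).
have h2 := @ge0_integral_scale _ _ leb (fun t => 2 * ep / ((2 * ep) ^+ 2 + t ^+ 2)) _ _
  (continuous_measurable_fun (cp (2 * ep) e20))
  (fun t => pp (2 * ep) t e20) P1 (integral_cauchy_density e20).
have E t : 2 / pi * (ep / (ep ^+ 2 + t ^+ 2)) =
    laplace_transform (2 * pi * ep) (2 * pi * t) + 1 / pi * (2 * ep / ((2 * ep) ^+ 2 + t ^+ 2)).
  rewrite laplace_transform_scale// ?mulf_neq0// ?gt_eqF//.
  have e2 : 0 < ep ^+ 2 by rewrite exprn_gt0.
  have t2 := sqr_ge0 t; have -> : (2 * ep) ^+ 2 = 4 * ep ^+ 2 by ring.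
  field; rewrite !gt_eqF//; lra.
have mtr : measurable_fun setT (fun t : R => laplace_transform (2 * pi * ep) (2 * pi * t)).
  rewrite (_ : (fun t => _) = (fun t => 2 / pi * (ep / (ep ^+ 2 + t ^+ 2)) -
    1 / pi * (2 * ep / ((2 * ep) ^+ 2 + t ^+ 2)))); last by apply/funext => t; rewrite E addrK.
  apply: measurable_funB; apply: measurable_funM => //.
    exact: continuous_measurable_fun (cp ep e0).
  exact: continuous_measurable_fun (cp (2 * ep) e20).
rewrite (@ge0_integral_sub _ _ leb (fun t => 2 / pi * (ep / (ep ^+ 2 + t ^+ 2)))
  (fun t => 1 / pi * (2 * ep / ((2 * ep) ^+ 2 + t ^+ 2)))
  (fun t => laplace_transform (2 * pi * ep) (2 * pi * t)) _ _ _ mtr _ _ E h1 h2).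
- by congr (_%:E); move: (pi : R) p0 => p p0; field; rewrite gt_eqF.
- by apply: measurable_funM => //; exact: continuous_measurable_fun (cp (2 * ep) e20).
- by move=> t; rewrite mulr_ge0// pp.
- by move=> t; apply: laplace_transform_ge0; rewrite !mulr_ge0// ltW.
Qed.

(** The decay of order 4 of the transform makes the first moment finite, and
    of the order of ep by scaling. *)
Lemma laplace_transform_moment (ep t : R) : 0 < ep ->
  laplace_transform (2 * pi * ep) (2 * pi * t) * `|t| <=
  (3 * ep / (2 * pi)) * (2 * ep / ((2 * ep) ^+ 2 + t ^+ 2)).
Proof.
move=> e0; have p0 : 0 < pi :> R := pi_gt0 R.
rewrite laplace_transform_scale// ?mulf_neq0// ?gt_eqF//.
have t2 : t ^+ 2 = `|t| ^+ 2 by rewrite real_normK ?num_real.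
rewrite t2; move: `|t| (normr_ge0 t) => u u0.
have -> : (2 * ep) ^+ 2 = 4 * ep ^+ 2 by ring.
have X0 : 0 < ep ^+ 2 + u ^+ 2 by rewrite ltr_pwDl ?exprn_gt0// sqr_ge0.
have Y0 : 0 < 4 * ep ^+ 2 + u ^+ 2 by rewrite ltr_pwDl ?mulr_gt0 ?exprn_gt0// sqr_ge0.
have -> : 3 * ep / (2 * pi) * (2 * ep / (4 * ep ^+ 2 + u ^+ 2)) =
  12 * ep ^+ 3 / (2 * pi * ((ep ^+ 2 + u ^+ 2) * (4 * ep ^+ 2 + u ^+ 2))) *
   ((ep ^+ 2 + u ^+ 2) / (2 * ep)).
  move: (4 * ep ^+ 2 + u ^+ 2) (ep ^+ 2 + u ^+ 2) X0 Y0 => Y X X0 Y0.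
  by move: (pi : R) p0 => p p0; field; rewrite !gt_eqF.
apply: ler_wpM2l.
  by rewrite divr_ge0 ?mulr_ge0 ?exprn_ge0 ?(ltW p0) ?(ltW e0) ?(ltW X0) ?(ltW Y0).
rewrite ler_pdivlMr; last lra.
by have := sqr_ge0 (ep - u); rewrite !expr2; lra.
Qed.

Lemma laplace_transform_bound (ep t : R) : 0 < ep ->
  laplace_transform (2 * pi * ep) (2 * pi * t) <=
  (6 * ep / pi) * (1 + (4 * ep ^+ 2)^-1) * (1 + t ^+ 2)^-1.
Proof.
move=> e0; have p0 : 0 < pi :> R := pi_gt0 R.
rewrite laplace_transform_scale// ?mulf_neq0// ?gt_eqF//.
have X0 : 0 < ep ^+ 2 + t ^+ 2 by rewrite ltr_pwDl ?exprn_gt0// sqr_ge0.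
have Y0 : 0 < 4 * ep ^+ 2 + t ^+ 2 by rewrite ltr_pwDl ?mulr_gt0 ?exprn_gt0// sqr_ge0.
have -> : 12 * ep ^+ 3 / (2 * pi * ((ep ^+ 2 + t ^+ 2) * (4 * ep ^+ 2 + t ^+ 2))) =
   (6 * ep / pi) * (ep ^+ 2 / ((ep ^+ 2 + t ^+ 2) * (4 * ep ^+ 2 + t ^+ 2))).
  move: (4 * ep ^+ 2 + t ^+ 2) (ep ^+ 2 + t ^+ 2) X0 Y0 => Y X X0 Y0.
  by move: (pi : R) p0 => p p0; field; rewrite !gt_eqF.
rewrite -[leRHS]mulrA; apply: ler_wpM2l; first by rewrite divr_ge0 ?mulr_ge0 ?(ltW p0) ?(ltW e0).
have t0 := sqr_ge0 t; have e2 : 0 < ep ^+ 2 by rewrite exprn_gt0.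
move: (t ^+ 2) (ep ^+ 2) t0 e2 => u v u0 v0.
rewrite ler_pdivlMr; last lra.
rewrite mulrAC ler_pdivrMr; last nra.
rewrite (_ : (1 + (4 * v)^-1) * ((v + u) * (4 * v + u)) =
  v * (1 + u) + (4 * v ^+ 2 + u * (4 * v) + u ^+ 2 + 5 * u / 4 + u ^+ 2 / (4 * v))).
  have v4 : 0 <= 4 * v by lra.
  have := divr_ge0 (sqr_ge0 u) v4; have := mulr_ge0 u0 (ltW v0).
  by have := sqr_ge0 u; have := sqr_ge0 v; lra.
by field; rewrite gt_eqF.
Qed.

End Kernel.

(** * Fourier inversion *)

Section Inversion.
Context {R : realType} {V : normedModType R}.
Context {dotp : {dot V for @idfun R}} {d : nat} {e : 'I_d -> V}.
Variable hE : euclidean_space dotp e.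
Context {A : tvsType R[i]}.
Variables (P : nat -> A -> R) (hP : seminorm_system P) (cP : complete_system P).
Local Notation mu := (lebesgue_tuple R d).
Local Notation chi := (character dotp).
Local Notation w := (weight dotp e).
Local Notation c := (coord_vec e).
Local Notation wdominated := (wdominated (dotp := dotp) (e := e) P).
Local Notation S := (@schwartz R V A).
Implicit Types (f g : V -> A) (s ep : R).

(** Tends to 1 as ep tends to 0, while its transform, the next function, tends
    to a Dirac mass. *)
Definition cutoff ep (x : V) : R := \prod_(i < d) laplace_kernel (2 * pi * ep) (dotp x (e i)).

Definition approximate_identity ep (x : V) : R :=
  \prod_(i < d) laplace_transform (2 * pi * ep) (2 * pi * dotp x (e i)).

Let p0 : 0 < pi :> R := pi_gt0 R.

Lemma product_weight_bound (h : R -> R) (C : R) (x : V) : (forall t, 0 <= h t) ->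
  (forall t, h t <= C * (1 + t ^+ 2)^-1) ->
  \prod_(i < d) h (dotp x (e i)) <= C ^+ d * w x.
Proof.
move=> h0 hC; rewrite -[X in C ^+ X]card_ord -prodr_const -big_split /=.
by apply: ler_prod => i _; rewrite h0 hC.
Qed.

Lemma cutoff_continuous ep : continuous (cutoff ep).
Proof.
apply: continuous_big => [|i _ x]; first exact: mul_continuous.
apply: (@continuous_comp _ _ _ (fun x => dotp x (e i)) (laplace_kernel (2 * pi * ep))).
  exact: (dotl_continuous hE).
exact: continuous_laplace_kernel.
Qed.

Lemma cutoff_ge0 ep x : 0 <= ep -> 0 <= cutoff ep x.
Proof.
by move=> e0; apply: prodr_ge0 => i _; rewrite laplace_kernel_ge0// !mulr_ge0// ltW.
Qed.

Lemma cutoff_le1 ep x : 0 <= ep -> cutoff ep x <= 1.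
Proof.
move=> e0; apply: prodr_ile1 => i; rewrite laplace_kernel_le1 andbT.
by rewrite laplace_kernel_ge0// !mulr_ge0// ltW.
Qed.

Lemma cutoff_bound ep : 0 < ep -> exists C, 0 <= C /\ forall x, cutoff ep x <= C * w x.
Proof.
move=> e0; have c0 : 0 < 2 * pi * ep by rewrite !mulr_gt0.
eexists; split; last first.
  move=> x; apply: product_weight_bound => t.
    by rewrite laplace_kernel_ge0// ltW.
  exact: laplace_kernel_bound.
by rewrite exprn_ge0// mulr_ge0// addr_ge0// divr_ge0// sqr_ge0.
Qed.

Lemma approximate_identity_ge0 ep x : 0 < ep -> 0 <= approximate_identity ep x.
Proof.
by move=> e0; apply: prodr_ge0 => i _; rewrite laplace_transform_ge0// !mulr_ge0// ltW.
Qed.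

Lemma approximate_identity_bound ep : 0 < ep ->
  exists C, 0 <= C /\ forall x, approximate_identity ep x <= C * w x.
Proof.
move=> e0; have c0 : 0 < 2 * pi * ep by rewrite !mulr_gt0.
eexists; split; last first.
  move=> x; apply: (product_weight_bound (h := fun t => laplace_transform (2 * pi * ep) (2 * pi * t))) => t.
    by rewrite laplace_transform_ge0// ltW.
  exact: laplace_transform_bound.
rewrite exprn_ge0// mulr_ge0//; first by rewrite divr_ge0 ?mulr_ge0 ?(ltW p0) ?(ltW e0).
by rewrite addr_ge0// invr_ge0 mulr_ge0// sqr_ge0.
Qed.

Lemma laplace_transform_continuous ep : 0 < ep ->
  continuous (fun t : R => laplace_transform (2 * pi * ep) (2 * pi * t)).
Proof.
move=> e0 t; have c2 : 0 < (2 * pi * ep) ^+ 2 by rewrite exprn_gt0// !mulr_gt0.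
have ct : (fun t : R => (2 * pi * t) ^+ 2) @ t --> (2 * pi * t) ^+ 2.
  apply: (@continuous_comp _ _ _ (fun t : R => 2 * pi * t) (fun a : R => a ^+ 2)).
    by apply: cvgM; [exact: cvg_cst|exact: cvg_id].
  exact: exprn_continuous.
have t2 : 0 <= (2 * pi * t) ^+ 2 := sqr_ge0 _.
apply: cvgM; first exact: cvg_cst.
apply: cvgV; first by rewrite mulf_neq0// gt_eqF//; lra.
by apply: cvgM; apply: cvgD => //; exact: cvg_cst.
Qed.

Lemma approximate_identity_continuous ep : 0 < ep -> continuous (approximate_identity ep).
Proof.
move=> e0; apply: continuous_big => [|i _ x]; first exact: mul_continuous.
apply: (@continuous_comp _ _ _ (fun x => dotp x (e i))
  (fun t : R => laplace_transform (2 * pi * ep) (2 * pi * t))).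
  exact: (dotl_continuous hE).
exact: laplace_transform_continuous.
Qed.

Lemma approximate_identity_mass ep : 0 < ep ->
  (\int[mu]_t (approximate_identity ep (c t))%:E = 1%:E)%E.
Proof.
move=> e0; transitivity (\int[mu]_t
    (\prod_(i < d) (fun t => laplace_transform (2 * pi * ep) (2 * pi * t)) (tnth t i))%:E)%E.
  by apply: eq_integral => t _; congr (_%:E); apply: eq_bigr => i _; rewrite dot_coord_vec.
rewrite (@ge0_integral_tuple_prod R d (fun _ t => laplace_transform (2 * pi * ep) (2 * pi * t)) (fun=> 1)).
- by rewrite big1.
- by move=> i; apply: continuous_measurable_fun; exact: laplace_transform_continuous.
- by move=> i x; rewrite laplace_transform_ge0// !mulr_ge0// ltW.
- by move=> i; exact: integral_laplace_transform.
Qed.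

Lemma approximate_identity_moment ep j : 0 < ep ->
  (\int[mu]_t (approximate_identity ep (c t) * `|tnth t j|)%:E <= (3 * ep / 2)%:E)%E.
Proof.
move=> e0; have e20 : 0 < 2 * ep by lra.
pose K t := laplace_transform (2 * pi * ep) (2 * pi * t).
pose M t := (3 * ep / (2 * pi)) * (2 * ep / ((2 * ep) ^+ 2 + t ^+ 2)).
have K0 t : 0 <= K t by rewrite laplace_transform_ge0// !mulr_ge0// ltW.
have M0 t : 0 <= M t.
  apply: mulr_ge0; apply: divr_ge0; rewrite ?mulr_ge0 ?(ltW p0) ?(ltW e0)//.
  by rewrite addr_ge0 ?sqr_ge0.
pose h i t := if i == j then M t else K t.
have cK : continuous K := laplace_transform_continuous e0.
have cc : continuous (fun t : R => 2 * ep / ((2 * ep) ^+ 2 + t ^+ 2)).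
  move=> t; apply: cvgM; first exact: cvg_cst.
  apply: cvgV; first by rewrite gt_eqF// ltr_pwDl ?exprn_gt0// sqr_ge0.
  by apply: cvgD; [exact: cvg_cst|exact: exprn_continuous].
have mh i : measurable_fun setT (h i).
  have -> : h i = if i == j then M else K by apply/funext => t; rewrite /h; case: ifP.
  case: ifP => _; first by apply: measurable_funM => //; exact: continuous_measurable_fun.
  exact: continuous_measurable_fun.
have h0 i t : 0 <= h i t by rewrite /h; case: ifP.
apply: (@le_trans _ _ (\int[mu]_t (\prod_(i < d) h i (tnth t i))%:E)%E).
  apply: ge0_le_integral => //.
  - by move=> t _; rewrite lee_fin mulr_ge0// approximate_identity_ge0.
  - apply/measurable_EFinP; apply: measurable_funM.
      exact: basis_measurable_fun (coord_vec_basis hE) (approximate_identity_continuous e0).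
    by apply: measurableT_comp => //; exact: measurable_tnth.
  - by apply/measurable_EFinP; exact: measurable_tuple_prod.
  - move=> t _; rewrite lee_fin /approximate_identity.
    under eq_bigr do rewrite dot_coord_vec//.
    rewrite (bigD1 j)//= [leRHS](bigD1 j)//= mulrAC {1}/h eqxx.
    rewrite (eq_bigr (fun i => h i (tnth t i))); last by move=> i ij; rewrite /h (negbTE ij).
    by apply: ler_wpM2r; [exact: prodr_ge0|exact: laplace_transform_moment].
rewrite (ge0_integral_tuple_prod (c := fun i => if i == j then 3 * ep / 2 else 1) mh h0).
  rewrite (bigD1 j)//= eqxx big1 ?mulr1// => i ij; by rewrite (negbTE ij).
move=> i; rewrite /h; case: ifP => _; last exact: integral_laplace_transform.
rewrite (@ge0_integral_scale R _ _ (@lebesgue_measure R) (fun t => 2 * ep / ((2 * ep) ^+ 2 + t ^+ 2)) _ pi).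
- by congr (_%:E); move: (pi : R) p0 => p p0'; field; rewrite gt_eqF.
- exact: continuous_measurable_fun.
- by move=> t; rewrite divr_ge0 ?(ltW e20)// addr_ge0 ?sqr_ge0.
- by rewrite divr_ge0 ?mulr_ge0 ?(ltW p0) ?(ltW e0).
- exact: integral_cauchy_density.
Qed.

(** Varying the phase th separates the two summands of 1 + cos. At the phases
    pi/2 and -pi/2 the cosines add up to 0, which isolates the integral of the
    cutoff. *)
Lemma integral_cutoff_cos ep th y : 0 < ep ->
  rintegrable mu (fun t => cutoff ep (c t)) /\
  rintegrable mu (fun t => cutoff ep (c t) * cos (th + 2 * pi * dotp (c t) y)) /\
  \int[mu]_t (cutoff ep (c t) * cos (th + 2 * pi * dotp (c t) y)) =
  approximate_identity ep y * cos th.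
Proof.
move=> e0; have c0 : 0 < 2 * pi * ep by rewrite !mulr_gt0.
have ik : rintegrable mu (fun t => cutoff ep (c t)).
  have [C [C0 hC]] := cutoff_bound e0.
  apply: rintegrable_le (rintegrableZ C (weight_integrable hE)) _.
    exact: basis_measurable_fun (coord_vec_basis hE) (cutoff_continuous (ep := ep)).
  by move=> t; rewrite ger0_norm ?cutoff_ge0// ltW.
have ic th' : rintegrable mu (fun t => cutoff ep (c t) * cos (th' + 2 * pi * dotp (c t) y)).
  apply: rintegrable_le ik _.
    apply: (basis_measurable_fun (F := fun x => cutoff ep x * cos (th' + 2 * pi * dotp x y)) (coord_vec_basis hE)).
    move=> x; apply: cvgM; first exact: cutoff_continuous.
    apply: continuous_comp; last exact: continuous_cos.
    apply: cvgD; first exact: cvg_cst.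
    by apply: cvgM; [exact: cvg_cst|exact: (dotl_continuous hE)].
  move=> t; rewrite normrM ger0_norm ?cutoff_ge0 ?(ltW e0)// ler_piMr ?cutoff_ge0 ?(ltW e0)//.
  exact: cos_max.
split=> //; split=> //.
have key th' : \int[mu]_t cutoff ep (c t) +
    \int[mu]_t (cutoff ep (c t) * cos (th' + 2 * pi * dotp (c t) y)) =
    laplace_transform (2 * pi * ep) 0 ^+ d + approximate_identity ep y * cos th'.
  rewrite -RintegralD//; last exact: (ic th').
  have := @integral_tuple_cos R d (laplace_kernel (2 * pi * ep)) (laplace_transform (2 * pi * ep) 0)
    (fun i => 2 * pi * dotp y (e i)) (fun i => laplace_transform (2 * pi * ep) (2 * pi * dotp y (e i))) th'
    (continuous_laplace_kernel (c := _)) (fun t => laplace_kernel_ge0 t (ltW c0))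
    (integral_laplace_kernel c0) (fun i th => integral_laplace_kernel_cos th _ c0) _.
  move=> h; rewrite /Rintegral -[RHS]/(fine (_%:E)%E) -h.
    congr fine; apply: eq_integral => t _; congr (_%:E).
    rewrite [RHS]mulrDr mulr1 /cutoff; congr (_ + _ * cos (_ + _)).
    - by apply: eq_bigr => i _; rewrite dot_coord_vec.
    - by apply: eq_bigr => i _; rewrite dot_coord_vec.
    - rewrite (dot_expand hE) mulr_sumr; apply: eq_bigr => i _.
      by rewrite (dot_coord_vec hE); ring.
  by move=> i; rewrite laplace_transform_ge0 ?laplace_transform_le// ltW.
have h1 := key th; have h2 := key (pi / 2).
have h3 := key (- (pi / 2)).
(* cos (th + pi) = - cos th *)
have h4 : \int[mu]_t (cutoff ep (c t) * cos (pi / 2 + 2 * pi * dotp (c t) y)) +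
   \int[mu]_t (cutoff ep (c t) * cos (- (pi / 2) + 2 * pi * dotp (c t) y)) = 0.
  rewrite -RintegralD//; [|exact: ic|exact: ic].
  rewrite /Rintegral integral0_eq// => t _; congr (_%:E).
  rewrite -mulrDr !cosD cosN sinN cos_pihalf !mul0r.
  by ring.
move: h2 h3; rewrite cosN cos_pihalf mulr0 addr0 => h2 h3; lra.
Qed.

Lemma approximate_identity_sign s ep x : s ^+ 2 = 1 ->
  approximate_identity ep (s *: x) = approximate_identity ep x.
Proof.
move=> s2; have E b : (2 * pi * (s * b)) ^+ 2 = (2 * pi * b) ^+ 2.
  by rewrite mulrCA exprMn s2 mul1r.
by apply: eq_bigr => i _; rewrite /laplace_transform dotZl E.
Qed.

Lemma intV_cutoff ep y (a : A) : 0 < ep ->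
  intV e (fun x => ((cutoff ep x)%:C * chi x y) *: a) = (approximate_identity ep y)%:C *: a.
Proof.
move=> e0; apply: (intV_eq hP) => psi psif; have [psil _] := psif.
have [_ [i1 E1]] := integral_cutoff_cos 0 y e0.
have [_ [i2 E2]] := integral_cutoff_cos (- (pi / 2)) y e0.
have E : (fun t => psi (((cutoff ep (c t))%:C * chi (c t) y) *: a)) = (fun t =>
    psi a * (cutoff ep (c t) * cos (0 + 2 * pi * dotp (c t) y)) +
    psi ('i *: a) * (cutoff ep (c t) * cos (- (pi / 2) + 2 * pi * dotp (c t) y))).
  apply/funext => t; rewrite add0r [- (pi / 2) + _]addrC cosB cos_pihalf sin_pihalf mulr0 add0r mulr1.
  rewrite (_ : (cutoff ep (c t))%:C * chi (c t) y = (cutoff ep (c t) * cos (2 * pi * dotp (c t) y))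
     +i* (cutoff ep (c t) * sin (2 * pi * dotp (c t) y))).
    by rewrite real_linear_complexZ// mulrC [X in _ + X]mulrC.
  by apply/eqP; rewrite eq_complex /= !mul0r subr0 addr0 !eqxx.
rewrite E; split; first by apply: rintegrableD; exact: rintegrableZ.
rewrite RintegralD//; [|exact: rintegrableZ|exact: rintegrableZ].
rewrite !RintegralZl// E1 E2 cosN cos_pihalf cos0 !mulr0 addr0 mulr1 real_linearZ//.
exact: mulrC.
Qed.

(** Telescoping along the coordinate axes, with the mean value inequality on
    each segment. *)
Lemma schwartz_lipschitz f n : S f -> exists L, 0 <= L /\
  forall x y, P n (f (x + y) - f x) <= L * \sum_(i < d) `|dotp y (e i)|.
Proof.
move=> hf.
have hL (i : 'I_d) : exists L, 0 <= L /\ forall x, P n (iter_dderive [:: e i] f x) <= L.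
  have [C [C0 hC]] := schwartz_bounded_fixed hP (schwartz_bounded_base hP 0 n [:: e i]) hf.
  by exists C; split=> // x; have := hC x; rewrite expr0 mul1r.
have [L hL'] := choice hL.
exists (\sum_(i < d) L i); split=> [|x y]; first by apply: sumr_ge0 => i _; have [] := hL' i.
rewrite {1}(euclidean_expand hE y) mulr_sumr.
have : forall l : seq 'I_d, forall x, P n (f (x + \sum_(i <- l) dotp y (e i) *: e i) - f x) <=
    \sum_(i <- l) (\sum_(j < d) L j) * `|dotp y (e i)|; last by apply.
elim=> [|i l IH] z; first by rewrite !big_nil addr0 subrr sys0.
rewrite !big_cons addrA; apply: le_trans (sys_tri hP n _ (f (z + dotp y (e i) *: e i)) _) _.
rewrite [leRHS]addrC; apply: lerD; first exact: IH.
apply: (mean_value hP (g := fun x => (dotp y (e i))%:C *: iter_dderive [:: e i] f x)) => s.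
  by apply: is_dderive_scale; exact: (schwartz_dderive hP (s := [::])).
move=> _; rewrite (sysZr hP) mulrC ler_wpM2r//; have [L0 hLi] := hL' i.
apply: le_trans (hLi _) _; rewrite (bigD1 i)//= lerDl.
by apply: sumr_ge0 => j _; have [] := hL' j.
Qed.

Lemma wdominated_real (h : V -> R) (C : R) f (M : nat -> R) : continuous h -> 0 <= C ->
  (forall x, 0 <= h x) -> (forall x, h x <= C * w x) -> continuous f ->
  (forall n x, P n (f x) <= M n) -> wdominated (fun x => (h x)%:C *: f x).
Proof.
move=> ch C0 h0 hC cf hM; split=> [x|n].
  by apply: tvs_cvgZ (cf x); apply: cvg_real_complex; exact: ch.
have M0 : 0 <= M n := le_trans (sys_ge0 hP n _) (hM n 0).
exists (C * M n); split=> [|x]; first exact: mulr_ge0.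
by rewrite (sysZr hP) ger0_norm// mulrAC ler_pM// sys_ge0.
Qed.

Lemma schwartz_sup_norm f n : S f -> exists M, forall x, P n (f x) <= M.
Proof.
move=> hf; have [C [C0 hC]] := schwartz_weight hE hP n 0 hf.
by exists C => x; have := hC x; rewrite expr0 mulr1.
Qed.

(** The error is controlled by the Lipschitz constant of f and the first
    moment of the approximate identity. *)
Lemma approximate_identity_cvg f z n : S f -> exists C, forall ep, 0 < ep ->
  P n (intV e (fun t => (approximate_identity ep t)%:C *: f (z - t)) - f z) <= C * ep.
Proof.
move=> hf; have [L [L0 hL]] := schwartz_lipschitz n hf.
exists (L * (d%:R * (3 / 2))) => ep e0.
have [C [C0 hC]] := approximate_identity_bound e0.
have K0 x := approximate_identity_ge0 x e0.
have cK := approximate_identity_continuous e0.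
have [M hM] : exists M : nat -> R, forall n x, P n (f x) <= M n.
  have [M hM] := choice (fun n => schwartz_sup_norm n hf); by exists M.
have cf : continuous (fun t => f (z - t)).
  move=> t; apply: (@continuous_comp _ _ _ (fun t => z - t) f); last first.
    exact: (schwartz_continuous (s := [::]) hf).
  by apply: cvgB; [exact: cvg_cst|exact: cvg_id].
have dom1 := wdominated_real cK C0 K0 hC cf (fun n t => hM n (z - t)).
have cz : continuous (fun _ : V => f z) by move=> x; exact: cvg_cst.
have dom2 := wdominated_real cK C0 K0 hC cz (fun n _ => hM n z).
have Ez : intV e (fun t => (approximate_identity ep t)%:C *: f z) = f z.
  apply: (intV_eq hP) => psi psif; have [psil _] := psif.
  have iK : rintegrable mu (fun t => approximate_identity ep (c t)).
    apply: rintegrable_le (rintegrableZ C (weight_integrable hE)) _.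
      exact: basis_measurable_fun (coord_vec_basis hE) cK.
    by move=> t; rewrite ger0_norm.
  have -> : (fun t => psi ((approximate_identity ep (c t))%:C *: f z)) =
      (fun t => psi (f z) * approximate_identity ep (c t)).
    by apply/funext => t; rewrite real_linearZ// mulrC.
  split; first exact: rintegrableZ.
  by rewrite RintegralZl// /Rintegral approximate_identity_mass//= mulr1.
rewrite -[X in _ - X]Ez -(intVB hE hP cP dom1 dom2).
have dom3 := wdominatedB hP dom1 dom2.
apply: le_trans (intV_seminorm_le hE hP cP n dom3) _.
have le1 : (\int[mu]_t (P n ((approximate_identity ep (c t))%:C *: f (z - c t) -
     (approximate_identity ep (c t))%:C *: f z))%:E <= (L * (d%:R * (3 / 2)) * ep)%:E)%E.
  apply: (@le_trans _ _ (\int[mu]_t (\sum_(i < d) (L%:E *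
      (approximate_identity ep (c t) * `|tnth t i|)%:E)))%E).
    apply: ge0_le_integral => //.
    - by move=> t _; rewrite lee_fin sys_ge0.
    - by apply/measurable_EFinP; exact: (seminorm_measurable hE hP n dom3.1).
    - apply: emeasurable_sum => i; apply: measurable_funeM; apply/measurable_EFinP.
      apply: measurable_funM; first exact: basis_measurable_fun (coord_vec_basis hE) cK.
      by apply: measurableT_comp => //; exact: measurable_tnth.
    - move=> t _; rewrite sumEFin lee_fin -scalerBr (sysZr hP) ger0_norm//.
      apply: (@le_trans _ _ (approximate_identity ep (c t) *
          (L * \sum_(i < d) `|dotp (- c t) (e i)|))); first by rewrite ler_wpM2l.
      rewrite mulrCA -!mulr_sumr; apply: ler_wpM2l => //; apply: ler_wpM2l => //.
      by apply: ler_sum => i _; rewrite dotNl normrN dot_coord_vec.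
  rewrite ge0_integral_sum//; last 2 first.
  - move=> i; apply: measurable_funeM; apply/measurable_EFinP.
    apply: measurable_funM; first exact: basis_measurable_fun (coord_vec_basis hE) cK.
    by apply: measurableT_comp => //; exact: measurable_tnth.
  - by move=> i t _; rewrite mule_ge0// lee_fin// mulr_ge0.
  rewrite (_ : L * _ * ep = \sum_(i < d) L * (3 * ep / 2)); last first.
    by rewrite sumr_const card_ord -mulr_natl; ring.
  rewrite -sumEFin; apply: lee_sum => i _.
  rewrite ge0_integralZl_EFin//; last 2 first.
  - by move=> t _; rewrite lee_fin mulr_ge0.
  - apply/measurable_EFinP; apply: measurable_funM.
      exact: basis_measurable_fun (coord_vec_basis hE) cK.
    by apply: measurableT_comp => //; exact: measurable_tnth.
  by rewrite EFinM; apply: lee_wpmul2l; [rewrite lee_fin|exact: approximate_identity_moment].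
rewrite -[leRHS]/(fine (_%:E)%E); apply: fine_le => //.
exact: (integrable_fin_num measurableT (seminorm_integrable hE hP n dom3)).
Qed.

Lemma cutoff_param_continuous x : continuous (fun ep => cutoff `|ep| x).
Proof.
apply: continuous_big => [|i _ ep]; first exact: mul_continuous.
have ck k b : continuous (fun ep : R => expR (- (k * `|ep| * b))).
  rewrite (_ : (fun ep => _) = (fun ep : R => expR (- (k * b * `|ep|)))); last first.
    by apply/funext => r; congr (expR (- _)); ring.
  exact: continuous_expRN.
have E : (fun ep : R => expR (- (2 * (2 * pi * `|ep|) * `|dotp x (e i)|))) =
    (fun ep : R => expR (- (2 * (2 * pi) * `|ep| * `|dotp x (e i)|))).
  by apply/funext => r; congr (expR (- _)); ring.
apply: cvgB; first by apply: cvgM; [exact: cvg_cst|exact: ck].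
have := ck (2 * (2 * pi)) `|dotp x (e i)|; rewrite -E; exact.
Qed.

(** With the cutoff inserted, the double integral converges absolutely and
    Fubini turns it into a convolution with the approximate identity. *)
Lemma ft_cutoff s z f ep : s ^+ 2 = 1 -> S f -> 0 < ep ->
  intV e (fun x => (cutoff ep x)%:C *: (chi (- s *: z) x *: ft dotp e s f x)) =
  intV e (fun t => (approximate_identity ep t)%:C *: f (z - t)).
Proof.
move=> s2 hf e0; have domf := schwartz_wdominated hE hP hf.
pose F (q : V * V) := ((cutoff ep q.1)%:C * chi q.1 (s *: (q.2 - z))) *: f q.2.
have [C [C0 hC]] := cutoff_bound e0.
have cchi : continuous (fun q : V * V => chi q.1 (s *: (q.2 - z)) : R[i]^o).
  move=> q; apply: (@continuous_comp _ _ _ (fun q : V * V => (q.1, s *: (q.2 - z)))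
    (fun q : V * V => chi q.1 q.2 : R[i]^o)); last exact: (character_continuous hE).
  apply: cvg_pair; first exact: cvg_fst.
  by apply: cvgZl_tmp; apply: cvgB; [exact: cvg_snd|exact: cvg_cst].
have domF : wdominated2 (dotp := dotp) (e := e) P F.
  split=> [q|n].
    apply: tvs_cvgZ.
      apply: (@tvs_cvgZ R R[i]^o _ _ _ (fun q : V * V => (cutoff ep q.1)%:C)
        (fun q : V * V => chi q.1 (s *: (q.2 - z)))); last exact: cchi.
      apply: cvg_real_complex.
      by apply: (@continuous_comp _ _ _ fst (cutoff ep)); [exact: cvg_fst|exact: cutoff_continuous].
    apply: (@continuous_comp _ _ _ snd f); [exact: cvg_snd|exact: domf.1].
  have [D [D0 hD]] := domf.2 n; exists (C * D); split=> [|q]; first exact: mulr_ge0.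
  rewrite /F (sysZ hP) Normc.normcM normc_real normc_character mulr1.
  rewrite ger0_norm ?cutoff_ge0 ?(ltW e0)// mulrACA ler_pM ?sys_ge0//.
  by rewrite cutoff_ge0// ltW.
transitivity (intV e (fun x => intV e (fun y => F (x, y)))).
  congr intV; apply/funext => x; rewrite scalerA.
  rewrite -(intVZ hE hP cP _ (wdominated_ft hE hP s x domf)); congr intV; apply/funext => y.
  rewrite /F /= scalerA -mulrA; congr ((_ * _) *: _).
  rewrite (characterC (- s *: z)) characterZ !(characterC x) -characterD.
  by rewrite scalerBr scaleNr addrC.
rewrite (intV_swap hE hP cP domF).
transitivity (intV e (fun y => (approximate_identity ep (y - z))%:C *: f y)).
  congr intV; apply/funext => y; rewrite /F /=.
  by rewrite intV_cutoff// approximate_identity_sign.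
have domH : wdominated (fun y => (approximate_identity ep (y - z))%:C *: f y).
  have [D [D0 hD]] := approximate_identity_bound e0.
  apply: (wdominated_scale hP (m := fun y => (approximate_identity ep (y - z))%:C) (C := D)) => //.
    move=> y; apply: cvg_real_complex.
    apply: (@continuous_comp _ _ _ (fun y => y - z) (approximate_identity ep)).
      by apply: cvgB; [exact: cvg_id|exact: cvg_cst].
    exact: approximate_identity_continuous.
  move=> y; rewrite normc_real ger0_norm ?approximate_identity_ge0//.
  by apply: le_trans (hD _) _; rewrite ler_piMr// weight_le1.
rewrite -(intV_reflect hE hP cP z domH); congr intV; apply/funext => t.
rewrite addrAC subrr add0r -scaleN1r approximate_identity_sign//.
by rewrite sqrrN expr1n.
Qed.

(** Removing the cutoff gives the repeated transform on one side and, since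
    the approximate identity concentrates at 0, the function itself on the
    other. *)
Theorem ft_inversion s f : s ^+ 2 = 1 -> S f ->
  ft dotp e (- s) (ft dotp e s f) = f.
Proof.
move=> s2 hf; apply/funext => z.
have s1 : `|s| = 1.
  by apply/eqP; rewrite -(@eqrXn2 _ 2)// real_normK ?num_real// s2 expr1n.
have hg : S (ft dotp e s f) := (schwartz_operator_ft hE hP cP s1 (schwartz_operator_id hP)).1 f hf.
set g := ft dotp e s f in hg *.
have domf := schwartz_wdominated hE hP hf; have domg := schwartz_wdominated hE hP hg.
have domG := wdominated_ft hE hP (- s) z domg.
pose G ep := intV e (fun x => (cutoff `|ep| x)%:C *: (chi (- s *: z) x *: g x)).
have limG : G @ 0^' --> ft dotp e (- s) g z.
  apply: (intV_cvg0 hE hP cP) => [ep _ _||n|x].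
  - move=> x; apply: tvs_cvgZ; last exact: domG.1.
    by apply: cvg_real_complex; exact: cutoff_continuous.
  - exact: domG.1.
  - have [C [C0 hC]] := domG.2 n; exists C; split=> // ep x _ _.
    rewrite (sysZr hP) ger0_norm ?cutoff_ge0//.
    by apply: le_trans (hC x); rewrite ler_piMl ?sys_ge0// cutoff_le1.
  - rewrite -[X in _ --> X]scale1r; apply: tvs_cvgZ; last exact: cvg_cst.
    rewrite -[1]/((1 : R)%:C); apply: cvg_real_complex.
    have -> : 1 = cutoff `|0 : R| x.
      rewrite /cutoff normr0 mulr0 big1// => i _.
      by rewrite /laplace_kernel !(mulr0, mul0r) oppr0 expR0; ring.
    by apply: cvg_within_filter; exact: cutoff_param_continuous.
have limf : G @ 0^' --> f z.
  apply/(sys_cvgP hP) => n eps eps0; have [C hC] := approximate_identity_cvg z n hf.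
  have : nbhs (0 : R) [set ep : R | `|ep| * (`|C| + 1) < eps].
    apply/nbhs_ballP; exists (eps / (`|C| + 1)) => /=; first by rewrite divr_gt0// ltr_wpDl.
    by move=> ep; rewrite /ball /= sub0r normrN ltr_pdivlMr// ltr_wpDl.
  move=> h; rewrite /dnbhs /within /=; apply: filterS h => ep /= h ep0.
  have e0 : 0 < `|ep| by rewrite normr_gt0.
  rewrite /G ft_cutoff//; apply: le_lt_trans (hC _ e0) _; apply: le_lt_trans h.
  by rewrite mulrC ler_wpM2l//; have := ler_norm C; lra.
exact: (cvg_unique (sys_hausdorff hP) limG limf).
Qed.

End Inversion.

(** * Smooth isometric actions *)

Section Frechet.
Context {R : realType} {A : tvsType R[i]}.
Variables (P : nat -> A -> R) (hP : seminorm_system P).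

(** Equicontinuity upgrades separate continuity to joint continuity. *)
Lemma equicontinuous_cvg (T X : Type) (F : set_system T) {FF : Filter F} (G : X -> A -> A)
    (x : T -> X) (x0 : X) (a : T -> A) (a0 : A) :
  (forall x a b, G x (a - b) = G x a - G x b) ->
  (forall n, exists m C, 0 <= C /\ forall x a, P n (G x a) <= C * P m a) ->
  (fun t => G (x t) a0) @ F --> G x0 a0 -> a @ F --> a0 ->
  (fun t => G (x t) (a t)) @ F --> G x0 a0.
Proof.
move=> GB bG Gx aa; apply/(sys_cvgP hP) => n eps e0.
have [m [C [C0 hC]]] := bG n.
have e2 : 0 < eps / 2 by rewrite divr_gt0.
have e3 : 0 < eps / 2 / (C + 1) by rewrite divr_gt0// ltr_wpDl.
move/(sys_cvgP hP)/(_ n _ e2) : Gx => h1; move/(sys_cvgP hP)/(_ m _ e3) : aa => h2.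
apply: filterS2 h1 h2 => t h1; rewrite ltr_pdivlMr ?ltr_wpDl// => h2.
apply: le_lt_trans (sys_tri hP n _ (G (x t) a0) _) _.
rewrite -GB; have := hC (x t) (a t - a0); have := sys_ge0 hP m (a t - a0).
by move: h1 h2; nra.
Qed.

Lemma bilinear_bound (mul : {bilinear A -> A -> A}) :
  continuous (fun ab : A * A => mul ab.1 ab.2) ->
  forall n, exists m C, 0 <= C /\ forall a b, P n (mul a b) <= C * P m a * P m b.
Proof.
move=> cm n.
have /(sys_cvgP hP)/(_ n 1 ltr01) := cm (0, 0).
rewrite /= linear0l => -[[U1 U2]] /= [/(sys_nbhs hP)[m1 [d1 [d10 h1]]]
  /(sys_nbhs hP)[m2 [d2 [d20 h2]]]] sub.
pose m := maxn m1 m2; pose del := Num.min d1 d2.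
have del0 : 0 < del by rewrite lt_min d10.
have small a b : P m a < del -> P m b < del -> P n (mul a b) <= 1.
  move=> ha hb; have : P n (mul a b - 0) < 1; last by rewrite subr0 => /ltW.
  apply: (sub (a, b)); split; [apply: h1|apply: h2] => /=.
    by apply: le_lt_trans (lt_le_trans ha _); rewrite ?ge_min ?lexx// (sys_mono hP)// leq_maxl.
  by apply: le_lt_trans (lt_le_trans hb _); rewrite ?ge_min ?lexx ?orbT// (sys_mono hP)// leq_maxr.
exists m, (4 / del ^+ 2); split=> [|a b]; first by rewrite divr_ge0// sqr_ge0.
have h3 b' : P m b' < del -> P n (mul a b') <= 2 * 1 / del * P m a.
  move=> hb; apply: (homogeneous_bound hP (q := fun a => P n (mul a b')) del0) => [r a' r0|a' ha].
    by rewrite linearZl_LR (sysZr hP) ger0_norm.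
  exact: small.
have := homogeneous_bound hP (q := fun b => P n (mul a b)) del0 _ h3 b.
move=> h; apply: le_trans (h _) _ => [r b' r0|].
  by rewrite linearZr_LR (sysZr hP) ger0_norm.
by rewrite le_eqVlt; apply/orP; left; apply/eqP; field; rewrite gt_eqF.
Qed.

End Frechet.

Section Action.
Context {R : realType} {V : normedModType R}.
Context {dotp : {dot V for @idfun R}} {d : nat} {e : 'I_d -> V}.
Variable hE : euclidean_space dotp e.
Context {A : tvsType R[i]}.
Variables (P : nat -> A -> R) (hP : seminorm_system P) (cP : complete_system P).
Variables (alpha : V -> {linear A -> A}).
Hypothesis alpha0 : forall a, alpha 0 a = a.
Hypothesis alphaD : forall x y a, alpha (x + y) a = alpha x (alpha y a).
Hypothesis isoP : forall n x a, P n (alpha x a) = P n a.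
Hypothesis smooth_alpha : smooth_action alpha.
Local Notation S := (@schwartz R V A).
Local Notation schwartz_operator := (schwartz_operator P).
Implicit Types (x y v X : V) (a b : A).

Lemma fdifferentiable_dderive (f : V -> A) x v : fdifferentiable f x ->
  exists l, is_dderive f x v l.
Proof.
move=> [D [DD DZ cD hD]]; exists (D v); rewrite /is_dderive.
have [->|v0] := eqVneq v 0.
  have D0 : D 0 = 0 by have := DZ 0 0; rewrite !scale0r.
  rewrite D0 (_ : (fun h => _) = (fun=> 0)); first exact: cvg_cst.
  by apply/funext => h; rewrite scaler0 addr0 subrr scaler0.
have hv : (fun h : R => h *: v) @ 0^' --> (0 : V)^'.
  move=> U /nbhs_ballP[eps /= e0 hU]; apply/nbhs_ballP; exists (eps / `|v|) => /=.
    by rewrite divr_gt0// normr_gt0.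
  move=> h; rewrite /ball /= sub0r normrN ltr_pdivlMr ?normr_gt0// => hb hn0.
  apply: hU; last by rewrite scaler_eq0 negb_or hn0.
  by rewrite -ball_normE /= sub0r normrN normrZ.
have h1 : (fun h : R => (`|h *: v|^-1)%:C *: (f (x + h *: v) - f x - D (h *: v))) @ 0^' --> (0 : A).
  exact: cvg_comp hv hD.
apply/(sys_cvgP hP (FF := punctured_filter R)) => n eps e0.
have e1 : 0 < eps / `|v| by rewrite divr_gt0// normr_gt0.
have /(sys_cvgP hP (FF := punctured_filter R))/(_ n _ e1) := h1.
have neq0 : \forall h \near (0 : R)^', h != 0 by exact: nbhs_dnbhs_neq.
apply: (@filterS2 _ _ (punctured_filter R)) neq0 => h hn0.
 rewrite subr0 (sysZr hP) normfV normr_id normrZ invfM ltr_pdivlMr ?normr_gt0//.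
rewrite mulrAC divfK ?normr_eq0// => hh.
have -> : (h^-1)%:C *: (f (x + h *: v) - f x) - D v =
    (h^-1)%:C *: (f (x + h *: v) - f x - D (h *: v)).
  by rewrite [RHS]scalerBr DZ scalerA -rmorphM mulVf// rmorph1 scale1r.
by rewrite (sysZr hP) normfV.
Qed.

Lemma fdifferentiable_continuous (f : V -> A) x : fdifferentiable f x ->
  {for x, continuous f}.
Proof.
move=> [D [DD DZ cD hD]].
apply/(sys_cvgP hP) => n eps e0.
have e2 : 0 < eps / 2 by rewrite divr_gt0.
have D0 : D 0 = 0 by have := DZ 0 0; rewrite !scale0r.
have /(sys_cvgP hP)/(_ n _ e2) := cD 0; rewrite D0 => h1.
have FF : Filter (0 : V)^' by exact: dnbhs_filter.
have /(sys_cvgP hP)/(_ n _ e2) := hD => h2.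
have h3 : \forall h \near (0 : V), P n (f (x + h) - f x) < eps.
  have hb : nbhs (0 : V) [set h : V | `|h| <= 1].
    apply/nbhs_ballP; exists 1 => //= h; rewrite -ball_normE /= sub0r normrN; exact: ltW.
  move: h2; rewrite /dnbhs /within /= => h2; near=> h.
  have [->|h0] := eqVneq h 0; first by rewrite addr0 subrr (sys0 hP).
  have : h != 0 -> P n ((`|h|^-1)%:C *: (f (x + h) - f x - D h) - 0) < eps / 2 by near: h.
  move/(_ h0); rewrite subr0 (sysZr hP) normfV normr_id.
  rewrite ltr_pdivrMl ?normr_gt0// => k1.
  have k2 : P n (D h - 0) < eps / 2 by near: h.
  have k3 : `|h| <= 1 by near: h.
  rewrite subr0 in k2; have := sysD hP n (f (x + h) - f x - D h) (D h); rewrite subrK.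
  have : `|h| * (eps / 2) <= eps / 2 by rewrite ler_piMl// ltW.
  lra.
have hx : (fun y => y - x) @ x --> (0 : V).
  by rewrite -(subrr x); apply: cvgB; [exact: cvg_id|exact: cvg_cst].
have : \forall y \near x, P n (f (x + (y - x)) - f x) < eps := hx _ h3.
by apply: filterS => y; rewrite [x + _]addrC subrK.
Unshelve. all: by end_near. Qed.

Definition generator X a : A := dderive (fun y => alpha y a) 0 X.

Lemma is_dderive_generator X a : is_dderive (fun y => alpha y a) 0 X (generator X a).
Proof.
have [l hl] := fdifferentiable_dderive X (smooth_alpha.1 a 0).
by rewrite /generator (dderiveE (sys_hausdorff hP) hl).
Qed.

Lemma generator_linear X (r : R[i]) a b : generator X (r *: a + b) = r *: generator X a + generator X b.
Proof.
apply: (dderiveE (sys_hausdorff hP)).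
have h := is_dderiveD (is_dderive_linear (L := fun a => r *: a) _ _ (is_dderive_generator (X := X) (a := a)))
  (is_dderive_generator (X := X) (a := b)).
apply: eq_is_dderive (h _ _) => [y|s a' b'|].
- by rewrite linearP.
- by rewrite !scalerBr !scalerA mulrC.
- by apply: tvs_cvgZ; [exact: cvg_cst|exact: cvg_id].
Qed.

Lemma generatorB X a b : generator X (a - b) = generator X a - generator X b.
Proof. by rewrite addrC -scaleN1r generator_linear scaleN1r addrC. Qed.

Lemma generator0 X : generator X 0 = 0.
Proof. by have := generatorB X 0 0; rewrite !subrr. Qed.

Lemma generatorZ X (r : R[i]) a : generator X (r *: a) = r *: generator X a.
Proof. by rewrite -[r *: a]addr0 generator_linear generator0 addr0. Qed.

Lemma generator_bound X n : exists m C, 0 <= C /\ forall a, P n (generator X a) <= C * P m a.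
Proof.
apply: (continuous_linear_bound hP hP) => [r a|]; first exact: generatorZ.
by rewrite -[X in _ --> X](generator0 X); exact: smooth_alpha.2 X 0.
Qed.

Lemma alphaB x a b : alpha x (a - b) = alpha x a - alpha x b.
Proof. by rewrite linearB. Qed.

Lemma cvg_alpha (T : Type) (F : set_system T) {FF : Filter F} (x : T -> V) (a : T -> A) x0 a0 :
  x @ F --> x0 -> a @ F --> a0 -> (fun t => alpha (x t) (a t)) @ F --> alpha x0 a0.
Proof.
move=> xx; apply: (equicontinuous_cvg hP (G := alpha)).
- by move=> ? ? ?; exact: alphaB.
- by move=> n; exists n, 1; split=> // y a'; rewrite isoP mul1r.
- exact: cvg_comp xx (fdifferentiable_continuous (smooth_alpha.1 a0 x0)).
Qed.

(** The group law transports the derivative at 0 along the orbit. *)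
Lemma is_dderive_orbit a x X : is_dderive (fun y => alpha y a) x X (alpha x (generator X a)).
Proof.
have h := is_dderive_linear (L := alpha x) _ _ (is_dderive_generator (X := X) (a := a)).
have {}h : is_dderive (fun y => alpha x (alpha y a)) 0 X (alpha x (generator X a)).
  apply: h => [r a' b'|]; first by rewrite linearZ linearB.
  by apply: (cvg_alpha (x := fun=> x)); [exact: cvg_cst|exact: cvg_id].
apply: eq_cvg_fun h => k.
by rewrite add0r alpha0 alphaD.
Qed.

Section Twist.
Variable L : V -> V.
Hypothesis LD : forall x y, L (x + y) = L x + L y.
Hypothesis LZ : forall (r : R) x, L (r *: x) = r *: L x.

Lemma linear_map_continuous : continuous L.
Proof.
have -> : L = fun x => \sum_(i < d) dotp x (e i) *: L (e i).
  apply/funext => x; rewrite {1}(euclidean_expand hE x).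
  have L0 : L 0 = 0 by rewrite -(scale0r (0 : V)) LZ !scale0r.
  by rewrite (big_morph L LD L0); apply: eq_bigr => i _; rewrite LZ.
apply: continuous_big => [|i _ x]; first exact: add_continuous.
by apply: cvgZr_tmp; exact: (dotl_continuous hE).
Qed.

Lemma is_dderive_twist (g : V -> A) x v l : is_dderive g x v l ->
  is_dderive (fun y => alpha (L y) (g y)) x v (alpha (L x) (generator (L v) (g x) + l)).
Proof.
move=> gl; rewrite linearD.
have h1 : is_dderive (fun y => alpha (L y) (g x)) x v (alpha (L x) (generator (L v) (g x))).
  have E : L v = L (x + v) - L x by rewrite LD addrC addKr.
  have := is_dderive_orbit (a := g x) (x := L x) (X := L v); rewrite {1}E.
  by apply: is_dderive_comp_linear => h; rewrite -E LD LZ.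
have cx : (fun h : R => L (x + h *: v)) @ 0^' --> L x.
  have cx : (fun h : R => x + h *: v) @ 0^' --> x.
    rewrite -[X in _ --> X]addr0 -(scale0r v); apply: cvgD; first exact: cvg_cst.
    by apply: cvgZr_tmp; exact: cvg_within.
  exact: cvg_comp cx (linear_map_continuous (x := x)).
have h2 := cvg_alpha (FF := punctured_filter R) cx gl.
apply: eq_cvg_fun (tvs_cvgD (FF := punctured_filter R) h1 h2) => h /=.
by rewrite linearZ/= -scalerDr alphaB addrC addrA subrK.
Qed.

Definition twist (f : V -> A) y : A := alpha (L y) (f y).

Lemma schwartz_operator_pointwise (B : A -> A) T :
  (forall (r : R) a b, B (r%:C *: (a - b)) = r%:C *: (B a - B b)) ->
  (forall n, exists m C, 0 <= C /\ forall a, P n (B a) <= C * P m a) ->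
  schwartz_operator T -> schwartz_operator (fun f x => B (T f x)).
Proof.
move=> BB bB hT.
have cB : continuous B.
  apply: (linear_bound_continuous hP hP) bB => a b.
  by rewrite -[a - b]scale1r -[1]/((1 : R)%:C) BB scale1r.
apply: (@schwartz_operator_class _ _ _ _ hP
  (fun T' => exists T, schwartz_operator T /\ T' = fun f x => B (T f x))); last by exists T.
- move=> _ [U [hU ->]] f hf x.
  apply: (@continuous_comp _ _ _ (U f) B); last exact: cB.
  exact: (schwartz_operator_continuous hU hf).
- move=> _ [U [hU ->]] v; exists (fun f x => B (iter_dderive [:: v] (U f) x)); split.
    by exists (fun f => iter_dderive [:: v] (U f)); split=> //; exact: (schwartz_operator_dderive hP).
  by move=> f hf x; apply: (is_dderive_linear (L := B) BB (cB _) (schwartz_operator_is_dderive hP hU hf)).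
- move=> _ [U [hU ->]] n k; have [m [C [C0 hC]]] := bB n.
  apply: schwartz_bounded_le (schwartz_boundedZ C0 (schwartz_operator_bound m k hU)) _ => // f _ x.
  by rewrite mulrCA ler_wpM2l ?exprn_ge0.
Qed.

(** A derivative of a twisted function is the twist of its derivative and of
    its image under a generator, so the family of twists of Schwartz operators
    is stable under differentiation. *)
Lemma schwartz_operator_twist T : schwartz_operator T ->
  schwartz_operator (fun f => twist (T f)).
Proof.
move=> hT.
apply: (@schwartz_operator_class _ _ _ _ hP
  (fun T' => exists T, schwartz_operator T /\ T' = fun f => twist (T f))); last by exists T.
- move=> _ [U [hU ->]] f hf x.
  by apply: cvg_alpha; [exact: linear_map_continuous|exact: (schwartz_operator_continuous hU hf)].
- move=> _ [U [hU ->]] v; eexists; split; last first.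
    move=> f hf x; apply: is_dderive_twist; exact: (schwartz_operator_is_dderive hP hU hf).
  exists (fun f y => generator (L v) (U f y) + iter_dderive [:: v] (U f) y); split=> //.
  apply: (schwartz_operatorD hP); last exact: (schwartz_operator_dderive hP).
  apply: schwartz_operator_pointwise => // [r a b|n]; last exact: generator_bound.
  by rewrite generatorZ generatorB.
- move=> _ [U [hU ->]] n k.
  by apply: schwartz_bounded_le (schwartz_operator_bound n k hU) _ => // f _ x; rewrite isoP.
Qed.

(** The operator Theta, through the two transforms of opposite signs for which
    inversion is stated. *)
Definition theta f := ft dotp e 1 (twist (ft dotp e (-1) f)).

Lemma schwartz_operator_theta : schwartz_operator theta.
Proof.
apply: (schwartz_operator_ft hE hP cP); first by rewrite normr1.
apply: schwartz_operator_twist.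
apply: (schwartz_operator_ft hE hP cP); first by rewrite normrN normr1.
exact: schwartz_operator_id.
Qed.

Lemma ft_theta f : S f -> ft dotp e (-1) (theta f) = twist (ft dotp e (-1) f).
Proof.
move=> hf; apply: (ft_inversion hE hP cP); first by rewrite expr1n.
suff h : schwartz_operator (fun f => twist (ft dotp e (-1) f)) by exact: h.1.
apply: schwartz_operator_twist; apply: (schwartz_operator_ft hE hP cP).
  by rewrite normrN normr1.
exact: schwartz_operator_id.
Qed.

End Twist.

(** On the Fourier side the two multipliers cancel pointwise. *)
Lemma thetaK (L M : V -> V) f :
  (forall x y, L (x + y) = L x + L y) -> (forall (r : R) x, L (r *: x) = r *: L x) ->
  (forall x, M x = - L x) -> S f -> theta M (theta L f) = f.
Proof.
move=> LD LZ ML hf; rewrite {1}/theta ft_theta//.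
rewrite (_ : twist M _ = ft dotp e (-1) f).
  by rewrite -[X in ft _ _ X]opprK; apply: (ft_inversion hE hP cP) => //; rewrite sqrrN expr1n.
by apply/funext => y; rewrite /twist -alphaD ML addNr alpha0.
Qed.

End Action.

(** * The two representations *)

Section Representations.
Context {R : realType} {V : normedModType R}.
Context {dotp : {dot V for @idfun R}} {d : nat} {e : 'I_d -> V}.
Variable hE : euclidean_space dotp e.
Context {A : tvsType R[i]}.
Variables (P : nat -> A -> R) (hP : seminorm_system P) (cP : complete_system P).
Variable (mul : {bilinear A -> A -> A}).
Hypothesis cmul : continuous (fun ab : A * A => mul ab.1 ab.2).
Variables (alpha : V -> {linear A -> A}).
Hypothesis alpha0 : forall a, alpha 0 a = a.
Hypothesis alphaD : forall x y a, alpha (x + y) a = alpha x (alpha y a).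
Hypothesis isoP : forall n x a, P n (alpha x a) = P n a.
Hypothesis smooth_alpha : smooth_action alpha.
Variable (J : {linear V -> V}).
Local Notation S := (@schwartz R V A).
Local Notation chi := (character dotp).
Local Notation w := (weight dotp e).
Local Notation wdominated := (wdominated (dotp := dotp) (e := e) P).
Local Notation wdominated2 := (wdominated2 (dotp := dotp) (e := e) P).
Local Notation ft := (ft dotp e).
Implicit Types (x y z : V) (a b : A) (f g xi : V -> A).

Lemma cvg_mul (T : Type) (F : set_system T) {FF : Filter F} (a b : T -> A) a0 b0 :
  a @ F --> a0 -> b @ F --> b0 -> (fun t => mul (a t) (b t)) @ F --> mul a0 b0.
Proof. move=> aa bb.
have h := @cvg_comp _ _ _ (fun t => (a t, b t)) (fun ab : A * A => mul ab.1 ab.2) _ _ _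
  (cvg_pair aa bb) (@cmul (a0, b0)).
exact: h.
Qed.

Lemma alphaZ x k a : alpha x (k *: a) = k *: alpha x a. Proof. by rewrite linearZ. Qed.
Lemma mulZl k a b : mul (k *: a) b = k *: mul a b. Proof. by rewrite linearZl_LR. Qed.
Lemma mulZr k a b : mul a (k *: b) = k *: mul a b. Proof. by rewrite linearZr_LR. Qed.

Lemma JD x y : J (x + y) = J x + J y. Proof. exact: linearD. Qed.
Lemma JZ (r : R) x : J (r *: x) = r *: J x. Proof. exact: linearZ. Qed.

Lemma J_continuous : continuous J.
Proof. exact: (linear_map_continuous hE JD JZ). Qed.

Lemma mul_boundedl (k : R[i]) x b n : exists m C, 0 <= C /\
  forall a, P n (k *: mul (alpha x a) b) <= C * P m a.
Proof.
have [m [C [C0 hC]]] := bilinear_bound hP cmul n.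
exists m, (normc k * (C * P m b)); rewrite !mulr_ge0 ?normc_ge0 ?sys_ge0//; split=> // a.
rewrite (sysZ hP) -mulrA ler_wpM2l ?normc_ge0//; apply: le_trans (hC _ _) _.
by rewrite isoP mulrAC.
Qed.

Lemma mul_boundedr a n : exists m C, 0 <= C /\ forall b, P n (mul a b) <= C * P m b.
Proof.
have [m [C [C0 hC]]] := bilinear_bound hP cmul n.
by exists m, (C * P m a); rewrite mulr_ge0 ?sys_ge0.
Qed.

Lemma intV_mull (k : R[i]) x b F : wdominated F ->
  intV e (fun z => k *: mul (alpha x (F z)) b) = k *: mul (alpha x (intV e F)) b.
Proof.
apply: (intV_linear hE hP cP (L := fun a => k *: mul (alpha x a) b)) => [r a a'|n].
  by rewrite linearP linearDl linearZl_LR scalerDr !scalerA mulrC.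
exact: mul_boundedl.
Qed.

Lemma intV_mulr a F : wdominated F -> intV e (fun z => mul a (F z)) = mul a (intV e F).
Proof.
apply: (intV_linear hE hP cP (L := mul a)) => [r b b'|n]; last exact: mul_boundedr.
by rewrite linearP.
Qed.

Lemma wdominated2_mul (h k : V * V -> A) (p q : V -> A) :
  continuous h -> continuous k -> wdominated p -> wdominated q ->
  (forall n (z : V * V), P n (h z) = P n (p z.1)) -> (forall n (z : V * V), P n (k z) = P n (q z.2)) ->
  wdominated2 (fun z : V * V => mul (h z) (k z)).
Proof.
move=> ch ck [cp bp] [cq bq] hp kq; split=> [z|n]; first by apply: cvg_mul; [exact: ch|exact: ck].
have [m [C [C0 hC]]] := bilinear_bound hP cmul n.
have [D [D0 hD]] := bp m; have [D' [D'0 hD']] := bq m.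
exists (C * D * D'); split=> [|z]; first by rewrite !mulr_ge0.
apply: le_trans (hC _ _) _; rewrite hp kq -!mulrA ler_wpM2l//.
rewrite [leRHS](_ : _ = (D * w z.1) * (D' * w z.2)); last by ring.
by rewrite ler_pM ?sys_ge0.
Qed.

Lemma continuous_pair_fst (f : V -> A) : continuous f -> continuous (fun z : V * V => f z.1).
Proof. by move=> cf z; apply: (@continuous_comp _ _ _ fst f); [exact: cvg_fst|exact: cf]. Qed.

Lemma continuous_pair_snd (f : V -> A) : continuous f -> continuous (fun z : V * V => f z.2).
Proof. by move=> cf z; apply: (@continuous_comp _ _ _ snd f); [exact: cvg_snd|exact: cf]. Qed.

Lemma cvg_character (T : Type) (F : set_system T) {FF : Filter F} (x y : T -> V) x0 y0 :
  x @ F --> x0 -> y @ F --> y0 ->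
  (fun t => chi (x t) (y t) : R[i]^o) @ F --> (chi x0 y0 : R[i]^o).
Proof.
move=> xx yy.
exact: continuous2_cvg (character_continuous hE (x := (x0, y0))) xx yy.
Qed.

Lemma schwartz_ft (s : R) f : `|s| = 1 -> S f -> S (ft s f).
Proof.
move=> s1; exact: (schwartz_operator_ft hE hP cP s1 (schwartz_operator_id hP)).1.
Qed.

Lemma schwartz_fourier f : S f -> S (ft (-1) f).
Proof. by apply: schwartz_ft; rewrite normrN normr1. Qed.

Lemma ft_fourierK f : S f -> ft 1 (ft (-1) f) = f.
Proof.
move=> hf; rewrite -[X in ft X _]opprK; apply: (ft_inversion hE hP cP) => //.
by rewrite sqrrN expr1n.
Qed.

Lemma ThetaE (L : V -> V) f : Theta dotp e alpha L f = theta (dotp := dotp) (e := e) alpha L f.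
Proof.
apply/funext => x; rewrite /Theta /theta fourierE {1}/ft /twist.
by congr intV; apply/funext => y; rewrite scale1r.
Qed.

Lemma schwartz_theta (L : V -> V) f :
  (forall x y, L (x + y) = L x + L y) -> (forall (r : R) x, L (r *: x) = r *: L x) ->
  S f -> S (theta (dotp := dotp) (e := e) alpha L f).
Proof.
move=> LD LZ hf.
exact: (schwartz_operator_theta hE hP cP alpha0 alphaD isoP smooth_alpha LD LZ).1.
Qed.

Lemma ft_translation xi z y : S xi ->
  ft (-1) (translation z xi) y = chi (- y) z *: ft (-1) xi y.
Proof.
move=> hxi; have dom := wdominated_ft hE hP (-1) y (schwartz_wdominated hE hP hxi).
have domz : wdominated (fun u => chi (- y) z *: (chi (-1 *: y) u *: xi u)).
  exact: (wdominatedZ hP _ dom).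
rewrite -(intVZ hE hP cP _ dom) -(intV_translate hE hP cP (- z) domz).
congr intV; apply/funext => u; rewrite /translation scaleN1r addrC scalerA.
by rewrite -characterDr addrA subrr add0r.
Qed.

(** Both sides equal
      int alpha_(Jy - x) (fhat y) xihat(y) e(x.y) dy,
    the left one by Fubini and the right one after expanding xi by Fourier
    inversion. *)
Theorem deformed_rep_theta f xi : S f -> S xi ->
  integrated_form e (deformed_rep dotp e alpha mul J) f xi =
  integrated_form e (crossed_rep alpha mul) (Theta dotp e alpha J f) xi.
Proof.
move=> hf hxi; apply/funext => x; rewrite ThetaE.
have domf := schwartz_wdominated hE hP hf.
have hfh := schwartz_fourier hf; have hxih := schwartz_fourier hxi.
have domxih := schwartz_wdominated hE hP hxih.
have hth := schwartz_theta JD JZ hf.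
set th := theta alpha J f in hth *.
have domth := schwartz_wdominated hE hP hth.
transitivity (intV e (fun y => chi x y *: mul (alpha (J y - x) (ft (-1) f y)) (ft (-1) xi y))).
  pose F (q : V * V) := mul (alpha (J q.2 - x) (f q.1))
     ((chi x q.2 * chi (- q.2) q.1) *: ft (-1) xi q.2).
  have domF : wdominated2 F.
    apply: (wdominated2_mul (p := f) (q := ft (-1) xi)) => //.
    - move=> q; apply: (cvg_alpha hP isoP smooth_alpha); last exact: (continuous_pair_fst domf.1).
      apply: cvgB; last exact: cvg_cst.
      by apply: (@continuous_comp _ _ _ snd J); [exact: cvg_snd|exact: J_continuous].
    - move=> q; apply: tvs_cvgZ; last exact: (continuous_pair_snd domxih.1).
      apply: (@tvs_cvgZ R R[i]^o _ _ _ (fun q : V * V => chi x q.2) (fun q : V * V => chi (- q.2) q.1)).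
        by apply: cvg_character; [exact: cvg_cst|exact: cvg_snd].
      by apply: cvg_character; [apply: cvgN; exact: cvg_snd|exact: cvg_fst].
    - by move=> n q; rewrite (sysZ hP) Normc.normcM !normc_character !mul1r.
  rewrite /integrated_form /deformed_rep.
  transitivity (intV e (fun z => intV e (fun y => F (z, y)))).
    congr intV; apply/funext => z; congr intV; apply/funext => y.
    by rewrite fourierE ft_translation// /F /= !mulZr scalerA.
  rewrite (intV_swap hE hP cP domF); congr intV; apply/funext => y.
  rewrite -(intV_mull _ _ _ (wdominated_ft hE hP (-1) y domf)).
  congr intV; apply/funext => z; rewrite /F /= scaleN1r alphaZ mulZl mulZr.
  by rewrite scalerA.
pose G (q : V * V) := mul (alpha (- x) (th q.1)) (chi (x - q.1) q.2 *: ft (-1) xi q.2).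
have domG : wdominated2 G.
  apply: (wdominated2_mul (p := th) (q := ft (-1) xi)) => //.
  - move=> q; apply: (cvg_alpha hP isoP smooth_alpha); first exact: cvg_cst.
    exact: (continuous_pair_fst domth.1).
  - move=> q; apply: tvs_cvgZ; last exact: (continuous_pair_snd domxih.1).
    apply: cvg_character; last exact: cvg_snd.
    by apply: cvgB; [exact: cvg_cst|exact: cvg_fst].
  - by move=> n q; rewrite (sysZ hP) normc_character mul1r.
rewrite /integrated_form /crossed_rep /translation.
transitivity (intV e (fun z => intV e (fun y => G (z, y)))); last first.
  congr intV; apply/funext => z.
  have -> : xi (x - z) = intV e (fun y => chi (x - z) y *: ft (-1) xi y).
    by rewrite -[in LHS](ft_fourierK hxi) {1}/ft scale1r.
  rewrite -intV_mulr//.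
  have := wdominated_ft hE hP 1 (x - z) domxih.
  by rewrite scale1r.
rewrite (intV_swap hE hP cP domG); congr intV; apply/funext => y.
rewrite -[RHS](_ : intV e (fun z => chi x y *: mul (alpha (- x) (chi (-1 *: y) z *: th z)) (ft (-1) xi y)) = _).
  rewrite intV_mull; last exact: wdominated_ft.
  rewrite -/(ft (-1) th y) (ft_theta hE hP cP alpha0 alphaD isoP smooth_alpha JD JZ hf).
  by rewrite /twist -alphaD addrC.
congr intV; apply/funext => z; rewrite /G /= alphaZ mulZl mulZr scalerA.
by rewrite scaleN1r characterD (characterC (- y)) characterNr.
Qed.

End Representations.

(** * Oscillatory integrals in one variable *)

Arguments Normc.normc : simpl never.

Lemma is_dderive_eq (R : realType) (W : normedModType R) (A : tvsType R[i])
    (f : W -> A) (x v : W) (l l' : A) :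
  is_dderive f x v l -> l = l' -> is_dderive f x v l'.
Proof. by move=> h <-. Qed.

Section UniformBounds.
Context {R : realType} {A : tvsType R[i]}.
Variables (P : nat -> A -> R) (hP : seminorm_system P).
Context {T : Type}.
Variable D : set T.

(** Estimates of X by a single seminorm, with constants independent of the
    parameter in D. *)
Definition uniform_bound (X : T -> A -> R) : Prop :=
  exists m C, 0 <= C /\ forall t a, D t -> X t a <= C * P m a.

Lemma uniform_bound_le X Y : uniform_bound Y ->
  (forall t a, D t -> X t a <= Y t a) -> uniform_bound X.
Proof.
move=> [m [C [C0 hC]]] XY; exists m, C; split=> // t a Dt.
exact: le_trans (XY t a Dt) (hC t a Dt).
Qed.

Lemma uniform_boundD X Y : uniform_bound X -> uniform_bound Y ->
  uniform_bound (fun t a => X t a + Y t a).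
Proof.
move=> [m [C [C0 hC]]] [m' [C' [C'0 hC']]]; exists (maxn m m'), (C + C').
split=> [|t a Dt]; first exact: addr_ge0.
rewrite mulrDl; apply: lerD.
  by apply: le_trans (hC t a Dt) _; rewrite ler_wpM2l// (sys_mono hP)// leq_maxl.
by apply: le_trans (hC' t a Dt) _; rewrite ler_wpM2l// (sys_mono hP)// leq_maxr.
Qed.

Lemma uniform_boundZ X (c : R) : 0 <= c -> uniform_bound X ->
  uniform_bound (fun t a => c * X t a).
Proof.
move=> c0 [m [C [C0 hC]]]; exists m, (c * C); split=> [|t a Dt]; first exact: mulr_ge0.
by rewrite -mulrA ler_wpM2l// hC.
Qed.

Lemma uniform_bound_comp X (B : A -> A) : uniform_bound X ->
  (forall n, exists m C, 0 <= C /\ forall a, P n (B a) <= C * P m a) ->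
  uniform_bound (fun t a => X t (B a)).
Proof.
move=> [m [C [C0 hC]]] bB; have [m' [C' [C'0 hC']]] := bB m.
exists m', (C * C'); split=> [|t a Dt]; first exact: mulr_ge0.
by apply: le_trans (hC t _ Dt) _; rewrite -mulrA ler_wpM2l.
Qed.

End UniformBounds.

Section Oscillatory.
Context {R : realType} {V : normedModType R}.
Context {dotp : {dot V for @idfun R}} {d : nat} {e : 'I_d -> V}.
Variable hE : euclidean_space dotp e.
Local Notation chi := (character dotp).
Local Notation w := (weight dotp e).
Local Notation symbol := (symbol (dotp := dotp) (e := e)).
Local Notation resolvent := (resolvent (dotp := dotp) (e := e)).
Implicit Types (x u v : V).

Definition resolvent_prod (l : seq 'I_d) x : R[i]^o :=
  \prod_(j <- l) (resolvent j x : R[i]).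

Lemma resolvent_prod_cons j l x :
  resolvent_prod (j :: l) x = (resolvent j x : R[i]) * resolvent_prod l x.
Proof. by rewrite /resolvent_prod big_cons. Qed.

Lemma resolvent_prod_symbol l : symbol false (resolvent_prod l).
Proof.
elim: l => [|j l IH].
  rewrite (_ : resolvent_prod [::] = fun=> 1); first exact: symbol_cst.
  by apply/funext => x; rewrite /resolvent_prod big_nil.
rewrite (_ : resolvent_prod _ = fun x => (resolvent j x : R[i]) * resolvent_prod l x).
  by apply: symbolM => //; exact: symbol_resolvent.
by apply/funext => x; rewrite resolvent_prod_cons.
Qed.

(** Each coordinate twice: the modulus of the product is the weight. *)
Definition all_twice : seq 'I_d := index_enum 'I_d ++ index_enum 'I_d.

Lemma normc_prod (l : seq 'I_d) (F : 'I_d -> R[i]) :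
  normc (\prod_(j <- l) F j) = \prod_(j <- l) normc (F j).
Proof. by rewrite (big_morph _ (@Normc.normcM R) (Normc.normc1 R)). Qed.

Lemma normc_resolvent_twice x : normc (resolvent_prod all_twice x) = w x.
Proof.
rewrite normc_prod big_cat /= -big_split /=; apply: eq_bigr => j _.
by rewrite -expr2 normc_resolvent2.
Qed.

Lemma prod_denominators_twice x :
  \prod_(j <- all_twice) normc (1 +i* dotp x (e j)) = (w x)^-1.
Proof.
apply: (mulIf (x := w x)); first by rewrite gt_eqF// weight_gt0.
rewrite mulVf ?gt_eqF ?weight_gt0// -normc_resolvent_twice normc_prod -big_split /=.
by rewrite big1// => j _; rewrite -Normc.normcM resolventK Normc.normc1.
Qed.

Lemma is_dderive_resolvent_prod l v : exists s, symbol false s /\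
  forall x, is_dderive (resolvent_prod l) x v ((resolvent_prod l x : R[i]) * s x).
Proof.
elim: l => [|j l [s [ss ds]]].
  exists (fun=> 0); split=> [|x]; first exact: symbol_cst.
  rewrite mulr0; have h : is_dderive (fun _ : V => 1 : R[i]^o) x v 0 by exact: is_dderive_cst.
  by apply: eq_is_dderive h => y; rewrite /resolvent_prod big_nil.
exists (fun x => - ('i * (dotp v (e j))%:C) * resolvent j x + s x); split=> [|x].
  apply: (symbolD (m := fun x => - ('i * (dotp v (e j))%:C) * resolvent j x)) => //.
  apply: (symbolM (m := fun=> - ('i * (dotp v (e j))%:C))); first exact: symbol_cst.
  exact: symbol_resolvent.
have := is_dderiveZ (is_dderive_resolvent hE (j := j) (x := x) (v := v)) (ds x).
rewrite (_ : _ + _ = (resolvent_prod (j :: l) x : R[i]) *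
   (- ('i * (dotp v (e j))%:C) * resolvent j x + s x)); last first.
  by rewrite resolvent_prod_cons /GRing.scale /=; ring.
by apply: eq_is_dderive => y; rewrite resolvent_prod_cons.
Qed.

(** Amplitudes decaying like the weight. Their derivatives decay in the same
    way, because each derivative of the product of resolvents is a multiple of
    it. *)
Definition decaying (q : V -> R[i]^o) : Prop := exists m, symbol false m /\
  q = fun x => (resolvent_prod all_twice x : R[i]) * m x.

Lemma decaying_resolvent : decaying (resolvent_prod all_twice).
Proof.
exists (fun=> 1); split; first exact: symbol_cst.
by apply/funext => x; rewrite mulr1.
Qed.

Lemma decaying_continuous q : decaying q -> continuous q.
Proof.
move=> [m [sm ->]] x.
exact: tvs_cvgZ (symbol_continuous hE (resolvent_prod_symbol all_twice) (x := x))
                (symbol_continuous hE sm (x := x)).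
Qed.

Lemma decaying_bound q : decaying q -> exists C, 0 <= C /\ forall x, normc (q x) <= C * w x.
Proof.
move=> [m [/symbol_bounded[C [C0 hC]] ->]]; exists C; split=> // x.
by rewrite Normc.normcM normc_resolvent_twice mulrC ler_wpM2r// ltW// weight_gt0.
Qed.

Lemma decaying_dderive q v : decaying q -> exists q', decaying q' /\
  forall x, is_dderive q x v (q' x).
Proof.
move=> [m [sm ->]]; have [s [ss ds]] := is_dderive_resolvent_prod all_twice v.
have [m' [sm' dm']] := symbol_dderive hE v sm.
exists (fun x => (resolvent_prod all_twice x : R[i]) * (s x * m x + m' x)); split=> [|x].
  eexists; split; last by reflexivity.
  by apply: (symbolD (m := fun x => (s x : R[i]) * m x)) => //; exact: symbolM.
have := is_dderiveZ (ds x) (dm' x).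
by rewrite mulrDr mulrA.
Qed.

(** Bounded functions with bounded derivatives of all orders; Q plays the role
    of the family of derivatives. *)
Definition bounded_smooth (psi : V * V -> R[i]^o) : Prop :=
  exists Q : (V * V -> R[i]^o) -> Prop, Q psi /\ forall q, Q q ->
    [/\ continuous q, exists C, 0 <= C /\ forall z, normc (q z) <= C &
        forall dir : V * V, exists q', Q q' /\ forall z, is_dderive q z dir (q' z)].

Lemma bounded_smooth_dderive psi (dir : V * V) : bounded_smooth psi ->
  exists psi', bounded_smooth psi' /\ forall z, is_dderive psi z dir (psi' z).
Proof.
move=> [Q [Qpsi hQ]]; have [_ _ /(_ dir)[q [Qq dq]]] := hQ _ Qpsi.
by exists q; split=> //; exists Q.
Qed.

Lemma bounded_smooth_cst (k : R[i]) : bounded_smooth (fun=> k).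
Proof.
exists (fun q => exists k, q = fun=> k); split; first by exists k.
move=> _ [{}k ->]; split; first by move=> z; exact: cvg_cst.
- by exists (normc k); rewrite normc_ge0.
- move=> v; exists (fun=> 0); split=> [|z]; first by exists 0.
  exact: is_dderive_cst.
Qed.

Lemma is_dderive_dilate_l (psi psi' : V * V -> R[i]^o) (ep : R) v (y : V) x :
  (forall z, is_dderive psi z (v, 0) (psi' z)) ->
  is_dderive (fun x : V => psi (ep *: x, ep *: y)) x v (ep%:C *: psi' (ep *: x, ep *: y)).
Proof.
move=> dpsi.
have E : ep *: (v, 0) = (ep *: (x + v), ep *: y) - (ep *: x, ep *: y) :> V * V.
  by apply/eqP; rewrite xpair_eqE /= scaler0 subrr eqxx scalerDr addrC addKr eqxx.
have := is_dderive_scale (r := ep) (dpsi (ep *: x, ep *: y)); rewrite E.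
apply: (is_dderive_comp_linear (W' := V) (L := fun x => (ep *: x, ep *: y))) => h.
rewrite -E; apply/eqP; rewrite xpair_eqE /= scalerDr !scalerA (mulrC h) eqxx.
by rewrite scaler0 addr0 eqxx.
Qed.

Lemma is_dderive_dilate_r (psi psi' : V * V -> R[i]^o) (ep : R) v (x : V) y :
  (forall z, is_dderive psi z (0, v) (psi' z)) ->
  is_dderive (fun y : V => psi (ep *: x, ep *: y)) y v (ep%:C *: psi' (ep *: x, ep *: y)).
Proof.
move=> dpsi.
have E : ep *: (0, v) = (ep *: x, ep *: (y + v)) - (ep *: x, ep *: y) :> V * V.
  by apply/eqP; rewrite xpair_eqE /= scaler0 subrr eqxx scalerDr addrC addKr eqxx.
have := is_dderive_scale (r := ep) (dpsi (ep *: x, ep *: y)); rewrite E.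
apply: (is_dderive_comp_linear (W' := V) (L := fun y => (ep *: x, ep *: y))) => h.
rewrite -E; apply/eqP; rewrite xpair_eqE /= scalerDr !scalerA (mulrC h) eqxx.
by rewrite scaler0 addr0 eqxx.
Qed.

Lemma cvg_dilate (T : Type) (F : set_system T) {FF : Filter F} (psi : V * V -> R[i]^o) (ep : T -> R)
    (x y : T -> V) ep0 x0 y0 : {for (ep0 *: x0, ep0 *: y0), continuous psi} ->
  ep @ F --> ep0 -> x @ F --> x0 -> y @ F --> y0 ->
  (fun t => psi (ep t *: x t, ep t *: y t) : R[i]^o) @ F --> (psi (ep0 *: x0, ep0 *: y0) : R[i]^o).
Proof.
move=> cpsi epF xF yF; have h : (fun t => (ep t *: x t, ep t *: y t)) @ F --> (ep0 *: x0, ep0 *: y0).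
  by apply: cvg_pair; apply: cvgZ.
exact: cvg_comp h cpsi.
Qed.

Section OneVariable.
Context {A : tvsType R[i]}.
Variables (P : nat -> A -> R) (hP : seminorm_system P) (cP : complete_system P).
Variables (alpha : V -> {linear A -> A}).
Hypothesis alpha0 : forall a, alpha 0 a = a.
Hypothesis alphaD : forall x y a, alpha (x + y) a = alpha x (alpha y a).
Hypothesis isoP : forall n x a, P n (alpha x a) = P n a.
Hypothesis smooth_alpha : smooth_action alpha.
Variable (J : {linear V -> V}).
Local Notation wdominated := (wdominated (dotp := dotp) (e := e) P).

Definition osc_integrand (q : V -> R[i]^o) (psi : V * V -> R[i]^o) (ep : R) v (a : A) u : A :=
  (chi u v * (q u * psi (ep *: u, ep *: v))) *: alpha (J u) a.

(** The part in u of the regularized product; at ep = 0 the regularization is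
    gone. *)
Definition osc q psi ep v a : A := intV e (osc_integrand q psi ep v a).

Lemma cvg_osc_integrand (T : Type) (F : set_system T) {FF : Filter F} q psi
    (ep : T -> R) (v u : T -> V) (a : T -> A) ep0 v0 u0 a0 :
  continuous q -> continuous psi ->
  ep @ F --> ep0 -> v @ F --> v0 -> u @ F --> u0 -> a @ F --> a0 ->
  (fun t => osc_integrand q psi (ep t) (v t) (a t) (u t)) @ F -->
    osc_integrand q psi ep0 v0 a0 u0.
Proof.
move=> cq cpsi epF vF uF aF; apply: tvs_cvgZ.
  apply: (@tvs_cvgZ R R[i]^o _ _ _ (fun t => chi (u t) (v t))
    (fun t => (q (u t) : R[i]) * psi (ep t *: u t, ep t *: v t))).
    exact: (continuous2_cvg FF (@character_continuous _ _ _ _ _ hE (u0, v0)) uF vF).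
  apply: (@tvs_cvgZ R R[i]^o _ _ _ (fun t => q (u t)) (fun t => psi (ep t *: u t, ep t *: v t))).
    exact: cvg_comp uF (cq u0).
  exact: (cvg_dilate (@cpsi _) epF uF vF).
apply: (cvg_alpha hP isoP smooth_alpha) => //.
exact: cvg_comp uF (@J_continuous _ _ _ _ _ hE J u0).
Qed.

Lemma osc_integrand_bound q psi n : decaying q -> bounded_smooth psi ->
  exists C, 0 <= C /\ forall ep v a u, P n (osc_integrand q psi ep v a u) <= C * P n a * w u.
Proof.
move=> /decaying_bound[C [C0 hC]] [Q [Qpsi hQ]].
have [_ [D [D0 hD]] _] := hQ _ Qpsi; exists (C * D); split=> [|ep v a u]; first exact: mulr_ge0.
rewrite /osc_integrand (sysZ hP) isoP !Normc.normcM normc_character mul1r.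
rewrite (_ : C * D * P n a * w u = (C * w u * D) * P n a); last by ring.
by rewrite ler_wpM2r ?sys_ge0// ler_pM ?normc_ge0.
Qed.

Lemma osc_wdominated q psi ep v a : decaying q -> bounded_smooth psi ->
  wdominated (osc_integrand q psi ep v a).
Proof.
move=> hq hpsi; split=> [u|n].
  have [Q [Qpsi hQ]] := hpsi; have [cpsi _ _] := hQ _ Qpsi.
  exact: (cvg_osc_integrand (ep := fun=> ep) (v := fun=> v) (u := id) (a := fun=> a)
    (decaying_continuous hq) cpsi (cvg_cst _) (cvg_cst _) (@cvg_id _ _) (cvg_cst _)).
have [C [C0 hC]] := osc_integrand_bound n hq hpsi.
by exists (C * P n a); split=> // ; rewrite mulr_ge0// sys_ge0.
Qed.

(** Integration by parts against the character: the factor 1 + i v_j costs one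
    derivative of the amplitude, of the test function or of the orbit of a. *)
Lemma osc_parts q q' psi psi' ep v a j : decaying q -> decaying q' ->
  bounded_smooth psi -> bounded_smooth psi' ->
  (forall x, is_dderive q x (e j) (q' x)) -> (forall z, is_dderive psi z (e j, 0) (psi' z)) ->
  (1 +i* dotp v (e j)) *: osc q psi ep v a =
  osc q psi ep v a - ((2 * pi)^-1)%:C *: (osc q' psi ep v a + ep%:C *: osc q psi' ep v a +
     osc q psi ep v (generator alpha (J (e j)) a)).
Proof.
move=> hq hq' hpsi hpsi' dq dpsi.
have d1 := osc_wdominated ep v a hq hpsi; have d2 := osc_wdominated ep v a hq' hpsi.
have d3 := osc_wdominated ep v a hq hpsi'.
have d4 := osc_wdominated ep v (generator alpha (J (e j)) a) hq hpsi.
have dZ (k : R[i]) F : wdominated F -> wdominated (fun u => k *: F u).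
  exact: wdominatedZ.
set k := (2 * pi * dotp v (e j))%:C * 'i.
have h0 : k *: osc q psi ep v a + (osc q' psi ep v a + ep%:C *: osc q psi' ep v a +
     osc q psi ep v (generator alpha (J (e j)) a)) = 0.
  have d5 := wdominatedD hP (wdominatedD hP d2 (dZ ep%:C _ d3)) d4.
  rewrite /osc -(intVZ hE hP cP k d1) -(intVZ hE hP cP ep%:C d3).
  rewrite -(intVD hE hP cP d2 (dZ _ _ d3)).
  rewrite -(intVD hE hP cP (wdominatedD hP d2 (dZ _ _ d3)) d4) -(intVD hE hP cP (dZ _ _ d1) d5).
  apply: (intV_derivative0 hE hP cP (h := osc_integrand q psi ep v a) (v := e j)) => //.
    exact: (wdominatedD hP (dZ _ _ d1) d5).
  move=> u.
  have s1 := is_dderiveZ (dq u) (is_dderive_dilate_l (ep := ep) (v := e j) (y := v) (x := u) dpsi).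
  have s2 := is_dderiveZ (is_dderive_character (dotp := dotp) (y := v) (x := u) (v := e j)) s1.
  have dcst : is_dderive (fun _ : V => a) u (e j) 0 by exact: is_dderive_cst.
  have s3 := is_dderive_twist hE hP alpha0 alphaD isoP smooth_alpha (JD J) (JZ J)
    dcst.
  have h := is_dderiveZ s2 s3; rewrite /osc_integrand.
  apply: is_dderive_eq h _.
  rewrite !addr0 (dotC (e j)) -/k !scalerA addrA -!scalerDl; congr (_ *: _ + _ *: _).
    by rewrite /GRing.scale /=; ring.
  by rewrite /GRing.scale /= mulrA.
have p0 : (2 * pi)%:C != 0 :> R[i] by rewrite fmorph_eq0 mulf_neq0// gt_eqF// pi_gt0.
have E : 1 +i* dotp v (e j) = 1 + ((2 * pi)^-1)%:C * k.
  rewrite /k mulrA -rmorphM mulrA mulVf ?mul1r; last by rewrite mulf_neq0// gt_eqF// pi_gt0.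
  by apply/eqP; rewrite eq_complex /= !mul0r !mulr0 !mulr1 subr0 !addr0 !add0r !eqxx.
rewrite E scalerDl scale1r -scalerA; congr (_ + _).
by rewrite -scalerN; congr (_ *: _); apply/eqP; rewrite -addr_eq0 h0.
Qed.

(** Repeated integration by parts, one coordinate of the list at a time.
    Derivatives of the dilated test function bring factors ep, which are
    harmless for bounded ep. *)
Lemma osc_decay_list l q psi n : decaying q -> bounded_smooth psi ->
  uniform_bound P [set t : R * V | `|t.1| <= 1]
    (fun t a => (\prod_(j <- l) normc (1 +i* dotp t.2 (e j))) * P n (osc q psi t.1 t.2 a)).
Proof.
elim: l q psi => [|j l IH] q psi hq hpsi.
  have [C [C0 hC]] := osc_integrand_bound n hq hpsi.
  exists n, (C * weight_mass (dotp := dotp) (e := e)); split=> [|[ep v] a _].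
    by rewrite mulr_ge0// weight_mass_ge0.
  rewrite big_nil mul1r /= mulrAC.
  by apply: (intV_bound hE hP cP (osc_wdominated ep v a hq hpsi)) => u; exact: hC.
have [q' [hq' dq]] := decaying_dderive (e j) hq.
have [psi' [hpsi' dpsi]] := bounded_smooth_dderive (e j, 0) hpsi.
have p0 : 0 <= (2 * pi)^-1 :> R by rewrite invr_ge0 mulr_ge0// pi_ge0.
have h := uniform_boundD hP (uniform_boundD hP (IH _ _ hq' hpsi) (IH _ _ hq hpsi'))
  (uniform_bound_comp (IH _ _ hq hpsi) (generator_bound hP smooth_alpha (J (e j)))).
have {}h := uniform_boundD hP (IH _ _ hq hpsi) (uniform_boundZ p0 h).
apply: uniform_bound_le h _ => -[ep v] a /= ep1.
rewrite big_cons [leLHS]mulrAC [leLHS]mulrC -(sysZ hP) (osc_parts ep v a hq hq' hpsi hpsi' dq dpsi).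
rewrite -!mulrDr mulrCA -mulrDr; apply: ler_wpM2l; first by rewrite prodr_ge0// => i _; exact: normc_ge0.
apply: le_trans (sysB hP _ _ _) _; rewrite lerD2l (sysZr hP) ger0_norm//; apply: ler_wpM2l => //.
apply: le_trans (sysD hP _ _ _) _; rewrite lerD2r.
apply: le_trans (sysD hP _ _ _) _; rewrite lerD2l (sysZr hP).
by rewrite ler_piMl// sys_ge0.
Qed.

(** Two integrations by parts in every coordinate yield an integrable bound in
    v. *)
Lemma osc_decay q psi n : decaying q -> bounded_smooth psi ->
  exists m C, 0 <= C /\ forall ep v a, `|ep| <= 1 -> P n (osc q psi ep v a) <= C * P m a * w v.
Proof.
move=> hq hpsi; have [m [C [C0 hC]]] := osc_decay_list all_twice n hq hpsi.
exists m, C; split=> // ep v a ep1; have := hC (ep, v) a ep1.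
by rewrite prod_denominators_twice /= ler_pdivrMl ?weight_gt0// mulrC.
Qed.

Lemma osc_continuous q psi ep a : decaying q -> bounded_smooth psi ->
  continuous (fun v => osc q psi ep v a).
Proof.
move=> hq hpsi; have [Q [Qpsi hQ]] := hpsi; have [cpsi _ _] := hQ _ Qpsi.
apply: (intV_continuous hE hP cP) => [v|u|n].
- exact: (osc_wdominated ep v a hq hpsi).1.
- move=> v.
  exact: (cvg_osc_integrand (ep := fun=> ep) (v := id) (u := fun=> u) (a := fun=> a)
    (decaying_continuous hq) cpsi (cvg_cst _) (@cvg_id _ _) (cvg_cst _) (cvg_cst _)).
- have [C [C0 hC]] := osc_integrand_bound n hq hpsi.
  by exists (C * P n a); split=> //; rewrite mulr_ge0// sys_ge0.
Qed.

Lemma osc_cvg q psi v a : decaying q -> bounded_smooth psi ->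
  (fun ep => osc q psi ep v a) @ 0^' --> (psi (0, 0) : R[i]) *: osc q (fun=> 1) 0 v a.
Proof.
move=> hq hpsi; have [Q [Qpsi hQ]] := hpsi; have [cpsi _ _] := hQ _ Qpsi.
have d1 := osc_wdominated 0 v a hq (bounded_smooth_cst 1).
rewrite /osc -(intVZ hE hP cP _ d1).
rewrite (_ : (fun u => _ *: _) = osc_integrand q psi 0 v a); last first.
  apply/funext => u; rewrite /osc_integrand !scale0r scalerA; congr (_ *: _).
  by ring.
apply: (intV_cvg0 hE hP cP) => [ep _ _||n|u].
- exact: (osc_wdominated ep v a hq hpsi).1.
- exact: (osc_wdominated 0 v a hq hpsi).1.
- have [C [C0 hC]] := osc_integrand_bound n hq hpsi.
  by exists (C * P n a); split=> //; rewrite mulr_ge0// sys_ge0.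
- apply: (cvg_osc_integrand (FF := punctured_filter R)) => //.
  + exact: decaying_continuous.
  + exact: cvg_within.
  + exact: cvg_cst.
  + exact: cvg_cst.
  + exact: cvg_cst.
Qed.

End OneVariable.
End Oscillatory.

(** * The deformed product as an absolutely convergent integral *)

Section TestFunctions.
Context {R : realType} {V : normedModType R}.
Context {dotp : {dot V for @idfun R}} {d : nat} {e : 'I_d -> V}.
Variable hE : euclidean_space dotp e.
Local Notation w := (weight dotp e).
Implicit Types (psi : V * V -> R[i]^o).

Lemma test_function_continuous psi : test_function psi -> continuous psi.
Proof. by move=> [/(_ [::])[]]. Qed.

Lemma test_function_is_dderive psi (z dir : V * V) : test_function psi ->
  is_dderive psi z dir (dderive psi z dir).
Proof.
move=> [/(_ [::])[_ /(_ z dir)[l hl]] _].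
by rewrite (dderiveE (sys_hausdorff (@scalar_system R)) hl).
Qed.

Lemma test_function_dderive psi (dir : V * V) : test_function psi ->
  test_function (fun z => dderive psi z dir).
Proof.
move=> hpsi; have [spsi [K cK K0]] := hpsi; split.
  move=> s; have := spsi (rcons s dir).
  by rewrite /iter_dderive foldr_rcons.
exists K => // z nKz; apply: (dderiveE (sys_hausdorff (@scalar_system R))).
have clK : closed K by apply: compact_closed cK; exact: norm_hausdorff.
have hz : \forall y \near z, ~ K y.
  by have := open_nbhs_nbhs (conj (closed_openC clK) (nKz : (~` K) z)).
have hl : (fun h : R => z + h *: dir) @ 0^' --> z.
  rewrite -[X in _ --> X]addr0 -(scale0r dir); apply: cvgD; first exact: cvg_cst.
  by apply: cvgZr_tmp; exact: cvg_within.
apply: cvg_trans (punctured_cst (R := R) (0 : R[i]^o)); apply: near_eq_cvg.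
have := hl _ hz; apply: (@filterS _ _ (punctured_filter R)) => h /= nK.
by rewrite K0// K0// subrr scaler0.
Qed.

Lemma test_function_bound psi (g : V * V -> R) : test_function psi -> continuous g ->
  exists C, 0 <= C /\ forall z, normc (psi z) * `|g z| <= C.
Proof.
move=> hpsi cg; have [_ [K cK K0]] := hpsi.
have ch : continuous (fun z => normc (psi z) * g z).
  move=> z; apply: cvgM; last exact: cg.
  apply: (@continuous_comp _ _ _ psi (fun k : R[i]^o => normc k)).
    exact: test_function_continuous.
  exact: (sys_continuous (@scalar_system R) (n := 0%N)).
have : compact ((fun z => normc (psi z) * g z) @` K).
  by apply: continuous_compact cK; exact: continuous_subspaceT.
move=> /compact_bounded [M [_ hM]].
exists (`|M| + 1); split=> [|z]; first by rewrite addr_ge0.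
have [Kz|nKz] := pselect (K z).
  rewrite -[normc _]ger0_norm ?normc_ge0// -normrM; apply: hM; last by exists z.
  by have := ler_norm M; lra.
by rewrite K0// Normc.normc0 mul0r addr_ge0.
Qed.

Lemma test_function_bounded_smooth psi : test_function psi -> bounded_smooth psi.
Proof.
move=> hpsi; exists (@test_function R V); split=> // q hq; split.
- exact: test_function_continuous.
- have [C [C0 hC]] := test_function_bound hq (fun z => cvg_cst (1 : R) (F := nbhs z)).
  by exists C; split=> // z; have := hC z; rewrite normr1 mulr1.
- move=> dir; exists (fun z => dderive q z dir); split; first exact: test_function_dderive.
  by move=> z; exact: test_function_is_dderive.
Qed.

(** A dilated test function has compact support, on which the weights are
    bounded below. *)
Lemma test_function_dilate psi (ep : R) : test_function psi -> ep != 0 ->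
  exists C, 0 <= C /\ forall x y, normc (psi (ep *: x, ep *: y)) <= C * (w x * w y).
Proof.
move=> hpsi ep0.
have cg : continuous (fun z : V * V => (1 + `|z.1|) ^+ (2 * d) * (1 + `|z.2|) ^+ (2 * d)).
  move=> z; apply: cvgM.
    apply: (@continuous_comp _ _ _ (fun z : V * V => 1 + `|z.1|) (fun a : R => a ^+ (2 * d))).
      by apply: cvgD; [exact: cvg_cst|apply: cvg_norm; exact: cvg_fst].
    exact: exprn_continuous.
  apply: (@continuous_comp _ _ _ (fun z : V * V => 1 + `|z.2|) (fun a : R => a ^+ (2 * d))).
    by apply: cvgD; [exact: cvg_cst|apply: cvg_norm; exact: cvg_snd].
  exact: exprn_continuous.
have [M [M0 hM]] := test_function_bound hpsi cg.
pose k := 1 + `|ep|^-1.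
have k0 : 0 <= k by rewrite addr_ge0// invr_ge0.
have hk x : (w x)^-1 <= k ^+ (2 * d) * (1 + `|ep *: x|) ^+ (2 * d).
  apply: le_trans (weight_inv_le hE x) _; rewrite -exprMn.
  rewrite lerXn2r ?nnegrE ?addr_ge0 ?mulr_ge0// normrZ /k.
  rewrite mulrDl mul1r mulrDr mulr1 mulrA mulVf ?normr_eq0// mul1r.
  have : 0 <= `|ep|^-1 by rewrite invr_ge0.
  by have := mulr_ge0 (normr_ge0 ep) (normr_ge0 x); have := normr_ge0 x; lra.
exists (M * (k ^+ (2 * d) * k ^+ (2 * d))); split=> [|x y].
  by rewrite !mulr_ge0// exprn_ge0.
rewrite -ler_pdivrMr ?mulr_gt0 ?weight_gt0// invfM.
apply: (@le_trans _ _ (normc (psi (ep *: x, ep *: y)) *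
    ((k ^+ (2 * d) * (1 + `|ep *: x|) ^+ (2 * d)) * (k ^+ (2 * d) * (1 + `|ep *: y|) ^+ (2 * d))))).
  rewrite ler_wpM2l ?normc_ge0//; apply: ler_pM => //.
    by rewrite invr_ge0 ltW// weight_gt0.
  by rewrite invr_ge0 ltW// weight_gt0.
have := hM (ep *: x, ep *: y); rewrite /= ger0_norm ?mulr_ge0 ?exprn_ge0 ?addr_ge0// => h.
have kk : 0 <= k ^+ (2 * d) * k ^+ (2 * d) by rewrite mulr_ge0// exprn_ge0.
have := ler_wpM2r kk h; apply: le_trans.
rewrite le_eqVlt; apply/orP; left; apply/eqP; ring.
Qed.

End TestFunctions.

Section RieffelProduct.
Context {R : realType} {V : normedModType R}.
Context {dotp : {dot V for @idfun R}} {d : nat} {e : 'I_d -> V}.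
Variable hE : euclidean_space dotp e.
Context {A : tvsType R[i]}.
Variables (P : nat -> A -> R) (hP : seminorm_system P) (cP : complete_system P).
Variable (mul : {bilinear A -> A -> A}).
Hypothesis cmul : continuous (fun ab : A * A => mul ab.1 ab.2).
Variables (alpha : V -> {linear A -> A}).
Hypothesis alpha0 : forall a, alpha 0 a = a.
Hypothesis alphaD : forall x y a, alpha (x + y) a = alpha x (alpha y a).
Hypothesis isoP : forall n x a, P n (alpha x a) = P n a.
Hypothesis smooth_alpha : smooth_action alpha.
Variable (J : {linear V -> V}).
Local Notation chi := (character dotp).
Local Notation w := (weight dotp e).
Local Notation wdominated2 := (wdominated2 (dotp := dotp) (e := e) P).
Local Notation symbol := (symbol (dotp := dotp) (e := e)).
Local Notation resolvent := (resolvent (dotp := dotp) (e := e)).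
Local Notation resolvent_prod := (resolvent_prod (dotp := dotp) (e := e)).
Local Notation osc := (osc (dotp := dotp) (e := e) alpha J).
Local Notation generator := (generator alpha).
Implicit Types (x y u v : V) (a b : A) (psi : V * V -> R[i]^o) (q : V -> R[i]^o).

Lemma intVV_sub (k : R[i]) F G : wdominated2 F -> wdominated2 G ->
  intVV e (fun u v => F (u, v) - k *: G (u, v)) =
  intVV e (fun u v => F (u, v)) - k *: intVV e (fun u v => G (u, v)).
Proof.
move=> dF dG; apply: (vintE hP); apply/(is_vintP hP) => psi psif; have [psil _] := psif.
have := intVV_is_vint hE hP cP dF; move=> /(is_vintP hP) /(_ psi psif) [iF EF].
have psik := real_functionalZ hP k psif.
have := intVV_is_vint hE hP cP dG; move=> /(is_vintP hP) /(_ _ psik) [iG EG].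
rewrite real_linearB// EF EG.
have -> : psi \o (fun t => F (coord_vec e t.1, coord_vec e t.2) -
    k *: G (coord_vec e t.1, coord_vec e t.2)) =
  (fun t => psi (F (coord_vec e t.1, coord_vec e t.2)) +
    (-1) * psi (k *: G (coord_vec e t.1, coord_vec e t.2))).
  by apply/funext => t /=; rewrite real_linearB// mulN1r.
split; first by apply: rintegrableD => //; exact: rintegrableZ.
have -> : (fun t => psi (F (coord_vec e t.1, coord_vec e t.2) -
    k *: G (coord_vec e t.1, coord_vec e t.2))) =
  (fun t => psi (F (coord_vec e t.1, coord_vec e t.2)) +
    (-1) * psi (k *: G (coord_vec e t.1, coord_vec e t.2))).
  by apply/funext => t /=; rewrite real_linearB// mulN1r.
rewrite RintegralD//; last exact: rintegrableZ.
by rewrite RintegralZl// mulN1r.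
Qed.

Lemma wdominated2_sub (k : R[i]) F G : wdominated2 F -> wdominated2 G ->
  wdominated2 (fun z => F z - k *: G z).
Proof.
move=> [cF bF] [cG bG]; split=> [z|n].
  by apply: tvs_cvgB; [exact: cF|apply: tvs_cvgZ; [exact: cvg_cst|exact: cG]].
have [C [C0 hC]] := bF n; have [D [D0 hD]] := bG n; exists (C + normc k * D).
split=> [|z]; first by rewrite addr_ge0// mulr_ge0 ?normc_ge0.
apply: le_trans (sysB hP _ _ _) _; rewrite mulrDl; apply: lerD => //.
by rewrite (sysZ hP) -mulrA ler_wpM2l ?normc_ge0.
Qed.

Definition regular_integrand q psi (ep : R) a b (z : V * V) : A :=
  (q z.1 * (psi (ep *: z.1, ep *: z.2) * chi z.1 z.2)) *: mul (alpha (J z.1) a) (alpha z.2 b).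

Definition regular_integral q psi ep a b : A :=
  intVV e (fun u v => regular_integrand q psi ep a b (u, v)).

Lemma regular_integrand_dominated q psi ep a b : symbol false q -> test_function psi ->
  ep != 0 -> wdominated2 (regular_integrand q psi ep a b).
Proof.
move=> sq hpsi ep0; split=> [z|n].
  apply: tvs_cvgZ.
    apply: (@tvs_cvgZ R R[i]^o _ _ _ (fun z : V * V => q z.1)
      (fun z : V * V => (psi (ep *: z.1, ep *: z.2) : R[i]) * chi z.1 z.2)).
      by apply: (@continuous_comp _ _ _ fst q); [exact: cvg_fst|exact: (symbol_continuous hE sq)].
    apply: (@tvs_cvgZ R R[i]^o _ _ _ (fun z : V * V => psi (ep *: z.1, ep *: z.2))
      (fun z : V * V => chi z.1 z.2)); last exact: (character_continuous hE).
    apply: (cvg_dilate (ep := fun=> ep) (x := fst) (y := snd)).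
    - exact: test_function_continuous.
    - exact: cvg_cst.
    - exact: cvg_fst.
    - exact: cvg_snd.
  apply: (cvg_mul cmul).
    apply: (cvg_alpha hP isoP smooth_alpha); last exact: cvg_cst.
    by apply: (@continuous_comp _ _ _ fst J); [exact: cvg_fst|exact: (J_continuous hE)].
  by apply: (cvg_alpha hP isoP smooth_alpha); [exact: cvg_snd|exact: cvg_cst].
have [C [C0 hC]] := symbol_bounded sq.
have [D [D0 hD]] := test_function_dilate hE hpsi ep0.
have [m [B [B0 hB]]] := bilinear_bound hP cmul n.
exists (C * D * (B * P m a * P m b)); split=> [|z].
  by rewrite !mulr_ge0 ?sys_ge0.
rewrite /regular_integrand (sysZ hP) !Normc.normcM normc_character mulr1.
rewrite (_ : C * D * (B * P m a * P m b) * (w z.1 * w z.2) =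
  (C * (D * (w z.1 * w z.2))) * (B * P m a * P m b)); last by ring.
apply: ler_pM; rewrite ?mulr_ge0 ?normc_ge0 ?sys_ge0//.
  by rewrite ler_pM ?normc_ge0.
by apply: le_trans (hB _ _) _; rewrite !isoP.
Qed.

(** The operator whose Fourier counterpart is multiplication by 1 + i u_j. *)
Definition regularize (j : 'I_d) b : A := b - ((2 * pi)^-1)%:C *: generator (e j) b.

(** Integration by parts in v trades a factor (1 + i u_j)^-1 for a derivative
    of b, up to a term containing a derivative of the test function. *)
Lemma regular_integral_parts q psi ep a b j : symbol false q -> test_function psi ->
  ep != 0 ->
  regular_integral q psi ep a b =
  regular_integral (fun u => (resolvent j u : R[i]) * q u) psi ep a (regularize j b) -
  ((2 * pi)^-1 * ep)%:C *:
    regular_integral (fun u => (resolvent j u : R[i]) * q u)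
      (fun z => dderive psi z (0, e j)) ep a b.
Proof.
move=> sq hpsi ep0; set psi' := fun z => dderive psi z (0, e j).
have hpsi' : test_function psi' by exact: test_function_dderive.
set r := fun u => (resolvent j u : R[i]) * q u.
have sr : symbol false r by apply: symbolM => //; exact: symbol_resolvent.
have d0 := regular_integrand_dominated a b sq hpsi ep0.
have d1 := regular_integrand_dominated a (regularize j b) sr hpsi ep0.
have d2 := regular_integrand_dominated a b sr hpsi' ep0.
have d3 := regular_integrand_dominated a b sr hpsi ep0.
rewrite /regular_integral -(intVV_sub _ d1 d2).
set k := ((2 * pi)^-1 * ep)%:C.
have d4 := wdominated2_sub k d1 d2.
rewrite -(intV_intV hE hP cP d0) -(intV_intV hE hP cP d4); congr intV; apply/funext => u.
have c0 := wdominated_curry u d0; have c4 := wdominated_curry u d4.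
apply/eqP; rewrite -subr_eq0 -(intVB hE hP cP c0 c4); apply/eqP.
apply: (intV_derivative0 hE hP cP (v := e j)
  (h := fun v => ((2 * pi)^-1)%:C *: regular_integrand r psi ep a b (u, v))).
- exact: (wdominatedZ hP _ (wdominated_curry u d3)).
- exact: (wdominatedB hP c0 c4).
move=> v.
have s1 := is_dderive_dilate_r (ep := ep) (v := e j) (x := u) (y := v)
  (fun z => test_function_is_dderive (z := z) (dir := (0, e j)) hpsi).
have s2 : is_dderive (fun v => chi u v : R[i]^o) v (e j) ((2 * pi * dotp (e j) u)%:C * 'i * chi v u).
  have := is_dderive_character (dotp := dotp) (y := u) (x := v) (v := e j).
  by apply: eq_is_dderive => t; rewrite characterC.
have s3 : is_dderive (fun v => mul (alpha (J u) a) (alpha v b)) v (e j)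
    (mul (alpha (J u) a) (alpha v (generator (e j) b))).
  apply: (is_dderive_linear (L := mul (alpha (J u) a))).
  - by move=> t a' b'; rewrite mulZr linearBr.
  - by apply: (cvg_mul cmul); [exact: cvg_cst|exact: cvg_id].
  - exact: (is_dderive_orbit hP alpha0 alphaD isoP smooth_alpha).
have s4 := is_dderiveZ (is_dderiveZ s1 s2) s3.
have s0 : is_dderive (fun _ : V => (((2 * pi)^-1)%:C * r u : R[i]) : R[i]^o) v (e j) 0.
  exact: is_dderive_cst.
have s5 := is_dderiveZ s0 s4.
have {s5} := eq_is_dderive _ s5.
move=> /(_ (fun v => ((2 * pi)^-1)%:C *: regular_integrand r psi ep a b (u, v))) h.
apply: is_dderive_eq (h _) _ => [t|].
  by rewrite /regular_integrand /= !scalerA; congr (_ *: _); rewrite /GRing.scale /= !mulrA.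
have mulBr a1 b1 b2 : mul a1 (b1 - b2) = mul a1 b1 - mul a1 b2 by rewrite linearBr.
have Eq : q u = (1 + ((2 * pi)^-1)%:C * ((2 * pi * dotp (e j) u)%:C * 'i)) * r u.
  have E2 : 1 +i* dotp u (e j) = 1 + ((2 * pi)^-1)%:C * ((2 * pi * dotp (e j) u)%:C * 'i).
    rewrite mulrA -rmorphM mulrA mulVf ?mul1r; last by rewrite mulf_neq0// gt_eqF// pi_gt0.
    apply/eqP; rewrite (dotC (e j)) eq_complex /= !mul0r !mulr0 !mulr1 subr0.
    by rewrite !addr0 !add0r !eqxx.
  by rewrite -E2 /r mulrA resolventK mul1r.
have comb (s1' s2' s3' c' k' : R[i]) (X Y : A) :
    s1' *: X - (s2' *: (X - c' *: Y) - k' *: (s3' *: X)) =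
    (s1' - s2' + k' * s3') *: X + (s2' * c') *: Y.
  rewrite scalerBr !scalerA scalerDl scalerBl !opprB -!addrA; congr (_ + _).
  by rewrite [RHS]addrC -addrA.
rewrite scale0r add0r /regular_integrand /= /regularize alphaB alphaZ mulBr mulZr comb Eq.
rewrite scalerDr !scalerA.
have -> : k = ((2 * pi)^-1)%:C * ep%:C by rewrite /k -rmorphM.
rewrite (characterC v) /psi' /GRing.scale /=.
move: (((2 * pi)^-1)%:C : R[i]) (ep%:C : R[i]) (r u : R[i]) (psi (ep *: u, ep *: v) : R[i])
  (dderive psi (ep *: u, ep *: v) (0, e j) : R[i]) (chi u v)
  ((2 * pi * dotp (e j) u)%:C * 'i) => z1 z2 z3 z4 z5 z6 z7.
by congr (_ + _); rewrite -/(GRing.scale _ _); congr (_ *: _); ring.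
Qed.

(** The value psi(0, 0) is kept because integration by parts replaces psi by
    its derivatives. *)
Definition regular_limit q (C : A -> A -> A) : Prop :=
  forall psi, test_function psi -> forall a b,
    (fun ep => regular_integral q psi ep a b) @ 0^' --> (psi (0, 0) : R[i]) *: C a b.

(** The term with a derivative of the test function carries a factor ep and
    disappears in the limit. *)
Lemma regular_limit_peel q C j : symbol false q ->
  regular_limit (fun u => (resolvent j u : R[i]) * q u) C ->
  regular_limit q (fun a b => C a (regularize j b)).
Proof.
move=> sq hC psi hpsi a b.
have hpsi' := test_function_dderive (0, e j) hpsi.
have h1 := hC _ hpsi a (regularize j b); have h2 := hC _ hpsi' a b.
have h3 : (fun ep : R => ((2 * pi)^-1 * ep)%:C : R[i]^o) @ 0^' --> (0 : R[i]^o).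
  rewrite -[X in _ --> X]/((0 : R)%:C : R[i]^o); apply: cvg_real_complex.
  rewrite -[X in _ --> X](mulr0 (2 * pi)^-1); apply: cvgM; first exact: cvg_cst.
  exact: cvg_within.
have h4 := tvs_cvgB (FF := punctured_filter R) h1 (tvs_cvgZ (FF := punctured_filter R) h3 h2).
rewrite scale0r subr0 in h4; apply: cvg_trans h4; apply: near_eq_cvg; near=> ep.
have ep0 : ep != 0 by near: ep; exact: nbhs_dnbhs_neq.
by rewrite (regular_integral_parts a b j sq hpsi ep0).
Unshelve. all: by end_near. Qed.

Definition regularize_all : A -> A := foldr regularize ^~ all_twice.

Lemma regular_limit_peel_all l C : regular_limit (resolvent_prod l) C ->
  regular_limit (fun=> 1) (fun a b => C a (foldr regularize b l)).
Proof.
elim: l C => [|j l IH] C hC.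
  have E : resolvent_prod [::] = fun=> 1 by apply/funext => u; rewrite /resolvent_prod big_nil.
  by rewrite -E.
apply: (IH (fun a b => C a (regularize j b))); apply: regular_limit_peel.
  exact: resolvent_prod_symbol.
rewrite (_ : (fun u => _) = resolvent_prod (j :: l))//.
by apply/funext => u; rewrite resolvent_prod_cons.
Qed.

(** The integral over u of the regularized product, at ep = 0. *)
Definition transform a v : A := osc (resolvent_prod all_twice) (fun=> 1) 0 v a.

Lemma transform_bound n : exists m C, 0 <= C /\
  forall a v, P n (transform a v) <= C * P m a * w v.
Proof.
have [m [C [C0 hC]]] := osc_decay hE hP cP alpha0 alphaD isoP smooth_alpha J n
  (decaying_resolvent (dotp := dotp) (e := e)) (bounded_smooth_cst (V := V) 1).
by exists m, C; split=> // a v; apply: hC; rewrite normr0.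
Qed.

Lemma transform_continuous a : continuous (transform a).
Proof.
apply: (osc_continuous hE hP cP isoP smooth_alpha).
  exact: decaying_resolvent.
exact: bounded_smooth_cst.
Qed.

Definition transform_product a b : A :=
  intV e (fun v => mul (transform a v) (alpha v b)).

(** Once the amplitude decays in u, the inner integral decays in v uniformly
    in ep, and dominated convergence applies. *)
Lemma regular_limit_resolvent : regular_limit (resolvent_prod all_twice) transform_product.
Proof.
move=> psi hpsi a b; have bpsi := test_function_bounded_smooth hpsi.
have dr := decaying_resolvent (dotp := dotp) (e := e).
set r := resolvent_prod all_twice in dr *.
pose K ep v := mul (osc r psi ep v a) (alpha v b).
have cK ep : continuous (K ep).
  move=> v; apply: (cvg_mul cmul); last first.
    by apply: (cvg_alpha hP isoP smooth_alpha); [exact: cvg_id|exact: cvg_cst].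
  exact: (osc_continuous hE hP cP isoP smooth_alpha).
have bK n : exists C, 0 <= C /\ forall ep v, `|ep| <= 1 -> P n (K ep v) <= C * w v.
  have [m [B [B0 hB]]] := bilinear_bound hP cmul n.
  have [m' [C [C0 hC]]] := osc_decay hE hP cP alpha0 alphaD isoP smooth_alpha J m dr bpsi.
  exists (B * (C * P m' a) * P m b); split=> [|ep v ep1].
    by rewrite !mulr_ge0// sys_ge0.
  apply: le_trans (hB _ _) _; rewrite isoP [leRHS]mulrAC; apply: ler_wpM2r; first exact: sys_ge0.
  by rewrite -mulrA; apply: ler_wpM2l => //; exact: hC.
(* dominated convergence after integrating over u first *)
have lim : (fun ep => intV e (K ep)) @ 0^' -->
    intV e (fun v => mul ((psi (0, 0) : R[i]) *: transform a v) (alpha v b)).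
  apply: (intV_cvg0 hE hP cP) => [ep _ _||n|v].
  - exact: cK.
  - move=> v; apply: (cvg_mul cmul).
      by apply: tvs_cvgZ; [exact: cvg_cst|exact: transform_continuous].
    by apply: (cvg_alpha hP isoP smooth_alpha); [exact: cvg_id|exact: cvg_cst].
  - by have [C [C0 hC]] := bK n; exists C; split=> // ep v _; exact: hC.
  - apply: (cvg_mul cmul (FF := punctured_filter R)); last exact: cvg_cst.
    exact: (osc_cvg hE hP cP isoP smooth_alpha).
have E : intV e (fun v => mul ((psi (0, 0) : R[i]) *: transform a v) (alpha v b)) =
    (psi (0, 0) : R[i]) *: transform_product a b.
  rewrite -(intVZ hE hP cP); first by congr intV; apply/funext => v; rewrite mulZl.
  split=> [v|n].
    apply: (cvg_mul cmul); first exact: transform_continuous.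
    by apply: (cvg_alpha hP isoP smooth_alpha); [exact: cvg_id|exact: cvg_cst].
  have [m [B [B0 hB]]] := bilinear_bound hP cmul n; have [m' [C [C0 hC]]] := transform_bound m.
  exists (B * (C * P m' a) * P m b); split=> [|v]; first by rewrite !mulr_ge0// sys_ge0.
  apply: le_trans (hB _ _) _; rewrite isoP [leRHS]mulrAC; apply: ler_wpM2r; first exact: sys_ge0.
  by rewrite -mulrA; apply: ler_wpM2l => //; exact: hC.
rewrite -E; apply: cvg_trans lim; apply: near_eq_cvg; near=> ep.
have ep0 : ep != 0 by near: ep; exact: nbhs_dnbhs_neq.
have d0 := regular_integrand_dominated a b (resolvent_prod_symbol all_twice) hpsi ep0.
rewrite /regular_integral -(wdominated2_intVV_swap hE hP cP d0).
rewrite -(intV_intV hE hP cP (wdominated_swap d0)); congr intV; apply/funext => v.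
have := intV_mull hE hP cP cmul isoP 1 0 (alpha v b)
  (osc_wdominated hE hP isoP smooth_alpha J ep v a dr bpsi).
rewrite alpha0 scale1r /K /osc => <-; congr intV; apply/funext => u.
rewrite alpha0 scale1r /regular_integrand /osc_integrand /= mulZl; congr (_ *: _).
by rewrite mulrC -mulrA.
Unshelve. all: by end_near. Qed.

(** The deformed product through absolutely convergent integrals: decay in u
    is paid with derivatives of b, and decay in v with derivatives of a. *)
Definition rieffel_product a b : A := transform_product a (regularize_all b).

Lemma regular_limit1 : regular_limit (fun=> 1) rieffel_product.
Proof. exact: regular_limit_peel_all regular_limit_resolvent. Qed.

Lemma rieffel_mulE a b :
  (exists chi : V * V -> R[i]^o, test_function chi /\ chi (0, 0) = 1) ->
  rieffel_mul dotp e alpha mul J a b = rieffel_product a b.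
Proof.
move=> [chi1 [tchi chi10]].
have lim (chi : V * V -> R[i]^o) : test_function chi -> chi (0, 0) = 1 ->
    (fun eps : R => intVV e (fun x y =>
       ((chi (eps *: x, eps *: y) : R[i]) * character dotp x y) *:
         mul (alpha (J x) a) (alpha y b))) @ 0^' --> rieffel_product a b.
  move=> hchi chi0; have := @regular_limit1 chi hchi a b; rewrite chi0 scale1r.
  apply: eq_cvg_fun => ep; congr intVV; apply/funext => u; apply/funext => v.
  by rewrite /regular_integrand mul1r.
rewrite /rieffel_mul; set X := [set c | _].
have hX : X (xget 0 X) by apply: (xgetPex 0); exists (rieffel_product a b).
exact: (cvg_unique (sys_hausdorff hP) (hX _ tchi chi10) (lim _ tchi chi10)).
Qed.

End RieffelProduct.

(** * A test function *)

Section FlatFunction.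
Context {R : realType}.
Implicit Types (t h : R) (n : nat).

(** These functions vanish to infinite order at 0, and their span is stable
    under differentiation. *)
Definition flat n t : R := if 0 < t then t^-1 ^+ n * expR (- t^-1) else 0.

Lemma flat_le0 n t : t <= 0 -> flat n t = 0.
Proof. by rewrite /flat ltNge => ->. Qed.

Lemma flat_ge0 n t : 0 <= flat n t.
Proof.
by rewrite /flat; case: ltP => // t0; rewrite mulr_ge0 ?expR_ge0// exprn_ge0// invr_ge0 ltW.
Qed.

(** From the term of degree n + 2 of the exponential series; it makes the
    derivative at 0 vanish. *)
Lemma flat_quadratic n t : flat n t <= (n.+2)`!%:R * t ^+ 2.
Proof.
rewrite /flat; case: ltP => t0; last by rewrite mulr_ge0 ?sqr_ge0// ler0n.
have s0 : 0 < t^-1 by rewrite invr_gt0.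
have h := expR_ge1Dxn n.+1 (ltW s0).
rewrite expRN ler_pdivrMr ?expR_gt0//.
have f0 : 0 < (n.+2)`!%:R :> R by rewrite ltr0n fact_gt0.
have E : t^-1 ^+ n = (n.+2)`!%:R * t ^+ 2 * (t^-1 ^+ n.+2 / (n.+2)`!%:R).
  have t1 : t ^+ 2 * t^-1 ^+ 2 = 1 by rewrite -exprMn mulfV ?expr1n// gt_eqF.
  rewrite -addn2 exprD in f0 *; set f := _%:R in f0 *; set b := t^-1 ^+ n.
  rewrite (_ : f * _ * _ = (t ^+ 2 * t^-1 ^+ 2) * (f / f) * b); last by ring.
  by rewrite t1 mulfV ?gt_eqF// !mul1r.
rewrite {1}E; apply: ler_wpM2l; first by rewrite mulr_ge0 ?sqr_ge0// ltW.
by apply: le_trans h; rewrite lerDr.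
Qed.

Lemma is_derive_flat n t :
  is_derive t (1 : R) (flat n) (flat n.+2 t - n%:R * flat n.+1 t).
Proof.
have [t0|t0|t0] := ltgtP t 0.
- rewrite !flat_le0 ?ltW// mulr0 subr0.
  apply: (near_eq_is_derive (f := cst 0)) => //.
  by near=> u; rewrite flat_le0// ltW//; near: u; exact: lt_nbhsl.
- pose g u : R := u^-1 ^+ n * expR (- u^-1).
  apply: (near_eq_is_derive (f := g)).
    have := lt_nbhsr t0; apply: filterS => u u0.
    by rewrite /g /flat u0.
  have dV : is_derive t (1 : R) (fun u : R => u^-1) (- t ^- 2 *: 1).
    by apply: (is_deriveV (f := id)); rewrite gt_eqF.
  have dE : is_derive t (1 : R) (expR \o (fun u : R => - u^-1)) (expR (- t^-1) * - (- t ^- 2 *: 1)).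
    exact: (is_derive1_comp (f := expR) (g := fun u : R => - u^-1)).
  have dX := is_deriveX n dV; have := is_deriveM dX dE.
  rewrite (_ : (fun u : R => u^-1) ^+ n * _ = g); last first.
    by rewrite exprfctE.
  move=> h; apply: is_derive_eq h _; rewrite /flat t0 /= /GRing.scale /= !mulr1.
  have E1 : t^-1 ^+ n.+2 = t^-1 ^+ n * t ^- 2 by rewrite -addn2 exprD [t^-1 ^+ 2]exprVn.
  have E2 : n%:R * t^-1 ^+ n.+1 = n%:R * t^-1 ^+ n.-1 * t ^- 2.
    case: (n) => [|m]; first by rewrite !mul0r.
    by rewrite -mulrA; congr (_ * _); rewrite -addn2 exprD [t^-1 ^+ 2]exprVn.
  rewrite exprfctE [n%:R * (_ * _)]mulrA E2 E1.
  by move: (t ^- 2) (t^-1 ^+ n) (expR _) (_ * t^-1 ^+ n.-1) => *; ring.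
- rewrite t0 !flat_le0// mulr0 subr0.
  have h : (fun h => h^-1 *: (flat n (h *: 1 + 0) - flat n 0)) @ 0^' --> (0 : R).
    pose C : R := (n.+2)`!%:R.
    have l (k : R) : (fun h => k * `|h| : R) @ 0^' --> (0 : R).
      rewrite [X in _ --> X](_ : 0 = k * `|0 : R|); last by rewrite normr0 mulr0.
      apply: cvgM; first exact: cvg_cst.
      by apply: cvg_norm; exact: cvg_within.
    apply: (@squeeze_cvgr _ _ _ _ (fun h => - C * `|h|) (fun h => C * `|h|)) => //.
    near=> h.
    rewrite (flat_le0 n (lexx 0)) subr0 addr0 [h *: 1]mulr1 mulNr -ler_norml.
    have h0 : h != 0 by near: h; exact: nbhs_dnbhs_neq.
    rewrite normrM normfV ler_pdivrMl ?normr_gt0// mulrCA -expr2 real_normK ?num_real//.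
    by rewrite ger0_norm ?flat_ge0// flat_quadratic.
  by apply: DeriveDef; [apply/cvg_ex; exists 0|apply: cvg_lim].
Unshelve. all: by end_near. Qed.

Lemma is_derive_quadratic (f : R -> R) (b c : R) :
  (forall h, f h = f 0 + h * b + h ^+ 2 * c) -> is_derive (0 : R) (1 : R) f b.
Proof.
move=> fE; have lim : (fun h => h^-1 *: (f (h *: 1 + 0) - f 0)) @ 0^' --> b.
  have l : (fun h => b + h * c) @ 0^' --> b.
    rewrite [X in _ --> X](_ : b = b + 0 * c); last by rewrite mul0r addr0.
    apply: cvgD; first exact: cvg_cst.
    by apply: cvgM; [exact: cvg_within|exact: cvg_cst].
  apply: cvg_trans l; apply: near_eq_cvg; near=> h.
  have h0 : h != 0 by near: h; exact: nbhs_dnbhs_neq.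
  rewrite addr0 [h *: 1]mulr1 [f h]fE /GRing.scale /=.
  by move: (f 0) => x; field.
by apply: DeriveDef; [apply/cvg_ex; exists b|apply: cvg_lim].
Unshelve. all: by end_near. Qed.

End FlatFunction.

Section Bump.
Context {R : realType} {V : normedModType R}.
Context {dotp : {dot V for @idfun R}} {d : nat} {e : 'I_d -> V}.
Variable hE : euclidean_space dotp e.
Implicit Types (z dir : V * V) (f : V * V -> R).

Definition pairing dir z : R := dotp dir.1 z.1 + dotp dir.2 z.2.

Lemma pairingD dir z1 z2 : pairing dir (z1 + z2) = pairing dir z1 + pairing dir z2.
Proof. by rewrite /pairing /= !dotDr addrACA. Qed.

Lemma pairingZ dir (r : R) z : pairing dir (r *: z) = r * pairing dir z.
Proof. by rewrite /pairing /= !dotZr mulrDr. Qed.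

Lemma pairingC z1 z2 : pairing z1 z2 = pairing z2 z1.
Proof. by rewrite /pairing dotC (dotC z1.2). Qed.

(** Contains the bump function of the unit ball and is stable under
    directional derivatives, which proves smoothness without iterating the
    chain rule. *)
Inductive bump_class : (V * V -> R) -> Prop :=
| bump_flat n : bump_class (fun z => flat n (1 - pairing z z))
| bump_pairing dir : bump_class (pairing dir)
| bump_cst (k : R) : bump_class (fun=> k)
| bump_add f g : bump_class f -> bump_class g -> bump_class (fun z => f z + g z)
| bump_mul f g : bump_class f -> bump_class g -> bump_class (fun z => f z * g z).

Lemma pairing_continuous : continuous (fun z : (V * V) * (V * V) => pairing z.1 z.2).
Proof.
move=> z; apply: cvgD.
  apply: (@continuous_comp _ _ _ (fun z : (V * V) * (V * V) => (z.1.1, z.2.1))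
    (fun u : V * V => dotp u.1 u.2)); last exact: (dot_continuous hE).
  apply: cvg_pair => /=.
    by apply: (@continuous_comp _ _ _ fst fst); [exact: cvg_fst|exact: cvg_fst].
  by apply: (@continuous_comp _ _ _ snd fst); [exact: cvg_snd|exact: cvg_fst].
apply: (@continuous_comp _ _ _ (fun z : (V * V) * (V * V) => (z.1.2, z.2.2))
  (fun u : V * V => dotp u.1 u.2)); last exact: (dot_continuous hE).
apply: cvg_pair => /=.
  by apply: (@continuous_comp _ _ _ fst snd); [exact: cvg_fst|exact: cvg_snd].
by apply: (@continuous_comp _ _ _ snd snd); [exact: cvg_snd|exact: cvg_snd].
Qed.

Lemma bump_continuous f : bump_class f -> continuous f.
Proof.
elim=> {f} [n|dir|k|f g _ cf _ cg|f g _ cf _ cg] z.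
- have cQ : {for z, continuous (fun z => 1 - pairing z z)}.
    apply: cvgB; first exact: cvg_cst.
    exact: (continuous2_cvg _ (@pairing_continuous (z, z)) (@cvg_id _ _) (@cvg_id _ _)).
  apply: (@continuous_comp _ _ _ (fun z => 1 - pairing z z) (flat n)) => //.
  apply: differentiable_continuous; apply/derivable1_diffP.
  exact: (@ex_derive _ _ _ _ _ _ _ (is_derive_flat n _)).
- exact: (continuous2_cvg _ (@pairing_continuous (dir, z)) (cvg_cst _) (@cvg_id _ _)).
- exact: cvg_cst.
- by apply: cvgD; [exact: cf|exact: cg].
- by apply: cvgM; [exact: cf|exact: cg].
Qed.

Lemma bump_derive f dir : bump_class f -> exists f', bump_class f' /\
  forall z, is_derive (0 : R) (1 : R) (fun h : R => f (z + h *: dir)) (f' z).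
Proof.
elim=> {f} [n|v|k|f g bf [f' [bf' df]] bg [g' [bg' dg]]|f g bf [f' [bf' df]] bg [g' [bg' dg]]].
- exists (fun z => (flat n.+2 (1 - pairing z z) + (- n%:R) * flat n.+1 (1 - pairing z z)) *
     (-2 * pairing dir z)); split=> [|z].
    apply: bump_mul; last by apply: bump_mul; [exact: bump_cst|exact: bump_pairing].
    apply: bump_add; first exact: bump_flat.
    by apply: bump_mul; [exact: bump_cst|exact: bump_flat].
  have E (h : R) : 1 - pairing (z + h *: dir) (z + h *: dir) =
      1 - pairing z z - h * (2 * pairing dir z) - h ^+ 2 * pairing dir dir.
    rewrite !pairingD !pairingZ (pairingC _ z) (pairingC (_ + _) dir) !pairingD !pairingZ.
    by rewrite (pairingC z dir); ring.
  have dq : is_derive (0 : R) (1 : R) (fun h : R => 1 - pairing (z + h *: dir) (z + h *: dir))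
      (-2 * pairing dir z).
    under eq_fun do rewrite E.
    apply: (is_derive_quadratic (c := - pairing dir dir)) => h.
    by move: (pairing z z) (pairing dir z) (pairing dir dir) => *; ring.
  have := is_derive1_comp (f := flat n)
    (g := fun h : R => 1 - pairing (z + h *: dir) (z + h *: dir)) (x := 0).
  rewrite scale0r addr0.
  by move=> /(_ _ _ (is_derive_flat n _) dq); rewrite -mulNr.
- exists (fun=> pairing v dir); split=> [|z]; first exact: bump_cst.
  under eq_fun do rewrite pairingD pairingZ.
  apply: (is_derive_quadratic (c := 0)) => h.
  by move: (pairing v z) (pairing v dir) => *; ring.
- exists (fun=> 0); split=> [|z]; first exact: bump_cst.
  exact: is_derive_cst.
- exists (fun z => f' z + g' z); split=> [|z]; first exact: bump_add.
  exact: is_deriveD.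
- exists (fun z => f z * g' z + g z * f' z); split=> [|z].
    by apply: bump_add; exact: bump_mul.
  have := is_deriveM (df z) (dg z).
  by rewrite scale0r addr0.
Qed.

Lemma bump_dderive f dir : bump_class f -> exists f', bump_class f' /\
  forall z, is_dderive (fun z => (f z)%:C : R[i]^o) z dir ((f' z)%:C).
Proof.
move=> /(bump_derive dir)[f' [bf' df]]; exists f'; split=> // z.
have := cvg_real_complex (FF := punctured_filter R) (is_derive_quotient (df z)).
apply: eq_cvg_fun => h /=; rewrite add0r scale0r addr0.
by rewrite rmorphM rmorphB.
Qed.

Lemma bump_smooth f : bump_class f -> smooth (fun z => (f z)%:C : R[i]^o).
Proof.
move=> bf s; have [g [bg ->]] : exists g, bump_class g /\
    iter_dderive s (fun z => (f z)%:C : R[i]^o) = fun z => (g z)%:C.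
  elim: s => [|v s [g [bg IH]]]; first by exists f.
  have [g' [bg' dg]] := bump_dderive v bg; exists g'; split=> //.
  rewrite /= -/(iter_dderive s _) IH; apply/funext => z.
  exact: (dderiveE (sys_hausdorff (@scalar_system R))).
split=> [z|z v]; first by apply: cvg_real_complex; exact: bump_continuous.
by have [g' [_ dg]] := bump_dderive v bg; exists (g' z)%:C.
Qed.

(** Cubes, built one coordinate at a time as continuous images of compact
    products. *)
Fixpoint box (l : seq 'I_d) : set V :=
  if l is i :: l then (fun u : R * V => u.1 *: e i + u.2) @` (`[-1, 1] `*` box l)
  else [set 0].

Lemma box_compact l : compact (box l).
Proof.
elim: l => [|i l IH] /=; first exact: compact_set1.
apply: continuous_compact; last by apply: compact_setX => //; exact: segment_compact.
apply: continuous_subspaceT => u; apply: cvgD; last exact: cvg_snd.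
by apply: cvgZr_tmp; exact: cvg_fst.
Qed.

Lemma box_sum l (c : 'I_d -> R) : (forall i, `|c i| <= 1) -> box l (\sum_(i <- l) c i *: e i).
Proof.
move=> c1; elim: l => [|i l IH] /=; first by rewrite big_nil.
exists (c i, \sum_(i <- l) c i *: e i); last by rewrite big_cons.
by split=> //=; rewrite in_itv /= -ler_norml.
Qed.

Lemma exists_test_function :
  exists chi : V * V -> R[i]^o, test_function chi /\ chi (0, 0) = 1.
Proof.
have f1 : flat 0 1 != 0 :> R by rewrite /flat ltr01 mul1r gt_eqF// expR_gt0.
exists (fun z => (flat 0 (1 - pairing z z) * (flat 0 1)^-1)%:C); split; last first.
  by rewrite /pairing /= dot0l addr0 subr0 mulfV.
split.
  apply: (@bump_smooth (fun z => flat 0 (1 - pairing z z) * (flat 0 1)^-1)).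
  by apply: bump_mul; [exact: bump_flat|exact: bump_cst].
pose B := box (index_enum 'I_d).
have inB x : `|x| <= 1 -> B x.
  move=> x1; rewrite (euclidean_expand hE x); apply: box_sum => i.
  exact: le_trans (coord_le_norm hE x i) x1.
exists (B `*` B); first by apply: compact_setX; exact: box_compact.
move=> [x y] nB; rewrite flat_le0 ?mul0r//.
rewrite /pairing /= -!(euclidean_norm hE) subr_le0 leNgt; apply/negP => lt1.
have sq1 (u : V) : `|u| ^+ 2 < 1 -> `|u| <= 1.
  by move=> /ltW; rewrite -[X in _ <= X -> _](expr1n R 2) ler_pXn2r ?nnegrE.
apply: nB; split=> /=; apply: inB; apply: sq1; apply: le_lt_trans lt1.
  by rewrite lerDl sqr_ge0.
by rewrite lerDr sqr_ge0.
Qed.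

End Bump.

(** * The crossed product of the deformed algebra *)

Lemma bounded_bilinear_cvg (R : realType) (A : tvsType R[i]) (P : nat -> A -> R)
    (hP : seminorm_system P) (M : A -> A -> A)
    (T : Type) (F : set_system T) {FF : Filter F} (a b : T -> A) a0 b0 :
  (forall a a' b, M (a - a') b = M a b - M a' b) ->
  (forall a b b', M a (b - b') = M a b - M a b') ->
  (forall n, exists m C, 0 <= C /\ forall a b, P n (M a b) <= C * P m a * P m b) ->
  a @ F --> a0 -> b @ F --> b0 -> (fun t => M (a t) (b t)) @ F --> M a0 b0.
Proof.
move=> Ml Mr bM /(sys_cvgP hP) aF /(sys_cvgP hP) bF; apply/(sys_cvgP hP) => n eps eps0.
have [m [C [C0 hC]]] := bM n.
pose K := C * (P m b0 + P m a0 + 1) + 1.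
have K0 : 0 < K by rewrite ltr_wpDl// mulr_ge0// !addr_ge0 ?sys_ge0.
(* del <= 1 absorbs the quadratic term *)
pose del := Num.min 1 (eps / K).
have del0 : 0 < del by rewrite lt_min ltr01 divr_gt0.
have del1 : del <= 1 by rewrite ge_min lexx.
have delK : del * K <= eps by rewrite -ler_pdivlMr// ge_min lexx orbT.
near=> t.
have ha : P m (a t - a0) < del by near: t; exact: aF.
have hb : P m (b t - b0) < del by near: t; exact: bF.
have E : M (a t) (b t) - M a0 b0 =
    M (a t - a0) b0 + M a0 (b t - b0) + M (a t - a0) (b t - b0).
  by rewrite !Ml !Mr -addrA [X in _ = _ + X]addrC subrK [RHS]addrC addrA subrK.
rewrite E; apply: le_lt_trans (sysD hP _ _ _) _.
apply: le_lt_trans (lerD (sysD hP _ _ _) (lexx _)) _.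
have h1 := hC (a t - a0) b0; have h2 := hC a0 (b t - b0); have h3 := hC (a t - a0) (b t - b0).
have p1 := sys_ge0 hP m (a t - a0); have p2 := sys_ge0 hP m (b t - b0).
have p3 := sys_ge0 hP m a0; have p4 := sys_ge0 hP m b0.
have g1 : C * P m (a t - a0) * P m b0 <= C * del * P m b0.
  by rewrite ler_wpM2r// ler_wpM2l// ltW.
have g2 : C * P m a0 * P m (b t - b0) <= C * P m a0 * del.
  by rewrite ler_wpM2l ?mulr_ge0// ltW.
have g3 : C * P m (a t - a0) * P m (b t - b0) <= C * del * 1.
  apply: ler_pM; rewrite ?mulr_ge0//.
    by rewrite ler_wpM2l// ltW.
  exact: le_trans (ltW hb) del1.
have E2 : C * del * P m b0 + C * P m a0 * del + C * del * 1 + del = del * K.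
  by rewrite /K; ring.
by apply: lt_le_trans delK; rewrite -E2; lra.
Unshelve. all: by end_near. Qed.

Section DeformedCrossedProduct.
Context {R : realType} {V : normedModType R}.
Context {dotp : {dot V for @idfun R}} {d : nat} {e : 'I_d -> V}.
Variable hE : euclidean_space dotp e.
Context {A : tvsType R[i]}.
Variables (P : nat -> A -> R) (hP : seminorm_system P) (cP : complete_system P).
Variable (mul : {bilinear A -> A -> A}).
Hypothesis cmul : continuous (fun ab : A * A => mul ab.1 ab.2).
Variables (alpha : V -> {linear A -> A}).
Hypothesis alpha0 : forall a, alpha 0 a = a.
Hypothesis alphaD : forall x y a, alpha (x + y) a = alpha x (alpha y a).
Hypothesis isoP : forall n x a, P n (alpha x a) = P n a.
Hypothesis smooth_alpha : smooth_action alpha.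
Variable (J : {linear V -> V}).
Local Notation chi := (character dotp).
Local Notation w := (weight dotp e).
Local Notation wdominated := (wdominated (dotp := dotp) (e := e) P).
Local Notation resolvent_prod := (resolvent_prod (dotp := dotp) (e := e)).
Local Notation transform := (transform (dotp := dotp) (e := e) alpha J).
Local Notation regularize := (regularize (e := e) alpha).
Local Notation regularize_all := (regularize_all (e := e) alpha).
Local Notation rieffel_product := (rieffel_product (dotp := dotp) (e := e) mul alpha J).
Local Notation generator := (generator alpha).
Implicit Types (x y u v r : V) (a b c : A) (f g h : V -> A).

Lemma transformE a v :
  transform a v = intV e (fun u => (chi u v * resolvent_prod all_twice u) *: alpha (J u) a).
Proof. by congr intV; apply/funext => u; rewrite /osc_integrand mulr1. Qed.

Lemma transform_wdominated a v :
  wdominated (fun u => (chi u v * resolvent_prod all_twice u) *: alpha (J u) a).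
Proof.
have := osc_wdominated hE hP isoP smooth_alpha J 0 v a (@decaying_resolvent _ _ dotp _ e)
  (bounded_smooth_cst 1).
by congr (dominated _ _ _); apply/funext => u; rewrite /osc_integrand mulr1.
Qed.

Lemma transformB a b v : transform (a - b) v = transform a v - transform b v.
Proof.
have da := transform_wdominated a v; have db := transform_wdominated b v.
rewrite !transformE -(intVB hE hP cP da db); congr intV; apply/funext => u.
by rewrite alphaB scalerBr.
Qed.

Lemma transformZ (k : R[i]) a v : transform (k *: a) v = k *: transform a v.
Proof.
have da := transform_wdominated a v.
rewrite !transformE -(intVZ hE hP cP k da); congr intV; apply/funext => u.
by rewrite alphaZ !scalerA mulrC.
Qed.

Lemma transform_cvg (T : Type) (F : set_system T) {FF : Filter F} (a : T -> A) (v : T -> V) a0 v0 :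
  a @ F --> a0 -> v @ F --> v0 ->
  (fun t => transform (a t) (v t)) @ F --> transform a0 v0.
Proof.
move=> aF vF; apply: (equicontinuous_cvg hP (G := fun v a => transform a v)) => //.
- by move=> v' a' b'; exact: transformB.
- move=> n; have [m [C [C0 hC]]] := transform_bound hE hP cP alpha0 alphaD isoP smooth_alpha J n.
  exists m, C; split=> // v' a'; apply: le_trans (hC _ _) _.
  by rewrite ler_piMr ?weight_le1// mulr_ge0 ?sys_ge0.
- exact: cvg_comp vF (transform_continuous hE hP cP isoP smooth_alpha (x := v0)).
Qed.

Lemma generator_alpha X x a : generator X (alpha x a) = alpha x (generator X a).
Proof.
apply: (dderiveE (sys_hausdorff hP)).
have h : is_dderive (fun y => alpha x (alpha y a)) 0 X (alpha x (generator X a)).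
  apply: (is_dderive_linear (L := alpha x)).
  - by move=> s a' b'; rewrite alphaZ alphaB.
  - by apply: (cvg_alpha hP isoP smooth_alpha); [exact: cvg_cst|exact: cvg_id].
  - exact: (is_dderive_generator hP smooth_alpha).
by apply: eq_is_dderive h => y; rewrite -!alphaD addrC.
Qed.

Lemma regularize_alpha j x b : regularize j (alpha x b) = alpha x (regularize j b).
Proof. by rewrite /regularize generator_alpha alphaB alphaZ. Qed.

Lemma regularize_linear j (k : R[i]) a b :
  regularize j (k *: a + b) = k *: regularize j a + regularize j b.
Proof.
rewrite /regularize (generator_linear hP smooth_alpha) scalerDr scalerBr opprD addrACA.
by rewrite !scalerA mulrC.
Qed.

Lemma regularize_bound j n : exists m C, 0 <= C /\ forall b, P n (regularize j b) <= C * P m b.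
Proof.
have [m [C [C0 hC]]] := generator_bound hP smooth_alpha (e j) n.
exists (maxn n m), (1 + normc ((2 * pi)^-1)%:C * C); split=> [|b].
  by rewrite addr_ge0// mulr_ge0 ?normc_ge0.
apply: le_trans (sysB hP _ _ _) _; rewrite (sysZ hP) [leRHS]mulrDl mul1r.
apply: lerD; first by rewrite (sys_mono hP)// leq_maxl.
rewrite -mulrA ler_wpM2l ?normc_ge0//; apply: le_trans (hC b) _.
by rewrite ler_wpM2l// (sys_mono hP)// leq_maxr.
Qed.

Lemma foldr_regularize_alpha l x b :
  foldr regularize (alpha x b) l = alpha x (foldr regularize b l).
Proof. by elim: l => //= j l ->; rewrite regularize_alpha. Qed.

Lemma regularize_all_linear (k : R[i]) a b :
  regularize_all (k *: a + b) = k *: regularize_all a + regularize_all b.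
Proof.
rewrite /regularize_all; elim: (all_twice (d := d)) => //= j l ->.
exact: regularize_linear.
Qed.

Lemma regularize_all_bound n :
  exists m C, 0 <= C /\ forall b, P n (regularize_all b) <= C * P m b.
Proof.
rewrite /regularize_all; elim: (all_twice (d := d)) n => [|j l IH] n /=.
  by exists n, 1; split=> // b; rewrite mul1r.
have [m [C [C0 hC]]] := regularize_bound j n; have [m' [C' [C'0 hC']]] := IH m.
exists m', (C * C'); split=> [|b]; first exact: mulr_ge0.
by apply: le_trans (hC _) _; rewrite -mulrA ler_wpM2l.
Qed.

Lemma rieffel_productE a b :
  rieffel_product a b = intV e (fun v => mul (transform a v) (alpha v (regularize_all b))).
Proof. by []. Qed.

Lemma product_bound n : exists m C, 0 <= C /\ forall a b v,
  P n (mul (transform a v) b) <= C * P m a * P m b * w v.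
Proof.
have [m [B [B0 hB]]] := bilinear_bound hP cmul n.
have [m' [C [C0 hC]]] := transform_bound hE hP cP alpha0 alphaD isoP smooth_alpha J m.
exists (maxn m m'), (B * C); split=> [|a b v]; first exact: mulr_ge0.
apply: le_trans (hB _ _) _; rewrite -!mulrA ler_wpM2l//.
rewrite [P _ b * _]mulrC !mulrA; apply: ler_pM; rewrite ?sys_ge0//; last first.
  by rewrite (sys_mono hP)// leq_maxl.
apply: le_trans (hC _ _) _; apply: ler_wpM2r; first by rewrite ltW// weight_gt0.
by rewrite ler_wpM2l// (sys_mono hP)// leq_maxr.
Qed.

Lemma rieffel_wdominated a b : wdominated (fun v => mul (transform a v) (alpha v b)).
Proof.
split=> [v|n].
  apply: (cvg_mul cmul); first by apply: transform_cvg; [exact: cvg_cst|exact: cvg_id].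
  by apply: (cvg_alpha hP isoP smooth_alpha); [exact: cvg_id|exact: cvg_cst].
have [m [C [C0 hC]]] := product_bound n; exists (C * P m a * P m b).
split=> [|v]; first by rewrite !mulr_ge0 ?sys_ge0.
by apply: le_trans (hC _ _ _) _; rewrite isoP.
Qed.

Lemma rieffel_product_linear a (k : R[i]) b c :
  rieffel_product a (k *: b + c) = k *: rieffel_product a b + rieffel_product a c.
Proof.
have db := rieffel_wdominated a (regularize_all b).
have dc := rieffel_wdominated a (regularize_all c).
rewrite !rieffel_productE -(intVZ hE hP cP k db) -(intVD hE hP cP (wdominatedZ hP k db) dc).
congr intV; apply/funext => v.
by rewrite regularize_all_linear !linearP -mulZr -linearDr.
Qed.

Lemma rieffel_productBl a a' b :
  rieffel_product (a - a') b = rieffel_product a b - rieffel_product a' b.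
Proof.
have da := rieffel_wdominated a (regularize_all b).
have da' := rieffel_wdominated a' (regularize_all b).
rewrite !rieffel_productE -(intVB hE hP cP da da'); congr intV; apply/funext => v.
by rewrite transformB linearBl.
Qed.

Lemma rieffel_productBr a b b' :
  rieffel_product a (b - b') = rieffel_product a b - rieffel_product a b'.
Proof.
by rewrite -[b - b']addrC -scaleN1r rieffel_product_linear scaleN1r addrC.
Qed.

Lemma rieffel_productZl (k : R[i]) a b :
  rieffel_product (k *: a) b = k *: rieffel_product a b.
Proof.
have da := rieffel_wdominated a (regularize_all b).
rewrite !rieffel_productE -(intVZ hE hP cP k da); congr intV; apply/funext => v.
by rewrite transformZ mulZl.
Qed.

Lemma rieffel_productZr (k : R[i]) a b :
  rieffel_product a (k *: b) = k *: rieffel_product a b.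
Proof.
have E0 : rieffel_product a 0 = 0 by have := rieffel_productBr a 0 0; rewrite !subrr.
by rewrite -[k *: b]addr0 rieffel_product_linear E0 addr0.
Qed.

Lemma rieffel_product_bound n : exists m C, 0 <= C /\ forall a b,
  P n (rieffel_product a b) <= C * P m a * P m b.
Proof.
have [m [C [C0 hC]]] := product_bound n; have [m' [C' [C'0 hC']]] := regularize_all_bound m.
have W0 := weight_mass_ge0 (dotp := dotp) (e := e).
exists (maxn m m'), (C * C' * weight_mass (dotp := dotp) (e := e)).
split=> [|a b]; first by rewrite !mulr_ge0.
have h := intV_bound hE hP cP (rieffel_wdominated a (regularize_all b)) (n := n)
  (C := C * P m a * P m (regularize_all b)).
rewrite rieffel_productE; apply: le_trans (h _) _ => [v|].
  by apply: le_trans (hC _ _ _) _; rewrite isoP.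
rewrite (_ : C * C' * _ * _ * _ = C * P (maxn m m') a * (C' * P (maxn m m') b) *
  weight_mass (dotp := dotp) (e := e)); last by ring.
apply: ler_wpM2r => //; apply: ler_pM; rewrite ?mulr_ge0 ?sys_ge0//.
  by rewrite ler_wpM2l// (sys_mono hP)// leq_maxl.
apply: le_trans (hC' b) _.
by rewrite ler_wpM2l// (sys_mono hP)// leq_maxr.
Qed.

Lemma rieffel_product_cvg (T : Type) (F : set_system T) {FF : Filter F} (a b : T -> A) a0 b0 :
  a @ F --> a0 -> b @ F --> b0 ->
  (fun t => rieffel_product (a t) (b t)) @ F --> rieffel_product a0 b0.
Proof.
apply: (bounded_bilinear_cvg hP (M := rieffel_product)).
- exact: rieffel_productBl.
- exact: rieffel_productBr.
- exact: rieffel_product_bound.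
Qed.

End DeformedCrossedProduct.

Section Intertwining.
Context {R : realType} {V : normedModType R}.
Context {dotp : {dot V for @idfun R}} {d : nat} {e : 'I_d -> V}.
Variable hE : euclidean_space dotp e.
Context {A : tvsType R[i]}.
Variables (P : nat -> A -> R) (hP : seminorm_system P) (cP : complete_system P).
Variable (mul : {bilinear A -> A -> A}).
Hypothesis cmul : continuous (fun ab : A * A => mul ab.1 ab.2).
Variables (alpha : V -> {linear A -> A}).
Hypothesis alpha0 : forall a, alpha 0 a = a.
Hypothesis alphaD : forall x y a, alpha (x + y) a = alpha x (alpha y a).
Hypothesis isoP : forall n x a, P n (alpha x a) = P n a.
Hypothesis smooth_alpha : smooth_action alpha.
Variable (J : {linear V -> V}).
Local Notation S := (@schwartz R V A).
Local Notation chi := (character dotp).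
Local Notation w := (weight dotp e).
Local Notation wdominated := (wdominated (dotp := dotp) (e := e) P).
Local Notation wdominated2 := (wdominated2 (dotp := dotp) (e := e) P).
Local Notation resolvent := (resolvent (dotp := dotp) (e := e)).
Local Notation resolvent_prod := (resolvent_prod (dotp := dotp) (e := e)).
Local Notation transform := (transform (dotp := dotp) (e := e) alpha J).
Local Notation regularize := (regularize (e := e) alpha).
Local Notation regularize_all := (regularize_all (e := e) alpha).
Local Notation rieffel_product := (rieffel_product (dotp := dotp) (e := e) mul alpha J).
Local Notation generator := (generator alpha).
Local Notation ft := (ft dotp e).
Local Notation theta := (theta (dotp := dotp) (e := e) alpha).
Local Notation twist := (twist alpha).
Implicit Types (x y u v r : V) (a b c : A) (f g h : V -> A).

Lemma alpha_intV (k : R[i]) x F : wdominated F ->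
  intV e (fun y => k *: alpha x (F y)) = k *: alpha x (intV e F).
Proof.
move=> dF; apply: (intV_linear hE hP cP (L := fun a => k *: alpha x a)) => //.
  by move=> s a b; rewrite linearP scalerDr !scalerA mulrC.
by move=> n; exists n, (normc k); split=> [|a]; [exact: normc_ge0|rewrite (sysZ hP) isoP].
Qed.

Lemma crossed_wdominated f c : S f -> wdominated (fun v => mul (f v) (alpha v c)).
Proof.
move=> hf; have [cf bf] := schwartz_wdominated hE hP hf; split=> [v|n].
  apply: (cvg_mul cmul); first exact: cf.
  by apply: (cvg_alpha hP isoP smooth_alpha); [exact: cvg_id|exact: cvg_cst].
have [m [B [B0 hB]]] := bilinear_bound hP cmul n; have [C [C0 hC]] := bf m.
exists (B * C * P m c); split=> [|v]; first by rewrite !mulr_ge0 ?sys_ge0.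
apply: le_trans (hB _ _) _; rewrite isoP [leRHS]mulrAC; apply: ler_wpM2r; first exact: sys_ge0.
by rewrite -mulrA ler_wpM2l.
Qed.

(** What the integral of the transforms of the values of f produces; with no
    damping factor it is theta J f. *)
Definition damped_theta l f : V -> A :=
  ft 1 (fun u => (resolvent_prod l u : R[i]) *: twist J (ft (-1) f) u).

Lemma schwartz_twist_ft f : S f -> S (twist J (ft (-1) f)).
Proof.
move=> hf; have hT := schwartz_operator_id hP (W := V).
have := schwartz_operator_ft hE hP cP (s := -1) (normrN1 _) hT.
move=> /(schwartz_operator_twist hE hP alpha0 alphaD isoP smooth_alpha (JD J) (JZ J)).
by move=> [h _]; exact: h.
Qed.

Lemma schwartz_resolvent l f : S f -> S (fun u => (resolvent_prod l u : R[i]) *: f u).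
Proof.
move=> hf; have hT := schwartz_operator_id hP (W := V).
have hm := symbol_multiplier hE (resolvent_prod_symbol (dotp := dotp) (e := e) l).
by have [h _] := schwartz_operator_multiplier hP hm hT; exact: h.
Qed.

(** Fubini: the integral over y collects the Fourier transform of f. *)
Lemma integral_transform f v : S f ->
  intV e (fun y => transform (f y) (v - y)) = damped_theta all_twice f v.
Proof.
move=> hf; have [cf bf] := schwartz_wdominated hE hP hf.
set rho := resolvent_prod all_twice.
have crho : continuous rho := symbol_continuous hE (resolvent_prod_symbol all_twice).
pose F (z : V * V) : A := (chi z.2 (v - z.1) * rho z.2) *: alpha (J z.2) (f z.1).
have dF : wdominated2 F.
  split=> [z|n].
    apply: tvs_cvgZ.
      apply: (@tvs_cvgZ R R[i]^o _ _ _ (fun z : V * V => chi z.2 (v - z.1)) (fun z : V * V => rho z.2)).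
        apply: (cvg_character hE); first exact: cvg_snd.
        by apply: cvgB; [exact: cvg_cst|exact: cvg_fst].
      by apply: (@continuous_comp _ _ _ snd rho); [exact: cvg_snd|exact: crho].
    apply: (cvg_alpha hP isoP smooth_alpha); last exact: (continuous_pair_fst cf).
    by apply: (@continuous_comp _ _ _ snd J); [exact: cvg_snd|exact: (J_continuous hE)].
  have [C [C0 hC]] := bf n; exists C; split=> // z.
  rewrite /F (sysZ hP) isoP Normc.normcM normc_character mul1r normc_resolvent_twice//.
  by rewrite mulrC mulrA ler_wpM2r// ltW// weight_gt0.
transitivity (intV e (fun y => intV e (fun u => F (y, u)))).
  by congr intV; apply/funext => y; rewrite transformE.
rewrite (intV_swap hE hP cP dF) /damped_theta /ft; congr intV; apply/funext => u.
rewrite scalerA scale1r /twist -alpha_intV; last first.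
  exact: (wdominated_ft hE hP (-1) u (schwartz_wdominated hE hP hf)).
congr intV; apply/funext => y; rewrite /F /= alphaZ scalerA; congr (_ *: _).
rewrite characterDr characterNr scaleN1r (characterC v u) -!mulrA; congr (_ * _).
by rewrite mulrC.
Qed.

(** The regularization of c subtracts a derivative along its orbit.
    Integration by parts moves that derivative to the Fourier transform, where
    it cancels the damping factor. *)
Lemma damping_parts j f c : S f ->
  intV e (fun v => mul (ft 1 (fun u => (resolvent j u : R[i]) *: f u) v)
                       (alpha v (regularize j c))) =
  intV e (fun v => mul (ft 1 f v) (alpha v c)).
Proof.
move=> hf; set g := fun u => (resolvent j u : R[i]) *: f u.
have hg : S g.
  have := schwartz_resolvent [:: j] hf; rewrite (_ : (fun u => _) = g)//.
  by apply/funext => u; rewrite resolvent_prod_cons /resolvent_prod big_nil mulr1.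
pose G := ft 1 g; have hG : S G by apply: (schwartz_ft hE hP cP) => //; exact: normr1.
pose D := iter_dderive [:: e j] G.
have hD : S D by exact: (schwartz_operator_iter hP [:: e j]).1.
set k : R[i] := ((2 * pi)^-1)%:C.
(* on the Fourier side: 1 + (2 pi)^-1 (2 pi i u_j) inverts the resolvent *)
have Gv v : ft 1 f v = G v + k *: D v.
  have -> : D v = ft 1 (fun y => ((2 * pi * dotp (e j) (1 *: y))%:C * 'i) *: g y) v.
    have := is_dderive_ft hE hP cP (s := 1) (x := v) (v := e j) hg.
    exact: (dderiveE (sys_hausdorff hP)).
  have hm : S (fun y => ((2 * pi * dotp (e j) (1 *: y))%:C * 'i) *: g y).
    have := schwartz_operator_multiplier hP (multiplier_coordinate hE 1 (e j))
      (schwartz_operator_id hP (W := V)).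
    by move=> [h _]; exact: h.
  have d1 := wdominated_ft hE hP 1 v (schwartz_wdominated hE hP hg).
  have d2 := wdominated_ft hE hP 1 v (schwartz_wdominated hE hP hm).
  rewrite /G /ft -(intVZ hE hP cP k d2) -(intVD hE hP cP d1 (wdominatedZ hP k d2)).
  have kZ (z : R[i]) (a : A) : k *: (z *: a) = z *: (k *: a) by rewrite !scalerA mulrC.
  congr intV; apply/funext => u; rewrite !scale1r kZ -scalerDr.
  congr (_ *: _); have E : 1 + k * ((2 * pi * dotp (e j) u)%:C * 'i) = 1 +i* dotp u (e j).
    rewrite mulrA -rmorphM mulrA mulVf ?mul1r; last by rewrite mulf_neq0// gt_eqF// pi_gt0.
    apply/eqP; rewrite (dotC (e j)) eq_complex /= !mul0r !mulr0 !mulr1 subr0.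
    by rewrite !addr0 !add0r !eqxx.
  rewrite scalerA -[X in _ = X + _]scale1r -scalerDl E /g scalerA.
  by rewrite resolventK scale1r.
have dG1 := crossed_wdominated c hG; have dG2 := crossed_wdominated (generator (e j) c) hG.
have dD := crossed_wdominated c hD; have dG3 := crossed_wdominated (regularize j c) hG.
have dS := wdominatedD hP dD dG2.
have h0 : intV e (fun v => mul (D v) (alpha v c) + mul (G v) (alpha v (generator (e j) c))) = 0.
  apply: (intV_derivative0 hE hP cP dG1 dS (v := e j)) => v.
  apply: (is_dderive_bilinear (M := mul)).
  - by move=> *; rewrite linearBl.
  - by move=> *; rewrite linearBr.
  - by move=> *; exact: mulZl.
  - by move=> *; exact: mulZr.
  - exact: cmul.
  - exact: (@schwartz_dderive R V A P hP G [::] v (e j) hG).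
  - exact: (is_dderive_orbit hP alpha0 alphaD isoP smooth_alpha).
rewrite -[LHS]addr0 -(scaler0 _ k) -h0 -(intVZ hE hP cP k dS).
rewrite -(intVD hE hP cP dG3 (wdominatedZ hP k dS)); congr intV; apply/funext => v.
rewrite -/(G v) Gv /regularize -/k alphaB alphaZ linearBr linearDl mulZr mulZl scalerDr.
by rewrite [k *: _ + _]addrC addrA subrK.
Qed.

Lemma damping_all l f b : S f ->
  intV e (fun v => mul (damped_theta l f v) (alpha v (foldr regularize b l))) =
  intV e (fun v => mul (theta J f v) (alpha v b)).
Proof.
move=> hf; elim: l => [|j l <-] /=.
  congr intV; apply/funext => v; rewrite /damped_theta; congr (mul (ft _ _ _) _).
  by apply/funext => u; rewrite /resolvent_prod big_nil scale1r.
rewrite -(damping_parts j (foldr regularize b l) (schwartz_resolvent l (schwartz_twist_ft hf))).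
congr intV; apply/funext => v; rewrite /damped_theta; congr (mul (ft _ _ _) _).
by apply/funext => u; rewrite resolvent_prod_cons scalerA.
Qed.

(** The product is written with absolutely convergent integrals, so Fubini
    applies, and the damping factors cancel against the regularizations of b. *)
Lemma deformed_integral f b : S f ->
  intV e (fun y => rieffel_product (f y) (alpha y b)) =
  intV e (fun v => mul (theta J f v) (alpha v b)).
Proof.
move=> hf; rewrite -(damping_all all_twice b hf) -/(regularize_all b).
set b' := regularize_all b.
have [cf bf] := schwartz_wdominated hE hP hf.
pose F (z : V * V) : A := mul (transform (f z.1) (z.2 - z.1)) (alpha z.2 b').
have dF : wdominated2 F.
  split=> [z|n].
    apply: (cvg_mul cmul).
      apply: (transform_cvg hE hP cP alpha0 alphaD isoP smooth_alpha).
        exact: (continuous_pair_fst cf).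
      by apply: cvgB; [exact: cvg_snd|exact: cvg_fst].
    by apply: (cvg_alpha hP isoP smooth_alpha); [exact: cvg_snd|exact: cvg_cst].
  have [m [B [B0 hB]]] := product_bound hE hP cP cmul alpha0 alphaD isoP smooth_alpha J n.
  have [C [C0 hC]] := schwartz_weight hE hP m 2 hf.
  exists (B * C * P m b' * 2 ^+ d); split=> [|[y v]]; first by rewrite !mulr_ge0 ?sys_ge0// exprn_ge0.
  apply: le_trans (hB _ _ _) _; rewrite isoP /=.
  apply: (@le_trans _ _ (B * P m b' * (C * w y) * (w (v - y) * w y))).
    rewrite (_ : B * P m b' * (C * w y) * (w (v - y) * w y) =
      B * (C * w y ^+ 2) * P m b' * w (v - y)); last by ring.
    apply: ler_wpM2r; first by rewrite ltW// weight_gt0.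
    by apply: ler_wpM2r; rewrite ?sys_ge0// ler_wpM2l.
  have h := weight_split (dotp := dotp) (e := e) v (- y); rewrite weightN in h.
  rewrite (_ : B * C * P m b' * 2 ^+ d * (w y * w v) =
    B * P m b' * (C * w y) * (2 ^+ d * w v)); last by ring.
  by apply: ler_wpM2l => //; rewrite !mulr_ge0 ?sys_ge0// ltW// weight_gt0.
transitivity (intV e (fun y => intV e (fun v => F (y, v)))).
  congr intV; apply/funext => y; rewrite rieffel_productE /regularize_all.
  rewrite (foldr_regularize_alpha hP alphaD isoP smooth_alpha).
  (* alpha_v alpha_y = alpha_(v + y) *)
  rewrite -(intV_translate hE hP cP y (F := fun v => F (y, v))); last first.
    exact: (wdominated_curry y dF).
  by congr intV; apply/funext => v; rewrite /F /= addrC addKr addrC alphaD.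
rewrite (intV_swap hE hP cP dF); congr intV; apply/funext => v.
rewrite -integral_transform//.
have dv : wdominated (fun y => transform (f y) (v - y)).
  split=> [y|n].
    apply: (transform_cvg hE hP cP alpha0 alphaD isoP smooth_alpha); first exact: cf.
    by apply: cvgB; [exact: cvg_cst|exact: cvg_id].
  have [m [C [C0 hC]]] := transform_bound hE hP cP alpha0 alphaD isoP smooth_alpha J n.
  have [D [D0 hD]] := bf m; exists (C * D); split=> [|y]; first exact: mulr_ge0.
  apply: le_trans (hC _ _) _; rewrite -!mulrA ler_wpM2l//.
  apply: (@le_trans _ _ (P m (f y))); last exact: hD.
  by rewrite ler_piMr ?sys_ge0// weight_le1.
have := intV_mull hE hP cP cmul isoP 1 0 (alpha v b') dv.
rewrite alpha0 scale1r => <-; congr intV; apply/funext => y.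
by rewrite alpha0 scale1r.
Qed.

End Intertwining.

Section CrossedProduct.
Context {R : realType} {V : normedModType R}.
Context {dotp : {dot V for @idfun R}} {d : nat} {e : 'I_d -> V}.
Variable hE : euclidean_space dotp e.
Context {A : tvsType R[i]}.
Variables (P : nat -> A -> R) (hP : seminorm_system P) (cP : complete_system P).
Variable (mul : {bilinear A -> A -> A}).
Hypothesis cmul : continuous (fun ab : A * A => mul ab.1 ab.2).
Variables (alpha : V -> {linear A -> A}).
Hypothesis alpha0 : forall a, alpha 0 a = a.
Hypothesis alphaD : forall x y a, alpha (x + y) a = alpha x (alpha y a).
Hypothesis alphaM : forall x a b, alpha x (mul a b) = mul (alpha x a) (alpha x b).
Hypothesis isoP : forall n x a, P n (alpha x a) = P n a.
Hypothesis smooth_alpha : smooth_action alpha.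
Variable (J : {linear V -> V}).
Local Notation S := (@schwartz R V A).
Local Notation chi := (character dotp).
Local Notation w := (weight dotp e).
Local Notation wdominated := (wdominated (dotp := dotp) (e := e) P).
Local Notation wdominated2 := (wdominated2 (dotp := dotp) (e := e) P).
Local Notation transform := (transform (dotp := dotp) (e := e) alpha J).
Local Notation rieffel_product := (rieffel_product (dotp := dotp) (e := e) mul alpha J).
Local Notation ft := (ft dotp e).
Local Notation theta := (theta (dotp := dotp) (e := e) alpha).
Local Notation twist := (twist alpha).
Local Notation crossed := (crossed_mul e alpha mul).
Implicit Types (x y u v r : V) (a b c : A) (f g h : V -> A).

Lemma ft_character f r u : ft (-1) (fun y => chi (- r) y *: f y) u = ft (-1) f (r + u).
Proof.
congr intV; apply/funext => y; rewrite scalerA -characterD; congr (chi _ _ *: _).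
by rewrite !scaleN1r opprD addrC.
Qed.

(** Modulation translates the Fourier transform by r, and the multiplier at a
    translated point differs by alpha_(-Jr). *)
Lemma theta_character f r v : S f ->
  theta J (fun y => chi (- r) y *: f y) v = chi (- r) v *: alpha (- J r) (theta J f v).
Proof.
move=> hf; set h := twist J (ft (-1) f).
have hh : S h := schwartz_twist_ft hE hP cP alpha0 alphaD isoP smooth_alpha J hf.
have dh := wdominated_ft hE hP 1 v (schwartz_wdominated hE hP hh).
rewrite /theta -/h [in RHS]/ft -(alpha_intV hE hP cP isoP _ _ dh).
have dK : wdominated (fun u => chi (- r) v *: alpha (- J r) (chi (1 *: v) u *: h u)).
  apply: (wdominatedZ hP); have [ch bh] := dh; split=> [u|n].
    by apply: (cvg_alpha hP isoP smooth_alpha); [exact: cvg_cst|exact: ch].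
  by have [C [C0 hC]] := bh n; exists C; split=> // u; rewrite isoP.
rewrite -(intV_translate hE hP cP r dK); apply: (congr1 (intV e)); apply/funext => u.
rewrite /twist ft_character alphaZ scalerA /h /twist -alphaD JD addKr; congr (_ *: _).
rewrite !scale1r characterDr mulrA (characterC (- r)) -characterDr addNr.
by rewrite [chi v 0]characterC character0 mul1r.
Qed.

Lemma crossed_dominated F G n : S F -> S G -> exists C, 0 <= C /\ forall x y,
  P n (mul (F y) (alpha y (G (x - y)))) <= C * (w x * w y).
Proof.
move=> hF hG; have [m [B [B0 hB]]] := bilinear_bound hP cmul n.
have [C [C0 hC]] := schwartz_weight hE hP m 2 hF.
have [D [D0 hD]] := schwartz_weight hE hP m 1 hG.
exists (B * C * D * 2 ^+ d); split=> [|x y]; first by rewrite !mulr_ge0// exprn_ge0.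
have w0 z : 0 <= w z by rewrite ltW// weight_gt0.
apply: le_trans (hB _ _) _; rewrite isoP.
apply: (@le_trans _ _ (B * (C * w y ^+ 2) * (D * w (x - y)))).
  apply: ler_pM; rewrite ?mulr_ge0 ?sys_ge0//; by rewrite ler_wpM2l.
have h := weight_split (dotp := dotp) (e := e) x (- y); rewrite weightN in h.
rewrite (_ : B * (C * w y ^+ 2) * (D * w (x - y)) = B * C * D * w y * (w (x - y) * w y)); last by ring.
rewrite (_ : B * C * D * 2 ^+ d * (w x * w y) = B * C * D * w y * (2 ^+ d * w x)); last by ring.
by apply: ler_wpM2l => //; rewrite !mulr_ge0.
Qed.

Lemma crossed_cvg (T : Type) (Phi : set_system T) {FF : Filter Phi} (F G : V -> A) (x y : T -> V) x0 y0 :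
  continuous F -> continuous G -> x @ Phi --> x0 -> y @ Phi --> y0 ->
  (fun t => mul (F (y t)) (alpha (y t) (G (x t - y t)))) @ Phi -->
    mul (F y0) (alpha y0 (G (x0 - y0))).
Proof.
move=> cF cG xx yy; apply: (cvg_mul cmul); first exact: cvg_comp yy (cF y0).
apply: (cvg_alpha hP isoP smooth_alpha) => //.
exact: cvg_comp (cvgB xx yy) (cG (x0 - y0)).
Qed.

Lemma crossed_wdominated2 F G : S F -> S G ->
  wdominated2 (fun z => mul (F z.2) (alpha z.2 (G (z.1 - z.2)))).
Proof.
move=> hF hG; split=> [z|n].
  apply: crossed_cvg; last exact: cvg_snd.
  - exact: (schwartz_wdominated hE hP hF).1.
  - exact: (schwartz_wdominated hE hP hG).1.
  - exact: cvg_fst.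
by have [C [C0 hC]] := crossed_dominated n hF hG; exists C.
Qed.

(** In the crossed product G enters only through its translate by v, on which
    the Fourier transform acts by a phase. *)
Lemma ft_crossed F G r : S F -> S G ->
  ft (-1) (crossed F G) r = intV e (fun v => mul (chi (- r) v *: F v) (alpha v (ft (-1) G r))).
Proof.
move=> hF hG; have d2 := crossed_wdominated2 hF hG.
pose K (z : V * V) : A := chi (- r) z.1 *: mul (F z.2) (alpha z.2 (G (z.1 - z.2))).
have dK : wdominated2 K.
  have [c2 b2] := d2; split=> [z|n].
    apply: tvs_cvgZ; last exact: c2.
    by apply: (cvg_character hE); [exact: cvg_cst|exact: cvg_fst].
  by have [C [C0 hC]] := b2 n; exists C; split=> // z; rewrite (sysZ hP) normc_character mul1r.
transitivity (intV e (fun x => intV e (fun v => K (x, v)))).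
  congr intV; apply/funext => x; rewrite scaleN1r.
  by rewrite -(intVZ hE hP cP _ (wdominated_curry x d2)).
rewrite (intV_swap hE hP cP dK); congr intV; apply/funext => v.
have dG := wdominated_ft hE hP (-1) r (schwartz_wdominated hE hP hG).
have dv : wdominated (fun x => alpha v (chi (-1 *: r) x *: G x)).
  have [cG bG] := dG; split=> [x|n].
    by apply: (cvg_alpha hP isoP smooth_alpha); [exact: cvg_cst|exact: cG].
  by have [C [C0 hC]] := bG n; exists C; split=> // x; rewrite isoP.
rewrite {1}/ft -[alpha v (intV _ _)]scale1r -(alpha_intV hE hP cP isoP _ _ dG).
under [in RHS]eq_fun do rewrite scale1r.
rewrite -(intV_mulr hE hP cP cmul _ dv).
have dm : wdominated (fun x => mul (chi (- r) v *: F v) (alpha v (chi (-1 *: r) x *: G x))).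
  have [cv bv] := dv; split=> [x|n].
    by apply: (cvg_mul cmul); [exact: cvg_cst|exact: cv].
  have [m [C [C0 hC]]] := mul_boundedr hP cmul (chi (- r) v *: F v) n.
  have [D [D0 hD]] := bv m; exists (C * D); split=> [|x]; first exact: mulr_ge0.
  by apply: le_trans (hC _) _; rewrite -mulrA ler_wpM2l.
rewrite -(intV_translate hE hP cP (- v) dm); congr intV; apply/funext => x.
rewrite /K /= [- v + x]addrC alphaZ mulZl mulZr scalerA scaleN1r; congr (_ *: _).
by rewrite -characterDr [v + _]addrC subrK.
Qed.

(** Expand g in characters. For each frequency r the deformed integral becomes
    an ordinary one for f modulated by a character, and the resulting factor
    alpha_(-Jr) is the multiplier of theta for -J. *)
Theorem deformed_crossed f g : S f -> S g ->
  crossed_mul e alpha rieffel_product f g =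
  theta (fun x => - J x) (crossed (theta J f) (theta J g)).
Proof.
move=> hf hg; apply/funext => x.
have hF := schwartz_theta hE hP cP alpha0 alphaD isoP smooth_alpha (JD J) (JZ J) hf.
have hG := schwartz_theta hE hP cP alpha0 alphaD isoP smooth_alpha (JD J) (JZ J) hg.
have hgh := schwartz_fourier hE hP cP hg.
have [cf bf] := schwartz_wdominated hE hP hf.
have [cgh bgh] := schwartz_wdominated hE hP hgh.
pose K (z : V * V) : A :=
  chi (x - z.1) z.2 *: rieffel_product (f z.1) (alpha z.1 (ft (-1) g z.2)).
have dK : wdominated2 K.
  split=> [z|n].
    apply: tvs_cvgZ.
      apply: (cvg_character hE); last exact: cvg_snd.
      by apply: cvgB; [exact: cvg_cst|exact: cvg_fst].
    apply: (rieffel_product_cvg hE hP cP cmul alpha0 alphaD isoP smooth_alpha).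
      exact: (continuous_pair_fst cf).
    apply: (cvg_alpha hP isoP smooth_alpha); first exact: cvg_fst.
    exact: (continuous_pair_snd cgh).
  have [m [B [B0 hB]]] := rieffel_product_bound hE hP cP cmul alpha0 alphaD isoP smooth_alpha J n.
  have [C [C0 hC]] := bf m; have [D [D0 hD]] := bgh m.
  exists (B * C * D); split=> [|z]; first by rewrite !mulr_ge0.
  rewrite /K (sysZ hP) normc_character mul1r; apply: le_trans (hB _ _) _; rewrite isoP.
  rewrite (_ : B * C * D * (w z.1 * w z.2) = B * (C * w z.1) * (D * w z.2)); last by ring.
  by apply: ler_pM; rewrite ?mulr_ge0 ?sys_ge0// ler_wpM2l.
transitivity (intV e (fun y => intV e (fun r => K (y, r)))).
  congr intV; apply/funext => y.
  have dg := wdominated_ft hE hP 1 (x - y) (schwartz_wdominated hE hP hgh).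
  have -> : g (x - y) = intV e (fun r => chi (1 *: (x - y)) r *: ft (-1) g r).
    by rewrite -[in LHS](ft_fourierK hE hP cP hg).
  rewrite -(intV_linear hE hP cP (L := fun b => rieffel_product (f y) (alpha y b)) _ _ dg).
  - congr intV; apply/funext => r; rewrite /K /= scale1r alphaZ.
    by rewrite (rieffel_productZr hE hP cP cmul alpha0 alphaD isoP smooth_alpha).
  - move=> s a b; rewrite linearP.
    exact: (rieffel_product_linear hE hP cP cmul alpha0 alphaD isoP smooth_alpha).
  - move=> n; have [m [B [B0 hB]]] :=
      rieffel_product_bound hE hP cP cmul alpha0 alphaD isoP smooth_alpha J n.
    exists m, (B * P m (f y)); split=> [|b]; first by rewrite mulr_ge0 ?sys_ge0.
    by apply: le_trans (hB _ _) _; rewrite isoP.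
rewrite (intV_swap hE hP cP dK); congr intV; apply/funext => r.
have hfr : S (fun y => chi (- r) y *: f y).
  have hm : symbol (dotp := dotp) (e := e) false (fun y => chi y (- r)).
    exact: symbol_character.
  have [h _] := schwartz_operator_multiplier hP (symbol_multiplier hE hm)
    (schwartz_operator_id hP (W := V)).
  have := h _ hf; rewrite (_ : (fun y => _) = (fun y => chi (- r) y *: f y))//.
  by apply/funext => y; rewrite characterC.
have dF := crossed_wdominated hE hP cmul isoP smooth_alpha (ft (-1) (theta J g) r) hF.
rewrite scale1r /twist ft_crossed//.
transitivity (chi x r *: intV e (fun y =>
    rieffel_product (chi (- r) y *: f y) (alpha y (ft (-1) g r)))).
  have dKr := wdominatedZ hP (chi (- x) r) (wdominated_curry r (wdominated_swap dK)).
  have E y : rieffel_product (chi (- r) y *: f y) (alpha y (ft (-1) g r)) = chi (- x) r *: K (y, r).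
    rewrite (rieffel_productZl hE hP cP cmul alpha0 alphaD isoP smooth_alpha) /K /= scalerA.
    by rewrite -characterD addKr (characterC (- r)) characterNr.
  under [in RHS]eq_fun do rewrite E.
  rewrite (intVZ hE hP cP _ (wdominated_curry r (wdominated_swap dK))) scalerA.
  by rewrite -characterD addrN character0 scale1r.
rewrite (deformed_integral hE hP cP cmul alpha0 alphaD isoP smooth_alpha J _ hfr).
congr (_ *: _).
have dFr : wdominated (fun v => mul (chi (- r) v *: theta J f v) (alpha v (ft (-1) (theta J g) r))).
  have [cF bF] := dF; split=> [v|n].
    apply: (cvg_mul cmul).
      apply: tvs_cvgZ; last exact: (schwartz_wdominated hE hP hF).1.
      by apply: (cvg_character hE); [exact: cvg_cst|exact: cvg_id].
    by apply: (cvg_alpha hP isoP smooth_alpha); [exact: cvg_id|exact: cvg_cst].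
  have [C [C0 hC]] := bF n; exists C; split=> // v.
  by rewrite mulZl (sysZ hP) normc_character mul1r.
have := alpha_intV hE hP cP isoP 1 (- J r) dFr; rewrite scale1r => <-.
congr intV; apply/funext => v; rewrite scale1r theta_character// alphaM alphaZ.
congr (mul _ _); rewrite (ft_theta hE hP cP alpha0 alphaD isoP smooth_alpha (JD J) (JZ J) hg).
by rewrite /twist -!alphaD addrAC addNr add0r.
Qed.

End CrossedProduct.

Section SchwartzLinear.
Context {R : realType} {V : normedModType R} {A : tvsType R[i]}.
Variables (P : nat -> A -> R) (hP : seminorm_system P).
Local Notation S := (@schwartz R V A).
Implicit Types f g : V -> A.

Lemma iter_dderive_linear s (k : R[i]) f g : S f -> S g ->
  iter_dderive s (k *: f + g) = fun x => k *: iter_dderive s f x + iter_dderive s g x.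
Proof.
move=> hf hg; elim: s => //= v s; rewrite -!/(iter_dderive s _) => ->; apply/funext => x.
apply: (dderiveE (sys_hausdorff hP)); apply: is_dderiveD; last first.
  exact: (@schwartz_dderive R V A P hP g s x v hg).
have h := @schwartz_dderive R V A P hP f s x v hf.
have hk : is_dderive (fun _ : V => k : R[i]^o) x v 0 by exact: is_dderive_cst.
by have := is_dderiveZ hk h; rewrite scale0r add0r.
Qed.

Lemma schwartz_linear (k : R[i]) f g : S f -> S g -> S (k *: f + g).
Proof.
move=> hf hg; split=> [s|p sp cp s n].
  split=> [x|x v].
    rewrite (iter_dderive_linear s k hf hg); apply: tvs_cvgD.
      by apply: tvs_cvgZ; [exact: cvg_cst|exact: (hf.1 s).1].
    exact: (hg.1 s).1.
  exists (iter_dderive (v :: s) (k *: f + g) x).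
  have h := @schwartz_dderive R V A P hP f s x v hf.
  have hk : is_dderive (fun _ : V => k : R[i]^o) x v 0 by exact: is_dderive_cst.
  have := is_dderiveD (is_dderiveZ hk h) (@schwartz_dderive R V A P hP g s x v hg).
  rewrite scale0r add0r (iter_dderive_linear (v :: s) k hf hg).
  by rewrite (iter_dderive_linear s k hf hg).
have [_ /(_ p sp cp s n)[C hC]] := hf; have [_ /(_ p sp cp s n)[D hD]] := hg.
exists (normc k * C + D) => x; rewrite (iter_dderive_linear s k hf hg).
apply: (@le_trans _ _ (normc k * (`|x| ^+ n * p (iter_dderive s f x)) +
    `|x| ^+ n * p (iter_dderive s g x))).
  rewrite mulrCA -mulrDr ler_wpM2l ?exprn_ge0//.
  apply: le_trans (seminormD sp _ _) _; rewrite lerD2r.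
  by rewrite le_eqVlt; apply/orP; left; apply/eqP/(@complexI R); rewrite (seminormZ sp) rmorphM.
by rewrite lerD// ler_wpM2l// normc_ge0.
Qed.

Lemma schwartzB f g : S f -> S g -> S (f - g).
Proof. by move=> hf hg; rewrite addrC -scaleN1r; exact: schwartz_linear. Qed.

(** By linearity the estimates on T are needed at g - f only. *)
Lemma schwartz_operator_nbhs (T : (V -> A) -> V -> A) f (B : set (V -> A)) :
  schwartz_operator P T -> (forall f g, S f -> S g -> T (f - g) = T f - T g) -> S f ->
  schwartz_nbhs (T f) B -> schwartz_nbhs f (T @^-1` B).
Proof.
move=> hT TB hf [ks [p [eps [sp cp eps0 sub]]]].
have [m [C [C0 hC]]] := continuous_seminorm_bound hP sp cp.
have [ks' [m' [C' [C'0 hC']]]] := schwartz_bounded_sum hP ks (fun i => hT.2 m i.1 i.2).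
pose K := C * (C' * (size ks')%:R) + 1.
have K0 : 0 < K by rewrite ltr_wpDl// !mulr_ge0.
have [spm cpm] := seminorm_sys hP m'.
exists ks', (P m'), (eps / K); split=> //; first exact: divr_gt0.
move=> g hg hgf; apply: sub => [|i iks x]; first exact: hT.1.
rewrite -TB//; have hd := schwartzB hg hf.
have hnorm : schwartz_norm P ks' m' (g - f) <= (size ks')%:R * (eps / K).
  rewrite /schwartz_norm big_seq; apply: (@le_trans _ _ (\sum_(i <- ks' | i \in ks') (eps / K))).
    by apply: ler_sum => l lks; apply: schwartz_sup_le => y; exact: hgf.
  by rewrite -big_seq big_const_seq count_predT iter_addr_0 mulr_natl.
have h := hC' (g - f) hd x.
have hi : `|x| ^+ i.1 * P m (iter_dderive i.2 (T (g - f)) x) <=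
    C' * ((size ks')%:R * (eps / K)).
  apply: (@le_trans _ _ (C' * schwartz_norm P ks' m' (g - f))); last by rewrite ler_wpM2l.
  apply: le_trans h; rewrite (big_rem i)//= lerDl sumr_ge0// => l _.
  by rewrite mulr_ge0 ?exprn_ge0 ?(sys_ge0 hP).
apply: (@le_trans _ _ (C * (`|x| ^+ i.1 * P m (iter_dderive i.2 (T (g - f)) x)))).
  by rewrite mulrCA ler_wpM2l// exprn_ge0.
apply: le_trans (ler_wpM2l C0 hi) _.
rewrite (_ : C * (C' * (_ * (eps / K))) = (K - 1) * (eps / K)); last first.
  by rewrite /K addrK -!mulrA.
rewrite mulrBl mul1r mulrCA mulfV ?gt_eqF// mulr1 gerDl oppr_le0 ltW//.
exact: divr_gt0.
Qed.

End SchwartzLinear.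

Section SchwartzCrossed.
Context {R : realType} {V : normedModType R}.
Context {dotp : {dot V for @idfun R}} {d : nat} {e : 'I_d -> V}.
Variable hE : euclidean_space dotp e.
Context {A : tvsType R[i]}.
Variables (P : nat -> A -> R) (hP : seminorm_system P) (cP : complete_system P).
Variable (mul : {bilinear A -> A -> A}).
Hypothesis cmul : continuous (fun ab : A * A => mul ab.1 ab.2).
Variables (alpha : V -> {linear A -> A}).
Hypothesis alpha0 : forall a, alpha 0 a = a.
Hypothesis alphaD : forall x y a, alpha (x + y) a = alpha x (alpha y a).
Hypothesis isoP : forall n x a, P n (alpha x a) = P n a.
Hypothesis smooth_alpha : smooth_action alpha.
Variable (J : {linear V -> V}).
Local Notation S := (@schwartz R V A).
Local Notation w := (weight dotp e).
Local Notation wdominated := (wdominated (dotp := dotp) (e := e) P).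
Local Notation ft := (ft dotp e).
Local Notation theta := (theta (dotp := dotp) (e := e) alpha).
Local Notation twist := (twist alpha).
Local Notation crossed := (crossed_mul e alpha mul).
Local Notation schwartz_bounded := (schwartz_bounded P).
Implicit Types (x y u v r : V) (a b c : A) (f g h : V -> A).

Lemma crossed_continuous f g : S f -> S g -> continuous (crossed f g).
Proof.
move=> hf hg; have [cf _] := schwartz_wdominated hE hP hf.
have [cg _] := schwartz_wdominated hE hP hg.
apply: (intV_continuous hE hP cP) => [x y|y x|n].
- exact: (crossed_cvg hP cmul isoP smooth_alpha (x := fun=> x) (y := id) cf cg
    (cvg_cst _) (@cvg_id _ _)).
- exact: (crossed_cvg hP cmul isoP smooth_alpha (x := id) (y := fun=> y) cf cg
    (@cvg_id _ _) (cvg_cst _)).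
have [C [C0 hC]] := crossed_dominated hE hP cmul isoP n hf hg; exists C; split=> // x y.
apply: le_trans (hC x y) _; apply: ler_wpM2l => //.
by rewrite ler_piMl ?weight_le1// ltW// weight_gt0.
Qed.

Lemma is_dderive_crossed f g x v : S f -> S g ->
  is_dderive (crossed f g) x v (crossed f (iter_dderive [:: v] g) x).
Proof.
move=> hf hg; have hg' : S (iter_dderive [:: v] g) := (schwartz_operator_iter hP [:: v]).1 g hg.
have d2 := crossed_wdominated2 hE hP cmul isoP smooth_alpha hf hg.
have d2' := crossed_wdominated2 hE hP cmul isoP smooth_alpha hf hg'.
apply: (intV_dderive hE hP cP (F := fun x y => mul (f y) (alpha y (g (x - y))))
  (F1 := fun x y => mul (f y) (alpha y (iter_dderive [:: v] g (x - y))))) => [y|y|y u|n].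
- exact: (wdominated_curry y d2).
- exact: (wdominated_curry y d2').1.
- apply: (is_dderive_linear (L := fun a => mul (f u) (alpha u a))).
  + by move=> s a b; rewrite alphaZ alphaB mulZr linearBr.
  + apply: (cvg_mul cmul); first exact: cvg_cst.
    by apply: (cvg_alpha hP isoP smooth_alpha); [exact: cvg_cst|exact: cvg_id].
  have h : is_dderive g (- u + y) v (iter_dderive [:: v] g (- u + y)).
    exact: (@schwartz_dderive R V A P hP g [::] (- u + y) v hg).
  have := is_dderive_translate h; rewrite addrC.
  by apply: eq_is_dderive => z; rewrite addrC.
have [C [C0 hC]] := crossed_dominated hE hP cmul isoP n hf hg'; exists C; split=> // y u.
apply: le_trans (hC y u) _; apply: ler_wpM2l => //.
by rewrite ler_piMl ?weight_le1// ltW// weight_gt0.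
Qed.

(** Powers of x are distributed by x = y + (x - y) over the two factors. *)
Lemma crossed_bounded g n k : S g ->
  schwartz_bounded (fun f x => `|x| ^+ k * P n (crossed f g x)).
Proof.
move=> hg; have [m [B [B0 hB]]] := bilinear_bound hP cmul n.
have hid := schwartz_operator_id hP (W := V).
have [D [D0 hD]] := schwartz_bounded_fixed hP (schwartz_bounded_poly hP m k hid) hg.
have [ks [m' [C [C0 hC]]]] := schwartz_bounded_poly hP m (2 * d + k) hid.
have h : schwartz_bounded (fun f x =>
    P n (intV e (fun y => (`|x| ^+ k)%:C *: mul (f y) (alpha y (g (x - y)))))).
  apply: (intV_schwartz_bounded hE hP cP (q := fun f (x : V) => (B * D * C) * schwartz_norm P ks m' f)).
  - by exists ks, m', (B * D * C); split=> // ; rewrite !mulr_ge0.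
  - move=> f x hf; apply: (wdominatedZ hP).
    exact: (wdominated_curry x (crossed_wdominated2 hE hP cmul isoP smooth_alpha hf hg)).
  move=> f x y hf; rewrite (sysZ hP) normc_real ger0_norm ?exprn_ge0//.
  have xk : `|x| ^+ k <= (1 + `|y|) ^+ k * (1 + `|x - y|) ^+ k.
    rewrite -exprMn lerXn2r ?nnegrE ?mulr_ge0 ?addr_ge0//.
    have t : `|x| <= `|y| + `|x - y| by rewrite -{1}[x](subrK y) addrC ler_normD.
    have t0 := mulr_ge0 (normr_ge0 y) (normr_ge0 (x - y)).
    by rewrite mulrDl mul1r mulrDr mulr1; lra.
  have wy : 0 < w y by exact: weight_gt0.
  (* the exponent 2 d bounds the inverse of the weight *)
  have fy : (1 + `|y|) ^+ k * P m (f y) <= w y * (C * schwartz_norm P ks m' f).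
    rewrite -ler_pdivrMl//; apply: le_trans (hC f hf y); rewrite exprD mulrA.
    apply: ler_wpM2r; first exact: sys_ge0.
    by apply: ler_wpM2r; [rewrite exprn_ge0// addr_ge0|exact: (weight_inv_le hE)].
  apply: (@le_trans _ _ ((1 + `|y|) ^+ k * (1 + `|x - y|) ^+ k *
      (B * P m (f y) * P m (g (x - y))))).
    apply: ler_pM; rewrite ?exprn_ge0 ?sys_ge0//.
    by apply: le_trans (hB _ _) _; rewrite isoP.
  rewrite [leLHS](_ : _ = B * ((1 + `|y|) ^+ k * P m (f y)) *
    ((1 + `|x - y|) ^+ k * P m (g (x - y)))); last by ring.
  rewrite (_ : B * D * C * schwartz_norm P ks m' f * w y =
    B * (w y * (C * schwartz_norm P ks m' f)) * D); last by ring.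
  apply: ler_pM; rewrite ?mulr_ge0 ?exprn_ge0 ?addr_ge0 ?sys_ge0//.
  by rewrite ler_wpM2l.
apply: schwartz_bounded_le h _ => // f hf x.
rewrite (intVZ hE hP cP _
  (wdominated_curry x (crossed_wdominated2 hE hP cmul isoP smooth_alpha hf hg))).
by rewrite (sysZ hP) normc_real ger0_norm ?exprn_ge0.
Qed.

(** All derivatives fall on g, so the operators f -> f * g form a stable
    family. *)
Lemma schwartz_crossed f g : S f -> S g -> S (crossed f g).
Proof.
move=> hf hg; suff [h _] : schwartz_operator P (crossed^~ g) by exact: h.
apply: (@schwartz_operator_class _ _ _ _ hP (fun T => exists g, S g /\ T = crossed^~ g)).
- by move=> _ [{}g [{}hg ->]] {}f {}hf; exact: crossed_continuous.
- move=> _ [{}g [{}hg ->]] v; exists (crossed^~ (iter_dderive [:: v] g)); split.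
    by eexists; split; last reflexivity; exact: (schwartz_operator_iter hP [:: v]).1.
  by move=> {}f {}hf x; exact: is_dderive_crossed.
- by move=> _ [{}g [{}hg ->]] n k; exact: crossed_bounded.
- by exists g.
Qed.

Lemma ft_linear s (k : R[i]) f g x : wdominated f -> wdominated g ->
  ft s (k *: f + g) x = k *: ft s f x + ft s g x.
Proof.
move=> df dg; have df' := wdominated_ft hE hP s x df; have dg' := wdominated_ft hE hP s x dg.
rewrite /ft -(intVZ hE hP cP k df') -(intVD hE hP cP (wdominatedZ hP k df') dg').
congr intV; apply/funext => y; rewrite scalerDr; congr (_ + _).
by rewrite [(k *: f) y]/GRing.scale /= !scalerA mulrC.
Qed.

Lemma theta_linear (L : V -> V) (k : R[i]) f g :
  (forall x y, L (x + y) = L x + L y) -> (forall (r : R) x, L (r *: x) = r *: L x) ->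
  S f -> S g -> theta L (k *: f + g) = k *: theta L f + theta L g.
Proof.
move=> LD LZ hf hg; apply/funext => x.
have [t _] := schwartz_operator_twist hE hP alpha0 alphaD isoP smooth_alpha LD LZ
  (schwartz_operator_id hP (W := V)).
have tf := t _ (schwartz_fourier hE hP cP hf); have tg := t _ (schwartz_fourier hE hP cP hg).
have dom h := @schwartz_wdominated _ _ _ _ _ hE _ _ hP h.
rewrite /theta -[RHS](ft_linear 1 k x (dom _ tf) (dom _ tg)).
congr (ft 1 _ x); apply/funext => u.
by rewrite /twist (ft_linear _ _ _ (dom _ hf) (dom _ hg)) linearP.
Qed.

End SchwartzCrossed.

Theorem theorem1p1 (R : realType) (V : normedModType R)
    (dotp : {dot V for @idfun R}) (d : nat) (e : 'I_d -> V)
    (A : tvsType R[i]) (mul : {bilinear A -> A -> A})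
    (alpha : V -> {linear A -> A}) (J : {linear V -> V}) :
  euclidean_space dotp e ->
  frechet_algebra mul ->
  algebra_action alpha mul -> isometric_action alpha -> smooth_action alpha ->
  skew_operator dotp J ->
  (forall f : V -> A, schwartz f ->
   forall xi : V -> A, schwartz xi ->
     integrated_form e (deformed_rep dotp e alpha mul J) f xi =
     integrated_form e (crossed_rep alpha mul) (Theta dotp e alpha J f) xi) /\
  topological_algebra_iso
    (@schwartz R V A) schwartz_nbhs
    (crossed_mul e alpha (rieffel_mul dotp e alpha mul J))
    (@schwartz R V A) schwartz_nbhs
    (crossed_mul e alpha mul)
    (Theta dotp e alpha J).

Proof.
move=> hE hA [alpha0 alphaD alphaM] [p [hp isop]] smooth_alpha _.
pose P := cumulative_seminorm p.
have hP : seminorm_system P := cumulative_seminorm_system hp (frechet_hausdorff hA).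
have cP : complete_system P := 
  cumulative_seminorm_complete hp (frechet_complete hA) (frechet_hausdorff hA).
have cmul := frechet_mul_continuous hA.
have isoP n x a : P n (alpha x a) = P n a by apply: eq_bigr => i _; exact: isop.
split=> [f hf xi hxi|].
  exact: (deformed_rep_theta hE hP cP cmul alpha0 alphaD isoP smooth_alpha).
set K := fun x => - J x.
have KD x y : K (x + y) = K x + K y by rewrite /K JD opprD.
have KZ (r : R) x : K (r *: x) = r *: K x by rewrite /K JZ scalerN.
have KJ x : K x = - J x by [].
have JK x : J x = - K x by rewrite opprK.
pose T L := theta (dotp := dotp) (e := e) alpha L.
have -> : Theta dotp e alpha J = T J by apply/funext => f; exact: ThetaE.
have -> : crossed_mul e alpha (rieffel_mul dotp e alpha mul J) =
    crossed_mul e alpha (rieffel_product (dotp := dotp) (e := e) mul alpha J).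
  congr (crossed_mul e alpha _); apply/funext => a; apply/funext => b.
  exact: (rieffel_mulE hE hP cP cmul alpha0 alphaD isoP smooth_alpha J a b (exists_test_function hE)).
have opT (L : V -> V) : (forall x y, L (x + y) = L x + L y) ->
    (forall (r : R) x, L (r *: x) = r *: L x) -> schwartz_operator P (T L).
  exact: (schwartz_operator_theta hE hP cP alpha0 alphaD isoP smooth_alpha).
have [TJ TK] := (opT _ (JD J) (JZ J), opT _ KD KZ).
have cancel f : schwartz f -> T K (T J f) = f.
  exact: (thetaK hE hP cP alpha0 alphaD isoP smooth_alpha (JD J) (JZ J) KJ).
have cancel' f : schwartz f -> T J (T K f) = f.
  exact: (thetaK hE hP cP alpha0 alphaD isoP smooth_alpha KD KZ JK).
have lin (L : V -> V) : (forall x y, L (x + y) = L x + L y) ->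
    (forall (r : R) x, L (r *: x) = r *: L x) -> forall (k : R[i]) f g,
    schwartz f -> schwartz g -> T L (k *: f + g) = k *: T L f + T L g.
  move=> LD LZ k f g hf hg.
  exact: (theta_linear hE hP cP alpha0 alphaD isoP smooth_alpha).
have linB (L : V -> V) : (forall x y, L (x + y) = L x + L y) ->
    (forall (r : R) x, L (r *: x) = r *: L x) -> forall f g,
    schwartz f -> schwartz g -> T L (f - g) = T L f - T L g.
  by move=> LD LZ f g hf hg; rewrite addrC -scaleN1r lin// scaleN1r addrC.
have crossedS f g : schwartz f -> schwartz g -> schwartz (crossed_mul e alpha mul f g).
  exact: (schwartz_crossed hE hP cP cmul isoP smooth_alpha).
have mulE f g : schwartz f -> schwartz g ->
    crossed_mul e alpha (rieffel_product (dotp := dotp) (e := e) mul alpha J) f g =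
    T K (crossed_mul e alpha mul (T J f) (T J g)).
  exact: (deformed_crossed hE hP cP cmul alpha0 alphaD alphaM isoP smooth_alpha J).
split.
- by move=> f g hf hg; rewrite mulE//; apply: TK.1; apply: crossedS; exact: TJ.1.
- exact: crossedS.
- split=> [f|f g /set_mem hf /set_mem hg fg|f hf].
  + exact: TJ.1.
  + exact: etrans (esym (cancel _ hf)) (etrans (congr1 (T K) fg) (cancel _ hg)).
  + by exists (T K f); [exact: TK.1|exact: cancel'].
- exact: lin _ (JD J) (JZ J).
- by move=> f g hf hg; rewrite mulE// cancel'//; apply: crossedS; exact: TJ.1.
- move=> f hf B; exact: (schwartz_operator_nbhs hP TJ (linB _ (JD J) (JZ J)) hf).
- move=> f hf B nB; have hTf := TJ.1 _ hf.
  have nB' : schwartz_nbhs (T K (T J f)) B by rewrite cancel.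
  have [ks [q [eps [sq cq eps0 sub]]]] := schwartz_operator_nbhs hP TK (linB _ KD KZ) hTf nB'.
  exists ks, q, eps; split=> // g hg hgf; exists (T K g); last exact: cancel'.
  by split; [exact: sub|exact: TK.1].
Qed.
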